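(* Let $\tau_0,\tau_1>0$, $n\ge1$, $\lambda_i>0$ with $\sum_{i=1}^n\lambda_i=1$, $a_i>0$, $\mu_i=\mathcal N(m_i,\Sigma_i)\in\mathcal G_d^1$. For every initialization $\nu^0\in\mathcal G_d^1$, the trajectory $\nu^{k+1}=T(\nu^k)$, $k\ge0$, of the moment update $T$ (see context) is contained in a compact subset of $\mathcal G_d^1$, has finite length in mean--covariance parameter space, $$\sum_{k=0}^\infty d_{\rm par}(\nu^{k+1},\nu^k)<\infty,$$ and converges to a single point $\nu_\infty\in\mathcal G_d^1$ which is a stationary point of $\Phi$ and a fixed point of $T$. Moreover, with $b^k=b(\nu^k)$ and $\beta^k=b^k\nu^k$, $$\sum_{k=0}^\infty\left(|b^{k+1}-b^k|+d_{\rm par}(\nu^{k+1},\nu^k)\right)<\infty,$$ and the finite Gaussian measures $\beta^k$ converge in the mass, mean, and covariance parameters to $\beta_\infty=b(\nu_\infty)\nu_\infty$.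
   Context: $\mathbb S_{++}^d$: real symmetric positive-definite $d\times d$ matrices; $\mathcal G_d^1=\{\mathcal N(m,\Sigma):m\in\mathbb R^d,\Sigma\in\mathbb S_{++}^d\}$, identified with the open set $\mathbb R^d\times\mathbb S_{++}^d$, with parameter distance $d_{\rm par}(\mathcal N(m,\Sigma),\mathcal N(m',\Sigma'))=(\|m-m'\|^2+\|\Sigma-\Sigma'\|_F^2)^{1/2}$. Put $s=\tau_0+\tau_1$, $\theta=\tau_0/s$. For $\mu,\nu\in\mathcal G_d^1$, $$\mathsf A(\mu,\nu)=\inf_{p,q\in\mathcal P(\mathbb R^d)}\{W_2^2(p,q)+\tau_0\mathrm{KL}(p\mid\mu)+\tau_1\mathrm{KL}(q\mid\nu)\},$$ with $\mathrm{KL}$ the relative entropy and $W_2^2(p,q)\in[0,\infty]$ the squared quadratic Wasserstein cost. It is known that the minimizer $(p,q)$ is unique, that $p,q$ are nondegenerate Gaussians, and that their parameters and $\mathsf A$ depend real-analytically on $(\mu,\nu)$. Set $A_i(\nu)=\mathsf A(\mu_i,\nu)$, let $q_i(\nu)=\mathcal N(v_i,Q_i)$ be the second component of the minimizer for $(\mu_i,\nu)$, $\mathsf Z(\nu)=\sum_i\lambda_ia_i^\theta e^{-A_i(\nu)/s}$, $\omega_i(\nu)=\lambda_ia_i^\theta e^{-A_i(\nu)/s}/\mathsf Z(\nu)$, $b(\nu)=\mathsf Z(\nu)^{1/\theta}$, $\bar a=\sum_i\lambda_ia_i$, and $\Phi(\nu)=\tau_0(\bar a-\mathsf Z(\nu)^{1/\theta})$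 (this is the infimum over $b>0$ of the weighted KL-unbalanced transport barycenter objective, attained at $b=b(\nu)$). The moment update is $T(\nu)=\mathcal N(m^+,\Sigma^+)$ with $m^+=\sum_i\omega_i(\nu)v_i$ and $\Sigma^+=\sum_i\omega_i(\nu)[Q_i+(v_i-m^+)(v_i-m^+)^\top]$. *)

(* Defs.v *)
From HB Require Import structures.
From mathcomp Require Import all_boot all_order all_algebra.
From mathcomp Require Import all_classical all_reals all_analysis.
From mathcomp Require Import measurable_realfun.

Set Implicit Arguments.
Unset Strict Implicit.
Unset Printing Implicit Defensive.

Import Order.TTheory GRing.Theory Num.Theory.
Import numFieldNormedType.Exports.

Local Open Scope classical_set_scope.
Local Open Scope ring_scope.

(* MathComp-Analysis puts a product sigma-algebra on tuples, not on matrices: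
   measures on the Euclidean space R^d live on tuples, whereas means and
   covariances are matrices. *)
Notation euclid R d := (d.-tuple (measurableTypeR R)).

Section euclid.
Context {R : realType}.

Definition cvec_of (d : nat) (x : euclid R d) : 'cV[R]_d := \col_i tnth x i.

Definition sqdist (d : nat) (x y : euclid R d) : R :=
  \sum_(i < d) (tnth x i - tnth y i) ^+ 2.

Definition tuple_snoc (n : nat) (z : euclid R n * measurableTypeR R) :
  euclid R n.+1 := [tuple of z.2 :: z.1].

(* Lebesgue measure on R^n; on R^0 it is the Dirac mass at the unique point.
   The factor lebesgue_measure is on the right because the product measure
   m1 \x m2 asks for sigma-finiteness of m2 only. *)
Fixpoint lebesgue_euclid (n : nat) : set (euclid R n) -> \bar R :=
  match n with
  | 0%N => dirac ([tuple] : euclid R 0)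
  | n'.+1 => pushforward (@lebesgue_euclid n' \x lebesgue_measure)%E
               (@tuple_snoc n')
  end.

Lemma measurable_tuple_snoc n : measurable_fun [set: _] (@tuple_snoc n).
Proof.
exact: (@measurable_cons _ _ _ _ snd n fst measurable_snd measurable_fst).
Qed.

Lemma lebesgue_euclid_measure n :
  exists m : {measure set (euclid R n) -> \bar R}, @lebesgue_euclid n = m.
Proof.
elim: n => [|n [m mE]]; first by eexists.
unshelve eexists (pushforward (m \x lebesgue_measure)%E (@tuple_snoc n)
  : {measure set _ -> \bar R}); first exact: measurable_tuple_snoc.
by rewrite /= mE.
Qed.

Section lebesgue_euclid_instance.
Variable n : nat.

Let lebesgue_euclid0 : @lebesgue_euclid n set0 = 0%E.
Proof. by have [m ->] := lebesgue_euclid_measure n; rewrite measure0. Qed.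

Let lebesgue_euclid_ge0 A : (0 <= @lebesgue_euclid n A)%E.
Proof. by have [m ->] := lebesgue_euclid_measure n; exact: measure_ge0. Qed.

Let lebesgue_euclid_sigma_additive : semi_sigma_additive (@lebesgue_euclid n).
Proof.
have [m ->] := lebesgue_euclid_measure n; exact: measure_semi_sigma_additive.
Qed.

HB.instance Definition _ := isMeasure.Build _ _ _ (@lebesgue_euclid n)
  lebesgue_euclid0 lebesgue_euclid_ge0 lebesgue_euclid_sigma_additive.

End lebesgue_euclid_instance.

End euclid.

(* A pair (m, S) stands for N(m, S); only pairs in [gaussians] are meaningful. *)
Notation gparam R d := ('cV[R]_d * 'M[R]_d)%type.

Section gaussian.
Context {R : realType} {d : nat}.

Definition posdef (S : 'M[R]_d) : Prop :=
  S^T = S /\ forall u : 'cV[R]_d, u != 0 -> 0 < (u^T *m S *m u) 0 0.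

Definition gaussians : set (gparam R d) := [set nu | posdef nu.2].

Definition gauss_pdf (nu : gparam R d) (x : euclid R d) : R :=
  let y := cvec_of x - nu.1 in
  (Num.sqrt ((2 * pi) ^+ d * \det nu.2))^-1 *
  expR (- (y^T *m invmx nu.2 *m y) 0 0 / 2).

Lemma gauss_pdf_ge0 nu x : 0 <= gauss_pdf nu x.
Proof. by rewrite mulr_ge0 ?invr_ge0 ?sqrtr_ge0 ?expR_ge0. Qed.

Lemma measurable_gauss_pdf nu : measurable_fun [set: _] (gauss_pdf nu).
Proof.
pose y (i : 'I_d) (x : euclid R d) : R := tnth x i - nu.1 i 0.
have my i : measurable_fun [set: _] (y i).
  by apply: measurable_funB => //; exact: measurable_tnth.
rewrite (_ : gauss_pdf nu = fun x =>
  (Num.sqrt ((2 * pi) ^+ d * \det nu.2))^-1 *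
  expR (- (\sum_(j < d) (\sum_(i < d) y i x * invmx nu.2 i j) * y j x) / 2)).
  apply: measurable_funM => //; apply: measurableT_comp => //.
  apply: measurable_funM => //; apply: measurable_funN.
  apply: measurable_sum => j; apply: measurable_funM => //.
  by apply: measurable_sum => i; exact: measurable_funM.
apply/funext => x; rewrite /gauss_pdf; congr (_ * expR (- _ / 2)).
rewrite mxE; apply: eq_bigr => j _; congr (_ * _).
  by rewrite mxE; apply: eq_bigr => i _; rewrite !mxE.
by rewrite !mxE.
Qed.

Definition gauss_density_measure (nu : gparam R d) (A : set (euclid R d)) :
  \bar R := (\int[@lebesgue_euclid R d]_(x in A) (gauss_pdf nu x)%:E)%E.

Section gauss_density_measure_instance.
Variable nu : gparam R d.

Let gauss_density_measure0 : gauss_density_measure nu set0 = 0%E.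
Proof. exact: integral_set0. Qed.

Let gauss_density_measure_ge0 A : (0 <= gauss_density_measure nu A)%E.
Proof. by apply: integral_ge0 => x _; rewrite lee_fin gauss_pdf_ge0. Qed.

Let gauss_density_measure_sigma_additive :
  semi_sigma_additive (gauss_density_measure nu).
Proof.
apply: semi_sigma_additive_nng_induced.
  by apply/measurable_EFinP; exact: measurable_gauss_pdf.
by move=> x; rewrite lee_fin gauss_pdf_ge0.
Qed.

HB.instance Definition _ := isMeasure.Build _ _ _ (gauss_density_measure nu)
  gauss_density_measure0 gauss_density_measure_ge0
  gauss_density_measure_sigma_additive.

End gauss_density_measure_instance.

(* For nu in [gaussians] the measure of density [gauss_pdf nu] has total mass 1,
   so [mnormalize] leaves it unchanged: it only serves to obtain a
   [probability] for every nu, the Dirac mass being a junk value. *)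
Definition gauss (nu : gparam R d) : probability (euclid R d) R :=
  mnormalize (gauss_density_measure nu)
    (@dirac _ (euclid R d) [tuple of nseq d 0] R).

Definition dpar (nu nu' : gparam R d) : R :=
  Num.sqrt (\sum_(i < d) (nu.1 i 0 - nu'.1 i 0) ^+ 2
          + \sum_(i < d) \sum_(j < d) (nu.2 i j - nu'.2 i j) ^+ 2).

(* Gradient, for the Euclidean/Frobenius inner product, of a function on the
   open subset [gaussians] of R^d x Sym_d. *)
Definition is_gradient (F : gparam R d -> R) (nu G : gparam R d) : Prop :=
  G.2^T = G.2 /\
  forall e : R, 0 < e -> exists2 r : R, 0 < r &
    forall nu', gaussians nu' -> dpar nu' nu < r ->
      `|F nu' - F nu - (((G.1)^T *m (nu'.1 - nu.1)) 0 0
                        + \tr ((G.2)^T *m (nu'.2 - nu.2)))|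
      <= e * dpar nu' nu.

Definition stationary (F : gparam R d -> R) (nu : gparam R d) : Prop :=
  is_gradient F nu (0, 0).

End gaussian.

Section transport.
Context {R : realType} {d : nat}.
Local Open Scope ereal_scope.
Local Open Scope charge_scope.

Implicit Types p q : probability (euclid R d) R.

Definition KL p (mu : probability (euclid R d) R) : \bar R :=
  if `[< p `<< mu >] then
    \int[p]_x (ln (fine (('d (charge_of_finite_measure p) '/d mu) x)))%:E
  else +oo.

Definition couplings p q : set (probability (euclid R d * euclid R d)%type R) :=
  [set g | forall A, measurable A ->
     g (A `*` setT) = p A /\ g (setT `*` A) = q A].

Definition W2sq p q : \bar R :=
  ereal_inf [set \int[g]_z (sqdist z.1 z.2)%:E | g in couplings p q].

Definition ut_cost (t0 t1 : R) (mu nu p q : probability (euclid R d) R) :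
  \bar R := W2sq p q + t0%:E * KL p mu + t1%:E * KL q nu.

Definition ut_minimizer (t0 t1 : R) (mu nu p q : probability (euclid R d) R) :
  Prop :=
  forall p' q', ut_cost t0 t1 mu nu p q <= ut_cost t0 t1 mu nu p' q'.

(* The infimum is finite for mu, nu in [gaussians], so [fine] loses nothing. *)
Definition ut_value (t0 t1 : R) (mu nu : gparam R d) : R :=
  fine (ereal_inf [set ut_cost t0 t1 (gauss mu) (gauss nu) pq.1 pq.2
                  | pq in [set: probability (euclid R d) R
                              * probability (euclid R d) R]]).

(* Parameters (v, Q) of the second component q = N(v, Q) of the minimizer
   (p, q); nu itself is a junk value, used only if there is no such Gaussian. *)
Definition ut_second (t0 t1 : R) (mu nu : gparam R d) : gparam R d :=
  xget nu [set vQ | gaussians vQ /\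
    exists p, ut_minimizer t0 t1 (gauss mu) (gauss nu) p (gauss vQ)].

End transport.

Section barycenter.
Context {R : realType} {d n : nat}.
Variables (t0 t1 : R) (lam a : 'I_n -> R) (mu : 'I_n -> gparam R d).

Let s := t0 + t1.
Let theta := t0 / s.

Definition bary_term (nu : gparam R d) (i : 'I_n) : R :=
  lam i * (a i `^ theta) * expR (- ut_value t0 t1 (mu i) nu / s).

Definition bary_Z (nu : gparam R d) : R := \sum_(i < n) bary_term nu i.

Definition bary_omega (nu : gparam R d) (i : 'I_n) : R :=
  bary_term nu i / bary_Z nu.

Definition bary_mass (nu : gparam R d) : R := bary_Z nu `^ theta^-1.

Definition bary_Phi (nu : gparam R d) : R :=
  t0 * (\sum_(i < n) lam i * a i - bary_mass nu).

Definition moment_update (nu : gparam R d) : gparam R d :=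
  let v i := (ut_second t0 t1 (mu i) nu).1 in
  let Q i := (ut_second t0 t1 (mu i) nu).2 in
  let m' := \sum_(i < n) bary_omega nu i *: v i in
  (m', \sum_(i < n) bary_omega nu i *: (Q i + (v i - m') *m (v i - m')^T)).

(* The finite Gaussian measure b N(m, S), with b = [bary_mass] of (m, S), given
   by its mass, mean and covariance (b, (m, S)). *)
Definition bary_beta (nu : gparam R d) : R * gparam R d := (bary_mass nu, nu).

End barycenter.

(* Main.v *)
(* A quadratic ansatz for the dual potentials reduces the optimal pair to a
   matrix Riccati equation; weak duality together with a Jensen (Gibbs) bound
   certifies the Gaussian solution among all probability measures.  The Riccati
   solution is analytic in (m, S) by the implicit function theorem, hence so are
   ln Z and T.

   Testing the minimizer at nu against another nu' and applying Jensen's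
   inequality gives ln Z(T nu) - ln Z(nu) >= (t1/s) KL(T nu | nu), a quadratic
   descent estimate along the trajectory, which stays in a compact set because
   sublevel sets of the transport values bound mean and covariance, and because
   a lower bound on the covariance is propagated by T.  The same comparison
   bounds the local Lipschitz constant of ln Z at nu by the distance from nu to
   T nu, so the Lojasiewicz gradient inequality turns descent into finite length.

   The Lojasiewicz inequality itself is obtained by contradiction: a sequence of
   counterexamples is followed along a free ultrafilter, and toric blow-ups together
   with analytic changes of variables turn the function into a unit times a monomial
   along that sequence, where the inequality is explicit. *)
Require Import Defs.
From HB Require Import structures.
From mathcomp Require Import all_boot all_order all_algebra.
From mathcomp Require Import all_classical all_reals all_analysis.
From mathcomp Require Import complex spectral ring lra measurable_realfun.

Set Implicit Arguments.
Unset Strict Implicit.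
Unset Printing Implicit Defensive.

Import Order.TTheory GRing.Theory Num.Theory.
Import numFieldNormedType.Exports.

Local Open Scope classical_set_scope.
Local Open Scope ring_scope.

(** * Real analytic functions *)

(** Analyticity is never expressed by coefficients or derivatives. A function counts as analytic
    when it is a locally uniform limit of polynomials whose weighted coefficient sums stay below a
    fixed bound. That bound is submultiplicative, so products, substitutions, division by a
    coordinate and the contraction behind implicit functions all reduce to estimates on polynomials.
    The gradient is likewise replaced by a local Lipschitz constant, [lip_at]. The transport value
    is then never differentiated: the envelope comparison bounds this constant for ln Z directly,
    and at a fixed point of T every positive constant is admissible, which is stationarity. The
    reduction to a monomial is an induction on the number of coordinates and, inside it, on the
    order of vanishing in one of them. The ultrafilter decides every sign and every comparison of
    monomials, so only the chart containing the sequence is followed. The order drops because a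
    Tschirnhaus translation has removed the coefficient just below the leading one. *)

Section polynomial_bounds.
Variable R : realType.

(* [PB rho M p]: the polynomial function p has an expression whose coefficients
   satisfy sum_al |c_al| rho^al <= M. *)
Inductive PB (I : finType) (rho : I -> R) : R -> ((I -> R) -> R) -> Prop :=
| PB_cst c : PB rho `|c| (fun=> c)
| PB_var i : PB rho (rho i) (fun x => x i)
| PB_add M N f g : PB rho M f -> PB rho N g -> PB rho (M + N) (fun x => f x + g x)
| PB_mul M N f g : PB rho M f -> PB rho N g -> PB rho (M * N) (fun x => f x * g x)
| PB_le M N f : PB rho M f -> M <= N -> PB rho N f.

Lemma PB_ge0 (I : finType) (rho : I -> R) M f :
  (forall i, 0 <= rho i) -> PB rho M f -> 0 <= M.
Proof.
move=> r0; elim=> // *; rewrite ?addr_ge0 ?mulr_ge0 //.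
by apply: le_trans; eauto.
Qed.

Lemma PB_bound (I : finType) (rho : I -> R) M f x :
  (forall i, `|x i| <= rho i) -> PB rho M f -> `|f x| <= M.
Proof.
move=> xr; elim=> //.
- by move=> {}M N {}f g _ fM _ gN; rewrite (le_trans (ler_normD _ _)) ?lerD.
- by move=> {}M N {}f g _ fM _ gN; rewrite normrM ler_pM.
- by move=> {}M N {}f _ fM /(le_trans fM).
Qed.

Lemma PB_comp (I J : finType) (rho : J -> R) (r : I -> R) M f
    (q : J -> (I -> R) -> R) :
  (forall j, PB r (rho j) (q j)) -> PB rho M f ->
  PB r M (fun x => f (fun j => q j x)).
Proof.
move=> qr; elim=> [c|//|||].
- exact: PB_cst.
- by move=> {}M N {}f g _ fM _ gN; apply: PB_add.
- by move=> {}M N {}f g _ fM _ gN; apply: PB_mul.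
- by move=> {}M N {}f _ fM MN; apply: PB_le MN.
Qed.

(** N0 bounds the order-zero part of the expansion at x and N1 the rest; they share the budget M
    because s * rho + (1 - s) * rho = rho. In a product the cross terms carry t or t^2 <= t, which
    keeps the increment linear in t. *)
Lemma PB_lip (I : finType) (rho : I -> R) s M f :
  (forall i, 0 <= rho i) -> 0 <= s <= 1 -> PB rho M f ->
  exists N0 N1, [/\ 0 <= N0, 0 <= N1, N0 + N1 <= M &
    forall x y t, 0 <= t <= 1 -> (forall i, `|x i| <= s * rho i) ->
      (forall i, `|y i - x i| <= t * ((1 - s) * rho i)) ->
      `|f x| <= N0 /\ `|f y - f x| <= t * N1].
Proof.
move=> r0 s01; elim=> [c|i|||].
- exists `|c|, 0; split=> //; first by rewrite addr0.
  by move=> x y t _ _ _; rewrite subrr normr0 mulr0.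
- exists (s * rho i), ((1 - s) * rho i); split.
  + by rewrite mulr_ge0 //; case/andP: s01.
  + by rewrite mulr_ge0 // subr_ge0; case/andP: s01.
  + by rewrite -mulrDl addrC subrK mul1r.
  + by move=> x y t _ xs yx; split.
- move=> {}M N {}f g _ [a0 [a1 [a00 a10 aM fa]]] _ [b0 [b1 [b00 b10 bM fb]]].
  exists (a0 + b0), (a1 + b1); split; rewrite ?addr_ge0 //; first by lra.
  move=> x y t t01 xs yx; have [fx fy] := fa x y t t01 xs yx.
  have [gx gy] := fb x y t t01 xs yx; split.
    by rewrite (le_trans (ler_normD _ _)) // lerD.
  rewrite (_ : _ - _ = (f y - f x) + (g y - g x)); last by ring.
  by apply: le_trans (ler_normD _ _) _; rewrite mulrDr lerD.
- move=> {}M N {}f g _ [a0 [a1 [a00 a10 aM fa]]] _ [b0 [b1 [b00 b10 bM fb]]].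
  exists (a0 * b0), (a0 * b1 + a1 * b0 + a1 * b1); split.
  + exact: mulr_ge0.
  + by rewrite !addr_ge0 // mulr_ge0.
  + rewrite (_ : _ + _ = (a0 + a1) * (b0 + b1)); last by ring.
    by rewrite ler_pM ?addr_ge0.
  move=> x y t t01 xs yx; have [fx fy] := fa x y t t01 xs yx.
  have [gx gy] := fb x y t t01 xs yx; split.
    by rewrite normrM ler_pM.
  rewrite (_ : _ - _ = f x * (g y - g x) + (f y - f x) * g x
    + (f y - f x) * (g y - g x)); last by ring.
  apply: le_trans (ler_normD _ _) _; rewrite [leRHS]mulrDr lerD //.
    apply: le_trans (ler_normD _ _) _; rewrite [leRHS]mulrDr lerD // normrM.
      by rewrite mulrCA ler_pM.
    by rewrite mulrA ler_pM.
  rewrite normrM; apply: (@le_trans _ _ ((t * a1) * (t * b1))).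
    by rewrite ler_pM.
  rewrite mulrACA -subr_ge0 -mulrBl mulr_ge0 // ?mulr_ge0 //.
  by move/andP: t01 => [t0 t1]; rewrite subr_ge0 ler_piMr.
- move=> {}M N {}f _ [a0 [a1 [a00 a10 aM fa]]] MN.
  by exists a0, a1; split => //; exact: le_trans MN.
Qed.

Definition upd (I : finType) (x : I -> R) i t : I -> R :=
  fun k => if k == i then t else x k.

Lemma upd_eq (I : finType) (x : I -> R) i t : upd x i t i = t.
Proof. by rewrite /upd eqxx. Qed.

Lemma upd_id (I : finType) (x : I -> R) i : upd x i (x i) = x.
Proof. by apply/funext => k; rewrite /upd; case: eqP => // ->. Qed.

Lemma upd_upd (I : finType) (x : I -> R) i s t : upd (upd x i s) i t = upd x i t.
Proof. by apply/funext => k; rewrite /upd; case: eqP. Qed.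

(** The monomials containing x_i are separated from the others and the bound splits with them; this
    is what later bounds the quotient by M / rho i. *)
Lemma PB_split (I : finType) (rho : I -> R) i M f :
  (forall i, 0 <= rho i) -> PB rho M f ->
  exists f0 f1 M0 M1, [/\ PB rho M0 f0, PB rho M1 f1, M0 + rho i * M1 <= M,
    forall x t, f0 (upd x i t) = f0 x & forall x, f x = f0 x + x i * f1 x].
Proof.
move=> r0; elim=> [c|k|||].
- exists (fun=> c), (fun=> 0), `|c|, `|0 : R|.
  split=> //; [exact: PB_cst|exact: PB_cst|by rewrite normr0 mulr0 addr0|].
  by move=> x; rewrite mulr0 addr0.
- have [->|ki] := eqVneq k i.
    exists (fun=> 0), (fun=> 1), `|0 : R|, `|1 : R|.
    split=> //; [exact: PB_cst|exact: PB_cst| |].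
      by rewrite normr0 normr1 mulr1 add0r.
    by move=> x; rewrite mulr1 add0r.
  exists (fun x => x k), (fun=> 0), (rho k), `|0 : R|.
  split=> //; [exact: PB_var|exact: PB_cst|by rewrite normr0 mulr0 addr0| |].
    by move=> x t; rewrite /upd (negPf ki).
  by move=> x; rewrite mulr0 addr0.
- move=> {}M N {}f g _ [a0 [a1 [A0 [A1 [pa0 pa1 aM a0i fa]]]]].
  move=> _ [b0 [b1 [B0 [B1 [pb0 pb1 bM b0i gb]]]]].
  exists (fun x => a0 x + b0 x), (fun x => a1 x + b1 x), (A0 + B0), (A1 + B1).
  split; [exact: PB_add|exact: PB_add|by rewrite mulrDr; lra| |].
    by move=> x t; rewrite a0i b0i.
  by move=> x; rewrite fa gb; ring.
- move=> {}M N {}f g _ [a0 [a1 [A0 [A1 [pa0 pa1 aM a0i fa]]]]].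
  move=> _ [b0 [b1 [B0 [B1 [pb0 pb1 bM b0i gb]]]]].
  exists (fun x => a0 x * b0 x),
    (fun x => (a0 x * b1 x + a1 x * b0 x) + x i * (a1 x * b1 x)),
    (A0 * B0), ((A0 * B1 + A1 * B0) + rho i * (A1 * B1)).
  split; first exact: PB_mul.
  + apply: PB_add; first by apply: PB_add; exact: PB_mul.
    by apply: PB_mul; [exact: PB_var|exact: PB_mul].
  + rewrite [leLHS](_ : _ = (A0 + rho i * A1) * (B0 + rho i * B1)); last by ring.
    have := PB_ge0 r0 pa0; have := PB_ge0 r0 pa1.
    have := PB_ge0 r0 pb0; have := PB_ge0 r0 pb1 => *.
    by rewrite ler_pM ?addr_ge0 ?mulr_ge0.
  + by move=> x t; rewrite a0i b0i.
  + by move=> x; rewrite fa gb; ring.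
- move=> {}M N {}f _ [a0 [a1 [A0 [A1 [pa0 pa1 aM a0i fa]]]]] MN.
  by exists a0, a1, A0, A1; split=> //; exact: le_trans MN.
Qed.

(** Every nonconstant monomial gains at least one factor t when all radii shrink by t, so once the
    constant term is removed the bound itself shrinks by t. *)
Lemma PB_scale (I : finType) (rho : I -> R) M f :
  (forall i, 0 <= rho i) -> PB rho M f ->
  exists g N, [/\ `|f (fun=> 0)| + N <= M, 0 <= N,
    forall x, f x = f (fun=> 0) + g x &
    forall t, 0 <= t <= 1 -> PB (fun i => t * rho i) (t * N) g].
Proof.
move=> r0; elim=> [c|k|||].
- exists (fun=> 0), 0; split => //; [by rewrite addr0|by move=> ?; rewrite addr0|].
  by move=> t _; rewrite mulr0 -[X in PB _ X](@normr0 _ R); exact: PB_cst.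
- exists (fun x => x k), (rho k); split=> //; first by rewrite normr0 add0r.
    by move=> x; rewrite add0r.
  by move=> t _; exact: (PB_var (fun i => t * rho i)).
- move=> {}M N {}f g _ [a [A [aM A0 fa pa]]] _ [b [B [bM B0 gb pb]]].
  exists (fun x => a x + b x), (A + B); split; last 2 first.
  + by move=> x; rewrite fa gb; ring.
  + by move=> t t01; rewrite mulrDr; apply: PB_add; [exact: pa|exact: pb].
  + by rewrite (le_trans _ (lerD aM bM)) // addrACA lerD2r ler_normD.
  + exact: addr_ge0.
- move=> {}M N {}f g _ [a [A [aM A0 fa pa]]] _ [b [B [bM B0 gb pb]]].
  set f0 := f _ in aM fa *; set g0 := g _ in bM gb *.
  exists (fun x => (f0 * b x + a x * g0) + a x * b x),
    (`|f0| * B + A * `|g0| + A * B); split; last 2 first.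
  + by move=> x; rewrite fa gb; ring.
  + move=> t t01.
    apply: (@PB_le _ _ ((`|f0| * (t * B) + (t * A) * `|g0|) + (t * A) * (t * B))).
      apply: PB_add; last by apply: PB_mul; [exact: pa|exact: pb].
      by apply: PB_add; apply: PB_mul; rewrite ?[PB _ `|_| _]PB_cst //;
        try exact: PB_cst; [exact: pb|exact: pa].
    rewrite !mulrDr lerD // ?lerD //; first by rewrite mulrCA.
      by rewrite mulrA.
    rewrite mulrACA -subr_ge0 -mulrBl mulr_ge0 // ?mulr_ge0 //.
    by move/andP: t01 => [t0 t1]; rewrite subr_ge0 ler_piMr.
  + rewrite normrM [leLHS](_ : _ = (`|f0| + A) * (`|g0| + B)); last by ring.
    by rewrite ler_pM ?addr_ge0.
  + by rewrite !addr_ge0 // mulr_ge0.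
- move=> {}M N {}f _ [a [A [aM A0 fa pa]]] MN.
  by exists a, A; split => //; exact: le_trans MN.
Qed.

End polynomial_bounds.

Section uniform_limits.
Variable R : realType.

Lemma cauchy_lim (u : nat -> R) :
  (forall e : R, 0 < e -> exists K, forall k l, (K <= k)%N -> (K <= l)%N ->
    `|u k - u l| <= e) ->
  exists l, forall e : R, 0 < e -> exists K, forall k, (K <= k)%N -> `|u k - l| <= e.
Proof.
move=> uC; have : cvg (u @ \oo).
  apply/cauchy_cvgP/cauchy_exP => e e0.
  have [K KP] := uC (e / 2) (divr_gt0 e0 (ltr0Sn _ _)).
  exists (u K), K => // k /= Kk; rewrite /ball /= (le_lt_trans (KP _ _ _ _)) //.
  by rewrite ltr_pdivrMr // ltr_pMr // ltr1n.
move=> /cvgrPdist_le uL; exists (lim (u @ \oo)) => e e0.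
have [K _ KP] := uL e e0; exists K => k Kk; rewrite distrC; exact: KP.
Qed.

(** In the uses, D s is the box of ratio s < 1: convergence is uniform on each box but perhaps not
    on the open polydisc they exhaust. Outside all D s the limit takes a default value. *)
Lemma unif_lim (T S : Type) (D : S -> T -> Prop) (u : nat -> T -> R) :
  (forall s (e : R), 0 < e -> exists K, forall k l x, (K <= k)%N -> (K <= l)%N ->
    D s x -> `|u k x - u l x| <= e) ->
  exists g, forall s (e : R), 0 < e -> exists K, forall k x, (K <= k)%N -> D s x ->
    `|u k x - g x| <= e.
Proof.
move=> uC.
have /choice[g gP] : forall x, exists l, (exists s, D s x) ->
    forall e : R, 0 < e -> exists K, forall k, (K <= k)%N -> `|u k x - l| <= e.
  move=> x; have [[s sx]|nx] := pselect (exists s, D s x); last by exists 0.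
  have [|l lP] := @cauchy_lim (u^~ x).
    move=> e e0; have [K KP] := uC s e e0.
    by exists K => k l Kk Kl; exact: KP.
  by exists l.
exists g => s e e0; have [K KP] := uC s e e0; exists K => k x Kk sx.
apply/ler_addgt0Pr => d d0.
have [|K' K'P] := gP x _ d d0; first by exists s.
rewrite (_ : _ - _ = (u k x - u (maxn K K') x) + (u (maxn K K') x - g x));
  last by ring.
apply: le_trans (ler_normD _ _) _; rewrite lerD //.
  by apply: KP => //; rewrite leq_maxl.
by apply: K'P; rewrite leq_maxr.
Qed.

End uniform_limits.

(** * Limits of polynomials with a weighted bound *)

Section power_series_algebra.
Variable R : realType.
Implicit Types (I J : finType).

Definition inbox I (s : R) (rho x : I -> R) := forall i, `|x i| <= s * rho i.

(* Stands for a power series with sum_al |c_al| rho^al <= M: it is only recorded as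
   a uniform limit of polynomials with that bound, on every smaller polydisc. *)
Definition An I (rho : I -> R) M (f : (I -> R) -> R) :=
  forall e s : R, 0 < e -> 0 < s < 1 -> exists p, PB rho M p /\
    forall x, inbox s rho x -> `|f x - p x| <= e.

Lemma inbox_le I s s' (rho x : I -> R) : (forall i, 0 <= rho i) -> s <= s' ->
  inbox s rho x -> inbox s' rho x.
Proof.
by move=> r0 ss xs i; apply: le_trans (xs i) _; rewrite ler_wpM2r.
Qed.

Lemma inbox1 I s (rho x : I -> R) : (forall i, 0 <= rho i) -> s <= 1 ->
  inbox s rho x -> forall i, `|x i| <= rho i.
Proof. by move=> r0 s1 xs i; have := inbox_le r0 s1 xs i; rewrite mul1r. Qed.

Lemma An_ext I (rho : I -> R) M f g :
  (forall (s : R) x, 0 < s < 1 -> inbox s rho x -> f x = g x) ->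
  An rho M f -> An rho M g.
Proof.
move=> fg fA e s e0 s01; have [p [pP fp]] := fA e s e0 s01.
by exists p; split=> // x xs; rewrite -(fg s) //; exact: fp.
Qed.

Lemma PB_An I (rho : I -> R) M p : PB rho M p -> An rho M p.
Proof. by move=> pP e s e0 _; exists p; split => // x _; rewrite subrr normr0 ltW. Qed.

Lemma An_le I (rho : I -> R) M N f : M <= N -> An rho M f -> An rho N f.
Proof.
move=> MN fA e s e0 s01; have [p [pP fp]] := fA e s e0 s01.
by exists p; split=> //; exact: PB_le MN.
Qed.

Lemma An_ge0 I (rho : I -> R) M f : (forall i, 0 <= rho i) -> An rho M f -> 0 <= M.
Proof.
by move=> r0 /(_ 1 (1/2) ltr01) []; [lra|move=> p [/(PB_ge0 r0)]].
Qed.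

Lemma An_bound I (rho : I -> R) M f s x : (forall i, 0 <= rho i) -> 0 < s < 1 ->
  An rho M f -> inbox s rho x -> `|f x| <= M.
Proof.
move=> r0 s01 fA xs; apply/ler_addgt0Pr => e e0.
have [p [pP fp]] := fA e s e0 s01.
rewrite -(subrK (p x) (f x)) (le_trans (ler_normD _ _)) // addrC lerD ?fp //.
by apply: PB_bound pP => i; apply: (inbox1 r0 _ xs); lra.
Qed.

Lemma An_lip I (rho : I -> R) M f s s' x y t : (forall i, 0 <= rho i) ->
  An rho M f -> 0 < s < 1 -> 0 < s' < 1 -> inbox s rho x -> inbox s' rho y ->
  0 <= t <= 1 -> (forall i, `|y i - x i| <= t * ((1 - s) * rho i)) ->
  `|f y - f x| <= t * M.
Proof.
move=> r0 fA s01 s01' xs ys t01 xy; apply/ler_addgt0Pr => e e0.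
pose s1 := Num.max s s'.
have ss1 : s <= s1 by rewrite le_max lexx.
have ss1' : s' <= s1 by rewrite le_max lexx orbT.
have s101 : 0 < s1 < 1 by rewrite /s1 /Num.max; case: ifP.
have [p [pP fp]] := fA (e / 2) s1 (divr_gt0 e0 (ltr0Sn _ _)) s101.
have s01w : 0 <= s <= 1 by lra.
have [N0 [N1 [N00 N10 NM /(_ x y t t01 xs xy)[_ pyx]]]] := PB_lip r0 s01w pP.
rewrite (_ : f y - f x = (f y - p y) + (p y - p x) - (f x - p x)); last by ring.
have fpx := fp _ (inbox_le r0 ss1 xs).
have fpy := fp _ (inbox_le r0 ss1' ys).
have tNM : t * N1 <= t * M by rewrite ler_wpM2l //; lra.
apply: le_trans (ler_normB _ _) _.
rewrite (le_trans (lerD (ler_normD _ _) (lexx _))) //; lra.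
Qed.

Lemma An_add I (rho : I -> R) M N f g : An rho M f -> An rho N g ->
  An rho (M + N) (fun x => f x + g x).
Proof.
move=> fA gA e s e0 s01.
have [p [pP fp]] := fA (e / 2) s (divr_gt0 e0 (ltr0Sn _ _)) s01.
have [q [qP gq]] := gA (e / 2) s (divr_gt0 e0 (ltr0Sn _ _)) s01.
exists (fun x => p x + q x); split; first exact: PB_add.
move=> x xs; rewrite (_ : _ - _ = (f x - p x) + (g x - q x)); last by ring.
by rewrite (le_trans (ler_normD _ _)) // (splitr e) lerD ?fp ?gq.
Qed.

Lemma An_mul I (rho : I -> R) M N f g : (forall i, 0 <= rho i) ->
  An rho M f -> An rho N g -> An rho (M * N) (fun x => f x * g x).
Proof.
move=> r0 fA gA e s e0 s01.
have M0 := An_ge0 r0 fA; have N0 := An_ge0 r0 gA.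
pose d := e / (M + N + 1).
have d0 : 0 < d by rewrite divr_gt0 //; lra.
have [p [pP fp]] := fA d s d0 s01.
have [q [qP gq]] := gA d s d0 s01.
exists (fun x => p x * q x); split; first exact: PB_mul.
move=> x xs; rewrite (_ : _ - _ = f x * (g x - q x) + (f x - p x) * q x);
  last by ring.
apply: le_trans (ler_normD _ _) _; rewrite !normrM.
have fM := An_bound r0 s01 fA xs.
have qN : `|q x| <= N.
  by apply: PB_bound qP => i; apply: (inbox1 r0 _ xs); lra.
apply: (@le_trans _ _ (M * d + d * N)).
  by rewrite lerD // ler_pM ?fp ?gq.
rewrite (_ : e = d * (M + N + 1)); last by rewrite /d divfK //; lra.
by rewrite mulrDr mulr1 mulrDr (mulrC M) lerDl ltW.
Qed.

Lemma An_lim I (rho : I -> R) M f :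
  (forall e s : R, 0 < e -> 0 < s < 1 -> exists g, An rho M g /\
    forall x, inbox s rho x -> `|f x - g x| <= e) -> An rho M f.
Proof.
move=> fA e s e0 s01.
have [g [gA fg]] := fA (e / 2) s (divr_gt0 e0 (ltr0Sn _ _)) s01.
have [p [pP gp]] := gA (e / 2) s (divr_gt0 e0 (ltr0Sn _ _)) s01.
exists p; split=> // x xs; rewrite (_ : _ - _ = (f x - g x) + (g x - p x)); last by ring.
by rewrite (le_trans (ler_normD _ _)) // (splitr e) lerD ?fg ?gp.
Qed.

Lemma An_subst I J (rho : J -> R) (r : I -> R) M f (q : J -> (I -> R) -> R) :
  (forall j, PB r (rho j) (q j)) ->
  (forall s : R, 0 < s < 1 -> exists s', 0 < s' < 1 /\
    forall x, inbox s r x -> inbox s' rho (fun j => q j x)) ->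
  An rho M f -> An r M (fun x => f (fun j => q j x)).
Proof.
move=> qP qb fA e s e0 s01; have [s' [s01' ss']] := qb s s01.
have [p [pP fp]] := fA e s' e0 s01'.
exists (fun x => p (fun j => q j x)); split; first exact: PB_comp pP.
by move=> x xs; apply: fp; exact: ss'.
Qed.

Lemma An_radius I (rho r : I -> R) M f : (forall i, r i <= rho i) ->
  An rho M f -> An r M f.
Proof.
move=> rr; apply: (@An_subst _ _ _ _ _ _ (fun i x => x i)).
  by move=> i; exact: PB_le (PB_var _ _) (rr i).
move=> s s01; exists s; split=> // x xs i; apply: le_trans (xs i) _.
by rewrite ler_wpM2l //; lra.
Qed.

(** The factor tau < 1 keeps the inner functions strictly inside the outer polydisc, so [PB_lip]
    controls the effect of replacing them by polynomial approximants. *)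
Lemma An_comp I J (rho : J -> R) (r : I -> R) (N : J -> R) M tau f
    (q : J -> (I -> R) -> R) :
  (forall i, 0 <= r i) -> (forall i, 0 < rho i) -> 0 < tau < 1 ->
  (forall j, N j <= tau * rho j) -> (forall j, An r (N j) (q j)) ->
  An rho M f -> An r M (fun x => f (fun j => q j x)).
Proof.
move=> r0 rho0 tau01 Ntau qA fA e s e0 s01.
have rho0' j : 0 <= rho j by exact: ltW.
have M0 := An_ge0 rho0' fA.
have [p [pP fp]] := fA (e / 2) tau (divr_gt0 e0 (ltr0Sn _ _)) tau01.
(* Approximating each [q j] within t times the margin (1 - tau) * rho j changes p by at most t * M
   <= e / 2. *)
have [t t01 tM] : exists2 t : R, 0 < t <= 1 & t * M <= e / 2.
  have Me : 0 < M + e / 2 by lra.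
  exists (e / 2 / (M + e / 2)); first by rewrite divr_gt0 ?ler_pdivrMr //=; lra.
  by rewrite mulrAC ler_pdivrMr // ler_wpM2l //; lra.
have /choice[h hP] j : exists h, PB r (N j) h /\
    forall x, inbox s r x -> `|q j x - h x| <= t * ((1 - tau) * rho j).
  apply: qA => //; apply: mulr_gt0; first by lra.
  by apply: mulr_gt0 => //; lra.
exists (fun x => p (fun j => h j x)); split.
  apply: PB_comp pP => j; apply: PB_le (hP j).1 _.
  apply: le_trans (Ntau j) _; rewrite ler_piMl //; lra.
move=> x xs.
have hb : inbox tau rho (fun j => h j x).
  move=> j; apply: le_trans (Ntau j); apply: PB_bound (hP j).1.
  by apply: (inbox1 r0 _ xs); lra.
have qb : inbox tau rho (fun j => q j x).
  by move=> j; apply: le_trans (Ntau j); exact: An_bound (qA j) xs.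
rewrite (_ : _ - _ = (f (fun j => q j x) - p (fun j => q j x)) +
   (p (fun j => q j x) - p (fun j => h j x))); last by ring.
rewrite (le_trans (ler_normD _ _)) // (splitr e) lerD ?fp //.
have tau01w : 0 <= tau <= 1 by lra.
have [N0 [N1 [N00 N10 NM]]] := PB_lip rho0' tau01w pP.
have t01w : 0 <= t <= 1 by lra.
move=> /(_ _ (fun j => q j x) t t01w hb) [].
  by move=> j; exact: (hP j).2.
move=> _ /le_trans; apply; apply: le_trans tM.
by rewrite ler_wpM2l; lra.
Qed.

Lemma An_scale I (rho : I -> R) M f t : (forall i, 0 <= rho i) ->
  0 < t <= 1 -> f (fun=> 0) = 0 -> An rho M f ->
  An (fun i => t * rho i) (t * M) f.
Proof.
move=> r0 t01 f0 fA e s e0 s01.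
have [p [pP fp]] := fA (e / 2) s (divr_gt0 e0 (ltr0Sn _ _)) s01.
have [g [N [gM N0 pg gP]]] := PB_scale r0 pP.
exists g; split.
  apply: PB_le (gP t _) _; first by lra.
  rewrite ler_wpM2l //; first by lra.
  by apply: le_trans gM; rewrite lerDr.
move=> x xs.
have xs' : inbox s rho x.
  move=> i; apply: le_trans (xs i) _; rewrite ler_wpM2l //; first by lra.
  by rewrite ler_piMl //; lra.
have p0 : `|p (fun=> 0)| <= e / 2.
  have := fp (fun=> 0); rewrite f0 sub0r normrN; apply.
  by move=> i; rewrite normr0 mulr_ge0 //; lra.
rewrite (_ : _ - _ = (f x - p x) + p (fun=> 0)); last by rewrite (pg x); ring.
by rewrite (le_trans (ler_normD _ _)) // (splitr e) lerD ?fp.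
Qed.

End power_series_algebra.

(** * Division by a coordinate and the Hadamard lemma *)

Section division.
Variable R : realType.
Implicit Types (I J : finType).

Lemma An_recenter I (rho : I -> R) M f (s : R) a : (forall i, 0 <= rho i) ->
  0 < s < 1 -> inbox s rho a -> An rho M f ->
  An (fun i => (1 - s) * rho i) M (fun x => f (fun i => a i + x i)).
Proof.
move=> r0 s01 ab; apply: (@An_subst _ _ _ _ _ _ _ (fun i x => a i + x i)).
  move=> i; apply: (@PB_le _ _ _ (`|a i| + (1 - s) * rho i)).
    by apply: PB_add; [exact: PB_cst|exact: (PB_var (fun i => (1 - s) * rho i))].
  have := ab i; lra.
move=> s1 s101; exists (s + s1 * (1 - s)); split; first by nra.
move=> x xs i; apply: le_trans (ler_normD _ _) _; rewrite mulrDl lerD //.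
by rewrite -mulrA; exact: xs.
Qed.

(** The quotients of the polynomial approximants converge: where |y_i| is bounded below, the
    identity f = f0 + x_i * g determines g stably, and [PB_lip] carries the estimate back to x, even
    when x_i = 0. *)
Lemma An_div I (rho : I -> R) M f i : (forall i, 0 < rho i) -> An rho M f ->
  exists g, An rho (M / rho i) g /\
    forall (s : R) x, 0 < s < 1 -> inbox s rho x -> f x = f (upd x i 0) + x i * g x.
Proof.
move=> r0 fA; have r0' k : 0 <= rho k by exact: ltW.
pose e k : R := k.+1%:R^-1; pose sg k : R := 1 - k.+2%:R^-1.
have e0 k : 0 < e k by rewrite invr_gt0 ltr0Sn.
have sg01 k : 0 < sg k < 1.
  by rewrite /sg subr_gt0 invf_lt1 ?ltr1n ?ltr0Sn // gtrBl invr_gt0 ltr0Sn.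
have small (d : R) : 0 < d -> exists K, forall k, (K <= k)%N -> e k <= d.
  move=> d0; exists (Num.bound d^-1) => k Kk; rewrite /e invf_ple ?posrE ?ltr0Sn //.
  have d1 : 0 <= d^-1 by rewrite invr_ge0 ltW.
  by rewrite (le_trans (ltW (archi_boundP d1))) // ler_nat leqW.
have /choice[q qP] k : exists g, PB rho (M / rho i) g /\
    forall x, inbox (sg k) rho x -> `|f x - f (upd x i 0) - x i * g x| <= 2 * e k.
  have [p [pP fp]] := fA (e k) (sg k) (e0 k) (sg01 k).
  have [f0 [f1 [M0 [M1 [pf0 pf1 MM f0i pE]]]]] := PB_split i r0' pP.
  exists f1; split.
    apply: PB_le pf1 _; rewrite ler_pdivlMr // mulrC.
    by apply: le_trans MM; rewrite lerDr; exact: PB_ge0 pf0.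
  move=> x xs.
  have xs0 : inbox (sg k) rho (upd x i 0).
    move=> j; rewrite /upd; case: eqP => _ //; rewrite normr0 mulr_ge0 //.
    by have := sg01 k; lra.
  have := fp _ xs; have := fp _ xs0.
  rewrite (pE x) (pE (upd x i 0)) f0i upd_eq mul0r addr0 => h1 h2.
  rewrite (_ : _ - _ = (f x - (f0 x + x i * f1 x)) - (f (upd x i 0) - f0 x)); last by ring.
  by rewrite (le_trans (ler_normB _ _)) //; lra.
have L0 : 0 <= M / rho i by exact: PB_ge0 r0' (qP 0%N).1.
have qC (s : {s : R | 0 < s < 1}) (d : R) : 0 < d -> exists K, forall k l x,
    (K <= k)%N -> (K <= l)%N -> inbox (sval s) rho x -> `|q k x - q l x| <= d.
  case: s => s s01 /= d0.
  pose L := M / rho i.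
  have [t t01 tL] : exists2 t : R, 0 < t <= 1 & t * L <= d / 4.
    have Ld : 0 < L + d / 4 by rewrite /L; lra.
    exists (d / 4 / (L + d / 4)).
      by rewrite divr_gt0 ?ler_pdivrMr //= /L; lra.
    by rewrite mulrAC ler_pdivrMr // ler_wpM2l //; lra.
  pose dl := t * (1 - s) * rho i / 2.
  have dl0 : 0 < dl.
    by rewrite /dl divr_gt0 ?mulr_gt0 //; lra.
  pose s1 := (1 + s) / 2.
  have s101 : 0 < s1 < 1 by rewrite /s1; lra.
  have [K1 K1P] : exists K, forall k, (K <= k)%N -> e k <= 1 - s1.
    by apply: small; lra.
  have [K2 K2P] : exists K, forall k, (K <= k)%N -> e k <= d * dl / 8.
    by apply: small; rewrite divr_gt0 // mulr_gt0.
  exists (maxn K1 K2) => k l x; rewrite !geq_max => /andP[k1 k2] /andP[l1 l2] xs.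
  (* Moving x_i away from zero by dl, on its own side, ensures |y_i| >= dl while y stays in the box
     of ratio s1. *)
  pose y := upd x i (if 0 <= x i then x i + dl else x i - dl).
  have yx : `|y i - x i| = dl /\ dl <= `|y i|.
    rewrite /y upd_eq; case: ifPn => [x0|]; last rewrite -ltNge => x0.
      by rewrite addrAC subrr add0r !ger0_norm; lra.
    by rewrite addrAC subrr add0r normrN gtr0_norm // ltr0_norm; lra.
  have yb : inbox s1 rho y.
    move=> j; have [->|ji] := eqVneq j i.
      rewrite -(subrK (x i) (y i)) (le_trans (ler_normD _ _)) // yx.1.
      have := xs i; have := r0 i => r0i; rewrite /s1 /dl => xi.
      suff : t * (1 - s) * rho i <= (1 - s) * rho i by lra.
      rewrite -mulrA ler_piMl ?mulr_ge0 //; lra.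
    rewrite /y /upd (negPf ji); apply: (inbox_le _ _ xs) => //.
    by rewrite /s1; lra.
  have xb : inbox s1 rho x by apply: (inbox_le _ _ xs) => //; rewrite /s1; lra.
  have sgP m : (K1 <= m)%N -> s1 <= sg m.
    move=> Km; have := K1P _ Km; rewrite /sg /e => em.
    have : m.+2%:R^-1 <= m.+1%:R^-1 :> R by rewrite lef_pV2 ?posrE ?ltr0Sn // ler_nat.
    by move: em; move: m.+1%:R^-1 m.+2%:R^-1 => a b; lra.
  have fq m : (K1 <= m)%N -> `|f y - f (upd y i 0) - y i * q m y| <= 2 * e m.
    by move=> Km; apply: (qP m).2; exact: inbox_le (sgP _ Km) yb.
  have lq m : `|q m y - q m x| <= d / 4.
    have s01w : 0 <= s <= 1 by lra.
    have [N0 [N1 [N00 N10 NM]]] := PB_lip r0' s01w (qP m).1.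
    have t01w : 0 <= t <= 1 by lra.
    move=> /(_ x y t t01w xs) [].
      move=> j; have [->|ji] := eqVneq j i.
        have sr0 : 0 <= t * ((1 - s) * rho i).
          by rewrite !mulr_ge0 //; lra.
        by rewrite yx.1 /dl; lra.
      rewrite /y /upd (negPf ji) subrr normr0 !mulr_ge0 //; lra.
    move=> _ /le_trans; apply; apply: le_trans tL.
    by rewrite ler_wpM2l /L; lra.
  have kl : `|q k y - q l y| <= d / 2.
    rewrite -(ler_pM2l dl0); apply: (@le_trans _ _ (`|y i| * `|q k y - q l y|)).
      by rewrite ler_wpM2r // yx.2.
    rewrite -normrM.
    have -> : y i * (q k y - q l y) = (f y - f (upd y i 0) - y i * q l y) -
      (f y - f (upd y i 0) - y i * q k y) by ring.
    have := fq _ k1; have := fq _ l1; have := K2P _ k2; have := K2P _ l2.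
    by move=> *; rewrite (le_trans (ler_normB _ _)) //; lra.
  rewrite (_ : _ - _ = (q k y - q l y) + (q l y - q l x) - (q k y - q k x)); last by ring.
  have := lq k; have := lq l => h1 h2.
  apply: le_trans (ler_normB _ _) _.
  rewrite (le_trans (lerD (ler_normD _ _) (lexx _))) //; lra.
have [g gP] := @unif_lim R _ _ (fun s : {s : R | 0 < s < 1} => inbox (sval s) rho) _ qC.
exists g; split.
  apply: An_lim => d s d0 s01; have [K KP] := gP (exist _ s s01) d d0.
  exists (q K); split; first exact: PB_An (qP K).1.
  by move=> x xs; rewrite distrC; exact: KP.
move=> s x s01 xs; apply/eqP; rewrite -subr_eq0 opprD addrA -normr_eq0.
rewrite eq_le normr_ge0 andbT; apply/ler_addgt0Pr => d d0; rewrite add0r.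
have xi0 : 0 < `|x i| + 1 by have := normr_ge0 (x i); lra.
have [K1 K1P] := gP (exist _ s s01) (d / 2 / (`|x i| + 1)) (divr_gt0 (divr_gt0 d0 (ltr0Sn _ _)) xi0).
have [K2 K2P] := small (d / 4) (divr_gt0 d0 (ltr0Sn _ _)).
have [K3 K3P] := small (1 - s) ltac:(lra).
pose K := maxn K1 (maxn K2 K3).
have := K1P K x; rewrite leq_maxl => /(_ isT xs) /= h1.
have := K2P K; rewrite !leq_max leqnn orbT => /(_ isT) h2.
have := K3P K; rewrite !leq_max leqnn !orbT => /(_ isT) h3.
have sK : s <= sg K.
  have : K.+2%:R^-1 <= e K :> R by rewrite lef_pV2 ?posrE ?ltr0Sn // ler_nat.
  by move: h3; rewrite /sg; move: (e K) K.+2%:R^-1 => a b; lra.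
have := (qP K).2 x (inbox_le r0' sK xs) => h4.
rewrite (_ : _ - _ = (f x - f (upd x i 0) - x i * q K x) + x i * (q K x - g x)); last by ring.
apply: le_trans (ler_normD _ _) _; rewrite normrM.
have : `|x i| * `|q K x - g x| <= (`|x i| + 1) * (d / 2 / (`|x i| + 1)).
  by rewrite ler_pM // lerDl.
rewrite mulrCA divff ?gt_eqF // mulr1; lra.
Qed.

Definition zer I (s : seq I) (x : I -> R) : I -> R := fun k => if k \in s then 0 else x k.

Lemma An_zer I (rho : I -> R) M f s : (forall i, 0 <= rho i) -> An rho M f ->
  An rho M (fun x => f (zer s x)).
Proof.
move=> r0; apply: (@An_subst _ _ _ _ _ _ _ (fun i x => zer s x i)).
  move=> i; rewrite /zer; case: (i \in s); last exact: PB_var.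
  by apply: (PB_le (PB_cst _ _)); rewrite normr0.
move=> t t01; exists t; split=> // x xs i; rewrite /zer; case: ifP => _ //.
by rewrite normr0 mulr_ge0 //; lra.
Qed.

(** Coordinates are divided out one at a time, each from the restriction of f to the common zero set
    of those already treated. *)
Lemma An_hadamard I (rho : I -> R) M f : (forall i, 0 < rho i) -> An rho M f ->
  exists g, (forall i, An rho (M / rho i) (g i)) /\
    forall (s : R) x, 0 < s < 1 -> inbox s rho x ->
      f x = f (fun=> 0) + \sum_i x i * g i x.
Proof.
move=> r0 fA; have r0' k : 0 <= rho k by exact: ltW.
suff H (l : seq I) : uniq l -> exists g, (forall i, An rho (M / rho i) (g i)) /\
    forall (s : R) x, 0 < s < 1 -> inbox s rho x ->
      f x = f (zer l x) + \sum_(i <- l) x i * g i x.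
  have [g [gA gP]] := H _ (index_enum_uniq I); exists g; split=> // s x s01 xs.
  rewrite (gP _ _ s01 xs); congr (f _ + _); apply/funext => i.
  by rewrite /zer mem_index_enum.
elim: l => [_|i l IH /= /andP[il /IH[g [gA gP]]]].
  exists (fun _ _ => 0); split.
    move=> i; apply: An_le (PB_An (PB_cst _ _)).
    by rewrite normr0 divr_ge0 // (An_ge0 r0' fA).
  by move=> s x s01 xs; rewrite big_nil addr0; congr f; apply/funext => k.
have [h [hA hP]] := An_div i r0 (An_zer l r0' fA).
exists (fun k => if k == i then h else g k); split.
  by move=> k; case: eqP => [->|].
move=> s x s01 xs; rewrite big_cons eqxx (gP _ _ s01 xs) (hP _ _ s01 xs) addrA.
congr (f _ + _ + _); first last.
  rewrite big_seq [RHS]big_seq; apply: eq_bigr => k kl.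
  by case: eqP => // ki; rewrite -ki kl in il.
by apply/funext => k; rewrite /zer /upd inE; case: (k \in l); case: eqP.
Qed.

End division.

Lemma half01 (R : realType) : (0 : R) < (1 : R) / 2 < (1 : R).
Proof. lra. Qed.

(** * Germs of analytic functions *)

Section analytic_germs.
Variable R : realType.
Implicit Types (I J : finType).

Definition nearpt I (a : I -> R) (P : (I -> R) -> Prop) :=
  exists2 e : R, 0 < e & forall x, (forall i, `|x i - a i| < e) -> P x.

Lemma nearpt_self I (a : I -> R) P : nearpt a P -> P a.
Proof. by move=> [e e0]; apply => i; rewrite subrr normr0. Qed.

Lemma nearptW I (a : I -> R) (P : (I -> R) -> Prop) : (forall x, P x) -> nearpt a P.
Proof. by exists 1. Qed.

Lemma nearptS I (a : I -> R) (P Q : (I -> R) -> Prop) :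
  (forall x, P x -> Q x) -> nearpt a P -> nearpt a Q.
Proof. by move=> PQ [e e0 eP]; exists e => // x /eP /PQ. Qed.

Lemma nearptI I (a : I -> R) (P Q : (I -> R) -> Prop) :
  nearpt a P -> nearpt a Q -> nearpt a (fun x => P x /\ Q x).
Proof.
move=> [e e0 eP] [d d0 dQ]; exists (Num.min e d); first by rewrite lt_min e0.
by move=> x xed; split; [apply: eP|apply: dQ] => i; have := xed i;
  rewrite lt_min => /andP[].
Qed.

Lemma nearpt_near I (a : I -> R) (P : (I -> R) -> Prop) :
  nearpt a P -> nearpt a (fun b => nearpt b P).
Proof.
move=> [e e0 eP]; exists (e / 2); first by rewrite divr_gt0.
move=> b ba; exists (e / 2); first by rewrite divr_gt0.
move=> x xb; apply: eP => i; rewrite (_ : _ - _ = (x i - b i) + (b i - a i)); last by ring.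
by rewrite (le_lt_trans (ler_normD _ _)) // (splitr e) ltrD.
Qed.

Lemma nearpt_all I J (a : I -> R) (P : J -> (I -> R) -> Prop) :
  (forall j, nearpt a (P j)) -> nearpt a (fun x => forall j, P j x).
Proof.
move=> nP; suff H (l : seq J) : nearpt a (fun x => forall j, j \in l -> P j x).
  by apply: nearptS (H (enum J)) => x xP j; apply: xP; rewrite mem_enum.
elim: l => [|j l IH]; first exact: nearptW.
apply: nearptS (nearptI (nP j) IH) => x [xj xl] k.
by rewrite inE => /orP[/eqP->|/xl].
Qed.

Lemma fin_radius J (P : J -> R -> Prop) :
  (forall j (r r' : R), P j r -> 0 < r' -> r' <= r -> P j r') ->
  (forall j, exists2 r : R, 0 < r & P j r) -> exists2 r : R, 0 < r & forall j, P j r.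
Proof.
move=> Pmon Pex.
suff H (l : seq J) : exists2 r : R, 0 < r & forall j, j \in l -> P j r.
  have [r r0 rP] := H (enum J); exists r => // j; apply: rP; exact: mem_enum.
elim: l => [|j l [r r0 rP]]; first by exists 1.
have [r' r'0 r'P] := Pex j; exists (Num.min r r'); first by rewrite lt_min r0.
move=> k; rewrite inE => /orP[/eqP->|/rP kr].
  by apply: Pmon r'P _ _; rewrite ?lt_min ?r0 ?ge_min ?lexx ?orbT.
by apply: Pmon kr _ _; rewrite ?lt_min ?r0 ?ge_min ?lexx.
Qed.

Definition ana I (f : (I -> R) -> R) (a : I -> R) :=
  exists r M : R, 0 < r /\ An (fun=> r) M (fun x => f (fun i => a i + x i)).

Lemma ana_ext I (f g : (I -> R) -> R) a : nearpt a (fun x => f x = g x) ->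
  ana f a -> ana g a.
Proof.
move=> [e e0 fg] [r [M [r0 fA]]]; exists (Num.min r e), M.
have m0 : 0 < Num.min r e by rewrite lt_min r0.
split=> //; apply: An_ext (An_radius (r := fun=> Num.min r e) _ fA); last first.
  by move=> i; rewrite ge_min lexx.
move=> s x s01 xs; apply: fg => i; rewrite addrAC subrr add0r.
apply: le_lt_trans (xs i) _; apply: (@lt_le_trans _ _ (Num.min r e)).
  by rewrite gtr_pMl //; lra.
by rewrite ge_min lexx orbT.
Qed.

Lemma ana_cst I c (a : I -> R) : ana (fun=> c) a.
Proof. by exists 1, `|c|; split=> //; apply: PB_An; exact: PB_cst. Qed.

Lemma ana_var I i (a : I -> R) : ana (fun x => x i) a.
Proof.
exists 1, (`|a i| + 1); split=> //; apply: PB_An; apply: PB_add.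
  exact: PB_cst.
exact: (PB_var (fun=> 1)).
Qed.

Lemma ana_rad2 I (f g : (I -> R) -> R) a : ana f a -> ana g a ->
  exists r M N : R, [/\ 0 < r, An (fun=> r) M (fun x => f (fun i => a i + x i)) &
   An (fun=> r) N (fun x => g (fun i => a i + x i))].
Proof.
move=> [r [M [r0 fA]]] [r' [N [r'0 gA]]]; exists (Num.min r r'), M, N; split.
- by rewrite lt_min r0.
- by apply: An_radius fA => i; rewrite ge_min lexx.
- by apply: An_radius gA => i; rewrite ge_min lexx orbT.
Qed.

Lemma ana_add I (f g : (I -> R) -> R) a : ana f a -> ana g a ->
  ana (fun x => f x + g x) a.
Proof.
move=> fa ga; have [r [M [N [r0 fA gA]]]] := ana_rad2 fa ga.
by exists r, (M + N); split=> //; exact: An_add.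
Qed.

Lemma ana_mul I (f g : (I -> R) -> R) a : ana f a -> ana g a ->
  ana (fun x => f x * g x) a.
Proof.
move=> fa ga; have [r [M [N [r0 fA gA]]]] := ana_rad2 fa ga.
by exists r, (M * N); split=> //; apply: An_mul => // _; exact: ltW.
Qed.

Lemma ana_opp I (f : (I -> R) -> R) a : ana f a -> ana (fun x => - f x) a.
Proof.
move=> fa; rewrite (_ : (fun x => - f x) = (fun x => -1 * f x)).
  by apply: ana_mul => //; exact: ana_cst.
by apply/funext => x; rewrite mulN1r.
Qed.

Lemma ana_sub I (f g : (I -> R) -> R) a : ana f a -> ana g a ->
  ana (fun x => f x - g x) a.
Proof. by move=> fa ga; apply: ana_add => //; exact: ana_opp. Qed.

Lemma ana_sum I (S : Type) (l : seq S) (P : pred S) (f : S -> (I -> R) -> R) a :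
  (forall s, P s -> ana (f s) a) -> ana (fun x => \sum_(s <- l | P s) f s x) a.
Proof.
move=> fa; elim: l => [|s l IH].
  by under eq_fun do rewrite big_nil; exact: ana_cst.
under eq_fun do rewrite big_cons.
by case Ps: (P s) => //; apply: ana_add => //; exact: fa.
Qed.

Lemma ana_prod I (S : Type) (l : seq S) (P : pred S) (f : S -> (I -> R) -> R) a :
  (forall s, P s -> ana (f s) a) -> ana (fun x => \prod_(s <- l | P s) f s x) a.
Proof.
move=> fa; elim: l => [|s l IH].
  by under eq_fun do rewrite big_nil; exact: ana_cst.
under eq_fun do rewrite big_cons.
by case Ps: (P s) => //; apply: ana_mul => //; exact: fa.
Qed.

Lemma ana_exp I (f : (I -> R) -> R) a n : ana f a -> ana (fun x => f x ^+ n) a.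
Proof.
move=> fa; elim: n => [|n IH].
  by under eq_fun do rewrite expr0; exact: ana_cst.
by under eq_fun do rewrite exprS; exact: ana_mul.
Qed.

Lemma ana_lip I (f : (I -> R) -> R) a : ana f a ->
  exists K e : R, [/\ 0 < K, 0 < e & forall x y (t : R),
    (forall i, `|x i - a i| < e) -> (forall i, `|y i - a i| < e) ->
    (forall i, `|y i - x i| <= t) -> 0 <= t -> `|f y - f x| <= K * t].
Proof.
move=> [r [M [r0 fA]]].
have M0 : 0 <= M by apply: An_ge0 fA => _; exact: ltW.
exists (2 * (M + 1) / r), (r / 4); split; first by rewrite divr_gt0 //; lra.
  by rewrite divr_gt0.
move=> x y t xa ya yx t0.
have [t' t'E] : exists t', t' = Num.min 1 (2 * t / r) by eexists.
have tr0 : 0 <= 2 * t / r by apply: divr_ge0; lra.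
have t'01 : 0 <= t' <= 1.
  by rewrite t'E le_min ler01 tr0 ge_min lexx.
have h01 := half01 R.
have e1 z : z = (fun i => a i + (z i - a i)) by apply/funext => i; ring.
have b z : (forall i, `|z i - a i| < r / 4) -> inbox (1/2) (fun=> r) (fun i => z i - a i).
  by move=> za i; apply: ltW; have := za i; lra.
have := An_lip (fun=> ltW r0) fA h01 h01 (b _ xa) (b _ ya) t'01.
rewrite -!e1 => /(_ _)/le_trans; apply; last first.
  apply: (@le_trans _ _ (2 * t / r * M)).
    by rewrite ler_wpM2r // t'E ge_min lexx orbT.
  rewrite (_ : 2 * (M + 1) / r * t = 2 * t / r * M + 2 * t / r); last by ring.
  by rewrite lerDl.
move=> i; rewrite (_ : _ - _ - _ = y i - x i); last by ring.
rewrite t'E minEle; case: ifP => _.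
  rewrite (_ : _ - _ = (y i - a i) - (x i - a i)); last by ring.
  have := xa i; have := ya i => ??.
  by apply: le_trans (ler_normB _ _) _; lra.
rewrite (_ : 2 * t / r * _ = t); first exact: yx.
by field; rewrite gt_eqF.
Qed.

Lemma ana_cont I (f : (I -> R) -> R) a (e : R) : ana f a -> 0 < e ->
  nearpt a (fun x => `|f x - f a| < e).
Proof.
move=> /ana_lip[K [d [K0 d0 fK]]] e0.
have m0 : 0 < Num.min (d / 2) (e / 2 / K) by rewrite lt_min !divr_gt0.
exists (Num.min (d / 2) (e / 2 / K)) => // x xa.
have xd i : `|x i - a i| < d.
  by have := xa i; rewrite lt_min => /andP[? _]; lra.
apply: le_lt_trans (fK a x (e / 2 / K) _ xd _ _) _.
- by move=> i; rewrite subrr normr0.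
- by move=> i; have := xa i; rewrite lt_min => /andP[_ /ltW].
- by rewrite ltW // !divr_gt0.
- by rewrite mulrC divfK ?gt_eqF //; lra.
Qed.

Lemma ana_neq0 I (f : (I -> R) -> R) a : ana f a -> f a != 0 ->
  nearpt a (fun x => `|f a| / 2 < `|f x|).
Proof.
move=> fa f0; have e0 : 0 < `|f a| / 2 by rewrite divr_gt0 ?normr_gt0.
apply: nearptS (ana_cont fa e0) => x; rewrite distrC.
have := ler_normD (f a - f x) (f x); rewrite subrK; lra.
Qed.

Lemma ana_near I (f : (I -> R) -> R) a : ana f a -> nearpt a (ana f).
Proof.
move=> [r [M [r0 fA]]]; exists (r / 2); first by rewrite divr_gt0.
move=> b ba; exists (r / 2), M; split; first by rewrite divr_gt0.
have h01 := half01 R.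
have bb : inbox (1/2) (fun=> r) (fun i => b i - a i).
  by move=> i; apply: ltW; have := ba i; lra.
have := An_recenter (fun=> ltW r0) h01 bb fA.
rewrite (_ : (fun _ : I => (1 - 1/2) * r) = (fun=> r / 2)); last first.
  by apply/funext => i; lra.
by apply: An_ext => s x _ _; congr f; apply/funext => i; ring.
Qed.

Lemma An_small I (g : (I -> R) -> R) r M d : 0 < r -> 0 < d -> g (fun=> 0) = 0 ->
  An (fun=> r) M g -> exists2 r' : R, 0 < r' & An (fun=> r') d g.
Proof.
move=> r0 d0 g0 gA.
have M0 := An_ge0 (fun=> ltW r0) gA.
have Md : 0 < M + d by lra.
have t01 : 0 < d / (M + d) <= 1.
  by rewrite divr_gt0 ?ler_pdivrMr //=; lra.
exists (d / (M + d) * r); first by rewrite mulr_gt0 // divr_gt0.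
apply: An_le (An_scale (fun=> ltW r0) t01 g0 gA).
by rewrite mulrAC ler_pdivrMr // ler_wpM2l //; lra.
Qed.

(** The inner functions minus their values at a vanish at a, so shrinking the radius brings their
    bounds below r / 2, as [An_comp] requires with ratio 1/2. *)
Lemma ana_comp I J (f : (J -> R) -> R) (q : J -> (I -> R) -> R) a :
  ana f (fun j => q j a) -> (forall j, ana (q j) a) ->
  ana (fun x => f (fun j => q j x)) a.
Proof.
move=> [r [M [r0 fA]]] qa.
pose g j x := q j (fun i => a i + x i) - q j a.
have [|j|r' r'0 gA] := @fin_radius J (fun j r' => An (fun=> r') (r / 2) (g j)).
- by move=> j s s' sA s'0 ss'; apply: An_radius sA.
- have [s [N [s0 qA]]] := qa j.
  apply: (@An_small _ _ s (N + `|- q j a|)) => //; first by rewrite divr_gt0.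
    rewrite /g (_ : (fun i => _) = a) ?subrr //.
    by apply/funext => i; rewrite addr0.
  by apply: An_add => //; apply: PB_An; exact: PB_cst.
exists r', M; split => //.
have h01 := half01 R.
have := An_comp (N := fun=> r / 2) (fun=> ltW r'0) (fun=> r0) h01 _ gA fA.
move=> /(_ _)/(An_ext _); apply; last by move=> j; lra.
by move=> s x _ _; congr f; apply/funext => j; rewrite /g addrC subrK.
Qed.

Lemma ana0P I (f : (I -> R) -> R) : ana f (fun=> 0) <->
  exists r M : R, 0 < r /\ An (fun=> r) M f.
Proof.
by split=> -[r [M [r0 fA]]]; exists r, M; split=> //; apply: An_ext fA => s x _ _;
  congr f; apply/funext => i; rewrite add0r.
Qed.

Lemma An_ana I (f : (I -> R) -> R) r M x : 0 < r -> An (fun=> r) M f ->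
  (forall i, `|x i| < r) -> ana f x.
Proof.
move=> r0 fA xr.
have [s s01 xs] : exists2 s : R, 0 < s < 1 & inbox s (fun=> r) x.
  have [|j|s s0 sP] := @fin_radius I (fun j s => s < 1 /\ `|x j| <= (1 - s) * r).
  - move=> j s s' [s1 xs] s'0 ss'; split; first exact: le_lt_trans s1.
    by apply: le_trans xs _; rewrite (ler_wpM2r (ltW r0)) //; lra.
  - have xj := xr j; have x0 := normr_ge0 (x j).
    exists ((1 - `|x j| / r) / 2).
      by rewrite divr_gt0 // subr_gt0 ltr_pdivrMr // mul1r.
    have h0 : 0 <= `|x j| / r by rewrite divr_ge0 // ltW.
    split; first by lra.
    have {1}-> : `|x j| = `|x j| / r * r by rewrite divfK ?gt_eqF.
    rewrite (ler_wpM2r (ltW r0)) //.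
    have : `|x j| / r < 1 by rewrite ltr_pdivrMr // mul1r.
    by lra.
  exists (1 - Num.min s (1 / 2)).
    have : 0 < Num.min s (1/2) by rewrite lt_min s0; lra.
    have : Num.min s (1/2) <= 1/2 by rewrite ge_min lexx orbT.
    lra.
  move=> i; apply: le_trans (sP i).2 _; rewrite (ler_wpM2r (ltW r0)) //.
  by rewrite lerD2l lerN2 ge_min lexx.
exists ((1 - s) * r), M; split; first by rewrite mulr_gt0 //; lra.
exact: An_recenter (fun=> ltW r0) s01 xs fA.
Qed.

Lemma ana_div I (f : (I -> R) -> R) i : ana f (fun=> 0) ->
  exists2 g, ana g (fun=> 0) &
    nearpt (fun=> 0) (fun x => f x = f (upd x i 0) + x i * g x).
Proof.
move=> /ana0P[r [M [r0 fA]]]; have [g [gA gP]] := An_div i (fun=> r0) fA.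
exists g; first by apply/ana0P; exists r, (M / r).
exists (r / 2); first by rewrite divr_gt0.
move=> x xr; apply: (gP (1/2)); first by lra.
by move=> j; have := xr j; rewrite subr0 => ?; lra.
Qed.

End analytic_germs.

(** * Analytic fixed points and implicit functions *)

Section implicit_functions.
Variable R : realType.
Implicit Types (I J : finType).

Definition join I J (x : I -> R) (y : J -> R) : (I + J)%type -> R :=
  fun k => match k with inl i => x i | inr j => y j end.

Lemma An_sum I (S : finType) (rho : I -> R) (M : S -> R) (f : S -> (I -> R) -> R) :
  (forall s, An rho (M s) (f s)) ->
  An rho (\sum_s M s) (fun x => \sum_s f s x).
Proof.
move=> fA; elim: (index_enum S) => [|s l IH].
  rewrite big_nil (_ : (fun x => _) = fun=> 0); last by apply/funext => x; rewrite big_nil.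
  by apply: PB_An; apply: PB_le (PB_cst _ _) _; rewrite normr0.
rewrite big_cons (_ : (fun x => _) = fun x => f s x + \sum_(j <- l) f j x).
  exact: An_add.
by apply/funext => x; rewrite big_cons.
Qed.

Section fixed_point.
Variables (I J : finType) (G : J -> ((I + J)%type -> R) -> R) (sg tau : R).
Hypotheses (sg0 : 0 < sg) (tau0 : 0 < tau).
Let rho : (I + J)%type -> R := join (fun=> sg) (fun=> tau).
Hypothesis GA : forall j, An rho (tau / 8) (G j).

Let rho0 k : 0 < rho k. Proof. by case: k. Qed.

(** The bound tau / 8 of [GA] is what yields the contraction factor 1/4: a move of size c in y is
    the fraction t = 2c / tau of the margin tau / 2, and [An_lip] bounds the change by t * (tau /
    8). *)
Let contr x y y' c j : (forall i, `|x i| <= sg / 2) ->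
  (forall j, `|y j| <= tau / 8) -> (forall j, `|y' j| <= tau / 8) ->
  0 <= c -> c <= tau / 4 -> (forall j, `|y' j - y j| <= c) ->
  `|G j (join x y') - G j (join x y)| <= c / 4.
Proof.
move=> xs yt y't c0 ct yy.
have tau0' := tau0; have sg0' := sg0.
have b z : (forall j, `|z j| <= tau / 8) -> inbox (1/2) rho (join x z).
  move=> zt [i|k]; rewrite /rho /=; first by have := xs i; lra.
  by have := zt k; lra.
have t01 : 0 <= 2 * c / tau <= 1.
  by rewrite ler_pdivrMr // divr_ge0 //= ?mul1r; lra.
rewrite [leRHS](_ : _ = 2 * c / tau * (tau / 8)); last by field; rewrite gt_eqF.
apply: (An_lip (fun k => ltW (rho0 k)) (GA j) (half01 R) (half01 R) (b _ yt) (b _ y't) t01).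
move=> [i|k]; rewrite /rho /=.
  by rewrite subrr normr0 !mulr_ge0 ?invr_ge0 //; lra.
rewrite [leRHS](_ : _ = c); first exact: yy.
by field; rewrite gt_eqF.
Qed.

Lemma fix_unique x y y' : (forall i, `|x i| <= sg / 2) ->
  (forall j, `|y j| <= tau / 8) -> (forall j, `|y' j| <= tau / 8) ->
  (forall j, y j = G j (join x y)) -> (forall j, y' j = G j (join x y')) ->
  y' = y.
Proof.
move=> xs yt y't yG y'G.
have H n j : `|y' j - y j| <= (1 / 4) ^+ n * (tau / 4).
  elim: n j => [|n IH] j.
    rewrite expr0 mul1r; apply: le_trans (ler_normB _ _) _.
    by have := yt j; have := y't j; have := tau0; lra.
  rewrite yG y'G exprS (_ : 1 / 4 * _ * _ = (1 / 4) ^+ n * (tau / 4) / 4); last by ring.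
  apply: contr => //; first by rewrite mulr_ge0 ?exprn_ge0 //; have := tau0; lra.
  rewrite ler_piMl //; first by have := tau0; lra.
  by rewrite exprn_ile1 //; lra.
apply/funext => j; apply/eqP; rewrite -subr_eq0 -normr_eq0.
rewrite eq_le normr_ge0 andbT leNgt; apply/negP => d0.
have : (fun n : nat => (1 / 4 : R) ^+ n * (tau / 4)) @ \oo --> (0 : R).
  rewrite -[X in _ --> X](mul0r (tau / 4)); apply: cvgM; last exact: cvg_cst.
  by apply: cvg_expr; rewrite ger0_norm; lra.
move=> /cvgrPdist_lt/(_ _ d0)[K _ /(_ K (leqnn _))] /=.
rewrite sub0r normrN ger0_norm ?ltNge ?H // mulr_ge0 ?exprn_ge0 //.
by have := tau0; lra.
Qed.

Fixpoint fix_iter (n : nat) : J -> (I -> R) -> R :=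
  match n with
  | 0%N => fun _ _ => 0
  | n.+1 => fun j x => G j (join x (fun k => fix_iter n k x))
  end.

Lemma fix_exists : exists z : J -> (I -> R) -> R,
  (forall j, An (fun=> sg / 2) (tau / 8) (z j)) /\
  forall (s : R) x, 0 < s < 1 -> inbox s (fun=> sg / 2) x -> forall j,
    z j x = G j (join x (fun k => z k x)).
Proof.
have tau0' := tau0; have sg0' := sg0; have sg2 : 0 < sg / 2 by lra.
have zA n j : An (fun=> sg / 2) (tau / 8) (fix_iter n j).
  elim: n j => [|n IH] j.
    by apply: PB_An; apply: (PB_le (PB_cst _ _)); rewrite normr0; lra.
  pose q (k : (I + J)%type) (x : I -> R) : R :=
    match k with inl i => x i | inr k => fix_iter n k x end.
  have := @An_comp R I _ rho (fun=> sg / 2) (join (fun=> sg / 2) (fun=> tau / 8))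
    (tau / 8) (1 / 2) (G j) q (fun=> ltW sg2) rho0 (half01 R) _ _ (GA j).
  move=> /(_ _ _)/(An_ext _); apply.
  - move=> s x _ _; rewrite /=; congr (G j _); apply/funext => -[i|k] //.
  - by move=> [i|k]; rewrite /rho /=; lra.
  - by move=> [i|k]; rewrite /q /=; [apply: PB_An; exact: (PB_var (fun=> sg / 2))|exact: IH].
have xb s x : 0 < s < 1 -> inbox s (fun=> sg / 2) x -> forall i : I, `|x i| <= sg / 2.
  by move=> s01 xs i; apply: le_trans (xs i) _; rewrite ler_piMl; lra.
have zb n j s x : 0 < s < 1 -> inbox s (fun=> sg / 2) x -> `|fix_iter n j x| <= tau / 8.
  by move=> s01 xs; apply: An_bound (zA n j) xs => // _; exact: ltW.
have zC n m j s x : 0 < s < 1 -> inbox s (fun=> sg / 2) x ->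
    `|fix_iter (n + m) j x - fix_iter n j x| <= (1 / 4) ^+ n * (tau / 4).
  move=> s01 xs; elim: n j => [|n IH] j.
    rewrite expr0 mul1r subr0; apply: le_trans (zb _ _ _ _ s01 xs) _; lra.
  rewrite exprS (_ : 1 / 4 * _ * _ = (1 / 4) ^+ n * (tau / 4) / 4); last by ring.
  apply: contr => //; first exact: xb xs.
  - by move=> k; exact: zb xs.
  - by move=> k; exact: zb xs.
  - by rewrite mulr_ge0 ?exprn_ge0 //; lra.
  - rewrite ler_piMl //; first by lra.
    by rewrite exprn_ile1 //; lra.
have small (e : R) : 0 < e -> exists K, forall n, (K <= n)%N -> (1 / 4) ^+ n * (tau / 4) <= e.
  move=> e0.
  have : (fun n : nat => (1 / 4 : R) ^+ n * (tau / 4)) @ \oo --> (0 : R).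
    rewrite -[X in _ --> X](mul0r (tau / 4)); apply: cvgM; last exact: cvg_cst.
    by apply: cvg_expr; rewrite ger0_norm; lra.
  move=> /cvgrPdist_lt/(_ _ e0)[K _ KP]; exists K => n Kn; have := KP n Kn => /=.
  by rewrite sub0r normrN ger0_norm ?mulr_ge0 ?exprn_ge0 //; lra.
have zU j : exists g, forall (s : {s : R | 0 < s < 1}) (e : R), 0 < e ->
    exists K, forall k x, (K <= k)%N -> inbox (sval s) (fun=> sg / 2) x ->
    `|fix_iter k j x - g x| <= e.
  apply: unif_lim => -[s s01] e e0 /=; have [K KP] := small (e / 2) (divr_gt0 e0 (ltr0Sn _ _)).
  exists K => k l x Kk Kl xs.
  have := zC K (k - K)%N j s x s01 xs; have := zC K (l - K)%N j s x s01 xs.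
  rewrite !subnKC // => h1 h2; have := KP K (leqnn _) => h3.
  rewrite (_ : _ - _ = (fix_iter k j x - fix_iter K j x) - (fix_iter l j x - fix_iter K j x)); last by ring.
  by apply: le_trans (ler_normB _ _) _; lra.
have [z zP] := choice zU.
have zzA j : An (fun=> sg / 2) (tau / 8) (z j).
  apply: An_lim => e s e0 s01; have [K KP] := zP j (exist _ s s01) e e0.
  by exists (fix_iter K j); split=> // x xs; rewrite distrC; exact: KP.
exists z; split=> // s x s01 xs j.
apply/eqP; rewrite -subr_eq0 -normr_eq0 eq_le normr_ge0 andbT.
apply/ler_addgt0Pr => e e0; rewrite add0r.
have d0 : 0 < Num.min (e / 2) (tau / 4) by rewrite lt_min; lra.
have /choice[K' K'P] : forall k, exists K, forall m, (K <= m)%N ->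
    `|fix_iter m k x - z k x| <= Num.min (e / 2) (tau / 4).
  move=> k; have [K KP] := zP k (exist _ s s01) _ d0.
  by exists K => m Km; exact: KP.
pose N := \max_j K' j.
have NP k : `|fix_iter N k x - z k x| <= Num.min (e / 2) (tau / 4).
  by apply: K'P; exact: leq_bigmax.
have N1P k : `|fix_iter N.+1 k x - z k x| <= Num.min (e / 2) (tau / 4).
  by apply: K'P; apply: leqW; exact: leq_bigmax.
have m1 : Num.min (e / 2) (tau / 4) <= e / 2 by rewrite ge_min lexx.
have m2 : Num.min (e / 2) (tau / 4) <= tau / 4 by rewrite ge_min lexx orbT.
have /= := contr j (xb _ _ s01 xs) (fun k => An_bound (fun=> ltW sg2) s01 (zzA k) xs)
  (fun k => zb N k s x s01 xs) (ltW d0) m2 NP.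
have := N1P j => /= h1 h2.
rewrite (_ : _ - _ = (G j (join x (fun k => fix_iter N k x)) - G j (join x (fun k => z k x)))
  - (G j (join x (fun k => fix_iter N k x)) - z j x)); last by ring.
by apply: le_trans (ler_normB _ _) _; lra.
Qed.

End fixed_point.

End implicit_functions.

Section implicit_functions_analytic.
Variable R : realType.
Implicit Types (I J : finType).

Lemma An_unif I J (rho : I -> R) (f : J -> (I -> R) -> R) :
  (forall i, 0 <= rho i) -> (forall j, exists M, An rho M (f j)) ->
  exists M : R, 0 <= M /\ forall j, An rho M (f j).
Proof.
move=> r0 /choice[M MP]; have M0 j : 0 <= M j by exact: An_ge0 r0 (MP j).
exists (\sum_j M j); split; first by rewrite sumr_ge0.
by move=> j; apply: An_le (MP j); rewrite (bigD1 j) //= lerDl sumr_ge0.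
Qed.

(** The third hypothesis says that the derivative of G in z vanishes at the origin. In the Hadamard
    decomposition of G the coefficients of the z-variables therefore vanish at the origin and become
    small on a small polydisc, while the x-variables are given a much smaller radius. This produces
    the bound tau / 8 that makes the iteration contract. *)
Lemma ana_fix I J (G : J -> ((I + J)%type -> R) -> R) :
  (forall j, ana (G j) (fun=> 0)) -> (forall j, G j (fun=> 0) = 0) ->
  (forall e : R, 0 < e -> exists2 d : R, 0 < d & forall (z : J -> R) (t : R),
    0 <= t -> t < d -> (forall j, `|z j| <= t) ->
    forall j, `|G j (join (fun=> 0) z)| <= e * t) ->
  exists z : J -> (I -> R) -> R, [/\ forall j, ana (z j) (fun=> 0),
    forall j, z j (fun=> 0) = 0,
    nearpt (fun=> 0) (fun x => forall j, z j x = G j (join x (fun k => z k x))) &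
    exists2 d : R, 0 < d & forall x y, (forall i, `|x i| < d) -> (forall j, `|y j| < d) ->
      (forall j, y j = G j (join x y)) -> forall j, y j = z j x].
Proof.
move=> Ga G0 GD.
have [|j|r r0 /(An_unif (fun=> ltW r0))[M [M0 GA]]] :=
    @fin_radius R J (fun j r => exists M, An (fun=> r) M (G j)).
- by move=> j s s' [M GA] s'0 ss'; exists M; exact: An_radius GA.
- by have /ana0P[r [M [r0 GA]]] := Ga j; exists r => //; exists M.
have /choice[g gP] j := An_hadamard (fun=> r0) (GA j).
have gA j k : An (fun=> r) (M / r) (g j k) by exact: (gP j).1.
have GE j w : (forall k, `|w k| <= r / 2) -> G j w = \sum_k w k * g j k w.
  move=> wr; rewrite ((gP j).2 (1/2) w (half01 R)) ?G0 ?add0r //.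
  by move=> k; have := wr k => ?; lra.
(* Evaluating the hypothesis on the axis of z_k isolates the coefficient [g j (inr k)]. *)
have B0 j k : g j (inr k) (fun=> 0) = 0.
  apply/eqP; rewrite -normr_eq0 eq_le normr_ge0 andbT.
  apply/ler_addgt0Pr => e e0; rewrite add0r.
  have e20 : 0 < e / 2 by lra.
  have [d d0 dP] := GD _ e20.
  have ga : ana (g j (inr k)) (fun=> 0) by apply/ana0P; exists r, (M / r).
  have [h h0 hP] := ana_cont ga e20.
  have [t t0 [td th tr]] : exists2 t : R, 0 < t & [/\ t < d, t < h & t < r / 2].
    exists (Num.min (Num.min d h) (r / 2) / 2).
      by rewrite divr_gt0 // !lt_min d0 h0 divr_gt0.
    have : 0 < Num.min (Num.min d h) (r / 2) by rewrite !lt_min d0 h0 divr_gt0.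
    have : Num.min (Num.min d h) (r / 2) <= d by rewrite !ge_min lexx.
    have : Num.min (Num.min d h) (r / 2) <= h by rewrite !ge_min lexx orbT.
    have : Num.min (Num.min d h) (r / 2) <= r / 2 by rewrite !ge_min lexx !orbT.
    by move=> *; split; lra.
  pose w : (I + J)%type -> R := upd (fun=> 0) (inr k) t.
  have wn l : `|w l| <= t.
    by rewrite /w /upd; case: eqP => _; rewrite ?normr0 ?gtr0_norm // ltW.
  have := dP (upd (fun=> 0) k t) t (ltW t0) td _ j.
  rewrite (_ : join _ _ = w); last first.
    by apply/funext => -[i|l]; rewrite /w /upd //=.
  rewrite GE; last by move=> l; apply: le_trans (wn l) (ltW tr).
  rewrite (bigD1 (inr k)) //= big1 ?addr0; last first.
    by move=> l /negPf lk; rewrite /w /upd lk mul0r.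
  rewrite {1}/w upd_eq normrM gtr0_norm // (mulrC t) ler_pM2r // => /(_ _) h1.
  have h2 : `|g j (inr k) w - g j (inr k) (fun=> 0)| < e / 2.
    by apply: hP => l; rewrite subr0; apply: le_lt_trans (wn l) th.
  have h3 : `|g j (inr k) w| <= e / 2.
    apply: h1 => l; rewrite /upd; case: eqP => _; rewrite ?normr0 ?gtr0_norm //.
    exact: ltW.
  rewrite -[X in `|X|](subrK (g j (inr k) w)) (le_trans (ler_normD _ _)) //.
  by rewrite distrC; lra.
have Mr0 : 0 <= M / r by rewrite divr_ge0 // ltW.
(* The scale a makes the z-part of the Hadamard sum at most tau / 16; the radius sg below does the
   same for the x-part, and together they give tau / 8. *)
have [a [a0 a1 aJ]] : exists a : R, [/\ 0 < a, a <= 1 & #|J|%:R * (a * (M / r)) <= 1 / 16].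
  have J0 : 0 <= #|J|%:R * (M / r) by rewrite mulr_ge0.
  have J1 : 0 < 16 * (#|J|%:R * (M / r) + 1) by lra.
  exists (16 * (#|J|%:R * (M / r) + 1))^-1; split.
  - by rewrite invr_gt0.
  - by rewrite invf_le1 //; lra.
  - rewrite [leLHS](_ : _ = #|J|%:R * (M / r) / (16 * (#|J|%:R * (M / r) + 1))).
      by rewrite ler_pdivrMr //; lra.
    by rewrite mulrCA mulrC.
pose tau := a * r; have tau0 : 0 < tau by rewrite mulr_gt0.
have [sg [sg0 sgt sgI]] : exists sg : R, [/\ 0 < sg, sg <= tau & #|I|%:R * (sg * (M / r)) <= tau / 16].
  have J0 : 0 <= #|I|%:R * (M / r) by rewrite mulr_ge0.
  have J1 : 0 < 16 * (#|I|%:R * (M / r) + 1) by move: J0; clear; lra.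
  exists (tau / (16 * (#|I|%:R * (M / r) + 1))); split.
  - by rewrite divr_gt0.
  - by rewrite ler_pdivrMr // ler_peMr ?ltW //; move: J0; clear; lra.
  - rewrite [leLHS](_ : _ = tau * (#|I|%:R * (M / r)) / (16 * (#|I|%:R * (M / r) + 1))).
      rewrite ler_pdivrMr // [leRHS](_ : _ = tau * (#|I|%:R * (M / r) + 1)); last by move: (#|I|%:R * _) => X; field.
      by rewrite ler_wpM2l ?lerDl // ltW.
    by move: (16 * (#|I|%:R * (M / r) + 1))^-1 (M / r) => Y Z; ring.
have rr (k : (I + J)%type) : join (fun=> sg) (fun=> tau) k <= tau.
  by case: k.
have taur : tau <= r by rewrite /tau ger_pMl.
have GA8 j : An (join (fun=> sg) (fun=> tau)) (tau / 8) (G j).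
  pose rho : (I + J)%type -> R := join (fun=> sg) (fun=> tau).
  pose N : (I + J)%type -> R := join (fun=> M / r) (fun=> a * (M / r)).
  have rho0 k : 0 <= rho k by case: k => k; rewrite /rho /= ltW.
  have gN k : An rho (N k) (g j k).
    case: k => [i|k]; rewrite /N /=.
      by apply: An_radius (gA j (inl i)) => l; apply: le_trans (rr l) taur.
    have a01 : 0 < a <= 1 by rewrite a0 a1.
    by apply: An_radius (An_scale (fun=> ltW r0) a01 (B0 j k) (gA j (inr k))) => l; exact: rr.
  apply: (@An_le _ _ _ (\sum_k rho k * N k)).
    rewrite big_sumType /= !sumr_const -[X in X + _]mulr_natl -[X in _ + X]mulr_natl.
    rewrite (_ : tau / 8 = tau / 16 + tau * (1 / 16)); last by field.
    by rewrite lerD // mulrCA ler_wpM2l // ltW.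
  apply: (@An_ext _ _ _ _ (fun x => \sum_k x k * g j k x)).
    move=> s x /andP[s0 s1] xs.
    rewrite ((gP j).2 s x) ?G0 ?add0r ?s0 // => k.
    apply: le_trans (xs k) _; rewrite ler_wpM2l ?(ltW s0) //.
    exact: le_trans (rr k) taur.
  apply: An_sum => k; apply: An_mul => //; apply: PB_An; exact: PB_var.
have [z [zA zE]] := fix_exists sg0 tau0 GA8.
have sg2 : 0 < sg / 2 by rewrite divr_gt0.
have tau8 : 0 <= tau / 8 by rewrite divr_ge0 // ltW.
have inb (x : I -> R) : (forall i, `|x i| < sg / 4) -> inbox (1 / 2) (fun=> sg / 2) x.
  by move=> xs i; apply: ltW; apply: lt_le_trans (xs i) _; move: sg0; clear; lra.
have le2 (x : I -> R) : (forall i, `|x i| < sg / 4) -> forall i : I, `|x i| <= sg / 2.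
  by move=> xs i; apply: ltW; apply: lt_le_trans (xs i) _; move: sg0; clear; lra.
have zb (x : I -> R) : (forall i, `|x i| < sg / 4) -> forall k, `|z k x| <= tau / 8.
  move=> xs k; apply: (An_bound _ (half01 R) (zA k) (inb x xs)) => i; exact: ltW.
exists z; split.
- by move=> j; apply/ana0P; exists (sg / 2), (tau / 8).
- have s0 : forall i : I, `|0 : R| < sg / 4 by move=> i; rewrite normr0 divr_gt0.
  have E : (fun j => z j (fun=> 0)) = (fun=> 0).
    apply: (@fix_unique R I J G sg tau sg0 tau0 GA8 (fun=> 0)) => //.
    + exact: le2 (fun=> 0) s0.
    + by move=> k; rewrite normr0.
    + exact: (zb (fun=> 0) s0).
    + by move=> k; rewrite (_ : join _ _ = fun=> 0) ?G0 //; apply/funext => -[].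
    + by move=> k; exact: zE (half01 R) (inb (fun=> 0) s0) _.
  by move=> j; exact: (congr1 (fun f : J -> R => f j) E).
- exists (sg / 4); first by rewrite divr_gt0.
  move=> x xs; apply: (zE _ _ (half01 R)); apply: inb => i.
  by have := xs i; rewrite subr0.
- exists (Num.min (sg / 4) (tau / 8)); first by rewrite lt_min !divr_gt0.
  move=> x y xs ys yE j.
  have xs' i : `|x i| < sg / 4 by have := xs i; rewrite lt_min => /andP[].
  apply: (congr1 (fun f : J -> R => f j) (@fix_unique R I J G sg tau sg0 tau0 GA8 x (fun j => z j x) y _ _ _ _ _)) => //.
  + exact: le2.
  + exact: zb.
  + by move=> k; have := ys k; rewrite lt_min => /andP[_ /ltW].
  + by move=> k; exact: zE (half01 R) (inb x xs') _.
Qed.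

Lemma ana_shift I (f : (I -> R) -> R) a : ana f a ->
  ana (fun x => f (fun i => a i + x i)) (fun=> 0).
Proof.
move=> fa; apply: (@ana_comp _ _ _ f (fun i x => a i + x i)).
  by under eq_fun do rewrite addr0.
by move=> i; apply: ana_add; [exact: ana_cst|exact: ana_var].
Qed.

Lemma ana_unshift I (f : (I -> R) -> R) a : ana f (fun=> 0) ->
  ana (fun x => f (fun i => x i - a i)) a.
Proof.
move=> fa; apply: (@ana_comp _ _ _ f (fun i x => x i - a i)).
  by under eq_fun do rewrite subrr.
by move=> i; apply: ana_sub; [exact: ana_var|exact: ana_cst].
Qed.

(** D is the partial derivative of F in y at the base point and K its inverse. The Newton map y - K
    F(x, y) has zero derivative in y there, and its fixed points are the zeros of F, so [ana_fix]
    applies after translation to the origin. Differentiability in y enters only through the last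
    hypothesis. *)
Theorem ana_ift I J (F : J -> ((I + J)%type -> R) -> R) (a : I -> R) (b : J -> R)
    (D K : J -> J -> R) :
  (forall j, ana (F j) (join a b)) -> (forall j, F j (join a b) = 0) ->
  (forall j l, \sum_k K j k * D k l = (j == l)%:R) ->
  (forall j l, \sum_k D j k * K k l = (j == l)%:R) ->
  (forall e : R, 0 < e -> exists2 d : R, 0 < d & forall (z : J -> R) (t : R),
    0 <= t -> t < d -> (forall j, `|z j| <= t) ->
    forall j, `|F j (join a (fun j => b j + z j)) - \sum_k D j k * z k| <= e * t) ->
  exists g : J -> (I -> R) -> R, [/\ forall j, ana (g j) a, forall j, g j a = b j,
    nearpt a (fun x => forall j, F j (join x (fun k => g k x)) = 0) &
    exists2 d : R, 0 < d & forall x y, (forall i, `|x i - a i| < d) ->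
      (forall j, `|y j - b j| < d) -> (forall j, F j (join x y) = 0) ->
      forall j, y j = g j x].
Proof.
move=> Fa F0 KD DK FD.
have KDz (z : J -> R) j : \sum_k K j k * (\sum_l D k l * z l) = z j.
  under eq_bigr do rewrite mulr_sumr.
  rewrite exchange_big /= (bigD1 j) //= [X in _ + X]big1 ?addr0.
    by under eq_bigr do rewrite mulrA; rewrite -mulr_suml KD eqxx mul1r.
  move=> l /negPf lj; under eq_bigr do rewrite mulrA.
  by rewrite -mulr_suml KD eq_sym lj mul0r.
have DKz (z : J -> R) j : \sum_k D j k * (\sum_l K k l * z l) = z j.
  under eq_bigr do rewrite mulr_sumr.
  rewrite exchange_big /= (bigD1 j) //= [X in _ + X]big1 ?addr0.
    by under eq_bigr do rewrite mulrA; rewrite -mulr_suml DK eqxx mul1r.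
  move=> l /negPf lj; under eq_bigr do rewrite mulrA.
  by rewrite -mulr_suml DK eq_sym lj mul0r.
pose H k w := F k (fun l => join a b l + w l).
have Ha k : ana (H k) (fun=> 0) by exact: ana_shift.
pose G j (w : (I + J)%type -> R) := w (inr j) - \sum_k K j k * H k w.
have jj x y : (fun l => join a b l + join x y l) = join (fun i => a i + x i) (fun j => b j + y j).
  by apply/funext => -[].
have GK j x y : y j = G j (join x y) <-> \sum_k K j k * H k (join x y) = 0.
  rewrite /G /=; split=> [/eqP|->]; last by rewrite subr0.
  by rewrite eq_sym -subr_eq0 addrAC subrr add0r oppr_eq0 => /eqP.
have GH x y : (forall j, y j = G j (join x y)) <-> forall j, H j (join x y) = 0.
  split=> [yG j|H0 j].
    by rewrite -(DKz (fun j => H j (join x y))) big1 // => k _; rewrite ((GK k x y).1 (yG k)) mulr0.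
  by apply/GK; rewrite big1 // => k _; rewrite H0 mulr0.
have [||e e0|z [za z0 zE [d d0 zU]]] := @ana_fix I J G.
- move=> j; apply: ana_sub; first exact: ana_var.
  by apply: ana_sum => k _; apply: ana_mul; [exact: ana_cst|exact: Ha].
- move=> j; rewrite /G sub0r big1 ?oppr0 // => k _.
  rewrite /H (_ : (fun l => _) = join a b) ?F0 ?mulr0 //.
  by apply/funext => l; rewrite addr0.
- pose S := \sum_j \sum_k `|K j k|.
  have S0 : 0 <= S by apply: sumr_ge0 => j _; apply: sumr_ge0.
  have eS : 0 < e / (S + 1) by rewrite divr_gt0 //; move: S0; clear; lra.
  have [d d0 dP] := FD _ eS; exists d => // z t t0 td zt j.
  rewrite /G /= -{1}(KDz z j) -sumrB.
  under eq_bigr => k _ do rewrite -mulrBr.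
  apply: le_trans (ler_norm_sum _ _ _) _.
  apply: (@le_trans _ _ (\sum_k `|K j k| * (e / (S + 1) * t))).
    apply: ler_sum => k _; rewrite normrM ler_wpM2l // distrC /H jj.
    have := dP z t t0 td zt k; congr (`|F k (join _ _) - _| <= _).
    by apply/funext => i; rewrite addr0.
  rewrite -mulr_suml mulrA ler_wpM2r //.
  have Sj : \sum_k `|K j k| <= S.
    by rewrite /S [leRHS](bigD1 j) //= lerDl; apply: sumr_ge0 => *; apply: sumr_ge0.
  have S1 : 0 < S + 1 by move: S0; clear; lra.
  rewrite mulrA ler_pdivrMr // mulrC ler_wpM2l ?ltW //.
  by move: Sj; clear; lra.
exists (fun j x => b j + z j (fun i => x i - a i)); split.
- by move=> j; apply: ana_add; [exact: ana_cst|exact: ana_unshift].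
- by move=> j; under eq_fun do rewrite subrr; rewrite z0 addr0.
- have [e e0 eP] := zE; exists e => // x xa j.
  have := eP (fun i => x i - a i) _ => /(_ _)/GH => h.
  rewrite (_ : join _ _ = (fun l => join a b l + join (fun i => x i - a i)
     (fun k => z k (fun i => x i - a i)) l)); last first.
    by rewrite jj; congr join; apply/funext => i; rewrite addrC subrK.
  by apply: h => i; rewrite subr0.
- exists d => // x y xa yb yF j.
  apply/eqP; rewrite addrC -subr_eq; apply/eqP.
  apply: (zU (fun i => x i - a i) (fun j => y j - b j)) => //.
  apply/GH => k; rewrite /H jj -(yF k); congr (F k (join _ _));
    by apply/funext => i; rewrite addrC subrK.
Qed.

End implicit_functions_analytic.

(** * Inverse, exponential and logarithm *)

Section elementary_analytic.
Variable R : realType.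
Implicit Types (I J : finType).

Lemma sum_unit (f : unit -> R) : \sum_k f k = f tt.
Proof. by rewrite (bigD1 tt) //= big1 ?addr0 // => -[]. Qed.

(** The inverse is the implicit solution of x * z = 1; the logarithm is obtained from the
    exponential in the same way below. *)
Lemma ana_inv1 (c : R) : c != 0 -> ana (fun x : unit -> R => (x tt)^-1) (fun=> c).
Proof.
move=> c0.
pose F (_ : unit) (w : (unit + unit)%type -> R) : R := w (inl tt) * w (inr tt) - 1.
have [||||e e0|g [ga gc gE _]] := @ana_ift R unit unit F (fun=> c) (fun=> c^-1)
  (fun _ _ => c) (fun _ _ => c^-1).
- move=> ?; apply: ana_sub; last exact: ana_cst.
  by apply: ana_mul; exact: ana_var.
- by move=> ?; rewrite /F /= divff // subrr.
- by move=> [] []; rewrite sum_unit mulVf // eqxx.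
- by move=> [] []; rewrite sum_unit divff // eqxx.
- exists 1 => // z t t0 _ _ [].
  rewrite /F /= sum_unit mulrDr divff //.
  rewrite (_ : _ - _ = 0); last by ring.
  by rewrite normr0 mulr_ge0 // ltW.
apply: ana_ext (ga tt).
apply: nearptS gE => x /(_ tt); rewrite /F /= => /eqP; rewrite subr_eq0 => /eqP xg.
have x0 : x tt != 0 by apply/eqP => x0; move: xg; rewrite x0 mul0r => /eqP; rewrite eq_sym oner_eq0.
by apply: (mulfI x0); rewrite xg divff.
Qed.

Lemma ana_comp1 I (h : R -> R) (f : (I -> R) -> R) a :
  ana (fun x : unit -> R => h (x tt)) (fun=> f a) -> ana f a -> ana (fun x => h (f x)) a.
Proof. by move=> ha fa; exact: (@ana_comp _ _ _ (fun x : unit -> R => h (x tt)) (fun=> f)). Qed.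

Lemma ana_inv I (f : (I -> R) -> R) a : ana f a -> f a != 0 -> ana (fun x => (f x)^-1) a.
Proof. by move=> fa f0; apply: ana_comp1 => //; exact: ana_inv1. Qed.

(** Termwise, the tail of the series at x is dominated by the tail at 1, which makes the convergence
    uniform for |x| <= 1. *)
Lemma expR_partial (x : R) n : `|x| <= 1 ->
  `|expR x - series (exp_coeff x) n| <= expR 1 - series (exp_coeff (1 : R)) n.
Proof.
move=> x1; apply/ler_addgt0Pr => e e0.
have e2 : 0 < e / 2 by rewrite divr_gt0.
have /cvgrPdist_le/(_ _ e2)[K1 _ K1P] := @is_cvg_series_exp_coeff R x.
have /cvgrPdist_le/(_ _ e2)[K2 _ K2P] := @is_cvg_series_exp_coeff R 1.
pose m := maxn n (maxn K1 K2).
have := K1P m; rewrite /= !leq_max leqnn orbT => /(_ isT) h1.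
have := K2P m; rewrite /= !leq_max leqnn !orbT => /(_ isT) h2.
have nm : (n <= m)%N by rewrite leq_maxl.
have h3 : `|series (exp_coeff x) m - series (exp_coeff x) n| <=
    series (exp_coeff (1 : R)) m - series (exp_coeff (1 : R)) n.
  rewrite /series /= !(big_cat_nat (leq0n n) nm) /= addrAC subrr add0r.
  rewrite [leRHS]addrAC subrr add0r.
  apply: le_trans (ler_norm_sum _ _ _) _; apply: ler_sum => i _.
  rewrite /exp_coeff /= expr1n normrM normrX ler_pM ?exprn_ge0 //.
    by rewrite exprn_ile1.
  by rewrite ger0_norm // invr_ge0.
rewrite /expR.
rewrite (_ : limn (series (exp_coeff x)) - _ = (limn (series (exp_coeff x)) - series (exp_coeff x) m) +
  (series (exp_coeff x) m - series (exp_coeff x) n)); last by ring.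
apply: le_trans (ler_normD _ _) _; move: h2; rewrite ler_norml => /andP[h2 _].
move: h1 h2 h3; clear; lra.
Qed.

Lemma ana_expR0 : ana (fun x : unit -> R => expR (x tt)) (fun=> 0).
Proof.
apply/ana0P; exists 1, (expR 1); split=> //; move=> e s e0 s01.
have /cvgrPdist_le/(_ _ e0)[K _ KP] := @is_cvg_series_exp_coeff R 1.
exists (fun x => series (exp_coeff (x tt)) K); split; last first.
  move=> x xs; apply: le_trans (expR_partial _ _) _.
    by have := xs tt; rewrite mulr1; move: s01; clear; lra.
  by have := KP K (leqnn _); rewrite /= -/(expR 1) ler_norml => /andP[].
apply: (@PB_le _ _ _ (series (exp_coeff 1) K)); last first.
  by have := @expR_partial 0 K; rewrite normr0 ler01 => /(_ isT)/(le_trans (normr_ge0 _));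
    rewrite subr_ge0.
elim: K {KP} => [|K IH].
  rewrite /series /= big_geq //.
  rewrite [X in PB _ _ X](_ : _ = fun=> 0); last by apply/funext => x; rewrite big_geq.
  by apply: PB_le (PB_cst _ _) _; rewrite normr0.
rewrite /series /= big_nat_recr //=.
rewrite [X in PB _ _ X](_ : _ = fun x : unit -> R => (\sum_(0 <= k < K) exp_coeff (x tt) k) + x tt ^+ K * (K`!%:R)^-1).
  apply: PB_add; first exact: IH.
  rewrite /exp_coeff /=; apply: PB_mul; last first.
    by apply: PB_le (PB_cst _ _) _; rewrite ger0_norm // invr_ge0.
  elim: K {IH} => [|K IH].
    rewrite [X in PB _ _ X](_ : _ = fun=> 1); last by apply/funext => x; rewrite expr0.
    by apply: PB_le (PB_cst _ _) _; rewrite normr1.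
  rewrite [X in PB _ _ X](_ : _ = fun x => x tt * x tt ^+ K); last by apply/funext => x; rewrite exprS.
  by rewrite exprS; apply: PB_mul IH; exact: (PB_var (fun=> 1)).
by apply/funext => x; rewrite big_nat_recr.
Qed.

Lemma ana_expR I (f : (I -> R) -> R) a : ana f a -> ana (fun x => expR (f x)) a.
Proof.
move=> fa.
rewrite [X in ana X](_ : _ = fun x => expR (f a) * expR (f x - f a)).
  apply: ana_mul; first exact: ana_cst.
  apply: (@ana_comp1 _ _ (fun x => f x - f a)).
    by rewrite subrr; exact: ana_expR0.
  by apply: ana_sub => //; exact: ana_cst.
by apply/funext => x; rewrite -expRD addrC subrK.
Qed.

Lemma expR_quad (z : R) : `|z| <= 1 / 2 -> `|expR z - 1 - z| <= 2 * z ^+ 2.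
Proof.
move=> z1; have [z11 z12] : - (1 / 2) <= z /\ z <= 1 / 2 by move: z1; rewrite ler_norml => /andP[].
have h1 := expR_ge1Dx z.
have h2 : expR z * (1 - z) <= 1.
  have := expR_ge1Dx (- z); rewrite expRN => h.
  have := ler_wpM2l (expR_ge0 z) h; rewrite divff ?gt_eqF ?expR_gt0 //.
rewrite ger0_norm; last by move: h1; clear; lra.
have h3 := expR_gt0 z.
have : (expR z - 1 - z) * (1 - z) <= z ^+ 2 by move: h2; clear; nra.
have : 0 <= expR z - 1 - z by move: h1; clear; lra.
by move: (expR z - 1 - z) z12 z11; clear => u; nra.
Qed.

Lemma ana_ln I (f : (I -> R) -> R) a : ana f a -> 0 < f a -> ana (fun x => ln (f x)) a.
Proof.
move=> fa f0; apply: ana_comp1 => //.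
have [c cE] : exists c, c = f a by eexists.
rewrite -cE in f0 *; move: c f0 {cE fa} => c c0.
pose F (_ : unit) (w : (unit + unit)%type -> R) : R := expR (w (inr tt)) - w (inl tt).
have c0' : c != 0 by rewrite gt_eqF.
have [||||e e0|g [ga gc gE _]] := @ana_ift R unit unit F (fun=> c) (fun=> ln c)
  (fun _ _ => c) (fun _ _ => c^-1).
- by move=> ?; apply: ana_sub; [apply: ana_expR|]; exact: ana_var.
- by move=> ?; rewrite /F /= lnK ?posrE // subrr.
- by move=> [] []; rewrite sum_unit mulVf // eqxx.
- by move=> [] []; rewrite sum_unit divff // eqxx.
- exists (Num.min (1 / 2) (e / (2 * c))).
    by rewrite lt_min divr_gt0 //= divr_gt0 // mulr_gt0.
  move=> z t t0; rewrite lt_min => /andP[t1 t2] /(_ tt) zt [].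
  rewrite /F /= sum_unit expRD lnK ?posrE //.
  rewrite (_ : _ - _ = c * (expR (z tt) - 1 - z tt)); last by ring.
  rewrite normrM (gtr0_norm c0).
  have := @expR_quad (z tt) (le_trans zt (ltW t1)).
  have zz : z tt ^+ 2 <= t ^+ 2 by rewrite -real_normK ?num_real // lerXn2r ?nnegrE.
  rewrite ltr_pdivlMr ?mulr_gt0 // in t2.
  move: (`|_|) t0 t1 t2 zz => u t0 t1 t2 zz uz.
  have : c * u <= c * (2 * t ^+ 2).
    by rewrite ler_wpM2l ?(ltW c0) // (le_trans uz) // ler_wpM2l.
  by move: t2 t0; clear; nra.
apply: ana_ext (ga tt); apply: nearptS gE => x /(_ tt); rewrite /F /= => /eqP.
by rewrite subr_eq0 => /eqP <-; rewrite expRK.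
Qed.

End elementary_analytic.

(** * Identity theorem and zero divisors *)

Section identity_theorem.
Variable R : realType.
Implicit Types (I J : finType).

(** Points with x_i = 0 are limits of points with x_i nonzero, and f is continuous. *)
Lemma ana_cancel I (f : (I -> R) -> R) i : ana f (fun=> 0) ->
  nearpt (fun=> 0) (fun x => x i != 0 -> f x = 0) -> nearpt (fun=> 0) (fun x => f x = 0).
Proof.
move=> fa f0; apply: nearptS (nearptI (nearpt_near f0) (ana_near fa)) => b [fb ab].
apply/eqP; rewrite -normr_eq0 eq_le normr_ge0 andbT; apply/ler_addgt0Pr => e e0.
rewrite add0r; have [d d0 dP] := nearptI fb (ana_cont ab e0).
pose t : R := if b i == 0 then d / 2 else b i.
have xb k : `|upd b i t k - b k| < d.
  rewrite /upd; case: eqP => [->|_]; last by rewrite subrr normr0.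
  rewrite /t; case: eqP => [->|_]; last by rewrite subrr normr0.
  by rewrite subr0 gtr0_norm ?divr_gt0 // ltr_pdivrMr // ltr_pMr // ltr1n.
have [fx] := dP _ xb; rewrite fx ?sub0r ?normrN; first exact: ltW.
rewrite upd_eq /t; have [_|//] := eqVneq (b i) 0.
by rewrite gt_eqF // divr_gt0.
Qed.

Lemma one_var_flat (rho M : R) (h : (unit -> R) -> R) : 0 < rho -> An (fun=> rho) M h ->
  (forall D, exists K, nearpt (fun=> 0) (fun x => `|h x| <= K * `|x tt| ^+ D)) ->
  forall x, `|x tt| < rho -> h x = 0.
Proof.
move=> rho0 hA hflat.
have H n : exists g, An (fun=> rho) (M / rho ^+ n) g /\ forall (s : R) x,
    0 < s < 1 -> inbox s (fun=> rho) x -> h x = x tt ^+ n * g x.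
  elim: n => [|n [g [gA hg]]].
    by exists h; split=> [|s x _ _]; rewrite expr0 ?divr1 ?mul1r.
  have [g' [g'A gE]] := An_div tt (fun=> rho0) gA.
  have u0 x : upd x tt 0 = (fun=> 0 : R) by apply/funext => -[]; rewrite /upd eqxx.
  have ga : ana g (fun=> 0) by apply/ana0P; exists rho, (M / rho ^+ n).
  have g0 : g (fun=> 0) = 0.
    have [K KP] := hflat n.+1.
    have rn : nearpt (fun=> 0) (fun x : unit -> R => `|x tt| < rho / 2).
      by exists (rho / 2); [rewrite divr_gt0|move=> x /(_ tt); rewrite subr0].
    have gK : nearpt (fun=> 0) (fun x => x tt != 0 -> `|g x| <= K * `|x tt|).
      apply: nearptS (nearptI rn KP) => x [xr hK] x0.
      have xn : 0 < `|x tt| ^+ n by rewrite exprn_gt0 // normr_gt0.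
      rewrite -(ler_pM2l xn) mulrCA -exprSr -normrX -normrM -(hg (1/2) x (half01 R)) //.
      by case; apply: ltW; move: xr; clear; lra.
    apply/eqP; rewrite -normr_eq0 eq_le normr_ge0 andbT; apply/ler_addgt0Pr => e e0.
    rewrite add0r; have e2 : 0 < e / 2 by rewrite divr_gt0.
    have [d d0 dP] := nearptI gK (ana_cont ga e2).
    pose t := Num.min (d / 2) (e / 2 / (`|K| + 1)).
    have K1 : 0 < `|K| + 1 by rewrite ltr_wpDl.
    have t0 : 0 < t by rewrite lt_min !divr_gt0.
    have td : t < d by rewrite (@le_lt_trans _ _ (d / 2)) ?ge_min ?lexx //; move: d0; clear; lra.
    have [] := dP (fun=> t).
      by move=> _; rewrite subr0 gtr0_norm.
    rewrite gt_eqF // => /(_ isT) gt1 gt2.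
    have : K * `|t| <= e / 2.
      apply: (@le_trans _ _ ((`|K| + 1) * (e / 2 / (`|K| + 1)))).
        rewrite (@le_trans _ _ ((`|K| + 1) * t)) //.
          by rewrite (gtr0_norm t0) ler_wpM2r ?(ltW t0) // (le_trans (ler_norm _)) // lerDl.
        by rewrite ler_wpM2l ?(ltW K1) // ge_min lexx orbT.
      by rewrite mulrCA divff ?gt_eqF // mulr1.
    move: gt1 gt2 (ler_normB (g (fun=> t)) (g (fun=> t) - g (fun=> 0))).
    by rewrite subKr; clear; lra.
  exists g'; split; first by rewrite exprS invfM mulrA mulrAC.
  move=> s x s01 xs; rewrite (hg s x) // (gE s x) // u0 g0 add0r mulrA -exprSr //.
move=> x xr.
pose s := (1 + `|x tt| / rho) / 2.
have q01 : 0 <= `|x tt| / rho < 1 by rewrite divr_ge0 ?(ltW rho0) //= ltr_pdivrMr // mul1r.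
have s01 : 0 < s < 1 by rewrite /s; move: q01; clear; lra.
have xs : inbox s (fun=> rho) x.
  case; rewrite -[leLHS](divfK (lt0r_neq0 rho0)) ler_wpM2r ?(ltW rho0) // /s.
  by move: q01; clear; lra.
have hM n : `|h x| <= (`|x tt| / rho) ^+ n * M.
  have [g [gA hg]] := H n; rewrite (hg s x) // normrM normrX expr_div_n mulrAC -mulrA.
  rewrite ler_wpM2l ?exprn_ge0 //.
  exact: (An_bound (fun=> ltW rho0) s01 gA xs).
apply/eqP; rewrite -normr_eq0 eq_le normr_ge0 andbT leNgt; apply/negP => hx.
have : (fun n : nat => (`|x tt| / rho) ^+ n * M) @ \oo --> (0 : R).
  rewrite -[X in _ --> X](mul0r M); apply: cvgM; last exact: cvg_cst.
  by apply: cvg_expr; rewrite ger0_norm; move: q01; clear; lra.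
move=> /cvgrPdist_lt/(_ _ hx)[K _ /(_ K (leqnn _))] /=.
rewrite sub0r normrN => hK; have := hM K.
by move: (le_lt_trans (ler_norm _) hK); clear; lra.
Qed.

(** Since v is interior to the polydisc, the restriction of f to the line through v has a radius 1 +
    t > 1; a function of one variable that is flat at 0 then vanishes at the parameter 1 as well. *)
Lemma An_ray_flat I (r M : R) (f : (I -> R) -> R) v : 0 < r -> An (fun=> r) M f ->
  (forall i, `|v i| < r) ->
  (forall D, exists K, nearpt (fun=> 0)
     (fun x : unit -> R => `|f (fun i => x tt * v i)| <= K * `|x tt| ^+ D)) ->
  f v = 0.
Proof.
move=> r0 fA vr flat.
have [|j|t t0 tP] := @fin_radius R I (fun j t => `|v j| * (1 + t) <= r).
- move=> j t t' tv t'0 tt'; apply: le_trans tv; rewrite ler_wpM2l // lerD2l //.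
- exists ((r - `|v j|) / (`|v j| + r)).
    by rewrite divr_gt0 ?subr_gt0 // ltr_wpDl.
  have vr0 : 0 < `|v j| + r by rewrite ltr_wpDl.
  rewrite mulrDr mulr1 -lerBrDl mulrA ler_pdivrMr // mulrC.
  rewrite ler_wpM2l ?subr_ge0 ?(ltW (vr j)) //.
  by rewrite lerDl ltW.
pose h (x : unit -> R) := f (fun i => x tt * v i).
have t1 : 0 < 1 + t by rewrite addr_gt0.
have hA : An (fun=> 1 + t) M h.
  apply: (@An_subst _ _ _ _ _ _ _ (fun i (x : unit -> R) => x tt * v i)) fA.
    move=> i; apply: (@PB_le _ _ _ ((1 + t) * `|v i|)); last by rewrite mulrC.
    by apply: PB_mul; [exact: (PB_var (fun=> 1 + t))|exact: PB_cst].
  move=> s s01; exists s; split=> // x xs i; rewrite normrM.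
  apply: (@le_trans _ _ (s * (1 + t) * `|v i|)).
    by rewrite ler_wpM2r //; exact: xs.
  by rewrite -mulrA ler_wpM2l 1?mulrC //; case/andP: s01 => /ltW.
have := one_var_flat t1 hA flat (x := fun=> 1).
rewrite /h (_ : (fun i => 1 * v i) = v); last by apply/funext => i; rewrite mul1r.
by apply; rewrite normr1 ltrDl.
Qed.

Lemma An_zero_near I (r M : R) (f : (I -> R) -> R) : 0 < r -> An (fun=> r) M f ->
  nearpt (fun=> 0) (fun x => f x = 0) -> forall v, (forall i, `|v i| < r) -> f v = 0.
Proof.
move=> r0 fA f0 v vr; apply: (An_ray_flat r0 fA vr).
move=> D; exists 0; have [e e0 eP] := f0; exists (e / r); first by rewrite divr_gt0.
move=> x /(_ tt); rewrite subr0 => xe.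
rewrite (eP (fun i => x tt * v i)) ?normr0 ?mul0r // => i.
rewrite subr0 normrM; apply: le_lt_trans (_ : `|x tt| * r < e).
  by rewrite ler_wpM2l // ltW.
by rewrite -ltr_pdivlMr.
Qed.

Lemma box_lt I (r : R) (x : I -> R) : 0 < r -> (forall i, `|x i| < r) ->
  exists2 s : R, 0 < s < 1 & inbox s (fun=> r) x.
Proof.
move=> r0 xr; have [|j|s s0 sP] := @fin_radius R I (fun j s => s < 1 /\ `|x j| <= (1 - s) * r).
- move=> j s s' [s1 xs] s'0 ss'; split; first exact: le_lt_trans s1.
  by apply: le_trans xs _; rewrite (ler_wpM2r (ltW r0)) //; lra.
- have xj := xr j; exists ((1 - `|x j| / r) / 2).
    by rewrite divr_gt0 // subr_gt0 ltr_pdivrMr // mul1r.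
  have h0 : 0 <= `|x j| / r by rewrite divr_ge0 // ltW.
  split; first by move: h0; clear; lra.
  rewrite -[leLHS](divfK (lt0r_neq0 r0)) (ler_wpM2r (ltW r0)) //.
  have : `|x j| / r < 1 by rewrite ltr_pdivrMr // mul1r.
  by clear; lra.
exists (1 - Num.min s (1 / 2)).
  have : 0 < Num.min s (1/2) by rewrite lt_min s0; move: s0; clear; lra.
  have : Num.min s (1/2) <= 1/2 by rewrite ge_min lexx orbT.
  by clear; lra.
move=> i; apply: le_trans (sP i).2 _; rewrite (ler_wpM2r (ltW r0)) //.
by rewrite lerD2l lerN2 ge_min lexx.
Qed.

(** The zeros are propagated along N equal steps of the segment from p to q: recentring at [c k]
    leaves the radius (1 - s) * r, and N is chosen to make each step shorter than that. *)
Lemma An_identity I (r M : R) (f : (I -> R) -> R) p : 0 < r -> An (fun=> r) M f ->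
  (forall i, `|p i| < r) -> nearpt p (fun x => f x = 0) ->
  forall q, (forall i, `|q i| < r) -> f q = 0.
Proof.
move=> r0 fA pr fp q qr.
have [s1 s101 ps1] := box_lt r0 pr; have [s2 s201 qs2] := box_lt r0 qr.
have [s [s01 s1s s2s]] : exists s : R, [/\ 0 < s < 1, s1 <= s & s2 <= s].
  exists (Num.max s1 s2); split; rewrite ?le_max ?lexx ?orbT //.
  by rewrite /Num.max; case: ifP.
have ps : inbox s (fun=> r) p by apply: inbox_le ps1 => // _; exact: ltW.
have qs : inbox s (fun=> r) q by apply: inbox_le qs2 => // _; exact: ltW.
have sr0 : 0 < (1 - s) * r by rewrite mulr_gt0 //; move: s01; clear; lra.
pose N := (Num.bound (2 * r / ((1 - s) * r))).+1.
have NP : 2 * r / N%:R < (1 - s) * r.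
  have h0 : 0 <= 2 * r / ((1 - s) * r) by apply: divr_ge0; [rewrite mulr_ge0 // ltW|exact: ltW].
  rewrite ltr_pdivrMr ?ltr0Sn // [ltRHS]mulrC -ltr_pdivrMr //.
  by apply: lt_le_trans (archi_boundP h0) _; rewrite ler_nat.
pose c k : I -> R := fun i => p i + (k%:R / N%:R) * (q i - p i).
have cs k : (k <= N)%N -> inbox s (fun=> r) (c k).
  move=> kN i; rewrite /c.
  have k01 : 0 <= (k%:R / N%:R : R) <= 1.
    by rewrite divr_ge0 //= ler_pdivrMr ?ltr0Sn // mul1r ler_nat.
  rewrite (_ : _ + _ = (1 - k%:R / N%:R) * p i + k%:R / N%:R * q i); last by ring.
  move: (k%:R / N%:R) k01 (ps i) (qs i); clear => a a01 h1 h2.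
  apply: le_trans (ler_normD _ _) _; rewrite !normrM (ger0_norm (_ : 0 <= 1 - a)); last by lra.
  rewrite (ger0_norm (_ : 0 <= a)); last by lra.
  by move: (`|p i|) (`|q i|) (s * r) h1 h2 => u v w; nra.
suff H k : (k <= N)%N -> nearpt (c k) (fun x => f x = 0).
  have /nearpt_self := H N (leqnn N); rewrite (_ : c N = q) //.
  by apply/funext => i; rewrite /c divff ?pnatr_eq0 // mul1r addrC subrK.
elim: k => [_|k IH kN].
  by rewrite (_ : c 0%N = p) //; apply/funext => i; rewrite /c !mul0r addr0.
have /IH fk : (k <= N)%N by exact: ltnW.
have gA := An_recenter (fun=> ltW r0) s01 (cs k (ltnW kN)) fA.
have g0 : nearpt (fun=> 0) (fun x => f (fun i => c k i + x i) = 0).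
  have [e e0 eP] := fk; exists e => // x xe; apply: eP => i.
  by have := xe i; rewrite subr0 addrAC subrr add0r.
have := An_zero_near sr0 gA g0 => fz.
exists ((1 - s) * r - 2 * r / N%:R); first by rewrite subr_gt0.
move=> x xc; have -> : x = (fun i => c k i + (x i - c k i)) by apply/funext => i; rewrite addrC subrK.
apply: fz => i; rewrite (_ : x i - c k i = (x i - c k.+1 i) + (c k.+1 i - c k i)); last by ring.
apply: le_lt_trans (ler_normD _ _) _.
have : `|c k.+1 i - c k i| <= 2 * r / N%:R.
  rewrite /c -natr1 (_ : _ - _ = (q i - p i) / N%:R); last first.
    by field; rewrite pnatr_eq0.
  rewrite normrM [`|_^-1|]ger0_norm ?invr_ge0 // ler_wpM2r ?invr_ge0 //.
  apply: le_trans (ler_normB _ _) _.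
  by have := pr i; have := qr i; clear; lra.
by have := xc i; clear; lra.
Qed.

Definition nzg I (f : (I -> R) -> R) := ~ nearpt (fun=> 0) (fun x => f x = 0).

(** Where f is nonzero, g must vanish nearby, and the identity theorem spreads this over the
    polydisc; hence germs have no zero divisors. *)
Lemma nzg_mul I (f g : (I -> R) -> R) : ana f (fun=> 0) -> ana g (fun=> 0) ->
  nzg f -> nzg g -> nzg (fun x => f x * g x).
Proof.
move=> fa ga f0 g0 [e e0 fg0].
have [r [M [N [r0 fA' gA']]]] := ana_rad2 fa ga.
have m0 : 0 < Num.min r e by rewrite lt_min r0.
have mr : Num.min r e <= r by rewrite ge_min lexx.
have e00 (h : (I -> R) -> R) L : An (fun=> r) L (fun x => h (fun i => 0 + x i)) ->
    An (fun=> Num.min r e) L h.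
  move=> /(An_radius (r := fun=> Num.min r e) (fun=> mr)); apply: An_ext => s x _ _.
  by congr h; apply/funext => i; rewrite add0r.
have fA := e00 _ _ fA'; have gA := e00 _ _ gA'.
apply: f0; exists (Num.min r e) => // p pm; apply: contrapT => /eqP fp.
have pm' i : `|p i| < Num.min r e by have := pm i; rewrite subr0.
apply: g0; exists (Num.min r e) => // q qm.
apply: (An_identity m0 gA pm') => [|i]; last by have := qm i; rewrite subr0.
have pe : nearpt p (fun x => forall i, `|x i| < e).
  apply: nearpt_all => i; exists (e - `|p i|).
    by rewrite subr_gt0 (lt_le_trans (pm' i)) // ge_min lexx orbT.
  move=> x /(_ i) xp; rewrite -(subrK (p i) (x i)) (le_lt_trans (ler_normD _ _)) //.
  by rewrite -ltrBrDr.
apply: nearptS (nearptI pe (ana_neq0 (An_ana m0 fA pm') fp)) => x [xe fx].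
have /eqP := fg0 x (fun i => ltac:(rewrite subr0; exact: xe i)).
rewrite mulf_eq0 => /orP[/eqP fx0|/eqP //].
by move: fx; rewrite fx0 normr0 ltNge divr_ge0.
Qed.

End identity_theorem.

(** * The Lojasiewicz gradient inequality *)

Section monomials.
Variables (R : realType) (I : finType).
Implicit Types (A B : {set I}) (f g u v w : (I -> R) -> R) (al be ga : I -> nat).

Local Notation o := (fun=> 0 : R).

Definition dep A f := forall x y, (forall i, i \in A -> x i = y i) -> f x = f y.

Definition proj A (x : I -> R) : I -> R := fun i => if i \in A then x i else 0.

Lemma dep_proj A f x : dep A f -> f (proj A x) = f x.
Proof. by apply => i iA; rewrite /proj iA. Qed.

Lemma proj_dep A f : dep A (fun x => f (proj A x)).
Proof.
move=> x y xy; congr f; apply/funext => i; rewrite /proj.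
by case: ifP => // /xy.
Qed.

Lemma dep_sub A B f : A \subset B -> dep A f -> dep B f.
Proof. by move=> /fintype.subsetP AB fA x y xy; apply: fA => i /AB /xy. Qed.

Lemma proj0 A : proj A o = o.
Proof. by apply/funext => i; rewrite /proj; case: ifP. Qed.

Lemma ana_proj A f : ana f o -> ana (fun x => f (proj A x)) o.
Proof.
move=> fa; apply: (@ana_comp _ _ _ f (fun i x => proj A x i)).
  by rewrite (_ : (fun j => _) = o) // proj0.
move=> i; rewrite /proj; case: (i \in A); first exact: ana_var.
exact: ana_cst.
Qed.

Lemma near_proj A (P : (I -> R) -> Prop) : nearpt o P -> nearpt o (fun x => P (proj A x)).
Proof.
move=> [e e0 eP]; exists e => // x xe; apply: eP => i.
by rewrite /proj; case: ifP => _; [exact: xe|rewrite subrr normr0].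
Qed.

Definition mono al (x : I -> R) : R := \prod_i x i ^+ al i.

Lemma ana_mono al a : ana (mono al) a.
Proof. by apply: ana_prod => i _; apply: ana_exp; exact: ana_var. Qed.

Lemma monoD al be x : mono (fun i => (al i + be i)%N) x = mono al x * mono be x.
Proof. by rewrite -big_split; apply: eq_bigr => i _; rewrite exprD. Qed.

Lemma mono0 x : mono (fun=> 0%N) x = 1.
Proof. by rewrite /mono big1 // => i _; rewrite expr0. Qed.

Lemma mono1 i x : mono (fun k => (k == i)%N) x = x i.
Proof.
rewrite /mono (bigD1 i) //= eqxx expr1 big1 ?mulr1 // => k /negPf ->.
by rewrite expr0.
Qed.

Lemma monoX al n x : mono (fun i => (n * al i)%N) x = mono al x ^+ n.
Proof. by rewrite -prodrXl; apply: eq_bigr => i _; rewrite mulnC exprM. Qed.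

Lemma mono_le al be x : (forall i, (be i <= al i)%N) ->
  mono al x = mono be x * mono (fun i => (al i - be i)%N) x.
Proof. by move=> le; rewrite -monoD; congr mono; apply/funext => i; rewrite subnKC. Qed.

Lemma dep_mono A al : (forall i, i \notin A -> al i = 0%N) -> dep A (mono al).
Proof.
move=> alA x y xy; apply: eq_bigr => i _; have [iA|iA] := boolP (i \in A).
  by rewrite xy.
by rewrite alA // !expr0.
Qed.

Lemma mono_o al : mono al o = \prod_i (al i == 0%N)%:R.
Proof. by apply: eq_bigr => i _; rewrite expr0n. Qed.

Lemma mono_o0 al i : al i != 0%N -> mono al o = 0.
Proof. by move=> ai; rewrite mono_o (bigD1 i) //= (negPf ai) mul0r. Qed.

(** The normal form sought throughout: a monomial times a unit, both in the coordinates of A only.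
    Tracking A leaves the other coordinates free for later stages of the induction. *)
Definition ismono A f := exists al u, [/\ forall i, i \notin A -> al i = 0%N,
  dep A u, ana u o, u o != 0 & nearpt o (fun x => f x = mono al x * u x)].

Lemma ismono_ext A f g : nearpt o (fun x => f x = g x) -> ismono A f -> ismono A g.
Proof.
move=> fg [al [u [alA uA ua u0 fE]]]; exists al, u; split=> //.
by apply: nearptS (nearptI fg fE) => x [<-].
Qed.

Lemma ismono_sub A B f : A \subset B -> ismono A f -> ismono B f.
Proof.
move=> AB [al [u [alA uA ua u0 fE]]]; exists al, u; split=> //.
  by move=> i iB; apply: alA; apply: contra iB; exact: (fintype.subsetP AB).
exact: dep_sub uA.
Qed.

Lemma ismono_unit A f : dep A f -> ana f o -> f o != 0 -> ismono A f.
Proof.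
move=> fA fa f0; exists (fun=> 0%N), f; split=> //.
by apply: nearptW => x; rewrite mono0 mul1r.
Qed.

Lemma ismono_var A i : i \in A -> ismono A (fun x => x i).
Proof.
move=> iA; exists (fun k => (k == i)%N), (fun=> 1); split.
- by move=> k kA; case: eqP => // ki; rewrite ki iA in kA.
- by [].
- exact: ana_cst.
- exact: oner_neq0.
- by apply: nearptW => x; rewrite mono1 mulr1.
Qed.

Lemma ismono_mul A f g : ismono A f -> ismono A g -> ismono A (fun x => f x * g x).
Proof.
move=> [al [u [alA uA ua u0 fE]]] [be [v [beA vA va v0 gE]]].
exists (fun i => (al i + be i)%N), (fun x => u x * v x); split.
- by move=> i iA; rewrite alA // beA.
- by move=> x y xy; rewrite (uA x y) // (vA x y).
- exact: ana_mul.
- exact: mulf_neq0.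
- by apply: nearptS (nearptI fE gE) => x [-> ->]; rewrite monoD mulrACA.
Qed.

Lemma ismono_exp A f n : ismono A f -> ismono A (fun x => f x ^+ n).
Proof.
move=> fm; elim: n => [|n IH].
  under eq_fun do rewrite expr0.
  by apply: ismono_unit => //; exact: ana_cst.
by under eq_fun do rewrite exprS; exact: ismono_mul.
Qed.

Lemma ismono_prod A (S : Type) (l : seq S) (P : pred S) (f : S -> (I -> R) -> R) :
  (forall s, P s -> ismono A (f s)) -> ismono A (fun x => \prod_(s <- l | P s) f s x).
Proof.
move=> fm; elim: l => [|s l IH].
  under eq_fun do rewrite big_nil.
  by apply: ismono_unit => //; exact: ana_cst.
under eq_fun do rewrite big_cons.
by case Ps: (P s) => //; apply: ismono_mul => //; exact: fm.
Qed.

(* Follows the ray x_i = t, along which a monomial never vanishes. *)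
Lemma ismono_nzg A f : ismono A f -> nzg f.
Proof.
move=> [al [u [alA uA ua u0 fE]]] f0.
have [e e0 eP] := nearptI (nearptI f0 fE) (ana_neq0 ua u0).
have [] := eP (fun=> e / 2).
  by move=> i; rewrite subr0 gtr0_norm ?divr_gt0 // ltr_pdivrMr // ltr_pMr // ltr1n.
move=> [-> fe] ue; have /eqP := esym fe; rewrite mulf_eq0 => /orP[|/eqP u00].
  by apply/negP; apply/prodf_neq0 => i _; rewrite expf_neq0 // gt_eqF // divr_gt0.
by move: ue; rewrite u00 normr0 ltNge divr_ge0.
Qed.

Lemma ana_upd0 f i : ana f o -> ana (fun x => f (upd x i 0)) o.
Proof.
move=> fa; apply: (@ana_comp _ _ _ f (fun k x => upd x i 0 k)).
  by rewrite (_ : (fun j => _) = o) //; apply/funext => k; rewrite /upd; case: eqP.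
by move=> k; rewrite /upd; case: (k == i); [exact: ana_cst|exact: ana_var].
Qed.

Lemma near_upd0 i (P : (I -> R) -> Prop) : nearpt o P -> nearpt o (fun x => P (upd x i 0)).
Proof.
move=> [e e0 eP]; exists e => // x xe; apply: eP => k.
by rewrite /upd; case: eqP => _; [rewrite subrr normr0|exact: xe].
Qed.

Lemma ana_div_dep A f i : i \in A -> ana f o -> dep A f ->
  exists g, [/\ ana g o, dep A g &
    nearpt o (fun x => f x = f (upd x i 0) + x i * g x)].
Proof.
move=> iA fa fA; have [g ga gE] := ana_div i fa.
exists (fun x => g (proj A x)); split; [exact: ana_proj|exact: proj_dep|].
apply: nearptS (near_proj A gE) => x; rewrite dep_proj // => ->.
rewrite {2}/proj iA; congr (_ + _); apply: fA => k kA.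
by rewrite /upd /proj kA.
Qed.

(** Each coordinate is prime among germs: if x_k divides f * g, one of the factors vanishes on x_k =
    0, and x_k can be split off from it. The induction is on the degree of the monomial. *)
Lemma mono_factor A f g al u : ana f o -> ana g o -> dep A f -> dep A g ->
  (forall i, i \notin A -> al i = 0%N) -> ana u o -> u o != 0 ->
  nearpt o (fun x => f x * g x = mono al x * u x) -> ismono A f.
Proof.
have [n] := ubnP (\sum_i al i); elim: n al f g => // n IH al f g aln fa ga fA gA alA ua u0 fg.
have [al0|] := pselect (forall i, al i = 0%N).
  apply: ismono_unit => //; have := nearpt_self fg.
  rewrite mono_o big1 ?mul1r => [f0|i _]; last by rewrite al0 eqxx.
  by apply/eqP => f00; move: u0; rewrite -f0 f00 mul0r eqxx.
move=> /existsNP[k /eqP ak].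
have kA : k \in A by apply: contraNT ak => /alA ->.
pose al' i := (al i - (i == k))%N.
have alE x : mono al x = x k * mono al' x.
  rewrite (@mono_le al (fun i => (i == k)%N)) ?mono1 // => i.
  by case: eqP => // ->; rewrite lt0n.
have al'n : (\sum_i al' i < n)%N.
  rewrite -ltnS; apply: leq_trans aln; rewrite ltnS.
  rewrite [ltnRHS](bigD1 k) //= (bigD1 k) //= /al' eqxx subn1.
  apply: (@leq_trans ((al k).-1.+1 + \sum_(i | i != k) al' i)) => //.
  by rewrite prednK ?lt0n // leq_add2l leq_sum // => i _; rewrite leq_subr.
have al'A i : i \notin A -> al' i = 0%N by rewrite /al' => /alA ->.
have f0g0 : nearpt o (fun x => f (upd x k 0) * g (upd x k 0) = 0).
  by apply: nearptS (near_upd0 k fg) => x ->; rewrite alE upd_eq !mul0r.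
have cancel h : ana h o -> nearpt o (fun x => x k * h x = x k * mono al' x * u x) ->
    nearpt o (fun x => h x = mono al' x * u x).
  move=> ha hE; have ma : ana (fun x => h x - mono al' x * u x) o.
    by apply: ana_sub => //; apply: ana_mul => //; exact: ana_mono.
  apply: nearptS (ana_cancel (i := k) ma _) => [x /eqP|]; first by rewrite subr_eq0 => /eqP.
  apply: nearptS hE => x hx xk; apply/eqP; rewrite subr_eq0; apply/eqP.
  by apply: (mulfI xk); rewrite hx -mulrA.
have [f0|g0] : nearpt o (fun x => f (upd x k 0) = 0) \/ nearpt o (fun x => g (upd x k 0) = 0).
- apply: contrapT => /not_orP[n1 n2].
  by apply: (nzg_mul (ana_upd0 k fa) (ana_upd0 k ga)).
- have [f' [f'a f'A fE]] := ana_div_dep kA fa fA.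
  have fxk : nearpt o (fun x => x k * f' x = f x).
    by apply: nearptS (nearptI f0 fE) => x [-> ->]; rewrite add0r.
  apply: (ismono_ext fxk); apply: ismono_mul; first exact: ismono_var.
  apply: (IH al' f' g) => //; apply: cancel; first exact: ana_mul.
  by apply: nearptS (nearptI fxk fg) => x [xf]; rewrite mulrA xf alE.
- have [g' [g'a g'A gE]] := ana_div_dep kA ga gA.
  apply: (IH al' f g') => //; apply: cancel; first exact: ana_mul.
  apply: nearptS (nearptI (nearptI g0 gE) fg) => x [[-> ->]].
  by rewrite add0r mulrCA alE.
Qed.

Lemma ana_bounded f : ana f o -> exists2 M : R, 0 < M & nearpt o (fun x => `|f x| <= M).
Proof.
move=> fa; exists (`|f o| + 1); first by rewrite ltr_wpDl.
apply: nearptS (ana_cont fa ltr01) => x fx.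
rewrite -(subrK (f o) (f x)) (le_trans (ler_normD _ _)) // addrC lerD2l ltW //.
Qed.

(** Order of vanishing of the monomial with exponent al along the curve with components t^(c i). *)
Let wt (c al : I -> nat) := (\sum_i c i * al i)%N.

Lemma wt_curve (c al : I -> nat) (t : R) : mono al (fun i => t ^+ c i) = t ^+ wt c al.
Proof.
rewrite /mono /wt; under eq_bigr do rewrite -exprM.
by rewrite expr_sum.
Qed.

(** After division by t^a the left side stays away from zero as t tends to 0 while the right side is
    of order t. *)
Lemma dominant_power (c : I -> nat) (a b d : nat) u v w : (forall i, (0 < c i)%N) ->
  ana u o -> ana v o -> ana w o -> u o != 0 -> (a < b)%N -> (a < d)%N ->
  nearpt o (fun x => forall t, 0 < t -> x = (fun i => t ^+ c i) ->
    t ^+ a * u x = t ^+ b * v x + t ^+ d * w x) -> False.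
Proof.
move=> c0 ua va wa u0 ab ad E.
have [M M0 vM] := ana_bounded va; have [N N0 wN] := ana_bounded wa.
have [e e0 eP] := nearptI (nearptI E (ana_neq0 ua u0)) (nearptI vM wN).
have um : 0 < `|u o| by rewrite normr_gt0.
have MN : 0 < M + N by rewrite addr_gt0.
pose q := Num.min (e / 2) (`|u o| / 2 / (M + N)).
have q0 : 0 < q by rewrite lt_min !divr_gt0.
pose t := Num.min 1 q.
have t0 : 0 < t by rewrite lt_min ltr01.
have t1 : t <= 1 by rewrite ge_min lexx.
have tq : t <= q by rewrite ge_min lexx orbT.
have te : t < e.
  apply: le_lt_trans tq _; apply: (@le_lt_trans _ _ (e / 2)).
    by rewrite ge_min lexx.
  by rewrite ltr_pdivrMr // ltr_pMr // ltr1n.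
have tu : t * (M + N) <= `|u o| / 2.
  by rewrite -ler_pdivlMr // (le_trans tq) // ge_min lexx orbT.
have [i|[Ex ux] [vx wx]] := eP (fun i => t ^+ c i).
  rewrite subr0 ger0_norm ?exprn_ge0 ?(ltW t0) //; apply: le_lt_trans te.
  rewrite -[leRHS]expr1; apply: ler_wiXn2l => //; exact: ltW.
have := Ex t t0 erefl.
have {}ab : b = (a + (b - a.+1).+1)%N by rewrite addnS -addSn subnKC.
have {}ad : d = (a + (d - a.+1).+1)%N by rewrite addnS -addSn subnKC.
rewrite {1}ab {1}ad !exprD -!mulrA -mulrDr => /(mulfI (expf_neq0 a (lt0r_neq0 t0))) uE.
have tX k : `|t ^+ k.+1| <= t.
  by rewrite ger0_norm ?exprn_ge0 ?(ltW t0) // exprS ger_pMr // exprn_ile1 // ltW.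
move: ux; apply/negP; rewrite -leNgt uE; apply: le_trans (ler_normD _ _) _.
rewrite !normrM; apply: le_trans tu; rewrite mulrDr.
by rewrite lerD // ler_pM.
Qed.

Lemma wtM (c al : I -> nat) m i : wt (fun k => (m * c k + (k == i))%N) al = (m * wt c al + al i)%N.
Proof.
rewrite /wt; under eq_bigr do rewrite mulnDl -mulnA.
rewrite big_split /= -big_distrr /=; congr (_ + _)%N.
by rewrite (bigD1 i) //= eqxx mul1n big1 ?addn0 // => k /negPf ->.
Qed.

(** A weight at k exceeding the total degree of al outweighs everything the other exponents of al
    contribute. *)
Lemma wt_lt (al be : I -> nat) k : (al k < be k)%N ->
  exists2 c : I -> nat, (forall i, (0 < c i)%N) & (wt c al < wt c be)%N.
Proof.
move=> ab; pose S := (\sum_i al i)%N.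
exists (fun i => if i == k then S.+1 else 1%N) => [i|]; first by case: ifP.
rewrite /wt (bigD1 k) //= [ltnRHS](bigD1 k) //= eqxx.
apply: (@leq_trans (S.+1 * (al k).+1)); last first.
  by apply: leq_trans (leq_addr _ _); rewrite leq_mul2l ab orbT.
rewrite mulnS addnC -addSn leq_add2r ltnS /S [leqRHS](bigD1 k) //=.
apply: leq_trans (leq_addl _ _); apply: leq_sum => i /negPf ->.
by rewrite mul1n.
Qed.

(** Along every curve on which x^al dominates x^be, the third monomial must have the order of x^al.
    Multiplying the weights by al i + 1 and adding one at i preserves the domination and reads off
    the exponent at i. *)
Lemma mono_order al be ga u v w k : ana u o -> ana v o -> ana w o ->
  u o != 0 -> w o != 0 -> (al k < be k)%N ->
  nearpt o (fun x => mono al x * u x = mono be x * v x + mono ga x * w x) ->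
  ga = al.
Proof.
move=> ua va wa u0 w0 ab E.
have wtE c : (forall i, (0 < c i)%N) -> (wt c al < wt c be)%N -> wt c ga = wt c al.
  move=> c0 cab; have {}E : nearpt o (fun x => forall t : R, 0 < t -> x = (fun i => t ^+ c i) ->
      t ^+ wt c al * u x = t ^+ wt c be * v x + t ^+ wt c ga * w x).
    by apply: nearptS E => x + t t0 xE; rewrite {1 3 5}xE !wt_curve.
  apply/eqP; rewrite eqn_leq leqNgt; apply/andP; split.
    by apply/negP => lt; exact: (dominant_power c0 ua va wa u0 cab lt E).
  rewrite leqNgt; apply/negP => lt.
  have va' : ana (fun x => - v x) o by exact: ana_opp.
  apply: (dominant_power c0 wa va' ua w0 (ltn_trans lt cab) lt).
  by apply: nearptS E => x + t t0 xE => /(_ t t0 xE) ->; ring.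
have [c c0 cab] := wt_lt ab.
apply/funext => i.
have := wtE (fun k => ((al i).+1 * c k + (k == i))%N).
rewrite !wtM (wtE c) // => /(_ _ _)/addnI; apply.
  by move=> l; rewrite addn_gt0 muln_gt0 c0.
apply: (@leq_trans ((al i).+1 * (wt c al).+1)).
  by rewrite mulnS addnC -addSn leq_add2r.
by apply: leq_trans (leq_addr _ _); rewrite leq_mul2l cab orbT.
Qed.

(** If neither exponent dominated the other, the normal form of the difference would have to equal
    both monomials by [mono_order]. Comparability is what provides a least exponent in [S_core]. *)
Lemma mono_comparable A al be u v : ana u o -> ana v o -> u o != 0 -> v o != 0 ->
  nearpt o (fun x => mono al x * u x - mono be x * v x = 0) \/
  ismono A (fun x => mono al x * u x - mono be x * v x) ->
  (forall i, (al i <= be i)%N) \/ (forall i, (be i <= al i)%N).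
Proof.
move=> ua va u0 v0 D; apply: contrapT => /not_orP[/existsNP[l /negP]] + /existsNP[k /negP].
rewrite -!ltnNge => bl ak.
case: D => [E|[ga [w [gaA wA wa w0 E]]]].
  have ba : be = al.
    apply: (mono_order (v := fun=> 0) ua (ana_cst 0 o) va u0 v0 ak).
    apply: nearptS E => x /eqP; rewrite subr_eq0 => /eqP ->.
    by rewrite mulr0 add0r.
  by move: ak; rewrite ba ltnn.
have e1 : ga = al.
  apply: (mono_order ua va wa u0 w0 ak).
  by apply: nearptS E => x <-; rewrite addrC subrK.
have e2 : ga = be.
  have wa' : ana (fun x => - w x) o by exact: ana_opp.
  apply: (mono_order va ua wa' v0 _ bl); first by rewrite oppr_eq0.
  by apply: nearptS E => x; rewrite mulrN => <-; ring.
by move: ak; rewrite -e1 e2 ltnn.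
Qed.

End monomials.

(** * Substitutions along an ultrafilter *)

Section charts.
Variables (R : realType) (I : finType) (T : Type) (U : set_system T).
Context {UU : UltraFilter U}.
Implicit Types (A B : {set I}) (f g u : (I -> R) -> R) (X Y Z : T -> I -> R).
Implicit Types (phi psi : I -> (I -> R) -> R) (ga : I -> nat).

Local Notation o := (fun=> 0 : R).

Definition ev (P : T -> Prop) := U [set k | P k].

Lemma evS (P Q : T -> Prop) : (forall k, P k -> Q k) -> ev P -> ev Q.
Proof. by move=> PQ; apply: filterS => k /PQ. Qed.

Lemma evI (P Q : T -> Prop) : ev P -> ev Q -> ev (fun k => P k /\ Q k).
Proof. exact: filterI. Qed.

Lemma evW (P : T -> Prop) : (forall k, P k) -> ev P.
Proof. by move=> p; apply: filterS (@filterT _ U _) => k _; exact: p. Qed.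

Lemma ev_ex (P : T -> Prop) : ev P -> exists k, P k.
Proof. by move=> /filter_ex[k]; exists k. Qed.

Lemma ev_not (P : T -> Prop) : ~ ev P -> ev (fun k => ~ P k).
Proof. by move=> nP; have [|//] := in_ultra_setVsetC [set k | P k] UU. Qed.

Lemma ev_all (J : finType) (P : J -> T -> Prop) : (forall j, ev (P j)) -> ev (fun k => forall j, P j k).
Proof.
move=> eP; suff H (l : seq J) : ev (fun k => forall j, j \in l -> P j k).
  by apply: evS (H (enum J)) => k kP j; apply: kP; rewrite mem_enum.
elim: l => [|j l IH]; first exact: evW.
apply: evS (evI (eP j) IH) => k [kj kl] i.
by rewrite inE => /orP[/eqP->|/kl].
Qed.

Definition evlim (r : T -> R) (c : R) := forall e : R, 0 < e -> ev (fun k => `|r k - c| < e).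

(** The limit is the supremum of the eventual lower bounds: the ultrafilter decides on which side of
    each threshold the values lie, so no subsequence has to be extracted. *)
Lemma ev_bounded_lim (r : T -> R) (M : R) : ev (fun k => `|r k| <= M) -> exists c, evlim r c.
Proof.
move=> rM; pose S := [set x : R | ev (fun k => x <= r k)].
have SM : S (- M) by apply: evS rM => k; rewrite ler_norml => /andP[].
have Sub : ubound S M.
  move=> x /(evI rM)/ev_ex[k [kM]]; move/le_trans; apply.
  by apply: le_trans kM; exact: ler_norm.
have hS : has_sup S by split; [exists (- M)|exists M].
exists (sup S) => e e0.
have /ev_not h1 : ~ ev (fun k => sup S + e / 2 <= r k).
  move=> h; have : sup S + e / 2 <= sup S by apply: ub_le_sup h; exists M.
  by move: e0; clear; lra.
have e2 : 0 < e / 2 by rewrite divr_gt0.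
have [x Sx xe] := sup_adherent e2 hS.
have {}Sx : ev (fun k => x <= r k) by [].
apply: evS (evI h1 Sx) => k [/negP]; rewrite -ltNge ltr_norml.
by move: xe e0; move: (sup S) => c; clear; move=> *; apply/andP; split; lra.
Qed.

Definition infml X := forall i, evlim (fun k => X k i) 0.

Lemma infmlP X i (e : R) : infml X -> 0 < e -> ev (fun k => `|X k i| < e).
Proof. by move=> iX e0; apply: evS (iX i e e0) => k; rewrite subr0. Qed.

Lemma ev_near X (P : (I -> R) -> Prop) : infml X -> nearpt o P -> ev (fun k => P (X k)).
Proof.
move=> iX [e e0 eP]; apply: evS (ev_all (fun i => iX i e e0)) => k Xk.
exact: eP.
Qed.

Definition at_phi phi (y : I -> R) : I -> R := fun i => phi i y.

(** The sequence X is lifted to a sequence Y, again tending to the origin, with X = phi(Y) almost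
    everywhere. A blow-up thus becomes a single analytic substitution. The coordinates outside A are
    left unchanged. *)
Definition chart A X phi Y :=
  [/\ forall i, ana (phi i) o /\ phi i o = 0, forall i, i \in A -> dep A (phi i),
      forall i, i \notin A -> phi i = (fun y => y i), infml Y &
      ev (fun k => X k = at_phi phi (Y k))].

Lemma at_phi0 phi : (forall i, phi i o = 0) -> at_phi phi o = o.
Proof. by move=> p0; apply/funext => i; exact: p0. Qed.

Lemma ana_pull phi f : (forall i, ana (phi i) o /\ phi i o = 0) -> ana f o ->
  ana (fun y => f (at_phi phi y)) o.
Proof.
move=> pa fa; apply: (@ana_comp _ _ _ f (fun i y => phi i y)); last by move=> i; exact: (pa i).1.
by rewrite (_ : (fun j => _) = o) //; apply/funext => i; rewrite (pa i).2.
Qed.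

Lemma near_pull phi (P : (I -> R) -> Prop) : (forall i, ana (phi i) o /\ phi i o = 0) ->
  nearpt o P -> nearpt o (fun y => P (at_phi phi y)).
Proof.
move=> pa [e e0 eP].
have /nearpt_all : forall i, nearpt o (fun y => `|phi i y - 0| < e).
  by move=> i; have := ana_cont (pa i).1 e0; rewrite (pa i).2.
by apply: nearptS => y; exact: eP.
Qed.

Lemma chart_ana A X phi Y : chart A X phi Y -> forall i, ana (phi i) o /\ phi i o = 0.
Proof. by case. Qed.

Lemma chart_infml A X phi Y : chart A X phi Y -> infml Y.
Proof. by case. Qed.

Lemma chart_dep A X phi Y f : chart A X phi Y -> dep A f -> dep A (fun y => f (at_phi phi y)).
Proof.
by move=> [_ pA _ _ _] fA x y xy; apply: fA => i iA; exact: pA.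
Qed.

Lemma chart_sub A B X phi Y : A \subset B -> chart A X phi Y -> chart B X phi Y.
Proof.
move=> AB [pa pA pn Yi XY]; split=> // i.
  move=> iB; have [/pA|/pn ->] := boolP (i \in A); first exact: dep_sub.
  by move=> x y; apply.
by move=> iB; apply: pn; apply: contra iB; exact: (fintype.subsetP AB).
Qed.

Lemma chart_comp A X Y Z phi psi : chart A X phi Y -> chart A Y psi Z ->
  chart A X (fun i z => phi i (at_phi psi z)) Z.
Proof.
move=> cXY cYZ; have [pa pA pn Yi XY] := cXY; have [qa qA qn Zi YZ] := cYZ; split=> //.
- move=> i; split; first exact: (ana_pull qa (pa i).1).
  by rewrite at_phi0 ?(pa i).2 // => k; exact: (qa k).2.
- by move=> i iA; apply: (chart_dep cYZ); exact: pA.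
- by move=> i iA; rewrite (pn _ iA) /at_phi; apply/funext => z; rewrite (qn _ iA).
- by apply: evS (evI XY YZ) => k [-> ->].
Qed.

Lemma chart_id A X : infml X -> chart A X (fun i y => y i) X.
Proof.
move=> Xi; split=> //; last exact: evW.
  by move=> i; split=> //; exact: ana_var.
by move=> i iA x y; apply.
Qed.

Definition subst j g : I -> (I -> R) -> R := fun i y => if i == j then g y else y i.

Lemma subst_eq j g y : subst j g j y = g y.
Proof. by rewrite /subst eqxx. Qed.

Lemma subst_neq j g y i : i != j -> subst j g i y = y i.
Proof. by rewrite /subst => /negPf ->. Qed.

Lemma infml_upd X j (r : T -> R) : infml X -> evlim r 0 -> infml (fun k => upd (X k) j (r k)).
Proof.
move=> Xi r0 i; have [->|ij] := eqVneq i j.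
  by move=> e e0; apply: evS (r0 e e0) => k; rewrite upd_eq.
by move=> e e0; apply: evS (Xi i e e0) => k; rewrite /upd (negPf ij).
Qed.

Lemma chart_subst A X j g (r : T -> R) : j \in A -> ana g o -> g o = 0 -> dep A g ->
  infml X -> evlim r 0 -> ev (fun k => X k j = g (upd (X k) j (r k))) ->
  chart A X (subst j g) (fun k => upd (X k) j (r k)).
Proof.
move=> jA ga g0 gA Xi r0 XE; split.
- move=> i; rewrite /subst; case: (i == j); first by split.
  by split=> //; exact: ana_var.
- move=> i iA; rewrite /subst; case: (i == j) => // x y; exact.
- by move=> i iA; rewrite /subst; case: eqP => // ij; rewrite ij jA in iA.
- exact: infml_upd.
- apply: evS XE => k XkE; apply/funext => i; rewrite /at_phi.
  have [->|ij] := eqVneq i j; first by rewrite subst_eq -XkE.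
  by rewrite subst_neq // /upd (negPf ij).
Qed.

Lemma chart_lim f X : ana f o -> infml X -> evlim (fun k => f (X k)) (f o).
Proof. by move=> fa Xi e e0; exact: (ev_near Xi (ana_cont fa e0)). Qed.

Lemma evlim_le r c (M : R) : evlim r c -> (forall e : R, 0 < e -> ev (fun k => `|r k| <= M + e)) -> `|c| <= M.
Proof.
move=> rc rM; apply/ler_addgt0Pr => e e0; have e2 : 0 < e / 2 by rewrite divr_gt0.
have [k [h1 h2]] := ev_ex (evI (rc _ e2) (rM _ e2)).
rewrite -(subrK (r k) c) (le_trans (ler_normD _ _)) // distrC.
by move: h1 h2; clear; lra.
Qed.

Lemma mono_split ga k (y : I -> R) : ga k != 0%N ->
  mono ga y = y k * mono (fun i => (ga i - (i == k))%N) y.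
Proof.
move=> gk; rewrite (@mono_le _ _ ga (fun i => (i == k)%N)) ?mono1 // => i.
by case: eqP => // ->; rewrite lt0n.
Qed.

(* Blowing up along the hyperpoint, guided by the ultrafilter, until x_j
   divides the monomial that it dominates. *)
Lemma toric_step A j ga X : j \in A -> (forall i, i \notin A -> ga i = 0%N) -> ga j = 0%N ->
  infml X -> ev (fun k => X k j != 0) ->
  (forall e : R, 0 < e -> ev (fun k => `|mono ga (X k)| <= e * `|X k j|)) ->
  exists phi Y, [/\ chart A X phi Y, forall i, i \in A -> ismono A (phi i) &
    exists rho, [/\ ana rho o, rho o = 0, dep A rho &
      nearpt o (fun y => mono ga (at_phi phi y) = phi j y * rho y)]].
Proof.
move=> jA; have [n] := ubnP (\sum_i ga i)%N; elim: n ga X => // n IH ga X gan gaA gj Xi Xj0 Xg.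
have [ga0|/existsNP[k /eqP gk]] := pselect (forall i, ga i = 0%N).
  (* For the constant monomial 1 the domination hypothesis would contradict x_j -> 0. *)
  have [k [h1 h2]] := ev_ex (evI (Xg 1 ltr01) (infmlP j Xi ltr01)).
  move: h1; rewrite /mono big1; last by move=> i _; rewrite ga0 expr0.
  by rewrite normr1 mul1r leNgt h2.
have kA : k \in A by apply: contraNT gk => /gaA ->.
have kj : k != j by apply: contraNneq gk => ->; rewrite gj.
pose ga' i := (ga i - (i == k))%N.
have ga'n : (\sum_i ga' i < n)%N.
  rewrite -ltnS; apply: leq_trans gan; rewrite ltnS.
  rewrite [ltnRHS](bigD1 k) //= (bigD1 k) //= /ga' eqxx subn1.
  apply: (@leq_trans ((ga k).-1.+1 + \sum_(i | i != k) ga' i)) => //.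
  by rewrite prednK ?lt0n // leq_add2l leq_sum // => i _; rewrite leq_subr.
have ga'A i : i \notin A -> ga' i = 0%N by rewrite /ga' => /gaA ->.
have ga'j : ga' j = 0%N by rewrite /ga' gj.
(* Either x_k = O(x_j), and the substitution x_k = x_j * (c + y_k) makes x_j a factor at once; or
   x_j = o(x_k), and x_j = x_k * y_j removes one power of x_k from the monomial. *)
have [[M XM]|nM] := pselect (exists M : R, ev (fun m => `|X m k| <= M * `|X m j|)).
  have [c rc] : exists c, evlim (fun m => X m k / X m j) c.
    apply: (@ev_bounded_lim _ M); apply: evS (evI XM Xj0) => m [mM m0].
    by rewrite normrM normfV ler_pdivrMr // normr_gt0.
  pose g (y : I -> R) := y j * (c + y k).
  have ga_ : ana g o.
    apply: ana_mul; first exact: ana_var.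
    by apply: ana_add; [exact: ana_cst|exact: ana_var].
  have r0 : evlim (fun m => X m k / X m j - c) 0.
    by move=> e e0; apply: evS (rc e e0) => m; rewrite subr0.
  have ch : chart A X (subst k g) (fun m => upd (X m) k (X m k / X m j - c)).
    apply: chart_subst => //; first by rewrite /g mul0r.
      by move=> x y xy; rewrite /g !xy.
    apply: evS Xj0 => m m0; rewrite /g upd_eq /upd eq_sym (negPf kj).
    by rewrite addrC subrK mulrC divfK.
  pose rho y := (c + y k) * mono ga' (at_phi (subst k g) y).
  have pa := chart_ana ch.
  have rhoa : ana rho o.
    apply: ana_mul; first by apply: ana_add; [exact: ana_cst|exact: ana_var].
    by apply: (ana_pull pa); exact: ana_mono.
  have rhoE y : mono ga (at_phi (subst k g) y) = subst k g j y * rho y.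
    rewrite (mono_split _ gk) {1}/at_phi subst_eq subst_neq 1?eq_sym //.
    by rewrite /g /rho mulrA.
  exists (subst k g), (fun m => upd (X m) k (X m k / X m j - c)); split=> //.
    move=> i iA; rewrite /subst; case: (i == k); last exact: ismono_var.
    apply: (@ismono_mul _ _ _ (fun y => y j) (fun y => c + y k)); first exact: ismono_var.
    have [c0|c0] := eqVneq c 0.
      by apply: (ismono_ext _ (ismono_var R kA)); apply: nearptW => y; rewrite c0 add0r.
    apply: ismono_unit; first by move=> x y xy; rewrite xy.
      by apply: ana_add; [exact: ana_cst|exact: ana_var].
    by rewrite addr0.
  exists rho; split=> //; last 2 first.
  - move=> x y xy; rewrite /rho xy //; congr (_ * _).
    by apply: (chart_dep ch) => //; exact: dep_mono.
  - exact: nearptW.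
  apply/eqP; rewrite -normr_eq0 eq_le normr_ge0 andbT.
  apply: evlim_le (chart_lim rhoa (chart_infml ch)) _ => e e0.
  have [_ _ _ _ XE] := ch.
  apply: evS (evI (evI XE Xj0) (Xg e e0)) => m [[mE m0]].
  rewrite {1}mE rhoE normrM subst_neq 1?eq_sym //.
  rewrite {1}/upd eq_sym (negPf kj) mulrC ler_pM2r ?normr_gt0 // add0r //.
have big (M : R) : ev (fun m => M * `|X m j| < `|X m k|).
  have /ev_not : ~ ev (fun m => `|X m k| <= M * `|X m j|) by move=> h; apply: nM; exists M.
  by apply: evS => m /negP; rewrite -ltNge.
have Xk0 : ev (fun m => X m k != 0).
  by apply: evS (big 0) => m; rewrite mul0r normr_gt0.
have r0 : evlim (fun m => X m j / X m k) 0.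
  move=> e e0; apply: evS (evI (big e^-1) Xk0) => m [mb m0].
  rewrite subr0 normrM normfV ltr_pdivrMr ?normr_gt0 //.
  by rewrite mulrC ltr_pdivrMr // mulrC in mb.
pose g (y : I -> R) := y k * y j.
have ch : chart A X (subst j g) (fun m => upd (X m) j (X m j / X m k)).
  apply: chart_subst => //.
  - by apply: ana_mul; exact: ana_var.
  - by rewrite /g mul0r.
  - by move=> x y xy; rewrite /g !xy.
  - by apply: evS Xk0 => m m0; rewrite /g upd_eq /upd (negPf kj) mulrC divfK.
have monoj (y : I -> R) t : mono ga' (upd y j t) = mono ga' y.
  apply: (@dep_mono _ _ (~: [set j])) => i; rewrite !inE ?negbK.
    by move=> /eqP ->.
  by rewrite /upd => /negPf ->.
have [||psi [Z [ch' pm [rho [rhoa rho0 rhoA rhoE]]]]] :=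
    IH ga' (fun m => upd (X m) j (X m j / X m k)) ga'n ga'A ga'j (chart_infml ch).
- by apply: evS (evI Xj0 Xk0) => m [mj mk]; rewrite upd_eq mulf_neq0 // invr_neq0.
- move=> e e0; apply: evS (evI (Xg e e0) Xk0) => m [+ mk].
  rewrite monoj upd_eq (mono_split _ gk) -/ga' !normrM normfV mulrA.
  by rewrite ler_pdivlMr ?normr_gt0 // mulrC.
exists (fun i z => subst j g i (at_phi psi z)), Z; split.
- exact: chart_comp ch ch'.
- move=> i iA; rewrite /subst; case: (i == j); last exact: pm.
  by apply: ismono_mul; exact: pm.
- exists rho; split=> //; apply: nearptS rhoE => z zE.
  rewrite (mono_split _ gk) -/ga' subst_eq {1}/at_phi subst_neq //.
  rewrite /g -mulrA; congr (_ * _); rewrite -zE.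
  by rewrite -(monoj (at_phi psi z) (g (at_phi psi z))); congr mono.
Qed.

End charts.

(** * Order of vanishing in one coordinate *)

Section regularity.
Variable R : realType.

Lemma near_comp (I J : finType) (q : J -> (I -> R) -> R) a (P : (J -> R) -> Prop) :
  (forall j, ana (q j) a) -> nearpt (fun j => q j a) P -> nearpt a (fun x => P (fun j => q j x)).
Proof.
move=> qa [e e0 eP].
have /nearpt_all : forall j, nearpt a (fun x => `|q j x - q j a| < e).
  by move=> j; exact: ana_cont.
by apply: nearptS => x; exact: eP.
Qed.

Variable I : finType.
Implicit Types (A B : {set I}) (f g u : (I -> R) -> R).

Local Notation o := (fun=> 0 : R).

Section distinguished_coordinate.
Variables (B : {set I}) (j : I).
Hypothesis jB : j \notin B.
Let A := j |: B.

Let jA : j \in A. Proof. by rewrite setU11. Qed.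
Let BA : B \subset A. Proof. exact: finset.subsetUr. Qed.

Lemma dep_upd f x t : dep B f -> f (upd x j t) = f x.
Proof.
move=> fB; apply: fB => i iB; rewrite /upd; case: eqP => // ij.
by rewrite ij (negPf jB) in iB.
Qed.

Lemma ana_expand f D : ana f o -> dep A f -> exists c e,
  [/\ forall i : nat, ana (c i) o /\ dep B (c i), ana e o, dep A e &
  nearpt o (fun x => f x = \sum_(0 <= i < D) c i x * x j ^+ i + x j ^+ D * e x)].
Proof.
move=> fa fA; elim: D => [|D [c [e [cP ea eA fE]]]].
  exists (fun _ _ => 0), f; split=> //.
    by move=> i; split=> //; exact: ana_cst.
  by apply: nearptW => x; rewrite big_geq // add0r expr0 mul1r.
have [g [ga gA eE]] := ana_div_dep jA ea eA.
exists (fun i => if i == D then (fun x => e (proj B x)) else c i), g; split=> //.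
  move=> i; case: eqP => // _; split; [exact: ana_proj|exact: proj_dep].
apply: nearptS (nearptI fE eE) => x [-> ->].
rewrite big_nat_recr //= eqxx.
rewrite (_ : e (upd x j 0) = e (proj B x)); last first.
  apply: eA => i; rewrite !inE /upd /proj; case: eqP => [-> _|_ /= ->//].
  by rewrite (negPf jB).
rewrite [X in _ = X + _ + _](_ : _ = \sum_(0 <= i < D) c i x * x j ^+ i); last first.
  by apply: eq_big_nat => i /andP[_ iD]; rewrite ltn_eqF.
by rewrite exprSr; ring.
Qed.

(** A substitute for Weierstrass preparation: the lower coefficients depend on B only and vanish at
    the origin, while the unit e may still depend on x_j. *)
Definition reg d f := exists c e,
  [/\ forall i : nat, [/\ ana (c i) o, dep B (c i) & (i < d)%N -> c i o = 0], ana e o,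
   dep A e, e o != 0 &
   nearpt o (fun x => f x = \sum_(0 <= i < d) c i x * x j ^+ i + x j ^+ d * e x)].

(** The order is the least index whose Taylor coefficient is nonzero at the origin; if there is none
    below D, then f is O(x_j^D) on the x_j-axis. *)
Lemma reg_or D f : ana f o -> dep A f ->
  (exists2 d, (d < D)%N & reg d f) \/
  exists c e, [/\ forall i : nat, [/\ ana (c i) o, dep B (c i) & (i < D)%N -> c i o = 0],
    ana e o, dep A e &
    nearpt o (fun x => f x = \sum_(0 <= i < D) c i x * x j ^+ i + x j ^+ D * e x)].
Proof.
move=> fa fA; have [c [e [cP ea eA fE]]] := ana_expand D fa fA.
have [ex|nex] := pselect (exists d, (d < D)%N && (c d o != 0)); last first.
  right; exists c, e; split=> // i; have [ca cB] := cP i; split=> // iD.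
  by apply: contrapT => /eqP ci; apply: nex; exists i; rewrite iD.
left; case: (ex_minnP ex) => d /andP[dD cd dmin]; exists d => //.
exists c, (fun x => \sum_(d <= i < D) c i x * x j ^+ (i - d) + x j ^+ (D - d) * e x).
split.
- move=> i; have [ca cB] := cP i; split=> // id; apply: contrapT => /eqP ci.
  have := dmin i; rewrite (ltn_trans id dD) ci => /(_ isT).
  by rewrite leqNgt id.
- apply: ana_add.
    apply: ana_sum => i _; apply: ana_mul; first exact: (cP i).1.
    by apply: ana_exp; exact: ana_var.
  by apply: ana_mul => //; apply: ana_exp; exact: ana_var.
- move=> x y xy; rewrite (eA x y xy) (xy j jA); congr (_ + _).
  apply: eq_bigr => i _; congr (_ * _); apply: (cP i).2 => k kB.
  by apply: xy; exact: (fintype.subsetP BA).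
- rewrite [X in X + _](_ : _ = c d o); last first.
    rewrite big_ltn // subnn expr0 mulr1 big_nat big1 ?addr0 // => i /andP[di _].
    by rewrite expr0n subn_eq0 leqNgt di mulr0.
  by rewrite expr0n subn_eq0 leqNgt dD mul0r addr0.
- apply: nearptS fE => x ->; rewrite (big_cat_nat (leq0n d) (ltnW dD)) /= -addrA.
  congr (_ + _); rewrite mulrDr mulrA -exprD subnKC ?(ltnW dD) //; congr (_ + _).
  rewrite mulr_sumr; apply: eq_big_nat => i /andP[di _].
  by rewrite mulrCA -exprD subnKC.
Qed.

End distinguished_coordinate.
End regularity.

(** * The Tschirnhaus translation *)

Section tschirnhaus.
Variables (R : realType) (I : finType) (B : {set I}) (j : I).
Hypothesis jB : j \notin B.
Implicit Types (f g u : (I -> R) -> R).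
Local Notation o := (fun=> 0 : R).
Let A := j |: B.

Let jA : j \in A. Proof. by rewrite setU11. Qed.
Let BA : B \subset A. Proof. exact: finset.subsetUr. Qed.

Definition anapoly (P : (I -> R) -> {poly R}) :=
  (exists n, forall x, (size (P x) <= n)%N) /\ forall i, ana (fun x => (P x)`_i) o.

Lemma anapoly_C f : ana f o -> anapoly (fun x => (f x)%:P).
Proof.
move=> fa; split; first by exists 1%N => x; exact: size_polyC_leq1.
by move=> i; under eq_fun do rewrite coefC; case: (i == 0%N) => //; exact: ana_cst.
Qed.

Lemma anapoly_X : anapoly (fun=> 'X).
Proof. by split; [exists 2%N => x; rewrite size_polyX|move=> i; exact: ana_cst]. Qed.

Lemma anapoly_add P Q : anapoly P -> anapoly Q -> anapoly (fun x => P x + Q x).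
Proof.
move=> [[n Pn] Pa] [[m Qm] Qa]; split.
  exists (maxn n m) => x; apply: leq_trans (size_polyD _ _) _.
  by rewrite geq_max !leq_max Pn Qm orbT.
by move=> i; under eq_fun do rewrite coefD; exact: ana_add.
Qed.

Lemma anapoly_mul P Q : anapoly P -> anapoly Q -> anapoly (fun x => P x * Q x).
Proof.
move=> [[n Pn] Pa] [[m Qm] Qa]; split.
  exists (n + m)%N => x; apply: leq_trans (size_polyMleq _ _) _.
  by apply: leq_trans (leq_pred _) _; exact: leq_add.
move=> i; under eq_fun do rewrite coefM.
by apply: ana_sum => k _; exact: ana_mul.
Qed.

Lemma anapoly_exp P n : anapoly P -> anapoly (fun x => P x ^+ n).
Proof.
move=> Pa; elim: n => [|n IH]; last by under eq_fun do rewrite exprS; exact: anapoly_mul.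
by under eq_fun do rewrite expr0; exact: (anapoly_C (ana_cst 1 o)).
Qed.

Lemma anapoly_sum n m (P : nat -> (I -> R) -> {poly R}) : (forall i, anapoly (P i)) ->
  anapoly (fun x => \sum_(n <= i < m) P i x).
Proof.
move=> Pa; elim: (index_iota n m) => [|i l IH].
  by under eq_fun do rewrite big_nil; exact: (anapoly_C (ana_cst 0 o)).
by under eq_fun do rewrite big_cons; exact: anapoly_add.
Qed.

Lemma coef_XaddC_exp (c : R) d i : (('X + c%:P) ^+ d)`_i = c ^+ (d - i) *+ 'C(d, i).
Proof.
rewrite exprDn_comm; last exact: mulrC.
rewrite coef_sum.
have E (k : 'I_d.+1) : ('X ^+ (d - k) * c%:P ^+ k *+ 'C(d, k))`_i =
    if (i == d - k)%N then c ^+ k *+ 'C(d, k) else 0.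
  rewrite coefMn -rmorphXn /= coefMC coefXn.
  by case: eqP => _; rewrite ?mul1r ?mul0r ?mul0rn.
under eq_bigr do rewrite E.
have [id|id] := leqP i d; last first.
  rewrite bin_small // mulr0n big1 // => k _; case: eqP => // ik.
  by move: id; rewrite ik ltnNge leq_subr.
have dl : (d - i < d.+1)%N by rewrite ltnS leq_subr.
rewrite (bigD1 (Ordinal dl)) //= subKn // eqxx bin_sub // big1 ?addr0 // => k ki.
case: eqP => // ik; case/eqP: ki; apply: val_inj => /=.
by rewrite ik subKn // -ltnS.
Qed.

Lemma tschirnhaus d f : (0 < d)%N -> ana f o -> dep A f -> reg B j d f ->
  exists g c e, [/\ [/\ ana g o, g o = 0 & dep B g],
    forall i : nat, [/\ ana (c i) o, dep B (c i) & (i < d)%N -> c i o = 0],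
    nearpt o (fun x => c d.-1 x = 0), [/\ ana e o, dep A e & e o != 0] &
    nearpt o (fun x => f (upd x j (x j + g x)) =
      \sum_(0 <= i < d) c i x * x j ^+ i + x j ^+ d * e x)].
Proof.
move=> d0 fa fA [c [e [cP ea eA e0 fE]]].
(* The additional variable [None] holds a displacement z of x_j; [et] is e at the displaced point,
   and it is expanded in powers of z with coefficients [E]. *)
pose opt (x : I -> R) (z : R) : option I -> R := fun k => if k is Some i then x i else z.
pose et (w : option I -> R) : R := e (upd (fun i => w (Some i)) j (w (Some j) + w None)).
pose Bo : {set option I} := Some @: A.
have NB : None \notin Bo by apply/imsetP => -[].
have eta : ana et o.
  apply: (@ana_comp _ _ _ e (fun i w => upd (fun i => w (Some i)) j (w (Some j) + w None) i)).
    rewrite (_ : (fun i => _) = o) //; apply/funext => i; rewrite /upd.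
    by case: eqP => // _; rewrite addr0.
  move=> i; rewrite /upd; case: (i == j); last exact: ana_var.
  by apply: ana_add; exact: ana_var.
have SB i : i \in A -> Some i \in None |: Bo.
  by move=> iA; rewrite setU1r //; apply: imset_f.
have etA : dep (None |: Bo) et.
  move=> x y xy; apply: eA => i iA; rewrite /upd.
  by case: eqP => _; rewrite ?(xy (Some j)) ?(xy (Some i)) ?(xy None) ?setU11 ?SB.
have [E [E' [EP E'a E'A etE]]] := ana_expand NB d eta etA.
have optd i x z z' : E i (opt x z) = E i (opt x z').
  by apply: (EP i).2 => -[k|] // h; rewrite (negPf NB) in h.
pose Ek i (x : I -> R) := E i (opt x 0).
have Ea i : ana (Ek i) o.
  apply: (@ana_comp _ _ _ (E i) (fun k x => opt x 0 k)).
    by rewrite (_ : (fun k => _) = o); [exact: (EP i).1|apply/funext => -[]].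
  by case=> [k|]; [exact: ana_var|exact: ana_cst].
have EA i : dep A (Ek i).
  by move=> x y xy; apply: (EP i).2 => _ /imsetP[k kA ->] /=; exact: xy.
(* Up to the term (x_j + z)^d * z^d * E', the value of P x at z is f at x with x_j replaced by x_j +
   z; the coefficients [C] of P x are analytic in x. *)
pose P (x : I -> R) : {poly R} := \sum_(0 <= i < d) (c i x)%:P * ('X + (x j)%:P) ^+ i
  + ('X + (x j)%:P) ^+ d * \sum_(0 <= k < d) (Ek k x)%:P * 'X ^+ k.
have Pa : anapoly P.
  have Xa : anapoly (fun x => 'X + (x j)%:P).
    by apply: anapoly_add; [exact: anapoly_X|apply: anapoly_C; exact: ana_var].
  apply: anapoly_add.
    apply: anapoly_sum => i; apply: anapoly_mul; last exact: anapoly_exp.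
    by apply: anapoly_C; have [] := cP i.
  apply: anapoly_mul; first exact: anapoly_exp.
  apply: anapoly_sum => i; apply: anapoly_mul; first exact: anapoly_C.
  by apply: anapoly_exp; exact: anapoly_X.
have PA x y : (forall i, i \in A -> x i = y i) -> P x = P y.
  move=> xy; rewrite /P (xy j jA); congr (_ + _ * _); apply: eq_bigr => i _.
    have [_ cB _] := cP i; rewrite (cB x y) // => k kB; apply: xy.
    exact: (fintype.subsetP BA).
  by rewrite (EA i x y).
have [[n0 Pn0] Pca] := Pa; pose n := maxn n0 d.
have dn : (d <= n)%N by rewrite leq_maxr.
have Pn x : (size (P x) <= n)%N by apply: leq_trans (Pn0 x) _; rewrite leq_maxl.
pose C i x := (P x)`_i.
have CA i : dep A (C i) by move=> x y xy; rewrite /C (PA x y).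
have CE t i : C i (upd o j t) = \sum_(l < i.+1) (t ^+ (d - l) *+ 'C(d, l)) *
    (if (i - l < d)%N then Ek (i - l)%N (upd o j t) else 0).
  rewrite /C /P big_nat big1 ?add0r; last first.
    move=> k /andP[_ kd]; have [_ cB c0] := cP k.
    by rewrite (dep_upd jB) // c0 // mul0r.
  rewrite upd_eq coefM; apply: eq_bigr => l _; rewrite coef_XaddC_exp; congr (_ * _).
  rewrite (_ : \sum_(0 <= k < d) _ = \poly_(k < d) Ek k (upd o j t)); last first.
    by rewrite poly_def big_mkord; apply: eq_bigr => k _; rewrite mul_polyC.
  by rewrite coef_poly.
have uo : upd o j 0 = o by apply/funext => k; rewrite /upd; case: eqP.
have E0e : nearpt o (fun x => Ek 0%N x = e x).
  have : nearpt o (fun x => et (opt x 0) = Ek 0%N x).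
    have oa k : ana (fun x : I -> R => opt x 0 k) o.
      by case: k => [k|]; [exact: ana_var|exact: ana_cst].
    have e1 : nearpt (fun k => opt o 0 k) (fun w => et w = \sum_(0 <= i < d) E i w * w None ^+ i + w None ^+ d * E' w).
      by rewrite (_ : (fun k => _) = o) //; apply/funext => -[].
    apply: nearptS (near_comp oa e1) => x ->.
    rewrite big_ltn // expr0 mulr1 big_nat big1 => [|i /andP[i0 _]].
      by rewrite addr0 expr0n gtn_eqF // mul0r addr0.
    by rewrite expr0n gtn_eqF // mulr0.
  apply: nearptS => x <-; rewrite /et /= addr0; congr e.
  exact: upd_id.
have E0o : Ek 0%N o = e o by exact: nearpt_self E0e.
have C0 i : (i < d)%N -> C i o = 0.
  move=> id; rewrite -uo CE big1 // => l _.
  have ld : (l < d)%N by exact: leq_trans (ltn_ord l) id.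
  by rewrite expr0n subn_eq0 leqNgt ld mul0rn mul0r.
have Cd : C d o = e o.
  rewrite -uo CE big_ord_recr /= subnn expr0 binn mulr1n mul1r d0 uo E0o big1 ?add0r //.
  by move=> l _; rewrite expr0n subn_eq0 leqNgt ltn_ord mul0rn mul0r.
(* On the x_j-axis the coefficient of degree d - 1 is t * h, so h(0) = d * e(0) is its
   derivative. *)
pose h (x : I -> R) := \sum_(l < d) (x j ^+ (d.-1 - l) *+ 'C(d, l)) * Ek (d.-1 - l)%N x.
have ha : ana h o.
  apply: ana_sum => l _; apply: ana_mul; last exact: Ea.
  under eq_fun do rewrite -mulr_natr.
  by apply: ana_mul; [apply: ana_exp; exact: ana_var|exact: ana_cst].
have Ch t : C d.-1 (upd o j t) = t * h (upd o j t).
  rewrite CE prednK // /h mulr_sumr; apply: eq_bigr => l _.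
  have -> : (d.-1 - l < d)%N by rewrite (leq_ltn_trans (leq_subr _ _)) // prednK.
  rewrite upd_eq mulrA mulrnAr -exprS; congr (_ ^+ _ *+ _ * _).
  by rewrite -subSn ?prednK // -ltnS prednK.
have ho : h o = d%:R * e o.
  rewrite /h -(prednK d0) big_ord_recr /= subnn expr0 binSn big1.
    by rewrite add0r E0o.
  move=> l _; rewrite expr0n subn_eq0 leqNgt ltn_ord mul0rn mul0r //.
have ho0 : h o != 0 by rewrite ho mulf_neq0 // pnatr_eq0 -lt0n.
pose F (_ : unit) (w : (I + unit)%type -> R) : R :=
  C d.-1 (upd (fun i => w (inl i)) j (w (inr tt))).
have Fupd (x : I -> R) (y : unit -> R) : F tt (join x y) = C d.-1 (upd x j (y tt)) by [].
have [||||eps eps0|g0 [g0a g0o g0E _]] := @ana_ift R I unit F o o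
    (fun _ _ => h o) (fun _ _ => (h o)^-1).
- move=> ?; apply: (@ana_comp _ _ _ (C d.-1) (fun i (w : (I + unit)%type -> R) => upd (fun i => w (inl i)) j (w (inr tt)) i)).
    by rewrite (_ : (fun i => _) = o) //=; exact: Pca.
  by move=> i; rewrite /upd; case: (i == j); exact: ana_var.
- by case; rewrite Fupd uo C0 // prednK.
- by move=> [] []; rewrite sum_unit mulVf // eqxx.
- by move=> [] []; rewrite sum_unit divff // eqxx.
- have [del del0 delP] := ana_cont ha eps0.
  exists del => // z t t0 td /(_ tt) zt [].
  rewrite Fupd sum_unit add0r Ch mulrC -mulrBl normrM ler_pM //.
  apply: ltW; apply: delP => i; rewrite subr0 /upd; case: eqP => _.
    exact: le_lt_trans zt td.
  by rewrite normr0; exact: le_lt_trans t0 td.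
pose g x := g0 tt (proj B x).
have ga : ana g o by exact: ana_proj.
have go : g o = 0 by rewrite /g proj0 g0o.
have gB : dep B g by exact: proj_dep.
have CgB x y i : (forall k, k \in B -> x k = y k) -> C i (upd x j (g x)) = C i (upd y j (g y)).
  move=> xy; apply: CA => k; rewrite !inE /upd (gB x y xy).
  by case: eqP => //= _ /xy.
have Cg : nearpt o (fun x => C d.-1 (upd x j (g x)) = 0).
  apply: nearptS (near_proj B g0E) => x /(_ tt); rewrite Fupd => <-.
  apply: CA => k; rewrite !inE /upd /proj; case: eqP => //= _ ->.
  by [].
have sa i : ana (fun x => upd x j (g x) i) o.
  by rewrite /upd; case: (i == j) => //; exact: ana_var.
have so : (fun i => upd o j (g o) i) = o by rewrite go; exact: uo.
have c'a i : ana (fun x => C i (upd x j (g x))) o.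
  by apply: (@ana_comp _ _ _ (C i) (fun k x => upd x j (g x) k)) => //; rewrite so; exact: Pca.
pose e' x := \sum_(d <= i < n) C i (upd x j (g x)) * x j ^+ (i - d)
  + (g x + x j) ^+ d * E' (opt (upd x j (g x)) (x j)).
have oa k : ana (fun x : I -> R => opt (upd x j (g x)) (x j) k) o.
  by case: k => [k|]; [exact: sa|exact: ana_var].
have uo' : (fun k => opt (upd o j (g o)) 0 k) = o.
  by apply/funext => -[i|] //=; exact: (congr1 (fun q : I -> R => q i) so).
have e'a : ana e' o.
  apply: ana_add.
    apply: ana_sum => i _; apply: ana_mul => //.
    by apply: ana_exp; exact: ana_var.
  apply: ana_mul.
    by apply: ana_exp; apply: ana_add => //; exact: ana_var.
  by apply: (@ana_comp _ _ _ E' (fun k x => opt (upd x j (g x)) (x j) k)) => //; rewrite uo'.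
have fE' : nearpt o (fun x => f (upd x j (x j + g x)) =
      \sum_(0 <= i < d) C i (upd x j (g x)) * x j ^+ i + x j ^+ d * e' x).
  have h1 : nearpt (fun k => opt (upd o j (g o)) 0 k) (fun w => et w = \sum_(0 <= i < d) E i w * w None ^+ i + w None ^+ d * E' w).
    by rewrite uo'.
  have qa i : ana (fun x => upd x j (x j + g x) i) o.
    rewrite /upd; case: (i == j); last exact: ana_var.
    by apply: ana_add => //; exact: ana_var.
  have h2 : nearpt (fun i => upd o j (0 + g o) i) (fun x => f x = \sum_(0 <= i < d) c i x * x j ^+ i + x j ^+ d * e x).
    by rewrite add0r so.
  apply: nearptS (nearptI (near_comp qa h2) (near_comp oa h1)) => x [-> /=].
  set y := upd x j (g x); set z := x j => etx.
  have -> : (fun i => upd x j (z + g x) i) = upd y j (y j + z).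
    by rewrite /y upd_upd upd_eq addrC.
  have {}etx : e (upd y j (y j + z)) = \sum_(0 <= i < d) Ek i y * z ^+ i + z ^+ d * E' (opt y z).
    apply: etrans (etx : e (upd y j (y j + z)) = _) _; congr (_ + _).
    by apply: eq_bigr => i _; rewrite /Ek -(optd i y z 0).
  have zy : z + g x = y j + z by rewrite /y upd_eq addrC.
  rewrite etx upd_eq zy.
  have -> : \sum_(0 <= i < d) c i (upd y j (y j + z)) * (y j + z) ^+ i +
     (y j + z) ^+ d * (\sum_(0 <= i < d) Ek i y * z ^+ i + z ^+ d * E' (opt y z)) =
     (P y).[z] + (y j + z) ^+ d * (z ^+ d * E' (opt y z)).
    rewrite mulrDr addrA; congr (_ + _); rewrite /P hornerD hornerM horner_exp hornerD hornerX hornerC.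
    rewrite !horner_sum (addrC z); congr (_ + _ * _); apply: eq_bigr => i _.
      rewrite hornerM horner_exp hornerD hornerX !hornerC (addrC z) (dep_upd jB) //.
      by have [] := cP i.
    by rewrite hornerM hornerC hornerXn.
  rewrite (horner_coef_wide z (Pn y)) -(big_mkord xpredT (fun i => (P y)`_i * z ^+ i)).
  rewrite (big_cat_nat (leq0n d) dn) /= -addrA; congr (_ + _).
  rewrite /e' mulrDr mulr_sumr; congr (_ + _).
    apply: eq_big_nat => i /andP[di _]; rewrite mulrCA -exprD subnKC //.
  by rewrite mulrCA /y upd_eq.
exists g, (fun i x => C i (upd x j (g x))), (fun x => e' (proj A x)); split=> //.
- by move=> i; split=> // [x y|id]; [exact: CgB|rewrite go uo C0].
- split; [exact: ana_proj|exact: proj_dep|].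
  rewrite proj0 /e' go add0r expr0n gtn_eqF // mul0r addr0 uo.
  have [nd|dlt] := leqP n d.
    have sd : (size (P o) <= d)%N by apply: leq_trans (Pn o) nd.
    by have := Cd; rewrite /C nth_default // => /esym /eqP; rewrite (negPf e0).
  rewrite big_ltn // subnn expr0 mulr1 big_nat big1 ?addr0 ?Cd // => i /andP[di _].
  by rewrite expr0n subn_eq0 leqNgt di mulr0.
- apply: nearptS (near_proj A fE') => x.
  have pj : proj A x j = x j by rewrite /proj jA.
  have gp : g (proj A x) = g x.
    apply: gB => k kB; rewrite /proj (fintype.subsetP BA) //.
  rewrite gp pj => E1; rewrite (_ : f _ = f (upd (proj A x) j (x j + g x))).
    rewrite E1; congr (_ + _); apply: eq_bigr => i _; congr (_ * _).
    rewrite -{1}gp; apply: CgB => k kB; rewrite /proj (fintype.subsetP BA) //.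
  apply: fA => k kA; rewrite /upd /proj kA //.
Qed.

End tschirnhaus.

(** * Lowering the order by one substitution *)

Section uniformization_step.
Variables (R : realType) (I : finType) (T : Type) (U : set_system T).
Context {UU : UltraFilter U}.
Local Notation o := (fun=> 0 : R).

Lemma poly_flat (q : {poly R}) (K : R) d :
  (exists2 e : R, 0 < e & forall t, 0 < t < e -> `|q.[t]| <= K * t ^+ d) ->
  forall i, (i < d)%N -> q`_i = 0.
Proof.
move=> [e e0 eP] i; have [n] := ubnP i; elim: n i => // n IH i ilt id.
have qE : q = drop_poly i q * 'X^i.
  rewrite -[LHS](poly_take_drop i) (_ : take_poly i q = 0) ?add0r //.
  apply/polyP => k; rewrite coef_take_poly coef0; case: ifP => // ki.
  by apply: IH; [exact: leq_trans ki _|exact: ltn_trans id].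
set r := drop_poly i q in qE.
have -> : q`_i = r.[0] by rewrite horner_coef0 /r coef_drop_poly add0n.
have ra : ana (fun x : unit -> R => r.[x tt]) o.
  under eq_fun do rewrite horner_coef.
  by apply: ana_sum => k _; apply: ana_mul; [exact: ana_cst|apply: ana_exp; exact: ana_var].
apply/eqP; rewrite -normr_eq0 eq_le normr_ge0 andbT; apply/ler_addgt0Pr => ep ep0.
rewrite add0r; have ep2 : 0 < ep / 2 by rewrite divr_gt0.
have [del del0 delP] := ana_cont ra ep2.
have K1 : 0 < `|K| + 1 by rewrite ltr_wpDl.
pose m := Num.min (Num.min e del) (Num.min 1 (ep / 2 / (`|K| + 1))).
have m0 : 0 < m by rewrite !lt_min e0 del0 ltr01 /= divr_gt0.
have [me md m1 mK] : [/\ m <= e, m <= del, m <= 1 & m <= ep / 2 / (`|K| + 1)].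
  by rewrite /m; split; rewrite !ge_min lexx ?orbT.
pose t := m / 2; have t0 : 0 < t by rewrite divr_gt0.
have tm : t < m by rewrite ltr_pdivrMr // ltr_pMr // ltr1n.
have := delP (fun=> t) (fun _ => ltac:(rewrite subr0 gtr0_norm //; exact: lt_le_trans tm md)).
have h1 : `|r.[t]| <= K * t ^+ (d - i).
  have ti : 0 < t ^+ i by rewrite exprn_gt0.
  rewrite -(ler_pM2r ti) -mulrA -exprD subnK ?(ltnW id) //.
  have := eP t; rewrite t0 (lt_le_trans tm me) => /(_ isT).
  by rewrite {1}qE hornerM hornerXn normrM (gtr0_norm ti).
have h2 : `|r.[t]| <= ep / 2.
  apply: le_trans h1 _; apply: (@le_trans _ _ ((`|K| + 1) * (ep / 2 / (`|K| + 1)))).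
    apply: (@le_trans _ _ ((`|K| + 1) * t ^+ (d - i))).
      rewrite ler_wpM2r ?exprn_ge0 ?(ltW t0) // (le_trans (ler_norm _)) // lerDl //.
    rewrite ler_wpM2l ?(ltW K1) //; apply: le_trans (le_trans (ltW tm) mK).
    have -> : (d - i)%N = (d - i.+1).+1 by rewrite subnSK.
    rewrite exprS ger_pMr // exprn_ile1 ?(ltW t0) //.
    exact: le_trans (ltW tm) m1.
  by rewrite mulrCA divff ?gt_eqF // mulr1.
move: h2 (ler_normB r.[t] (r.[t] - r.[0])); rewrite subKr; clear; lra.
Qed.

Variables (B : {set I}) (j : I).
Hypothesis jB : j \notin B.
Let A := j |: B.
Implicit Types (f g h u : (I -> R) -> R) (X Y Z : T -> I -> R).

Let jA : j \in A. Proof. by rewrite setU11. Qed.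
Let BA : B \subset A. Proof. exact: finset.subsetUr. Qed.

(** h collects the factors split off by earlier substitutions; it has to reach its normal form in
    the same chart as f. *)
Definition uniformizable h f X := exists phi Y, chart U A X phi Y /\
  ismono A (fun y => h (at_phi phi y) * f (at_phi phi y)).

Definition regular_step d := forall h f X, ana h o -> dep B h -> nzg h ->
  ana f o -> dep A f -> reg B j d f -> infml U X -> uniformizable h f X.

Lemma at_subst g y : at_phi (subst j g) y = upd y j (g y).
Proof. by apply/funext => i; rewrite /at_phi /subst /upd; case: eqP. Qed.

Lemma uniformizable_pull h f X phi Y h' f' : chart U A X phi Y ->
  nearpt o (fun y => h (at_phi phi y) * f (at_phi phi y) = h' y * f' y) ->
  uniformizable h' f' Y -> uniformizable h f X.
Proof.
move=> ch E [psi [Z [ch' hm]]].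
exists (fun i z => phi i (at_phi psi z)), Z; split; first exact: chart_comp ch ch'.
apply: ismono_ext hm; apply: nearptS (near_pull (chart_ana ch') E) => z <- //.
Qed.

(** Along the sequence, x_j is compared with the smallest monomial x^gam. If x_j = O(x^gam), the
    substitution x_j = x^gam * (c + y_j) extracts the d-th power of x^gam and leaves a function of
    order below d, to which [IH] applies. Otherwise a toric step turns x^gam into x_j times a germ
    vanishing at the origin, and F becomes x_j^d times a unit. *)
Lemma S_core d (nz : pred 'I_d) (ga : 'I_d -> I -> nat) (u : 'I_d -> (I -> R) -> R) e F h Z :
  (forall d', (d' < d)%N -> regular_step d') ->
  (forall i, nz i -> [/\ forall k, k \notin B -> ga i k = 0%N, ana (u i) o, dep B (u i),
     u i o != 0 & exists k, ga i k != 0%N]) ->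
  (forall i i', nz i -> nz i' -> (forall k, (ga i k <= ga i' k)%N) \/ (forall k, (ga i' k <= ga i k)%N)) ->
  (forall i, nz i -> i.+1 != d :> nat) ->
  ana e o -> dep A e -> e o != 0 -> ana h o -> dep B h -> ismono B h ->
  ana F o -> dep A F -> infml U Z ->
  nearpt o (fun x => F x = \sum_(i | nz i) mono (ga i) x ^+ (d - i) * u i x * x j ^+ i
     + x j ^+ d * e x) ->
  uniformizable h F Z.
Proof.
move=> IH nzP cmp nzd ea eA e0 ha hB hm Fa FA Zi FE.
have hmA : ismono A h by exact: ismono_sub hm.
have [[i00 nz00]|nz0] := pselect (exists i, nz i); last first.
  exists (fun i y => y i), Z; split; first exact: chart_id.
  apply: ismono_mul; first exact: hmA.
  apply: (ismono_ext (f := fun x => x j ^+ d * e x)).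
    apply: nearptS FE => x ->; rewrite big1 ?add0r // => i nzi.
    by case: nz0; exists i.
  by apply: ismono_mul; [apply: ismono_exp; exact: ismono_var|exact: ismono_unit].
(* Since the exponents are pairwise comparable, one of least degree is least in every coordinate. *)
have [i0 nzi0 gmin] : exists2 i0, nz i0 & forall i, nz i -> forall k, (ga i0 k <= ga i k)%N.
  case: (arg_minnP (fun i => \sum_k ga i k)%N nz00) => i0 nzi0 imin.
  exists i0 => // i nzi k; have [|le] := cmp i0 i nzi0 nzi; first exact.
  have [_] := @leqif_sum _ xpredT (fun k => ga i k == ga i0 k) (fun k => ga i k) (fun k => ga i0 k)
    (fun k _ => conj (le k) erefl).
  rewrite eqn_leq imin // andbT leq_sum // => /esym/forallP/(_ k)/eqP -> //.
have [g0B _ _ _ [k0 gk0]] := nzP i0 nzi0.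
set gam := ga i0 in gmin g0B gk0.
have gj : gam j = 0%N by exact: g0B.
have mg0 : mono gam o = 0 by exact: mono_o0 gk0.
have monB i x t : nz i -> mono (ga i) (upd x j t) = mono (ga i) x.
  by move=> /nzP[giB _ _ _ _]; apply: (dep_upd jB); exact: dep_mono.
have uB i x t : nz i -> u i (upd x j t) = u i x.
  by move=> /nzP[_ _ uiB _ _]; exact: (dep_upd jB).
pose de i k := (ga i k - gam k)%N.
have deB i : nz i -> forall k, k \notin B -> de i k = 0%N.
  by move=> /nzP[giB _ _ _ _] k kB; rewrite /de giB.
have moE i x : nz i -> mono (ga i) x = mono gam x * mono (de i) x.
  by move=> nzi; rewrite -mono_le //; exact: gmin.
have [[M ZM]|nM] := pselect (exists M : R, ev U (fun m => `|Z m j| <= M * `|mono gam (Z m)|)).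
  have [c rc] : exists c, evlim U (fun m => Z m j / mono gam (Z m)) c.
    apply: (@ev_bounded_lim _ _ _ _ _ `|M|); apply: evS ZM => m mM.
    have [->|m0] := eqVneq (mono gam (Z m)) 0; first by rewrite invr0 mulr0 normr0.
    rewrite normrM normfV ler_pdivrMr ?normr_gt0 //; apply: le_trans mM _.
    by rewrite ler_wpM2r // ler_norm.
  have r0 : evlim U (fun m => Z m j / mono gam (Z m) - c) 0.
    by move=> ep ep0; apply: evS (rc ep ep0) => m; rewrite subr0.
  pose g (y : I -> R) := mono gam y * (c + y j).
  have cya : ana (fun y : I -> R => c + y j) o.
    by apply: ana_add; [exact: ana_cst|exact: ana_var].
  have ga_ : ana g o by apply: ana_mul => //; exact: ana_mono.
  have gA : dep A g.
    move=> x y xy; rewrite /g (xy j jA); congr (_ * _).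
    apply: (@dep_mono _ _ B) => //k kB; apply: xy.
    exact: (fintype.subsetP BA).
  have ch : chart U A Z (subst j g) (fun m => upd (Z m) j (Z m j / mono gam (Z m) - c)).
    apply: chart_subst => //; first by rewrite /g mg0 mul0r.
    apply: evS ZM => m mM; rewrite /g upd_eq (addrC c) subrK.
    rewrite -[mono gam (upd _ _ _)]/(mono (ga i0) _) monB // -/gam.
    have [m0|m0] := eqVneq (mono gam (Z m)) 0; last by rewrite mulrC divfK.
    by move: mM; rewrite m0 normr0 mulr0 normr_le0 => /eqP ->; rewrite mul0r.
  have pa := chart_ana ch.
  pose G (y : I -> R) := \sum_(i | nz i) mono (de i) y ^+ (d - i) * u i y * (c + y j) ^+ i
     + (c + y j) ^+ d * e (at_phi (subst j g) y).
  have Ga : ana G o.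
    apply: ana_add.
      apply: ana_sum => i /nzP[_ ua _ _ _]; apply: ana_mul; last exact: ana_exp.
      by apply: ana_mul => //; apply: ana_exp; exact: ana_mono.
    by apply: ana_mul; [exact: ana_exp|exact: (ana_pull pa)].
  have GA : dep A G.
    move=> x y xy; rewrite /G (xy j jA) (chart_dep ch eA xy); congr (_ + _).
    have xyB k : k \in B -> x k = y k by move=> kB; apply: xy; exact: (fintype.subsetP BA).
    apply: eq_bigr => i nzi; have [_ _ uiB _ _] := nzP i nzi.
    by rewrite (uiB x y) // (dep_mono (deB i nzi) xyB).
  have FG : nearpt o (fun y => F (at_phi (subst j g) y) = mono gam y ^+ d * G y).
    apply: nearptS (near_pull pa FE) => y ->; rewrite at_subst.
    rewrite upd_eq /G mulrDr mulr_sumr at_subst; congr (_ + _).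
      apply: eq_bigr => i nzi; rewrite monB // uB // moE // /g !exprMn.
      have -> : mono gam y ^+ d = mono gam y ^+ (d - i) * mono gam y ^+ i.
        by rewrite -exprD subnK // ltnW.
      by ring.
    by rewrite /g exprMn mulrA.
  apply: (uniformizable_pull (h' := fun y => h y * mono gam y ^+ d) (f' := G) ch).
    apply: nearptS FG => y ->; rewrite at_subst (dep_upd jB) // mulrA //.
  have h'm : ismono B (fun y => h y * mono gam y ^+ d).
    apply: ismono_mul => //; apply: ismono_exp; exists gam, (fun=> 1); split=> //.
    - exact: ana_cst.
    - by apply: nearptW => y; rewrite mulr1.
  have [[d' d'd rG]|[c' [e' [c'P e'a e'A GE]]]] := reg_or jB d Ga GA.
    apply: (IH d' d'd) => //; last exact: chart_infml ch.
    - by apply: ana_mul => //; apply: ana_exp; exact: ana_mono.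
    - move=> x y xy; rewrite (hB x y xy) (dep_mono g0B xy) //.
    - exact: ismono_nzg h'm.
  (* If G had no order below d, it would be O(t^d) on the y_j-axis, where it equals p(c + t); hence
     p = e(0) * (X - c)^d. The absent coefficient of degree d - 1 forces c = 0, and this contradicts
     the nonzero coefficient [b i0]. *)
  exfalso.
  pose b i := (\prod_k (de i k == 0%N)%:R) * u i o.
  pose p : {poly R} := \sum_(i | nz i) b i *: 'X^i + e o *: 'X^d.
  pose q := p \Po ('X + c%:P).
  have [K K0 [del del0 delP]] := ana_bounded e'a.
  have [del' del'0 del'P] := GE.
  have qflat : exists2 ep : R, 0 < ep & forall t, 0 < t < ep -> `|q.[t]| <= K * t ^+ d.
    exists (Num.min del del'); first by rewrite lt_min del0.
    move=> t; rewrite lt_min => /and3P[t0 td td'].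
    have tb (ep : R) : t < ep -> forall i, `|upd o j t i - 0| < ep.
      move=> tep i; rewrite subr0 /upd; case: eqP => _; first by rewrite gtr0_norm.
      by rewrite normr0; exact: lt_trans tep.
    have := del'P _ (tb _ td'); rewrite big_nat big1 ?add0r; last first.
      move=> i /andP[_ id]; have [_ cB c0] := c'P i.
      by rewrite (dep_upd jB) // c0 // mul0r.
    rewrite upd_eq => Gt.
    have -> : q.[t] = G (upd o j t).
      rewrite /q horner_comp (hornerD 'X) hornerX hornerC /p hornerD horner_sum hornerZ hornerXn.
      rewrite /G upd_eq (addrC t) at_subst upd_upd.
      have -> : upd o j (g (upd o j t)) = o.
        rewrite /g -[mono gam (upd _ _ _)]/(mono (ga i0) _) monB // -/gam mg0 mul0r.
        by apply/funext => k; rewrite /upd; case: eqP.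
      rewrite [e o * _]mulrC; congr (_ + _); apply: eq_bigr => i nzi.
      rewrite hornerZ hornerXn /b uB //; congr (_ * _ * _).
      rewrite (dep_upd jB); last exact: dep_mono (deB i nzi).
      rewrite mono_o; have [z|/existsNP[k /eqP z]] := pselect (forall k, de i k = 0%N).
        by rewrite big1 ?expr1n // => k _; rewrite z eqxx.
      rewrite (bigD1 k) //= (negPf z) mul0r expr0n subn_eq0 leqNgt ltn_ord //.
    rewrite Gt normrM ger0_norm ?exprn_ge0 ?(ltW t0) // mulrC.
    rewrite ler_wpM2r ?exprn_ge0 ?(ltW t0) //.
    by apply: delP; exact: tb.
  have q0 := poly_flat qflat.
  have pd : (size p <= d.+1)%N.
    apply: leq_trans (size_polyD _ _) _; rewrite geq_max; apply/andP; split.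
      apply: leq_trans (size_sum _ _ _) _; apply/bigmax_leqP => i _.
      apply: leq_trans (size_scale_leq _ _) _; rewrite size_polyXn ltnS ltnW //.
    by apply: leq_trans (size_scale_leq _ _) _; rewrite size_polyXn.
  have qd : (size q <= d.+1)%N.
    rewrite /q size_comp_poly2 //; exact: size_XaddC.
  have qE : q = q`_d *: 'X^d.
    apply/polyP => i; rewrite coefZ coefXn.
    have [id|id|->] := ltngtP i d; rewrite ?mulr0 ?mulr1 //; first exact: q0.
    by rewrite nth_default // (leq_trans qd).
  have pE : p = q`_d *: ('X + (- c)%:P) ^+ d.
    have {1}-> : p = q \Po ('X + (- c)%:P).
      have XX : ('X + c%:P) \Po ('X + (- c)%:P) = 'X.
        by rewrite comp_polyD comp_polyX comp_polyC -addrA -rmorphD /= addNr addr0.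
      by rewrite /q -comp_polyA XX comp_polyXr.
    by rewrite {1}qE comp_polyZ comp_Xn_poly.
  have bi (k : 'I_d) : (\sum_(i | nz i) b i *: 'X^i)`_k = if nz k then b k else 0.
    rewrite coef_sum; under eq_bigr do rewrite coefZ coefXn.
    case: ifP => nzk.
      rewrite (bigD1 k) //= eqxx mulr1 big1 ?addr0 // => i /andP[_ ik].
      by rewrite eq_sym (inj_eq val_inj) (negPf ik) mulr0.
    rewrite big1 // => i nzi; case: eqP => [/val_inj ki|]; last by rewrite mulr0.
    by rewrite ki nzi in nzk.
  have d0 : (0 < d)%N by apply: leq_ltn_trans (ltn_ord i0).
  have dl : (d.-1 < d)%N by rewrite prednK.
  have pc (k : 'I_d) : p`_k = if nz k then b k else 0.
    by rewrite /p coefD bi coefZ coefXn ltn_eqF // mulr0 addr0.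
  have pdE : p`_d = e o.
    rewrite /p coefD coefZ coefXn eqxx mulr1 coef_sum big1 ?add0r // => i _.
    by rewrite coefZ coefXn gtn_eqF // mulr0.
  have qde : q`_d = e o.
    by rewrite -pdE pE coefZ coef_XaddC_exp subnn expr0 binn mulr1n mulr1.
  have c0 : c = 0.
    have := pc (Ordinal dl); rewrite ifF /=; last first.
      by apply/negP => /nzd /=; rewrite prednK // eqxx.
    rewrite pE coefZ coef_XaddC_exp qde => /eqP; rewrite mulf_eq0 (negPf e0) /=.
    have -> : (d - d.-1 = 1)%N by rewrite -{1}(prednK d0) subSnn.
    rewrite expr1 mulrn_eq0 oppr_eq0 => /orP[|/eqP //].
    by rewrite -[X in 'C(X, _)](prednK d0) binSn.
  have := pc i0; rewrite nzi0 pE coefZ c0 oppr0 addr0 coefXn ltn_eqF // mulr0 /b.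
  have [_ _ _ u0 _] := nzP i0 nzi0.
  rewrite big1 => [/esym/eqP|k _]; last by rewrite /de subnn.
  by rewrite mul1r (negPf u0).
have big (M : R) : ev U (fun m => M * `|mono gam (Z m)| < `|Z m j|).
  have /ev_not : ~ ev U (fun m => `|Z m j| <= M * `|mono gam (Z m)|) by move=> hM; apply: nM; exists M.
  by apply: evS => m /negP; rewrite -ltNge.
have Zj0 : ev U (fun m => Z m j != 0).
  by apply: evS (big 0) => m; rewrite mul0r normr_gt0.
have Zg (ep : R) : 0 < ep -> ev U (fun m => `|mono gam (Z m)| <= ep * `|Z m j|).
  move=> ep0; apply: evS (big ep^-1) => m; rewrite mulrC ltr_pdivrMr // => /ltW.
  by rewrite mulrC.
have g0A i : i \notin A -> gam i = 0%N.
  by move=> iA; apply: g0B; apply: contra iA; exact: (fintype.subsetP BA).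
have [psi [Y [ch pm [rho [rhoa rho0 rhoA rhoE]]]]] := toric_step jA g0A gj Zi Zj0 Zg.
have pa := chart_ana ch.
exists psi, Y; split=> //; apply: ismono_mul.
  have [eta [uh [etaB uhB uha uh0 hE]]] := hm.
  apply: (ismono_ext (f := fun y => (\prod_i psi i y ^+ eta i) * uh (at_phi psi y))).
    by apply: nearptS (near_pull pa hE) => y ->.
  apply: ismono_mul.
    apply: ismono_prod => i _; have [iA|iA] := boolP (i \in A).
      by apply: ismono_exp; exact: pm.
    rewrite etaB; last by apply: contra iA; exact: (fintype.subsetP BA).
    by under eq_fun do rewrite expr0; apply: ismono_unit => //; exact: ana_cst.
  apply: ismono_unit; first by apply: (chart_dep ch); exact: dep_sub uhB.
    exact: (ana_pull pa).
  by rewrite at_phi0 // => i; exact: (pa i).2.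
(* Each lower term carries a positive power d - i of rho, which vanishes at the origin, so V is a
   unit with value e(0) there. *)
pose V y := \sum_(i | nz i) (rho y * mono (de i) (at_phi psi y)) ^+ (d - i) * u i (at_phi psi y)
  + e (at_phi psi y).
have p0 : at_phi psi o = o by apply: at_phi0 => i; exact: (pa i).2.
apply: (ismono_ext (f := fun y => psi j y ^+ d * V y)).
  apply: nearptS (nearptI (near_pull pa FE) rhoE) => y [-> ry].
  rewrite /V mulrDr mulr_sumr -[at_phi psi y j]/(psi j y); congr (_ + _).
  apply: eq_bigr => i nzi; rewrite moE // ry -mulrA !exprMn.
  have -> : psi j y ^+ d = psi j y ^+ (d - i) * psi j y ^+ i.
    by rewrite -exprD subnK // ltnW.
  by ring.
apply: ismono_mul; first by apply: ismono_exp; exact: pm.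
apply: ismono_unit.
- move=> x y xy; rewrite /V (chart_dep ch eA xy) (rhoA x y xy); congr (_ + _).
  apply: eq_bigr => i nzi; have [_ _ uiB _ _] := nzP i nzi.
  rewrite (chart_dep ch (dep_sub BA uiB) xy).
  by rewrite (chart_dep ch (dep_sub BA (dep_mono (deB i nzi))) xy).
- apply: ana_add; last exact: (ana_pull pa).
  apply: ana_sum => i /nzP[_ ua _ _ _]; apply: ana_mul; last exact: (ana_pull pa).
  by apply: ana_exp; apply: ana_mul => //; apply: (ana_pull pa); exact: ana_mono.
- rewrite /V p0 rho0 big1 ?add0r // => i _.
  by rewrite mul0r expr0n subn_eq0 leqNgt ltn_ord mul0r.
Qed.

End uniformization_step.

(** * Uniformization by induction on the number of coordinates *)

Section uniformization.
Variables (R : realType) (I : finType) (T : Type) (U : set_system T).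
Context {UU : UltraFilter U}.
Local Notation o := (fun=> 0 : R).
Implicit Types (A B : {set I}) (f g h u : (I -> R) -> R) (X Y Z : T -> I -> R).

Definition uniformization A := forall f X, ana f o -> dep A f -> nzg f -> infml U X ->
  exists phi Y, chart U A X phi Y /\ ismono A (fun y => f (at_phi phi y)).

Lemma nzg_prod (S : Type) (l : seq S) (P : pred S) (f : S -> (I -> R) -> R) :
  (forall s, P s -> ana (f s) o /\ nzg (f s)) -> nzg (fun x => \prod_(s <- l | P s) f s x).
Proof.
move=> fP; elim: l => [|s l IH].
  under eq_fun do rewrite big_nil.
  by move=> /nearpt_self/eqP; rewrite oner_eq0.
under eq_fun do rewrite big_cons; case Ps: (P s) => //; have [fa f0] := fP s Ps.
by apply: nzg_mul => //; apply: ana_prod => k /fP[].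
Qed.

Definition power_map B (ep : I -> R) D : I -> (I -> R) -> R :=
  fun i y => if i \in B then ep i * y i ^+ D else y i.

(** The ultrafilter fixes the sign [ep i] of each coordinate, so x_i = ep i * y_i^D can be solved by
    y_i = |x_i|^(1/D). The substitution makes exponents divisible by D. *)
Lemma power_chart B X D : (0 < D)%N -> infml U X ->
  exists (ep : I -> R) Z, (forall i, ep i != 0) /\ chart U B X (power_map B ep D) Z.
Proof.
move=> D0 Xi; have D0' : D%:R != 0 :> R by rewrite pnatr_eq0 -lt0n.
have /choice[ep epP] i : exists s : R, s != 0 /\ ev U (fun k => X k i = s * `|X k i|).
  have [p|/ev_not n] := pselect (ev U (fun k => 0 <= X k i)).
    exists 1; split; first exact: oner_neq0.
    by apply: evS p => k k0; rewrite mul1r ger0_norm.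
  exists (-1); split; first by rewrite oppr_eq0 oner_neq0.
  apply: evS n => k /negP; rewrite -ltNge => k0.
  by rewrite ltr0_norm // mulrNN mul1r.
exists ep, (fun k i => if i \in B then `|X k i| `^ D%:R^-1 else X k i).
split; first by move=> i; have [] := epP i.
have rt (x : R) : (`|x| `^ D%:R^-1) ^+ D = `|x|.
  by rewrite -powR_mulrn ?powR_ge0 // -powRrM mulVf // powRr1.
split.
- move=> i; rewrite /power_map; case: (i \in B).
    split; last by rewrite expr0n gtn_eqF // mulr0.
    by apply: ana_mul; [exact: ana_cst|apply: ana_exp; exact: ana_var].
  by split=> //; exact: ana_var.
- by move=> i iB; rewrite /power_map iB => x y xy; rewrite xy.
- by move=> i /negPf iB; rewrite /power_map iB.
- move=> i; have [iB|iB] := boolP (i \in B); last exact: Xi.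
  move=> e e0; have eD : 0 < e ^+ D by rewrite exprn_gt0.
  apply: evS (infmlP i Xi eD) => k xk; rewrite subr0 ger0_norm ?powR_ge0 //.
  by rewrite -(@ltr_pXn2r _ D) ?nnegrE ?powR_ge0 ?(ltW e0) // rt.
- apply: evS (ev_all (fun i => (epP i).2)) => k Xk; apply/funext => i.
  by rewrite /at_phi /power_map; case: ifP => iB; rewrite iB ?rt //.
Qed.

Lemma mono_power B ep D al y : (forall i, i \notin B -> al i = 0%N) ->
  mono al (at_phi (power_map B ep D) y) =
  (\prod_i ep i ^+ al i) * mono (fun i => (D * al i)%N) y.
Proof.
move=> alB; rewrite /mono -big_split; apply: eq_bigr => i _ /=.
rewrite /at_phi /power_map; case: ifPn => [_|/alB ->].
  by rewrite exprMn exprM.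
by rewrite muln0 !expr0 mulr1.
Qed.

Lemma prod_neq0 (ep : I -> R) al : (forall i, ep i != 0) -> \prod_i ep i ^+ al i != 0.
Proof. by move=> e0; apply/prodf_neq0 => i _; rewrite expf_neq0. Qed.

Lemma ismono_power B ep D X Z f : (forall i, ep i != 0) ->
  chart U B X (power_map B ep D) Z -> ismono B f ->
  ismono B (fun y => f (at_phi (power_map B ep D) y)).
Proof.
move=> ep0 ch [al [u [alB uB ua u0 fE]]]; have pa := chart_ana ch.
exists (fun i => (D * al i)%N),
  (fun y => (\prod_i ep i ^+ al i) * u (at_phi (power_map B ep D) y)); split.
- by move=> i iB; rewrite alB // muln0.
- by move=> x y xy; rewrite (chart_dep ch uB xy).
- by apply: ana_mul; [exact: ana_cst|exact: (ana_pull pa)].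
- rewrite mulf_neq0 ?prod_neq0 // at_phi0 // => i; exact: (pa i).2.
- by apply: nearptS (near_pull pa fE) => y ->; rewrite mono_power //; ring.
Qed.

Section step.
Variables (B : {set I}) (j : I).
Hypotheses (jB : j \notin B) (LUB : uniformization B).
Let A := j |: B.
Let jA : j \in A. Proof. by rewrite setU11. Qed.
Let BA : B \subset A. Proof. exact: finset.subsetUr. Qed.

(** After the Tschirnhaus translation, all nonzero coefficients and all nonzero differences of their
    powers [q i] are factors of one product W in the coordinates of B. The hypothesis on B brings W
    to normal form, and [mono_factor] passes this to each factor. The differences make the exponents
    comparable, and a power substitution turns [c i] into a (d - i)-th power up to a unit, as
    [S_core] requires. *)
Lemma S_step d : regular_step R U B j d.
Proof.
have [n] := ubnP d; elim: n d => // n IHn d dn.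
have IH d' : (d' < d)%N -> regular_step R U B j d'.
  by move=> d'd; apply: IHn; exact: leq_trans d'd _.
move=> h f X ha hB h0 fa fA fr Xi.
have [d0|d0] := posnP d.
  have [c [e [cP ea eA e0]]] := fr; rewrite d0 => fE.
  have [phi [Y [ch hm]]] := LUB ha hB h0 Xi.
  have pa := chart_ana ch; have chA : chart U A X phi Y by exact: chart_sub BA ch.
  exists phi, Y; split=> //; apply: ismono_mul; first exact: ismono_sub hm.
  apply: (ismono_ext (f := fun y => e (at_phi phi y))).
    by apply: nearptS (near_pull pa fE) => y ->; rewrite big_geq // add0r expr0 mul1r.
  apply: ismono_unit; [exact: (chart_dep chA)|exact: (ana_pull pa)|].
  by rewrite at_phi0 // => i; exact: (pa i).2.
have [g [c [e [[ga g0 gB] cP cd0 [ea eA e0] fE]]]] := tschirnhaus jB d0 fa fA fr.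
have ch1 : chart U A X (subst j (fun y => y j + g y)) (fun m => upd (X m) j (X m j - g (X m))).
  apply: chart_subst => //.
  - by apply: ana_add => //; exact: ana_var.
  - by rewrite g0 addr0.
  - move=> x y xy; rewrite (xy j jA) (gB x y) // => k kB; apply: xy.
    exact: (fintype.subsetP BA).
  - move=> ep ep0; have ep2 : 0 < ep / 2 by rewrite divr_gt0.
    apply: evS (evI (infmlP j Xi ep2) (chart_lim ga Xi ep2)) => m [h1].
    rewrite g0 !subr0 => h2; apply: le_lt_trans (ler_normB _ _) _.
    by rewrite (splitr ep) ltrD.
  - by apply: evW => m; rewrite upd_eq (dep_upd jB) // subrK.
pose F1 y := f (at_phi (subst j (fun y => y j + g y)) y).
apply: (uniformizable_pull (h' := h) (f' := F1) ch1).
  by apply: nearptW => y; rewrite at_subst (dep_upd jB).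
have F1E : nearpt o (fun x => F1 x = \sum_(0 <= i < d) c i x * x j ^+ i + x j ^+ d * e x).
  by apply: nearptS fE => x; rewrite /F1 at_subst.
have F1a : ana F1 o by exact: (ana_pull (chart_ana ch1)).
have F1A : dep A F1 by exact: (chart_dep ch1).
have := chart_infml ch1; move: (fun m => upd (X m) j _) => Y1 Y1i.
(* The quantities to be compared are the roots of [c i] of order d - i; raising them to the power d!
   gives the analytic powers [q i]. *)
pose N (i : 'I_d) := (d`! %/ (d - i))%N.
have dN (i : 'I_d) : ((d - i) * N i = d`!)%N.
  by rewrite mulnC divnK // dvdn_fact // subn_gt0 ltn_ord leq_subr.
have N0 i : (0 < N i)%N.
  by have := fact_gt0 d; rewrite -(dN i) muln_gt0 => /andP[].
pose q (i : 'I_d) x := c i x ^+ N i.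
pose nz1 (i : 'I_d) := `[< nzg (c i) >].
pose nz2 (p : 'I_d * 'I_d) := `[< nzg (fun x => q p.1 x - q p.2 x) >].
have ca (i : 'I_d) : ana (c i) o by have [] := cP i.
have cB (i : 'I_d) : dep B (c i) by have [] := cP i.
have qa i : ana (q i) o by exact: ana_exp.
have qB i : dep B (q i) by move=> x y xy; rewrite /q (cB i x y).
pose W1 x := \prod_(i | nz1 i) c i x.
pose W2 x := \prod_(p | nz2 p) (q p.1 x - q p.2 x).
have W1a : ana W1 o by apply: ana_prod.
have W2a : ana W2 o by apply: ana_prod => p _; exact: ana_sub.
have W1B : dep B W1 by move=> x y xy; apply: eq_bigr => i _; exact: cB.
have W2B : dep B W2.
  by move=> x y xy; apply: eq_bigr => p _; rewrite (qB p.1 x y) // (qB p.2 x y).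
pose W x := h x * (W1 x * W2 x).
have Wa : ana W o by do 2! apply: ana_mul => //.
have WB : dep B W by move=> x y xy; rewrite /W (hB x y) // (W1B x y) // (W2B x y).
have W0 : nzg W.
  apply: nzg_mul => //; first exact: ana_mul.
  apply: nzg_mul => //; apply: nzg_prod; first by move=> i /asboolP.
  by move=> p /asboolP p0; split=> //; exact: ana_sub.
have [phi2 [Y2 [ch2 [al0 [u0 [al0B u0B u0a u00 WE]]]]]] := LUB Wa WB W0 Y1i.
have pa2 := chart_ana ch2.
have factor G1 G2 : ana G1 o -> ana G2 o -> dep B G1 -> dep B G2 ->
    (forall x, W x = G1 x * G2 x) -> ismono B (fun y => G1 (at_phi phi2 y)).
  move=> G1a G2a G1B G2B WG.
  apply: (@mono_factor _ _ B _ (fun y => G2 (at_phi phi2 y)) al0 u0) => //.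
  - exact: (ana_pull pa2).
  - exact: (ana_pull pa2).
  - exact: (chart_dep ch2).
  - exact: (chart_dep ch2).
  - by apply: nearptS WE => y <-; rewrite WG.
have hm : ismono B (fun y => h (at_phi phi2 y)).
  apply: (factor h (fun x => W1 x * W2 x)) => //; first exact: ana_mul.
  by move=> x y xy; rewrite (W1B x y) // (W2B x y).
have cm i : nz1 i -> ismono B (fun y => c i (at_phi phi2 y)).
  move=> nzi; apply: (factor (c i) (fun x => h x * ((\prod_(k | nz1 k && (k != i)) c k x) * W2 x))) => //.
  - by do 2! apply: ana_mul => //; apply: ana_prod.
  - move=> x y xy; rewrite (hB x y) // (W2B x y) //; congr (_ * (_ * _)).
    by apply: eq_bigr => k _; exact: cB.
  - by move=> x; rewrite /W /W1 (bigD1 i) //=; ring.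
have q2m p : nz2 p -> ismono B (fun y => q p.1 (at_phi phi2 y) - q p.2 (at_phi phi2 y)).
  move=> nzp; apply: (factor (fun x => q p.1 x - q p.2 x) (fun x => h x * (W1 x *
      \prod_(k | nz2 k && (k != p)) (q k.1 x - q k.2 x)))).
  - exact: ana_sub.
  - by do 2! apply: ana_mul => //; apply: ana_prod => k _; exact: ana_sub.
  - by move=> x y xy; rewrite (qB p.1 x y) // (qB p.2 x y).
  - move=> x y xy; rewrite (hB x y) // (W1B x y) //; congr (_ * (_ * _)).
    by apply: eq_bigr => k _; rewrite (qB k.1 x y) // (qB k.2 x y).
  - by move=> x; rewrite /W /W2 (bigD1 p) //=; ring.
have /choice[av avP] i : exists av : (I -> nat) * ((I -> R) -> R), nz1 i ->
    [/\ forall k, k \notin B -> av.1 k = 0%N, dep B av.2, ana av.2 o, av.2 o != 0 &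
    nearpt o (fun y => c i (at_phi phi2 y) = mono av.1 y * av.2 y)].
  have [nzi|nnz] := boolP (nz1 i); last by exists (fun=> 0%N, fun=> 0).
  by have [al [v ?]] := cm i nzi; exists (al, v).
pose al i := (av i).1; pose v i := (av i).2.
(* The substitution multiplies exponents by d! = (d - i) * N i, so the monomial of [c i] becomes the
   (d - i)-th power of the one with exponent N i * al i. *)
have [ep [Z [ep0 ch3]]] := power_chart B (fact_gt0 d) (chart_infml ch2).
set ps := power_map B ep d`! in ch3.
have pa3 := chart_ana ch3.
pose chi := (fun i z => phi2 i (at_phi ps z)).
have ch23 : chart U A Y1 chi Z by exact: (chart_sub BA (chart_comp ch2 ch3)).
have pa23 := chart_ana ch23.
apply: (uniformizable_pull (h' := fun z => h (at_phi chi z)) (f' := fun z => F1 (at_phi chi z)) ch23).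
  exact: nearptW.
apply: (@S_core _ _ _ _ _ B j jB d nz1 (fun i k => (N i * al i k)%N)
  (fun i z => (\prod_k ep k ^+ al i k) * v i (at_phi ps z)) (fun z => e (at_phi chi z))) => //.
- move=> i nzi; have [alB vB va v0 cE] := avP i nzi; split.
  + by move=> k kB; rewrite /al alB // muln0.
  + by apply: ana_mul; [exact: ana_cst|exact: (ana_pull pa3)].
  + by move=> x y xy; rewrite /v (chart_dep ch3 vB xy).
  + rewrite mulf_neq0 ?prod_neq0 // at_phi0 // => k; exact: (pa3 k).2.
  + apply: contrapT => /forallNP na.
    have al0' k : al i k = 0%N.
      have /negP := na k; rewrite negbK muln_eq0 => /orP[|/eqP //].
      by rewrite -leqn0 leqNgt N0.
    have := nearpt_self cE; rewrite at_phi0; last by move=> k; exact: (pa2 k).2.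
    have [_ _ -> //] := cP i; rewrite mono_o big1 ?mul1r => [/esym/eqP|k _].
      by rewrite (negPf v0).
    by rewrite -/(al i) al0' eqxx.
- move=> i i' nzi nzi'; have [alB vB va v0 cE] := avP i nzi.
  have [alB' vB' va' v0' cE'] := avP i' nzi'.
  have qE (k : 'I_d) : nearpt o (fun y => c k (at_phi phi2 y) = mono (al k) y * v k y) ->
      nearpt o (fun y => q k (at_phi phi2 y) = mono (fun l => (N k * al k l)%N) y * v k y ^+ N k).
    by apply: nearptS => y; rewrite /q => ->; rewrite exprMn monoX.
  have dE := nearptI (qE _ cE) (qE _ cE').
  apply: (@mono_comparable _ _ B _ _ (fun y => v i y ^+ N i) (fun y => v i' y ^+ N i')).
  + exact: ana_exp.
  + exact: ana_exp.
  + exact: expf_neq0.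
  + exact: expf_neq0.
  + have [p2|np2] := boolP (nz2 (i, i')).
      right; apply: ismono_ext (q2m _ p2).
      by apply: nearptS dE => y [-> ->].
    left; move: np2; rewrite /nz2 => /asboolPn/contrapT qq.
    by apply: nearptS (nearptI dE (near_pull pa2 qq)) => y [[<- <-]].
- move=> i /asboolP nzi; apply/eqP => id; apply: nzi.
  by rewrite -id in cd0.
- exact: (ana_pull pa23).
- exact: (chart_dep ch23).
- rewrite at_phi0 // => i; exact: (pa23 i).2.
- exact: (ana_pull pa23).
- exact: (chart_dep (chart_comp ch2 ch3)).
- exact: (ismono_power ep0 ch3 hm).
- exact: (ana_pull pa23).
- exact: (chart_dep ch23).
- exact: chart_infml ch3.
- have chij z : at_phi chi z j = z j.
    have [_ _ p2n _ _] := ch2; have [_ _ p3n _ _] := ch3.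
    by rewrite /at_phi /chi (p2n j jB) /at_phi (p3n j jB).
  have cE (i : 'I_d) : nearpt o (fun z => c i (at_phi chi z) =
      if nz1 i then mono (fun k => (N i * al i k)%N) z ^+ (d - i) *
        ((\prod_k ep k ^+ al i k) * v i (at_phi ps z)) else 0).
    have [nzi|nnz] := boolP (nz1 i).
      have [alB vB va v0 cE] := avP i nzi.
      apply: nearptS (near_pull pa3 cE) => z.
      rewrite -[at_phi phi2 (at_phi ps z)]/(at_phi chi z) => ->.
      rewrite mono_power // -/(al i) -/(v i) -monoX.
      rewrite (_ : (fun k => ((d - i) * (N i * al i k))%N) = fun k => (d`! * al i k)%N).
        by ring.
      by apply/funext => k; rewrite mulnA dN.
    move: nnz; rewrite /nz1 => /asboolPn/contrapT ci.
    exact: (near_pull pa23 ci).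
  apply: nearptS (nearptI (near_pull pa23 F1E) (nearpt_all cE)) => z [-> cz].
  rewrite chij big_mkord; congr (_ + _).
  rewrite [RHS]big_mkcond /=; apply: eq_bigr => i _; rewrite cz.
  by case: ifP => _; rewrite ?mul0r.
Qed.

End step.

(** A linear shear along a vector v with f v nonzero makes f regular in some x_j: without a finite
    order f would be flat along the line of v, and [An_ray_flat] would give f v = 0. Then [S_step]
    applies, with one coordinate fewer in B. *)
Theorem uniformization_all A : uniformization A.
Proof.
have [n] := ubnP #|A|; elim: n A => // n IH A An0 f X fa fA f0 Xi.
have [fo|fo] := eqVneq (f o) 0; last first.
  exists (fun i y => y i), X; split; first exact: chart_id.
  exact: ismono_unit.
have [r [M [r0 fAn]]] := (ana0P f).1 fa.
have [v vr fv] : exists2 v, forall i, `|v i| < r & f v != 0.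
  apply: contrapT => nv; apply: f0; exists r => // x xr; apply: contrapT => /eqP fx.
  by apply: nv; exists x => // i; have := xr i; rewrite subr0.
have [j jA vj] : exists2 j, j \in A & v j != 0.
  apply: contrapT => nv; move: fv; rewrite -fo (fA v o) ?eqxx // => i iA.
  by apply: contrapT => /eqP vi; apply: nv; exists i.
pose B := A :\ j.
have jB : j \notin B by rewrite !inE eqxx.
have AE : A = j |: B by rewrite finset.setD1K.
have LUB : uniformization B.
  by apply: IH; move: An0; rewrite (cardsD1 j) jA add1n ltnS.
(* The shear maps the x_j-axis to the line spanned by the part of v in A. *)
pose phi i (y : I -> R) : R := if i \in B then y i + v i / v j * y j else y i.
pose Y m i := if i \in B then X m i - v i / v j * X m j else X m i.
have ch : chart U A X phi Y.
  split.
  - move=> i; rewrite /phi; case: (i \in B).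
      split; last by rewrite mulr0 addr0.
      apply: ana_add; first exact: ana_var.
      by apply: ana_mul; [exact: ana_cst|exact: ana_var].
    by split=> //; exact: ana_var.
  - by move=> i iA x y xy; rewrite /phi !xy.
  - move=> i iA; have iB : (i \in B) = false by rewrite !inE (negPf iA) andbF.
    by rewrite /phi iB.
  - move=> i; rewrite /Y; case: (i \in B); last exact: Xi.
    have w1 : 0 < 1 + `|v i / v j| by rewrite ltr_pwDl.
    move=> e e0; have e1 : 0 < e / (1 + `|v i / v j|) by rewrite divr_gt0.
    apply: evS (evI (infmlP i Xi e1) (infmlP j Xi e1)) => m [h1 h2].
    rewrite subr0; apply: le_lt_trans (ler_normB _ _) _; rewrite normrM.
    have -> : e = e / (1 + `|v i / v j|) + `|v i / v j| * (e / (1 + `|v i / v j|)).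
      by rewrite -[X in _ = X + _]mul1r -mulrDl [RHS]mulrC divfK // gt_eqF.
    by rewrite ltr_leD // ler_wpM2l // ltW.
  - apply: evW => m; apply/funext => i; rewrite /at_phi /phi /Y (negPf jB).
    by case: ifP => iB; rewrite ?iB // subrK.
pose f1 y := f (at_phi phi y).
have pa := chart_ana ch.
have f1a : ana f1 o by exact: (ana_pull pa).
have f1A : dep (j |: B) f1 by rewrite -AE; exact: (chart_dep ch).
have [d f1r] : exists d, reg B j d f1.
  apply: contrapT => /forallNP nr.
  have := fv; rewrite (fA v (proj A v)); last by move=> i iA; rewrite /proj iA.
  move/eqP; apply; apply: (An_ray_flat r0 fAn).
    by move=> i; rewrite /proj; case: ifP => _; rewrite ?normr0.
  move=> D; have [[d _ /nr //]|[c [e [cP ea eA f1E]]]] := reg_or jB D f1a f1A.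
  have [K K0 eK] := ana_bounded ea; have [del del0 delP] := nearptI eK f1E.
  exists (K * `|v j| ^+ D); exists (del / `|v j|).
    by rewrite divr_gt0 // normr_gt0.
  move=> x /(_ tt); rewrite subr0 ltr_pdivlMr ?normr_gt0 // => xv.
  pose y : I -> R := upd o j (x tt * v j).
  have [|ey] := delP y.
    by move=> i; rewrite subr0 /y /upd; case: eqP => _; rewrite ?normr0 // normrM.
  rewrite big_nat big1 ?add0r; last first.
    move=> i /andP[_ iD]; have [_ cB c0] := cP i.
    by rewrite /y (dep_upd jB) // c0 // mul0r.
  rewrite {2}/y upd_eq => f1y.
  have -> : (fun i => x tt * proj A v i) = at_phi phi y.
    apply/funext => i; rewrite /at_phi /phi /proj.
    have [->|ij] := eqVneq i j; first by rewrite jA (negPf jB) /y upd_eq.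
    rewrite !inE ij /=; case: ifP => iA.
      by rewrite /y upd_eq /upd (negPf ij) add0r mulrCA divfK.
    by rewrite /y /upd (negPf ij) mulr0.
  rewrite -/(f1 y) f1y normrM normrX normrM exprMn.
  rewrite [leRHS](_ : _ = `|x tt| ^+ D * `|v j| ^+ D * K); last by ring.
  by rewrite ler_wpM2l // mulr_ge0 ?exprn_ge0.
have [|||psi [Z [ch' m']]] := S_step jB LUB (h := fun=> 1) _ _ _ f1a f1A f1r (chart_infml ch).
- exact: ana_cst.
- by [].
- by move=> /nearpt_self/eqP; rewrite oner_eq0.
exists (fun i z => phi i (at_phi psi z)), Z; split.
  by apply: chart_comp ch _; rewrite AE.
rewrite AE; apply: ismono_ext m'; apply: nearptW => y; rewrite mul1r //.
Qed.

End uniformization.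

(** * From the normal form to the inequality *)

Section lojasiewicz_inequality.
Variables (R : realType) (I : finType).
Local Notation o := (fun=> 0 : R).
Implicit Types (f g u : (I -> R) -> R) (al : I -> nat).

(** A Lipschitz constant of f at the single point x, for the sup norm; it plays the role of an upper
    bound on the norm of the gradient. *)
Definition lip_at f x (L : R) := exists2 d : R, 0 < d & forall y (t : R), 0 <= t -> t < d ->
  (forall i, `|y i - x i| <= t) -> `|f y - f x| <= L * t.

Lemma lip_at_ge0 f x L : lip_at f x L -> 0 <= L.
Proof.
move=> [d d0 dP]; have d2 : 0 < d / 2 by rewrite divr_gt0.
have := dP x (d / 2) (ltW d2).
rewrite ltr_pdivrMr // ltr_pMr // ltr1n subrr normr0 => /(_ isT) h.
rewrite -(pmulr_lge0 _ d2) h // => i; rewrite subrr normr0; exact: ltW.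
Qed.

Lemma powR_root (x : R) n : 0 <= x -> (0 < n)%N -> (x ^+ n) `^ n%:R^-1 = x.
Proof.
move=> x0 n0; rewrite -powR_mulrn // -powRrM divff ?powRr1 //.
by rewrite pnatr_eq0 -lt0n.
Qed.

(* Compares the values at y and at the point obtained by scaling the smallest
   coordinate of y that occurs in the monomial. *)
Lemma mono_grad al u : ana u o -> u o != 0 -> (exists i, al i != 0%N) ->
  exists2 c : R, 0 < c & nearpt o (fun y => mono al y != 0 -> forall L,
    lip_at (fun y => mono al y * u y) y L ->
    c * `|mono al y| `^ (1 - (\sum_i al i)%:R^-1) <= L).
Proof.
move=> ua u0 [i00 ali00]; set N := (\sum_i al i)%N.
have [K [e [K0 e0 uK]]] := ana_lip ua.
have u0' : 0 < `|u o| by rewrite normr_gt0.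
exists (`|u o| / 4); first by rewrite divr_gt0.
(* With this radius the variation of the unit u, at most 2^N * K * |y_i| * s, costs no more than
   half of what the monomial gains. *)
pose del := Num.min (Num.min 1 (e / 2)) (`|u o| / 4 / (2 ^+ N * K)).
have K2 : 0 < 2 ^+ N * K by rewrite mulr_gt0 // exprn_gt0.
have del0 : 0 < del by rewrite !lt_min ltr01 !divr_gt0.
have [del1 dele delu] : [/\ del <= 1, del <= e / 2 & del <= `|u o| / 4 / (2 ^+ N * K)].
  by rewrite /del; split; rewrite !ge_min lexx ?orbT.
have nd : nearpt o (fun y : I -> R => forall i, `|y i| < del).
  by exists del => // y yd i; have := yd i; rewrite subr0.
apply: nearptS (nearptI nd (ana_neq0 ua u0)) => y [yd uy] m0 L gL.
have L0 := lip_at_ge0 gL; have [d d0 dP] := gL.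
(* For the smallest coordinate y_i in the monomial, |y_i|^N is at most the absolute value of the
   monomial, and a relative change s of y_i changes the monomial by a relative amount at least s. *)
have [i ali imin] : exists2 i, al i != 0%N & forall k, al k != 0%N -> `|y i| <= `|y k|.
  by have [i ali imin] := @Order.TotalTheory.arg_minP _ R I i00 (fun i => al i != 0%N)
    (fun k => `|y k|) ali00; exists i.
have yi0 : 0 < `|y i|.
  rewrite normr_gt0; apply: contraNneq m0 => yi.
  by rewrite /mono (bigD1 i) //= yi expr0n (negPf ali) mul0r.
pose s := Num.min 1 (d / 2 / `|y i|).
have s0 : 0 < s by rewrite lt_min ltr01 !divr_gt0.
have s1 : s <= 1 by rewrite ge_min lexx.
have sd : `|y i| * s < d.
  apply: (@le_lt_trans _ _ (d / 2)); last by rewrite ltr_pdivrMr // ltr_pMr // ltr1n.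
  by rewrite mulrC -ler_pdivlMr // ge_min lexx orbT.
pose y' := upd y i (y i * (1 + s)).
have yy k : `|y' k - y k| <= `|y i| * s.
  rewrite /y' /upd; case: eqP => [->|_].
    by rewrite mulrDr mulr1 addrAC subrr add0r normrM (gtr0_norm s0).
  by rewrite subrr normr0 mulr_ge0 // ltW.
have ys0 : 0 <= `|y i| * s by rewrite mulr_ge0 // ltW.
have := dP y' (`|y i| * s) ys0 sd yy.
have my : mono al y' = mono al y * (1 + s) ^+ al i.
  have E : \prod_(k | k != i) y' k ^+ al k = \prod_(k | k != i) y k ^+ al k.
    by apply: eq_bigr => k /negPf ki; rewrite /y' /upd ki.
  by rewrite /mono (bigD1 i) //= E [in RHS](bigD1 i) //= /y' upd_eq exprMn; ring.
rewrite my -mulrA -mulrBr normrM => h1.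
have y'd k : `|y' k - 0| < e.
  rewrite subr0 -(subrK (y k) (y' k)); apply: le_lt_trans (ler_normD _ _) _.
  have yis : `|y i| * s <= `|y i| by rewrite ler_piMr.
  rewrite (splitr e) ltr_leD //.
    by apply: le_lt_trans (yy k) _; apply: le_lt_trans yis _; apply: lt_le_trans (yd i) dele.
  by apply: ltW; apply: lt_le_trans (yd k) dele.
have y0d k : `|y k - 0| < e.
  rewrite subr0; apply: lt_le_trans (yd k) _; apply: le_trans dele _.
  by rewrite ler_pdivrMr // ler_peMr ?ltW // ltr1n.
have u'u := uK y y' (`|y i| * s) y0d y'd yy ys0.
have alN : (al i <= N)%N by rewrite /N (bigD1 i) //= leq_addr.
pose w := (1 + s) ^+ al i.
have w1 : 1 + s <= w.
  by rewrite /w -{1}[1 + s]expr1 ler_weXn2l ?lt0n // lerDl ltW.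
have w2 : w <= 2 ^+ N.
  apply: (@le_trans _ _ (2 ^+ al i)).
    by rewrite lerXn2r ?nnegrE ?addr_ge0 ?(ltW s0) //; move: s1; clear; lra.
  by rewrite ler_weXn2l // ler1n.
have h2 : s * (`|u o| / 4) <= `|w * u y' - u y|.
  have -> : w * u y' - u y = (w - 1) * u y - w * (u y - u y') by ring.
  apply: le_trans (lerB_dist _ _); rewrite !normrM (distrC (u y)).
  have w10 : 0 <= w - 1 by move: w1 s0; clear; lra.
  have w0 : 0 <= w by move: w10; clear; lra.
  rewrite (ger0_norm w10) (ger0_norm w0).
  have a1 : s * (`|u o| / 2) <= (w - 1) * `|u y|.
    by apply: ler_pM; [exact: ltW|rewrite divr_ge0|move: w1; clear; lra|exact: ltW].
  have a2 : w * `|u y' - u y| <= s * (`|u o| / 4).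
    apply: (@le_trans _ _ (2 ^+ N * (K * (`|y i| * s)))).
      by rewrite ler_pM.
    rewrite [leLHS](_ : _ = s * (`|y i| * (2 ^+ N * K))); last by ring.
    rewrite ler_pM2l // -ler_pdivlMr //.
    by apply: ltW; apply: lt_le_trans (yd i) delu.
  by move: a1 a2; clear; lra.
have h3 : `|mono al y| * (`|u o| / 4) <= L * `|y i|.
  rewrite -(ler_pM2r s0); apply: (@le_trans _ _ (`|mono al y| * `|w * u y' - u y|)).
    by rewrite -mulrA ler_wpM2l // mulrC.
  by rewrite -mulrA.
have N0 : (0 < N)%N by rewrite (leq_trans _ alN) // lt0n.
have yiN : `|y i| <= `|mono al y| `^ N%:R^-1.
  rewrite -{1}(powR_root (normr_ge0 (y i)) N0).
  apply: ge0_ler_powR; rewrite ?nnegrE ?exprn_ge0 ?invr_ge0 //.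
  rewrite /mono normr_prod /N -prodrXr; apply: ler_prod => k _.
  rewrite exprn_ge0 //= normrX; have [->|alk] := eqVneq (al k) 0%N; first by rewrite !expr0.
  by rewrite lerXn2r ?nnegrE // imin.
have mp : 0 < `|mono al y| `^ N%:R^-1 by rewrite powR_gt0 // normr_gt0.
rewrite -(ler_pM2r mp) -mulrA -powRD; last by rewrite normr_eq0 m0 implybT.
rewrite subrK powRr1 // mulrC; apply: le_trans h3 _.
by rewrite ler_wpM2l.
Qed.

Lemma ana_lip_fam (J : finType) (q : J -> (I -> R) -> R) a : (forall j, ana (q j) a) ->
  exists K e : R, [/\ 0 < K, 0 < e & forall j x y (t : R),
    (forall i, `|x i - a i| < e) -> (forall i, `|y i - a i| < e) ->
    (forall i, `|y i - x i| <= t) -> 0 <= t -> `|q j y - q j x| <= K * t].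
Proof.
move=> qa; have /choice[K KP] j := ana_lip (qa j).
have [|j|e e0 eP] := @fin_radius R J (fun j e => 0 < K j /\ forall x y (t : R),
    (forall i, `|x i - a i| < e) -> (forall i, `|y i - a i| < e) ->
    (forall i, `|y i - x i| <= t) -> 0 <= t -> `|q j y - q j x| <= K j * t).
- move=> j r r' [K0 rP] r'0 r'r; split=> // x y t xr yr.
  by apply: rP => i; apply: lt_le_trans r'r.
- by have [e [K0 e0 eP]] := KP j; exists e.
exists (1 + \sum_j K j), e; split=> //.
  by rewrite ltr_pwDl // sumr_ge0 // => j _; have [/ltW] := eP j.
move=> j x y t xe ye yx t0; have [Kj0 h] := eP j.
apply: le_trans (h x y t xe ye yx t0) _; rewrite ler_wpM2r //.
rewrite (bigD1 j) //= addrCA lerDl addr_ge0 // sumr_ge0 // => k _.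
by have [/ltW] := eP k.
Qed.

Lemma lip_at_comp (phi : I -> (I -> R) -> R) f (K e : R) y L : 0 < K ->
  (forall j x y (t : R), (forall i, `|x i| < e) -> (forall i, `|y i| < e) ->
    (forall i, `|y i - x i| <= t) -> 0 <= t -> `|phi j y - phi j x| <= K * t) ->
  (forall i, `|y i| < e / 2) ->
  lip_at f (at_phi phi y) L -> lip_at (fun y => f (at_phi phi y)) y (L * K).
Proof.
move=> K0 phiK ye [d d0 dP].
have [i0|nI] := pselect (exists i : I, True); last first.
  exists 1 => // z t t0 _ _; rewrite (_ : z = y) ?subrr ?normr0.
    have := lip_at_ge0 (ex_intro2 _ _ d d0 dP) => L0.
    by rewrite !mulr_ge0 // ltW.
  by apply/funext => i; case: nI; exists i.
have [i _] := i0; have e2 : 0 < e / 2 by apply: le_lt_trans (ye i).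
exists (Num.min (e / 2) (d / K)); first by rewrite lt_min e2 divr_gt0.
move=> z t t0; rewrite lt_min => /andP[te td] zy.
rewrite -mulrA; apply: dP; first by rewrite mulr_ge0 // ltW.
  by rewrite mulrC -ltr_pdivlMr.
move=> k; apply: phiK => // l.
  by apply: lt_le_trans (ye l) _; move: e2; clear; lra.
rewrite -(subrK (y l) (z l)) (splitr e); apply: le_lt_trans (ler_normD _ _) _.
by rewrite ltr_leD // ?(ltW (ye l)) //; exact: le_lt_trans (zy l) te.
Qed.

Lemma free_ultrafilter : exists U : set_system nat, UltraFilter U /\
  forall K, U [set k | (K <= k)%N].
Proof.
have [U [UU sU]] := ultraFilterLemma eventually_filter.
by exists U; split=> // K; apply: sU; exists K.
Qed.

(** One sequence of counterexamples exhausts the exponents [th k] -> 1 and the constants k + 1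
    together. In the uniformizing chart the inequality holds with the fixed exponent 1 - 1/N, N
    being the degree of the monomial; as |f| < 1, it then holds with [th k] once [th k] >= 1 -
    1/N. *)
Lemma lojasiewicz0 f : ana f o -> f o = 0 -> exists th C : R, [/\ 0 < th, th < 1, 0 < C &
  nearpt o (fun x => f x != 0 -> forall L, lip_at f x L -> `|f x| `^ th <= C * L)].
Proof.
move=> fa fo; apply: contrapT => nL.
pose th (k : nat) : R := 1 - k.+2%:R^-1.
have th01 k : 0 < th k < 1.
  by rewrite /th subr_gt0 invf_lt1 ?ltr1n ?ltr0Sn // gtrBl invr_gt0 ltr0Sn.
have /choice[XL XLP] k : exists xl : (I -> R) * R, [/\ forall i, `|xl.1 i| < k.+1%:R^-1,
    f xl.1 != 0, lip_at f xl.1 xl.2 & k.+1%:R * xl.2 < `|f xl.1| `^ th k].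
  apply: contrapT => nx; apply: nL; exists (th k), k.+1%:R.
  have /andP[t0 t1] := th01 k; split=> //; exists k.+1%:R^-1; first by rewrite invr_gt0.
  move=> x xk fx L Lx; rewrite leNgt; apply/negP => lt; apply: nx; exists (x, L).
  by split=> // i; have := xk i; rewrite subr0.
pose X k := (XL k).1; pose L k := (XL k).2.
have [U [UU Uoo]] := free_ultrafilter.
have Xi : infml U X.
  move=> i e e0; apply: filterS (Uoo (Num.bound e^-1)) => k /= ek.
  have [xk _ _ _] := XLP k; rewrite subr0; apply: lt_le_trans (xk i) _.
  have e1 : 0 <= e^-1 by rewrite invr_ge0 ltW.
  rewrite invf_ple ?posrE // (le_trans (ltW (archi_boundP e1))) // ler_nat.
  exact: leqW.
have f0 : nzg f.
  move=> /(ev_near Xi)/ev_ex[k fk]; have [_ + _ _] := XLP k.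
  by rewrite -/(X k) fk eqxx.
have fT : dep [set: I] f by move=> x y xy; congr f; apply/funext => i; exact: xy.
have [phi [Y [ch [al [u [_ _ ua u0 gE]]]]]] := uniformization_all fa fT f0 Xi.
have pa := chart_ana ch; have [_ _ _ Yi XY] := ch.
have [i0 ali0] : exists i, al i != 0%N.
  apply: contrapT => nal; have := nearpt_self gE.
  rewrite at_phi0 ?fo; last by move=> i; exact: (pa i).2.
  rewrite mono_o big1 ?mul1r => [/esym/eqP|i _]; first by rewrite (negPf u0).
  by case: eqP => // /eqP ai; case: nal; exists i.
have [c c0 cP] := mono_grad ua u0 (ex_intro _ i0 ali0).
set N := (\sum_i al i)%N in cP; set rh := 1 - N%:R^-1 in cP.
have N0 : (0 < N)%N by rewrite /N (bigD1 i0) //= addn_gt0 lt0n ali0.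
have rh0 : 0 <= rh by rewrite subr_ge0 invf_le1 ?ltr0n // ler1n.
have rh1 : rh <= 1 by rewrite /rh gerBl invr_ge0.
have [M' M'0 uM'] := ana_bounded ua.
pose M := Num.max 1 M'.
have M1 : 1 <= M by rewrite le_max lexx.
have [K [e [K0 e0 phiK]]] := ana_lip_fam (fun i => (pa i).1).
have phiK' j x y (t : R) : (forall i, `|x i| < e) -> (forall i, `|y i| < e) ->
    (forall i, `|y i - x i| <= t) -> 0 <= t -> `|phi j y - phi j x| <= K * t.
  by move=> xe ye; apply: phiK => i; rewrite subr0.
pose C := M / c * K.
have e2 : 0 < e / 2 by rewrite divr_gt0.
have ye : nearpt o (fun y : I -> R => forall i, `|y i| < e / 2).
  by exists (e / 2) => // y ye i; have := ye i; rewrite subr0.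
have f1 : nearpt o (fun x => `|f x| < 1).
  by have := ana_cont fa ltr01; rewrite fo; apply: nearptS => x; rewrite subr0.
have gg := nearpt_near gE.
have [k []] := ev_ex (evI (evI (evI XY (ev_near Yi (nearptI (nearptI ye gg) (nearptI cP uM'))))
  (ev_near Xi f1)) (Uoo (maxn N (Num.bound C)))).
move=> [[Xk [[yk gk] [ck uk]]] fk1] /=; rewrite geq_max => /andP[kN kC].
have [_ fk0 lk bad] := XLP k; rewrite -/(X k) -/(L k) in fk0 lk bad.
have L0 := lip_at_ge0 lk.
have gky := nearpt_self gk; rewrite -Xk in gky.
have mu0 : mono al (Y k) * u (Y k) != 0 by rewrite -gky.
have m0 : mono al (Y k) != 0 by move: mu0; rewrite mulf_eq0 negb_or => /andP[].
have lg : lip_at (fun y => mono al y * u y) (Y k) (L k * K).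
  rewrite Xk in lk; have [d d0 dP] := lip_at_comp K0 phiK' yk lk.
  have [d' d'0 d'P] := gk; exists (Num.min d d'); first by rewrite lt_min d0.
  move=> z t t0; rewrite lt_min => /andP[td td'] zy.
  rewrite -(d'P z) => [|i]; last exact: le_lt_trans (zy i) td'.
  by rewrite -gky Xk; exact: dP.
have := ck m0 _ lg; set m := mono al (Y k) in m0 gky mu0 * => h1.
have h2 : `|f (X k)| `^ rh <= C * L k.
  rewrite gky normrM powRM //; apply: (@le_trans _ _ (`|m| `^ rh * M)).
    rewrite ler_wpM2l ?powR_ge0 //; apply: (@le_trans _ _ (M `^ rh)).
      by apply: ge0_ler_powR; rewrite ?nnegrE ?(le_trans ler01 M1) // le_max uk orbT.
    exact: ler1_powR.
  rewrite /C (_ : M / c * K * L k = (L k * K / c) * M); last by ring.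
  rewrite ler_wpM2r ?(le_trans ler01 M1) // ler_pdivlMr // mulrC //.
have h3 : `|f (X k)| `^ th k <= `|f (X k)| `^ rh.
  apply: ger_powR; first by rewrite normr_gt0 fk0 ltW.
  rewrite /th /rh lerD2l lerN2 lef_pV2 ?posrE ?ltr0n // ler_nat.
  by apply: leq_trans kN _; rewrite !leqW.
have C0 : 0 <= C by rewrite /C !mulr_ge0 ?invr_ge0 ?(ltW c0) ?(ltW K0) ?(le_trans ler01 M1).
have h4 : C * L k <= k.+1%:R * L k.
  rewrite ler_wpM2r // (le_trans (ltW (archi_boundP C0))) // ler_nat.
  exact: leqW.
by move: bad; rewrite ltNge (le_trans h3) // (le_trans h2).
Qed.

Theorem lojasiewicz f a : ana f a -> f a = 0 -> exists th C : R, [/\ 0 < th, th < 1, 0 < C &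
  nearpt a (fun x => f x != 0 -> forall L, lip_at f x L -> `|f x| `^ th <= C * L)].
Proof.
move=> fa f0.
have [|th [C [t0 t1 C0 [e e0 eP]]]] := lojasiewicz0 (ana_shift fa).
  by rewrite -[RHS]f0; congr f; apply/funext => i; rewrite addr0.
exists th, C; split=> //; exists e => // x xa fx L [d d0 dP].
have xE : (fun i => a i + (x i - a i)) = x by apply/funext => i; rewrite addrC subrK.
have := eP (fun i => x i - a i); rewrite xE; apply=> //.
  by move=> i; rewrite subr0.
exists d => // y t t0' td yx; rewrite xE; apply: dP => // i.
by have := yx i; rewrite opprB addrA addrAC addrC addrA.
Qed.

End lojasiewicz_inequality.

(** * Positive definite matrices *)

Lemma horner_mx_diagonalized (F : fieldType) (d : nat) (A P : 'M[F]_d.+1)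
    (sp : 'rV_d.+1) (p : {poly F}) : P \in unitmx ->
  A = invmx P *m diag_mx sp *m P ->
  horner_mx A p = invmx P *m diag_mx (\row_i p.[sp 0 i]) *m P.
Proof.
move=> Pu ->; rewrite horner_mx_uconjC // horner_mx_diag.
by congr (_ *m diag_mx _ *m _); apply/rowP => i; rewrite !mxE.
Qed.

(** * Functional calculus of symmetric matrices *)

Section spectral_calculus.
Variables (R : realType) (d : nat).
Implicit Type D : 'M[R]_d.+1.

(** D is diagonalized over the complex numbers as a Hermitian matrix, and only what descends to the
    reals is kept: the eigenvalues, and the trace, determinant and vanishing of polynomials in D.
    This suffices for a calculus without real eigenvectors. *)
Lemma symmetric_spectrum D : D^T = D ->
  exists r : 'I_d.+1 -> R, forall p : {poly R},
  [/\ \tr (horner_mx D p) = \sum_i p.[r i],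
      \det (horner_mx D p) = \prod_i p.[r i] &
      (forall i, p.[r i] = 0) -> horner_mx D p = 0].
Proof.
move=> Ds.
have [f fE] : exists f : {rmorphism R -> complex R}, forall x, f x = real_complex R x.
  by exists (real_complex R).
set A := map_mx f D.
have Ah : A \is hermsymmx.
  apply/is_hermitianmxP; rewrite expr0 scale1r; apply/matrixP => i j.
  rewrite !mxE -[in LHS]Ds mxE; apply/eqP; rewrite eq_sym.
  by apply/eqP/CrealP; rewrite fE complex_real.
have [P [sp [Pu spr AE]]] : exists (P : 'M[complex R]_d.+1) sp,
    [/\ P \in unitmx, sp \is a mxOver Num.real & A = invmx P *m diag_mx sp *m P].
  exists (spectralmx A), (spectral_diag A); split; first exact: spectral_unit.
    exact: hermitian_spectral_diag_real.
  by apply/orthomx_spectralP; exact: hermitian_normalmx.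
have rE i : sp 0 i = f (complex.Re (sp 0 i)).
  move/mxOverP: spr => /(_ 0 i); rewrite -/sp => h.
  by rewrite fE RRe_real.
exists (fun i => complex.Re (sp 0 i)) => p.
have hE : map_mx f (horner_mx D p) =
    invmx P *m diag_mx (map_mx f (\row_i p.[complex.Re (sp 0 i)])) *m P.
  rewrite map_horner_mx -/A (horner_mx_diagonalized _ Pu AE).
  have -> // : \row_i (map_poly f p).[sp 0 i] =
    map_mx f (\row_i p.[complex.Re (sp 0 i)]).
  by apply/rowP => i; rewrite !mxE {1}rE horner_map.
have finj : injective f by exact: fmorph_inj.
split.
- apply: finj; rewrite -trace_map_mx hE mxtrace_mulC mulmxA mulmxV // mul1mx.
  by rewrite mxtrace_diag rmorph_sum; apply: eq_bigr => i _; rewrite !mxE.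
- apply: finj; rewrite -det_map_mx hE !det_mulmx det_inv det_diag mulrAC.
  rewrite mulVr ?mul1r; last by rewrite -unitmxE.
  by rewrite rmorph_prod; apply: eq_bigr => i _; rewrite !mxE.
- move=> p0; apply/matrixP => i j; apply: finj.
  have -> : f (horner_mx D p i j) = map_mx f (horner_mx D p) i j by rewrite mxE.
  rewrite hE (_ : \row_i _ = 0) ?map_mx0; last first.
    by apply/rowP => k; rewrite !mxE p0.
  by rewrite linear0 mulmx0 mul0mx !mxE raddf0.
Qed.

(** Interpolation on the spectrum turns functions of a matrix, such as the square root, into
    polynomials in it. *)
Lemma interpolation_poly (s : seq R) (g : R -> R) :
  exists p : {poly R}, forall x, x \in s -> p.[x] = g x.
Proof.
elim: s => [|a s [p hp]]; first by exists 0.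
have [as_|as_] := boolP (a \in s).
  by exists p => x; rewrite inE => /predU1P[->|]; exact: hp.
have [q qx qa] : exists2 q : {poly R},
    forall x : R, x \in s -> q.[x] = 0 & q.[a] != 0.
  exists (\prod_(y <- s) ('X - y%:P)).
    by move=> x xs; apply/rootP; rewrite root_prod_XsubC.
  by apply: contraNneq as_ => /rootP; rewrite root_prod_XsubC.
exists (p + ((g a - p.[a]) / q.[a])%:P * q) => x; rewrite inE.
move=> /predU1P[->|xs]; first by rewrite hornerD hornerM hornerC mulfVK // addrC subrK.
by rewrite hornerD hornerM (qx _ xs) mulr0 addr0 hp.
Qed.

End spectral_calculus.

(** * Quadratic forms and positive definiteness *)

Section quadratic_forms.
Context {R : realType}.

Definition qf n (S : 'M[R]_n) (u : 'cV[R]_n) : R := (u^T *m S *m u) 0 0.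
Definition dotp n (u v : 'cV[R]_n) : R := (u^T *m v) 0 0.

Section any_size.
Variable n : nat.
Implicit Types (S T M : 'M[R]_n) (u v : 'cV[R]_n).

Lemma dotpE u v : dotp u v = \sum_i u i 0 * v i 0.
Proof. by rewrite /dotp mxE; apply: eq_bigr => i _; rewrite mxE. Qed.

Lemma dotpC u v : dotp u v = dotp v u.
Proof. by rewrite !dotpE; apply: eq_bigr => i _; rewrite mulrC. Qed.

Lemma dotpDl u u' v : dotp (u + u') v = dotp u v + dotp u' v.
Proof. by rewrite /dotp linearD mulmxDl mxE. Qed.

Lemma dotpNl u v : dotp (- u) v = - dotp u v.
Proof. by rewrite /dotp linearN mulNmx mxE. Qed.

Lemma dotpZl a u v : dotp (a *: u) v = a * dotp u v.
Proof. by rewrite /dotp linearZ /= -scalemxAl mxE. Qed.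

Lemma dotpDr u v v' : dotp u (v + v') = dotp u v + dotp u v'.
Proof. by rewrite dotpC dotpDl !(dotpC u). Qed.

Lemma dotpNr u v : dotp u (- v) = - dotp u v.
Proof. by rewrite dotpC dotpNl dotpC. Qed.

Lemma dotpZr a u v : dotp u (a *: v) = a * dotp u v.
Proof. by rewrite dotpC dotpZl dotpC. Qed.

Lemma dotpBl u u' v : dotp (u - u') v = dotp u v - dotp u' v.
Proof. by rewrite dotpDl dotpNl. Qed.

Lemma dotpBr u v v' : dotp u (v - v') = dotp u v - dotp u v'.
Proof. by rewrite dotpDr dotpNr. Qed.

Lemma dotp_mul M u v : dotp u (M *m v) = dotp (M^T *m u) v.
Proof. by rewrite /dotp trmx_mul trmxK mulmxA. Qed.

Lemma dotp_ge0 u : 0 <= dotp u u.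
Proof. by rewrite dotpE sumr_ge0 // => i _; rewrite -expr2 sqr_ge0. Qed.

Lemma dotp_gt0 u : u != 0 -> 0 < dotp u u.
Proof.
move=> u0; rewrite lt_neqAle dotp_ge0 andbT eq_sym.
apply: contra u0; rewrite dotpE psumr_eq0; last first.
  by move=> i _; rewrite -expr2 sqr_ge0.
move=> /allP h; apply/eqP/colP => i; rewrite mxE.
by have := h i (mem_index_enum i); rewrite /= mulf_eq0 orbb => /eqP.
Qed.

Lemma qfE S u : qf S u = dotp u (S *m u).
Proof. by rewrite /qf /dotp mulmxA. Qed.

Lemma qf_tr S u : qf S u = \tr (S *m (u *m u^T)).
Proof. by rewrite /qf mulmxA mxtrace_mulC mulmxA /mxtrace big_ord1. Qed.

Lemma qfD S T u : qf (S + T) u = qf S u + qf T u.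
Proof. by rewrite /qf mulmxDr mulmxDl mxE. Qed.

Lemma qfZ a S u : qf (a *: S) u = a * qf S u.
Proof. by rewrite /qf -scalemxAr -scalemxAl mxE. Qed.

Lemma qfN S u : qf (- S) u = - qf S u.
Proof. by rewrite /qf mulmxN mulNmx mxE. Qed.

Lemma qf1 a u : qf a%:M u = a * dotp u u.
Proof. by rewrite -scalemx1 qfZ /qf mulmx1. Qed.

Lemma qf_congr M S u : qf (M^T *m S *m M) u = qf S (M *m u).
Proof. by rewrite /qf trmx_mul !mulmxA. Qed.

Lemma qf0 S : qf S 0 = 0.
Proof. by rewrite /qf mulmx0 mxE. Qed.

Lemma qfNr S u : qf S (- u) = qf S u.
Proof. by rewrite !qfE mulmxN dotpNl dotpNr opprK. Qed.

Lemma qfZr S a u : qf S (a *: u) = a ^+ 2 * qf S u.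
Proof. by rewrite !qfE -scalemxAr dotpZl dotpZr expr2 mulrA. Qed.

Lemma qfDr S u v : S^T = S ->
  qf S (u + v) = qf S u + 2 * dotp u (S *m v) + qf S v.
Proof.
move=> Ss; rewrite !qfE mulmxDr !dotpDl !dotpDr (dotp_mul _ v u) Ss.
rewrite (dotpC (S *m v)); ring.
Qed.

Lemma posdef_sym S : posdef S -> S^T = S. Proof. by case. Qed.

Lemma posdef_gt0 S u : posdef S -> u != 0 -> 0 < qf S u.
Proof. by case=> _; exact. Qed.

Lemma posdef_ge0 S u : posdef S -> 0 <= qf S u.
Proof.
move=> Sp; have [->|u0] := eqVneq u 0; first by rewrite qf0.
exact/ltW/posdef_gt0.
Qed.

Lemma posdefD S T : posdef S -> posdef T -> posdef (S + T).
Proof.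
move=> [Ss Sp] [Ts Tp]; split; first by rewrite linearD /= Ss Ts.
by move=> u u0; rewrite -/(qf _ _) qfD addr_gt0 //; [exact: Sp|exact: Tp].
Qed.

Lemma posdefDge0 S T : posdef S -> T^T = T -> (forall u, 0 <= qf T u) ->
  posdef (S + T).
Proof.
move=> [Ss Sp] Ts Tp; split; first by rewrite linearD /= Ss Ts.
by move=> u u0; rewrite -/(qf _ _) qfD ltr_wpDr //; exact: Sp.
Qed.

Lemma posdefZ a S : 0 < a -> posdef S -> posdef (a *: S).
Proof.
move=> a0 [Ss Sp]; split; first by rewrite linearZ /= Ss.
by move=> u u0; rewrite -/(qf _ _) qfZ mulr_gt0 //; exact: Sp.
Qed.

Lemma posdef_scalar a : 0 < a -> posdef (a%:M : 'M[R]_n).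
Proof.
move=> a0; split; first by rewrite tr_scalar_mx.
by move=> u u0; rewrite -/(qf _ _) qf1 mulr_gt0 // dotp_gt0.
Qed.

Lemma posdef_unit S : posdef S -> S \in unitmx.
Proof.
move=> [Ss Sp]; rewrite unitmxE unitfE; apply/negP => /det0P [v v0 vS].
have vT0 : v^T != 0 by apply: contra v0 => /eqP h; rewrite -[v]trmxK h trmx0.
by have := Sp _ vT0; rewrite trmxK vS mul0mx mxE ltxx.
Qed.

Lemma posdef_congr M S : M \in unitmx -> posdef S -> posdef (M^T *m S *m M).
Proof.
move=> Mu [Ss Sp]; split; first by rewrite !trmx_mul trmxK Ss mulmxA.
move=> u u0; rewrite -/(qf _ _) qf_congr; apply: Sp.
by apply: contra u0 => /eqP h; rewrite -[u](mulKmx Mu) h mulmx0.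
Qed.

Lemma qf_inv S u : posdef S -> qf (invmx S) u = qf S (invmx S *m u).
Proof.
by move=> Sp; rewrite !qfE mulKVmx ?posdef_unit // dotpC.
Qed.

Lemma posdef_inv S : posdef S -> posdef (invmx S).
Proof.
move=> Sp; have Su := posdef_unit Sp; have [Ss S0] := Sp.
split; first by rewrite trmx_inv Ss.
move=> u u0; rewrite -/(qf _ _) qf_inv //; apply: posdef_gt0 => //.
by apply: contra u0 => /eqP h; rewrite -[u](mulKVmx Su) h mulmx0.
Qed.

End any_size.

End quadratic_forms.

(** * Roots, Riccati equations and matrix entropy *)

Section posdef_spectral.
Variables (R : realType) (d : nat).
Local Notation n := d.+1.
Implicit Type D : 'M[R]_n.

Definition spectrum D (r : 'I_n -> R) := forall p : {poly R},
  [/\ \tr (horner_mx D p) = \sum_i p.[r i],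
      \det (horner_mx D p) = \prod_i p.[r i] &
      (forall i, p.[r i] = 0) -> horner_mx D p = 0].

Lemma horner_mx_sym D p : D^T = D -> (horner_mx D p)^T = horner_mx D p.
Proof.
move=> Ds; elim/poly_ind: p => [|p c IH]; first by rewrite rmorph0 trmx0.
rewrite rmorphD rmorphM /= horner_mx_C horner_mx_X linearD /= tr_scalar_mx.
rewrite -mulmxE trmx_mul Ds IH; congr (_ + _).
by have := comm_horner_mx p (erefl (D *m D) : comm_mx D D); rewrite /comm_mx => ->.
Qed.

(** A nonpositive eigenvalue r would make D - r positive definite and yet singular. *)
Lemma posdef_spectrum D : posdef D ->
  exists r, (forall i, 0 < r i) /\ spectrum D r.
Proof.
move=> Dp; have [r hr] := symmetric_spectrum (posdef_sym Dp).
exists r; split=> // i; rewrite ltNge; apply/negP => ri.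
have : posdef (horner_mx D ('X - (r i)%:P)).
  rewrite rmorphB /= horner_mx_X horner_mx_C -raddfN.
  apply: posdefDge0 => //; first by rewrite tr_scalar_mx.
  by move=> u; rewrite qf1 mulr_ge0 ?oppr_ge0 ?dotp_ge0.
move/posdef_unit; rewrite unitmxE unitfE; have [_ -> _] := hr ('X - (r i)%:P).
by rewrite (bigD1 i) //= !hornerE subrr mul0r eqxx.
Qed.

(** With q interpolating the square root of p on the spectrum, p(D) is the square of the invertible
    symmetric matrix q(D). *)
Lemma symmetric_horner_posdef D r p : D^T = D -> spectrum D r ->
  (forall i, 0 < p.[r i]) -> posdef (horner_mx D p).
Proof.
move=> Ds hr hp.
have [q hq] := interpolation_poly [seq r i | i : 'I_n] (fun x => Num.sqrt p.[x]).
have {hq}hq i : q.[r i] = Num.sqrt p.[r i] by apply: hq; apply: map_f; rewrite mem_enum.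
have -> : horner_mx D p = (horner_mx D q)^T *m 1%:M *m horner_mx D q.
  rewrite horner_mx_sym // mulmx1; have [_ _ h0] := hr (p - q * q).
  suff : horner_mx D (p - q * q) = 0.
    by rewrite rmorphB rmorphM /= -mulmxE => /eqP; rewrite subr_eq0 => /eqP.
  by apply: h0 => i; rewrite !hornerE hq -expr2 sqr_sqrtr ?subrr // ltW.
apply: posdef_congr; last exact: posdef_scalar.
rewrite unitmxE unitfE; have [_ -> _] := hr q.
by apply/prodf_neq0 => i _; rewrite hq gt_eqF // sqrtr_gt0.
Qed.

Lemma posdef_horner D r p : posdef D -> spectrum D r ->
  (forall i, 0 < p.[r i]) -> posdef (horner_mx D p).
Proof. by move=> /posdef_sym; exact: symmetric_horner_posdef. Qed.

Lemma posdef_root D (g : R -> R) :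
  posdef D -> (forall x, 0 < x -> 0 < g x) ->
  exists (r : 'I_n -> R) (M : 'M[R]_n) p, [/\ posdef M, M = horner_mx D p, spectrum D r,
    forall i, 0 < r i & forall i, p.[r i] = g (r i)].
Proof.
move=> Dp g0; have [r [r0 hr]] := posdef_spectrum Dp.
have [p hp] := interpolation_poly [seq r i | i : 'I_n] g.
have {}hp i : p.[r i] = g (r i) by apply: hp; apply: map_f; rewrite mem_enum.
exists r, (horner_mx D p), p; split => //.
by apply: (posdef_horner Dp hr) => i; rewrite hp g0.
Qed.

Lemma posdef_quadratic D (k : R) : posdef D ->
  exists2 M, posdef M & M *m M + k *: M = D.
Proof.
(* The positive root y of y^2 + k * y = x, to be applied to each eigenvalue x. *)
move=> Dp; pose g x := (- k + Num.sqrt (k ^+ 2 + 4 * x)) / 2.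
have gE x : 0 < x -> g x * g x + k * g x = x.
  move=> x0; rewrite /g.
  have : Num.sqrt (k ^+ 2 + 4 * x) ^+ 2 = k ^+ 2 + 4 * x.
    by rewrite sqr_sqrtr // addr_ge0 ?sqr_ge0 // mulr_ge0 // ltW.
  by move: (Num.sqrt _) => y; rewrite !expr2 => yE; field: yE.
have g0 x : 0 < x -> 0 < g x.
  move=> x0; rewrite /g divr_gt0 // addrC subr_gt0.
  have [k0|k0] := ltP k 0; first by rewrite (lt_le_trans k0) // sqrtr_ge0.
  rewrite -[ltLHS]ger0_norm // -sqrtr_sqr ltr_sqrt ?ltrDl ?mulr_gt0 //.
  by rewrite ltr_wpDl ?sqr_ge0 ?mulr_gt0.
have [r [M [p [Mp ME hr r0 hp]]]] := posdef_root Dp g0.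
exists M => //; have [_ _ h0] := hr (p * p + k *: p - 'X).
suff : horner_mx D (p * p + k *: p - 'X) = 0.
  rewrite rmorphB rmorphD rmorphM /= horner_mx_X -mulmxE horner_mxZ -ME.
  by move=> /eqP; rewrite subr_eq0 => /eqP.
by apply: h0; move=> i; rewrite !hornerE !hp gE // subrr.
Qed.

Lemma posdef_sqrt D : posdef D -> exists2 H, posdef H & H *m H = D.
Proof.
by move=> /(posdef_quadratic 0) [H Hp]; rewrite scale0r addr0; exists H.
Qed.

(** Conjugation by the square root H of B turns the equation into M^2 + k M = H C H for M = H L
    H. *)
Lemma posdef_riccati (B C : 'M[R]_n) (k : R) : posdef B -> posdef C ->
  exists2 L, posdef L & L *m B *m L + k *: L = C.
Proof.
move=> /posdef_sqrt [H Hp <-] Cp; have Hu := posdef_unit Hp.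
have Hs := posdef_sym Hp; have Hi := posdef_inv Hp.
have Dp := posdef_congr Hu Cp; rewrite Hs in Dp.
have [M Mp ME] := posdef_quadratic k Dp.
exists (invmx H *m M *m invmx H).
  have := posdef_congr (posdef_unit Hi) Mp.
  by rewrite (posdef_sym Hi).
apply: (can_inj (mulKmx Hu)); apply: (can_inj (mulmxK Hu)).
rewrite -ME mulmxDr mulmxDl -!scalemxAr -!scalemxAl.
by rewrite !mulmxA mulmxV // mul1mx !mulmxKV // ?mulmxK.
Qed.

Lemma spectrum_tr D r : spectrum D r -> \tr D = \sum_i r i.
Proof.
move=> /(_ 'X) [h _ _]; rewrite horner_mx_X in h; rewrite h.
by apply: eq_bigr => i _; rewrite hornerX.
Qed.

Lemma spectrum_det D r : spectrum D r -> \det D = \prod_i r i.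
Proof.
move=> /(_ 'X) [_ h _]; rewrite horner_mx_X in h; rewrite h.
by apply: eq_bigr => i _; rewrite hornerX.
Qed.

Lemma ln_prod (I : finType) (r : I -> R) : (forall i, 0 < r i) ->
  ln (\prod_i r i) = \sum_i ln (r i) /\ 0 < \prod_i r i.
Proof.
move=> r0; elim/big_ind2: _ => [|x y x' y' [<- x0] [<- y0]|i _] //.
  by rewrite ln1.
by rewrite lnM ?posrE // mulr_gt0.
Qed.

Lemma posdef_det D : posdef D -> 0 < \det D.
Proof.
move=> /posdef_spectrum [r [r0 hr]]; rewrite (spectrum_det hr).
by have [] := ln_prod r0.
Qed.

Lemma posdef_tr_ge0 D : posdef D -> 0 <= \tr D.
Proof.
move=> /posdef_spectrum [r [r0 hr]]; rewrite (spectrum_tr hr).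
by apply: sumr_ge0 => i _; rewrite ltW.
Qed.

(** Twice the relative entropy of the centred Gaussian of covariance D with respect to the standard
    one. *)
Definition entropy D : R := \tr D - n%:R - ln (\det D).

Lemma spectrum_entropy D r : (forall i, 0 < r i) -> spectrum D r ->
  entropy D = \sum_i (r i - 1 - ln (r i)).
Proof.
move=> r0 hr; rewrite /entropy (spectrum_tr hr) (spectrum_det hr).
have [-> _] := ln_prod r0; rewrite !sumrB; congr (_ - _ - _).
by rewrite sumr_const card_ord.
Qed.

(** With y the square root of x, ln x = 2 ln y <= 2 (y - 1) gives x - 1 - ln x >= (y - 1)^2, and the
    remaining polynomial inequality has the difference (y - 1)^4. *)
Lemma entropy1_lower (x : R) : 0 < x -> (x - 1) ^+ 2 <= 2 * (x + 1) * (x - 1 - ln x).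
Proof.
move=> x0; set y := Num.sqrt x; have y0 : 0 < y by rewrite sqrtr_gt0.
have xE : x = y * y by rewrite -expr2 sqr_sqrtr // ltW.
have ly : ln y <= y - 1 by have := @le_ln1Dx _ (y - 1); rewrite addrCA subrr addr0; apply; lra.
have -> : ln x = ln y + ln y by rewrite xE lnM ?posrE.
move: ly; move: (ln y) => l; rewrite xE => ly.
have : 2 * (y * y + 1) * ((y - 1) * (y - 1)) <= 2 * (y * y + 1) * (y * y - 1 - (l + l)).
  by rewrite ler_pM2l; nra.
suff : (y * y - 1) ^+ 2 <= 2 * (y * y + 1) * ((y - 1) * (y - 1)) by lra.
have : 0 <= ((y - 1) * (y - 1)) * ((y - 1) * (y - 1)) by rewrite -!expr2 sqr_ge0.
rewrite -subr_ge0 => h; rewrite -subr_ge0; apply: le_trans h _.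
by rewrite le_eqVlt; apply/orP; left; apply/eqP; ring.
Qed.

Lemma entropy1_ge0 (x : R) : 0 < x -> 0 <= x - 1 - ln x.
Proof.
by move=> x0; have := @le_ln1Dx _ (x - 1); rewrite addrCA subrr addr0 => h; lra.
Qed.

Lemma entropy1_bounds (x K : R) : 0 < x -> x - 1 - ln x <= K ->
  expR (- (K + 2)) < x /\ x < 2 * K + 3.
Proof.
move=> x0 xK; split.
  rewrite -[ltRHS]lnK ?posrE // ltr_expR; lra.
(* The bound ln z <= z - 1 at z = x / 2 consumes only half of x, so the other half is bounded in
   terms of K. *)
have := @le_ln1Dx _ (x / 2 - 1); rewrite addrCA subrr addr0 => h.
have {}h : ln (x / 2) <= x / 2 - 1 by apply: h; lra.
have l2 : ln 2 <= 1 :> R.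
  by have := @le_ln1Dx R 1; apply; lra.
rewrite ln_div ?posrE // in h; lra.
Qed.

Lemma entropy_ge0 D : posdef D -> 0 <= entropy D.
Proof.
move=> /posdef_spectrum [r [r0 hr]]; rewrite (spectrum_entropy r0 hr).
by apply: sumr_ge0 => i _; exact: entropy1_ge0.
Qed.

Lemma entropy_lower D : posdef D ->
  \tr ((D - 1%:M) *m (D - 1%:M)) <= 2 * (\tr D + 1) * entropy D.
Proof.
move=> /posdef_spectrum [r [r0 hr]]; rewrite (spectrum_entropy r0 hr).
have [h _ _] := hr (('X - 1) * ('X - 1)).
rewrite rmorphM rmorphB /= rmorph1 horner_mx_X -mulmxE in h; rewrite h.
rewrite (spectrum_tr hr) mulr_sumr ler_sum // => i _.
rewrite !hornerE -expr2; apply: le_trans (entropy1_lower (r0 i)) _.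
rewrite ler_wpM2r ?entropy1_ge0 // ler_wpM2l // lerD2r.
by rewrite (bigD1 i) //= lerDl sumr_ge0 // => j _; rewrite ltW.
Qed.

Lemma entropy_bounds D K : posdef D -> entropy D <= K ->
  [/\ posdef (D - (expR (- (K + 2)))%:M), posdef ((2 * K + 3)%:M - D) &
      \tr D <= n%:R * (2 * K + 3)].
Proof.
move=> Dp; have [r [r0 hr]] := posdef_spectrum Dp.
rewrite (spectrum_entropy r0 hr) => hK.
have hi i : expR (- (K + 2)) < r i /\ r i < 2 * K + 3.
  apply: entropy1_bounds => //; apply: le_trans hK.
  by rewrite (bigD1 i) //= lerDl sumr_ge0 // => j _; exact: entropy1_ge0.
split.
- have := @posdef_horner _ _ ('X - (expR (- (K + 2)))%:P) Dp hr.
  rewrite rmorphB /= horner_mx_X horner_mx_C; apply => i.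
  by rewrite hornerD hornerN hornerX hornerC subr_gt0; case: (hi i).
- have := @posdef_horner _ _ ((2 * K + 3)%:P - 'X) Dp hr.
  rewrite rmorphB /= horner_mx_X horner_mx_C; apply => i.
  by rewrite hornerD hornerN hornerX hornerC subr_gt0; case: (hi i).
- rewrite (spectrum_tr hr); apply: le_trans (_ : \sum_(i < n) (2 * K + 3) <= _).
    by apply: ler_sum => i _; case: (hi i) => _ /ltW.
  by rewrite sumr_const card_ord -[leLHS]mulr_natl.
Qed.

Lemma posdef_le_tr D : posdef D -> posdef ((\tr D + 1)%:M - D).
Proof.
move=> Dp; have [r [r0 hr]] := posdef_spectrum Dp.
have := @posdef_horner _ _ ((\tr D + 1)%:P - 'X) Dp hr.
rewrite rmorphB /= horner_mx_X horner_mx_C; apply => i.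
rewrite hornerD hornerN hornerX hornerC subr_gt0 (spectrum_tr hr) (bigD1 i) //=.
by rewrite -addrA ltrDl ltr_wpDl // sumr_ge0 // => j _; rewrite ltW.
Qed.

End posdef_spectral.

(** * Relative entropy and the optimal Gaussian pair *)

Lemma invmx_mul (F : fieldType) n (A B : 'M[F]_n) :
  A \in unitmx -> B \in unitmx -> invmx (A *m B) = invmx B *m invmx A.
Proof.
move=> Au Bu; have ABu : A *m B \in unitmx by rewrite unitmx_mul Au.
apply: (can_inj (mulKmx ABu)); rewrite mulmxV // -mulmxA (mulmxA B) mulmxV //.
by rewrite mul1mx mulmxV.
Qed.

(** * Relative entropy of Gaussians *)

Section gaussian_divergence.
Variables (R : realType) (d : nat).
Local Notation n := d.+1.
Implicit Types (q nu : gparam R n) (S Q L : 'M[R]_n).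

Definition frob m k (X : 'M[R]_(m, k)) : R := \sum_i \sum_j X i j ^+ 2.

Lemma frob_ge0 m k (X : 'M[R]_(m, k)) : 0 <= frob X.
Proof. by apply: sumr_ge0 => i _; apply: sumr_ge0 => j _; rewrite sqr_ge0. Qed.

Lemma frob_tr m k (X : 'M[R]_(m, k)) : frob X = \tr (X^T *m X).
Proof.
rewrite /frob exchange_big; apply: eq_bigr => j _; rewrite mxE.
by apply: eq_bigr => i _; rewrite mxE expr2.
Qed.

Lemma frob_dotp m (u : 'cV[R]_m) : frob u = dotp u u.
Proof. by rewrite frob_tr /mxtrace big_ord1. Qed.

Lemma sum_Cauchy (I : finType) (f g : I -> R) :
  (\sum_i f i * g i) ^+ 2 <= (\sum_i f i ^+ 2) * (\sum_i g i ^+ 2).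
Proof.
set F := \sum_i f i ^+ 2; set G := \sum_i g i ^+ 2; set H := \sum_i _.
have F0 : 0 <= F by apply: sumr_ge0 => i _; exact: sqr_ge0.
have key : 0 <= F * (F * G - H ^+ 2).
  have : 0 <= \sum_i (F * g i - H * f i) ^+ 2.
    by apply: sumr_ge0 => i _; exact: sqr_ge0.
  rewrite (_ : \sum_i _ = F ^+ 2 * G - 2 * F * H * H + H ^+ 2 * F).
    by move=> h; rewrite (_ : F * _ = F ^+ 2 * G - 2 * F * H * H + H ^+ 2 * F) //; ring.
  transitivity (\sum_i (F ^+ 2 * g i ^+ 2) - \sum_i (2 * F * H * (f i * g i)) +
                \sum_i (H ^+ 2 * f i ^+ 2)).
    by rewrite -sumrB -big_split /=; apply: eq_bigr => i _; ring.
  by rewrite -!mulr_sumr.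
have [F1|F1] := ltP 0 F; first by rewrite pmulr_rge0 // subr_ge0 in key.
have {}F0 : F = 0 by apply/eqP; rewrite eq_le F1 F0.
have f0 i : f i = 0.
  move/eqP: F0; rewrite psumr_eq0 => [/allP/(_ i)|j _]; last exact: sqr_ge0.
  by rewrite mem_index_enum sqrf_eq0 => /(_ isT)/eqP.
rewrite F0 mul0r /H big1 ?expr0n // => i _; by rewrite f0 mul0r.
Qed.

Lemma frobM m k l (X : 'M[R]_(m, k)) (Y : 'M[R]_(k, l)) :
  frob (X *m Y) <= frob X * frob Y.
Proof.
rewrite {2}/frob mulr_suml {1}/frob; apply: ler_sum => i _.
rewrite /frob exchange_big mulr_sumr; apply: ler_sum => j _.
by rewrite mxE; exact: sum_Cauchy.
Qed.

Lemma dotp_sq_le S (k : R) z : posdef S -> (forall u, qf S u <= k * dotp u u) ->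
  dotp (S *m z) (S *m z) <= k * qf S z.
Proof.
move=> Sp Sk; have [G Gp GE] := posdef_sqrt Sp; have Gs := posdef_sym Gp.
have -> : dotp (S *m z) (S *m z) = qf S (G *m z).
  by rewrite qfE -GE -!mulmxA [in RHS]dotp_mul Gs.
apply: le_trans (Sk _) _; rewrite le_eqVlt; apply/orP; left; apply/eqP.
by rewrite qfE -GE -mulmxA [in RHS]dotp_mul Gs.
Qed.

Lemma qf_le_tr S u : posdef S -> qf S u <= (\tr S + 1) * dotp u u.
Proof.
move=> Sp; have := posdef_ge0 u (posdef_le_tr Sp).
by rewrite qfD qfN qf1 subr_ge0.
Qed.

Lemma qf_inv_ge S (k : R) w : posdef S -> (forall u, qf S u <= k * dotp u u) ->
  dotp w w <= k * qf (invmx S) w.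
Proof.
move=> Sp Sk; rewrite qf_inv //.
by have := dotp_sq_le (invmx S *m w) Sp Sk; rewrite mulKVmx // posdef_unit.
Qed.

(* KL(N(q) | N(nu)). *)
Definition gKL q nu : R :=
  (\tr (invmx nu.2 *m (q.2 + (q.1 - nu.1) *m (q.1 - nu.1)^T)) - n%:R
   + ln (\det nu.2) - ln (\det q.2)) / 2.

(** Whitening by H, the inverse square root of the covariance of nu, separates the contributions of
    covariance and mean. *)
Lemma gKL_entropy q nu : posdef q.2 -> posdef nu.2 ->
  exists2 H : 'M[R]_n, posdef H /\ H *m H = invmx nu.2 &
    gKL q nu = (entropy (H *m q.2 *m H) + qf (invmx nu.2) (q.1 - nu.1)) / 2.
Proof.
move=> Qp Sp; have [H Hp HE] := posdef_sqrt (posdef_inv Sp); exists H => //.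
rewrite /gKL /entropy mulmxDr mxtraceD -qf_tr; congr (_ / 2).
have -> : \tr (H *m q.2 *m H) = \tr (invmx nu.2 *m q.2).
  by rewrite mxtrace_mulC mulmxA HE.
have dS := posdef_det Sp; have dQ := posdef_det Qp; have dH := posdef_det Hp.
have -> : ln (\det (H *m q.2 *m H)) = ln (\det q.2) - ln (\det nu.2).
  rewrite -ln_div ?posrE //; congr ln.
  have : \det H * \det H = (\det nu.2)^-1 by rewrite -det_mulmx HE det_inv.
  by rewrite !det_mulmx => <-; ring.
ring.
Qed.

Lemma gKL_ge0 q nu : posdef q.2 -> posdef nu.2 -> 0 <= gKL q nu.
Proof.
move=> Qp Sp; have [H [Hp HE] ->] := gKL_entropy Qp Sp.
rewrite divr_ge0 // addr_ge0 //; last exact/posdef_ge0/posdef_inv.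
apply: entropy_ge0; rewrite -{1}(posdef_sym Hp).
by apply: posdef_congr => //; exact: posdef_unit.
Qed.

Lemma gKL_bounds (K : R) q nu : posdef q.2 -> posdef nu.2 -> gKL q nu <= K ->
  [/\ posdef (q.2 - expR (- (2 * K + 2)) *: nu.2),
      posdef ((4 * K + 3) *: nu.2 - q.2) &
      dotp (q.1 - nu.1) (q.1 - nu.1) <= (\tr nu.2 + 1) * (2 * K)].
Proof.
move=> Qp Sp; have [H [Hp HE] ->] := gKL_entropy Qp Sp.
have Hu := posdef_unit Hp; have Hs := posdef_sym Hp.
have HQp : posdef (H *m q.2 *m H) by rewrite -{1}Hs; exact: posdef_congr.
have e0 := entropy_ge0 HQp.
have m0 := posdef_ge0 (q.1 - nu.1) (posdef_inv Sp) => hK.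
have {}hK : entropy (H *m q.2 *m H) <= 2 * K /\ qf (invmx nu.2) (q.1 - nu.1) <= 2 * K.
  by split; move: e0 m0 hK; move: (entropy _) (qf _ _) => x y; lra.
have Si : invmx H *m invmx H = nu.2.
  by rewrite -invmx_mul // HE invmxK.
have cong X : posdef X -> posdef (invmx H *m X *m invmx H).
  have Hi := posdef_inv Hp; move=> Xp; have := posdef_congr (posdef_unit Hi) Xp.
  by rewrite (posdef_sym Hi).
have QE : invmx H *m (H *m q.2 *m H) *m invmx H = q.2.
  by rewrite !mulmxA mulVmx // mul1mx mulmxK.
have [c1 c2 _] := entropy_bounds HQp hK.1.
split.
- have := cong _ c1; rewrite mulmxBr mulmxBl QE mul_mx_scalar -scalemxAl Si.
  by [].
- have := cong _ c2; rewrite mulmxBr mulmxBl QE mul_mx_scalar -scalemxAl Si.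
  by rewrite (_ : 2 * (2 * K) = 4 * K) //; ring.
- apply: le_trans (qf_inv_ge _ Sp (fun u => qf_le_tr u Sp)) _.
  by rewrite ler_wpM2l ?hK.2 // ?addr_ge0 ?posdef_tr_ge0.
Qed.

Let gKL_lower_aux (a b x y : R) : 0 <= a -> 0 <= b -> 0 <= x -> 0 <= y ->
  (a + 1) * y + a * (a * (2 * (b + 1) * x)) <=
  4 * (a + 1) ^+ 2 * (b + 1) * ((x + y) / 2).
Proof.
move=> a0 b0 x0 y0.
have -> : 4 * (a + 1) ^+ 2 * (b + 1) * ((x + y) / 2) =
  2 * (a + 1) ^+ 2 * (b + 1) * x + 2 * (a + 1) ^+ 2 * (b + 1) * y by field.
rewrite addrC lerD //.
  have -> : a * (a * (2 * (b + 1) * x)) = 2 * (a ^+ 2) * (b + 1) * x by ring.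
  rewrite ler_wpM2r // ler_wpM2r ?addr_ge0 // ler_wpM2l //.
  by rewrite ler_pXn2r ?nnegrE // ?lerDl // addr_ge0.
rewrite ler_wpM2r //; have -> : 2 * (a + 1) ^+ 2 * (b + 1) =
  (a + 1) * (2 * (a + 1) * (b + 1)) by ring.
rewrite ler_peMr ?addr_ge0 //; nra.
Qed.

(** This converts ascent measured by relative entropy into a bound on squared parameter distances;
    under the a priori bounds on a trajectory the factor is uniform. *)
Lemma gKL_lower q nu : posdef q.2 -> posdef nu.2 ->
  frob (q.1 - nu.1) + frob (q.2 - nu.2) <=
  4 * (\tr nu.2 + 1) ^+ 2 * (\tr (invmx nu.2 *m q.2) + 1) * gKL q nu.
Proof.
move=> Qp Sp; have [H [Hp HE] ->] := gKL_entropy Qp Sp.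
have Hu := posdef_unit Hp; have Hs := posdef_sym Hp.
have HQp : posdef (H *m q.2 *m H) by rewrite -{1}Hs; exact: posdef_congr.
have Si : invmx H *m invmx H = nu.2 by rewrite -invmx_mul // HE invmxK.
have trE : \tr (H *m q.2 *m H) = \tr (invmx nu.2 *m q.2).
  by rewrite mxtrace_mulC mulmxA HE.
have e0 := entropy_ge0 HQp; have el := entropy_lower HQp.
have tS := posdef_tr_ge0 Sp; have tQ := posdef_tr_ge0 HQp.
have m0 := posdef_ge0 (q.1 - nu.1) (posdef_inv Sp).
have h1 : frob (q.1 - nu.1) <= (\tr nu.2 + 1) * qf (invmx nu.2) (q.1 - nu.1).
  by rewrite frob_dotp; exact: qf_inv_ge Sp (fun u => qf_le_tr u Sp).
have His : (invmx H)^T = invmx H by rewrite trmx_inv Hs.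
have fH : frob (invmx H) = \tr nu.2 by rewrite frob_tr His Si.
have h2 : frob (q.2 - nu.2) <= \tr nu.2 * (\tr nu.2 *
    (2 * (\tr (H *m q.2 *m H) + 1) * entropy (H *m q.2 *m H))).
  set X := H *m q.2 *m H - 1%:M in el.
  have -> : q.2 - nu.2 = invmx H *m (X *m invmx H).
    rewrite /X mulmxBl mul1mx mulmxBr Si; congr (_ - _).
    by rewrite !mulmxA mulVmx // mul1mx mulmxK.
  apply: le_trans (frobM _ _) _; rewrite fH ler_wpM2l //.
  apply: le_trans (frobM _ _) _; rewrite fH mulrC ler_wpM2l //.
  suff -> : frob X = \tr (X *m X) by [].
  have Xs : X^T = X by rewrite /X raddfB /= tr_scalar_mx (posdef_sym HQp).
  by rewrite frob_tr Xs.
rewrite trE in tQ h2 *; apply: le_trans (lerD h1 h2) _.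
exact: gKL_lower_aux.
Qed.

Lemma gKL_eq0 q nu : posdef q.2 -> posdef nu.2 -> gKL q nu <= 0 -> q = nu.
Proof.
move=> Qp Sp h; have {}h : gKL q nu = 0.
  by apply/eqP; rewrite eq_le h gKL_ge0.
have := gKL_lower Qp Sp; rewrite h mulr0.
have f1 := frob_ge0 (q.1 - nu.1); have f2 := frob_ge0 (q.2 - nu.2) => h'.
have f0 m k (X : 'M[R]_(m, k)) : frob X <= 0 -> X = 0.
  move=> X0; have {X0} /eqP : frob X = 0 by apply/eqP; rewrite eq_le X0 frob_ge0.
  rewrite psumr_eq0 => [/allP hX|i _]; last first.
    by apply: sumr_ge0 => j _; exact: sqr_ge0.
  apply/matrixP => i j; have := hX i (mem_index_enum i).
  rewrite /= psumr_eq0 => [/allP/(_ j)|k' _]; last exact: sqr_ge0.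
  by rewrite mem_index_enum sqrf_eq0 mxE => /(_ isT)/eqP.
have e1 : q.1 = nu.1 by apply/subr0_eq/f0; lra.
have e2 : q.2 = nu.2 by apply/subr0_eq/f0; lra.
by rewrite [q]surjective_pairing e1 e2 -surjective_pairing.
Qed.

End gaussian_divergence.

(** * The optimal pair and its dual potentials *)

Section optimal_pair.
Variables (R : realType) (d : nat).
Local Notation n := d.+1.
Implicit Types (mu nu : gparam R n) (L : 'M[R]_n).

(* L is the linear part of the optimal map from p to q, so Q = L P L; the equation
   results from eliminating P and Q from the two first-order optimality conditions. *)
Definition opt_eq (t0 t1 : R) mu nu L :=
  L *m (invmx nu.2 + (2 / t1)%:M) *m L + (2 / t0 - 2 / t1) *: L =
  invmx mu.2 + (2 / t0)%:M.

(** Precision of the first optimal marginal P: stationarity of the cost in P reads P^-1 = mu.2^-1 +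
    (2 / t0) (1 - L). *)
Definition opt_Pi (t0 : R) mu L := invmx mu.2 + (2 / t0)%:M - (2 / t0) *: L.
Definition opt_P (t0 : R) mu L := invmx (opt_Pi t0 mu L).
Definition opt_Q (t0 : R) mu L := L *m opt_P t0 mu L *m L.
(** The difference u - v of the optimal means, solved from the two linear stationarity conditions on
    the means. *)
Definition opt_w (t0 t1 : R) mu nu : 'cV[R]_n :=
  invmx (1%:M + (2 / t0) *: mu.2 + (2 / t1) *: nu.2) *m (mu.1 - nu.1).
Definition opt_u (t0 t1 : R) mu nu := mu.1 - (2 / t0) *: (mu.2 *m opt_w t0 t1 mu nu).
Definition opt_v (t0 t1 : R) mu nu := nu.1 + (2 / t1) *: (nu.2 *m opt_w t0 t1 mu nu).
Definition opt_p t0 t1 mu nu L : gparam R n := (opt_u t0 t1 mu nu, opt_P t0 mu L).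
Definition opt_q t0 t1 mu nu L : gparam R n := (opt_v t0 t1 mu nu, opt_Q t0 mu L).

(** [opt_kp] and [opt_kq] are the constants with log(dp/dmu) = opt_kp - opt_phi / t0 and log(dq/dnu)
    = opt_kq - opt_psi / t1; together with |w|^2 they make up the dual value [opt_A]. *)
Definition opt_kp t0 t1 mu nu L : R :=
  (ln (\det mu.2) + ln (\det (opt_Pi t0 mu L))
   + (2 / t0) ^+ 2 * qf mu.2 (opt_w t0 t1 mu nu)) / 2.
Definition opt_kq t0 t1 mu nu L : R :=
  (ln (\det nu.2) + ln (\det (opt_Pi t0 mu L)) - 2 * ln (\det L)
   + (2 / t1) ^+ 2 * qf nu.2 (opt_w t0 t1 mu nu)) / 2.
Definition opt_A t0 t1 mu nu L : R :=
  dotp (opt_w t0 t1 mu nu) (opt_w t0 t1 mu nu)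
  + t0 * opt_kp t0 t1 mu nu L + t1 * opt_kq t0 t1 mu nu L.

(** The Kantorovich potentials of the affine map x -> v + L (x - u), centred at the optimal
    means. *)
Definition opt_phi t0 t1 mu nu L (x : 'cV[R]_n) : R :=
  qf (1%:M - L) (x - opt_u t0 t1 mu nu)
  + 2 * dotp (opt_w t0 t1 mu nu) (x - opt_u t0 t1 mu nu).
Definition opt_psi t0 t1 mu nu L (y : 'cV[R]_n) : R :=
  qf (1%:M - invmx L) (y - opt_v t0 t1 mu nu)
  - 2 * dotp (opt_w t0 t1 mu nu) (y - opt_v t0 t1 mu nu).

(* Logarithm of the density of N(m, S), without the factor (2 pi)^(-n/2). *)
Definition log_density nu (x : 'cV[R]_n) : R :=
  - (ln (\det nu.2) + qf (invmx nu.2) (x - nu.1)) / 2.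
Definition mean_log_density q nu : R :=
  - (ln (\det nu.2) + \tr (invmx nu.2 *m (q.2 + (q.1 - nu.1) *m (q.1 - nu.1)^T))) / 2.

Lemma gKL_mean_log_density (q : gparam R n) nu : posdef q.2 ->
  gKL q nu = mean_log_density q q - mean_log_density q nu.
Proof.
move=> Qp; rewrite /gKL /mean_log_density subrr mul0mx addr0.
rewrite mulVmx ?posdef_unit // mxtrace1; move: (\tr _) (ln _) (ln _) => a b c.
by field.
Qed.

Lemma qf_inv_mul (S : 'M[R]_n) w : posdef S -> qf (invmx S) (S *m w) = qf S w.
Proof. by move=> Sp; rewrite !qfE mulKmx ?posdef_unit // dotpC. Qed.

Lemma posdef_horner_gt0 (D : 'M[R]_n) r p : spectrum D r ->
  posdef (horner_mx D p) -> forall i, 0 < p.[r i].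
Proof.
move=> hr Dp i; rewrite ltNge; apply/negP => pi0.
have : posdef (horner_mx D (p - (p.[r i])%:P)).
  rewrite rmorphB /= horner_mx_C -raddfN.
  apply: posdefDge0 => //; first by rewrite tr_scalar_mx.
  by move=> u; rewrite qf1 mulr_ge0 ?oppr_ge0 ?dotp_ge0.
move/posdef_unit; rewrite unitmxE unitfE; have [_ -> _] := hr (p - (p.[r i])%:P).
by rewrite (bigD1 i) //= !hornerE subrr mul0r eqxx.
Qed.

Variables (t0 t1 : R) (mu nu : gparam R n) (L : 'M[R]_n).
Hypotheses (t0_gt0 : 0 < t0) (t1_gt0 : 0 < t1).
Hypotheses (mu_pd : posdef mu.2) (nu_pd : posdef nu.2).

Let a0 := 2 / t0.
Let a1 := 2 / t1.
Let a0_gt0 : 0 < a0. Proof. exact: divr_gt0. Qed.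
Let a1_gt0 : 0 < a1. Proof. exact: divr_gt0. Qed.

Lemma opt_eq_exists : exists2 L, posdef L & opt_eq t0 t1 mu nu L.
Proof.
by apply: posdef_riccati; (apply: posdefD; first exact: posdef_inv);
  exact: posdef_scalar.
Qed.

Hypotheses (L_pd : posdef L) (L_eq : opt_eq t0 t1 mu nu L).
Let Ls := posdef_sym L_pd.
Let Lu := posdef_unit L_pd.

Lemma opt_PiE : opt_Pi t0 mu L =
  L *m (invmx nu.2 + a1%:M) *m L - a1 *: L.
Proof.
by rewrite /opt_Pi -L_eq -/a0 -/a1 scalerBl addrA addrAC addrK.
Qed.

(** Let M = H L H with H the square root of [B]. The Riccati equation makes (M + a0)(M - a1)
    positive definite, so all eigenvalues of M exceed a1; hence M (M - a1), which is congruent to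
    [opt_Pi], is positive definite. *)
Lemma opt_Pi_pd : posdef (opt_Pi t0 mu L).
Proof.
set B := invmx nu.2 + a1%:M; set C := invmx mu.2 + a0%:M.
have Bp : posdef B by apply: posdefD; [exact: posdef_inv|exact: posdef_scalar].
have [H Hp HE] := posdef_sqrt Bp; have Hu := posdef_unit Hp; have Hs := posdef_sym Hp.
pose M := H *m L *m H.
have Mp : posdef M by rewrite /M -{1}Hs; exact: posdef_congr.
have MM : M *m M = H *m (L *m B *m L) *m H by rewrite /M -HE !mulmxA.
have DE : M *m M + (a0 - a1) *: M = H *m C *m H.
  by rewrite MM /C -L_eq mulmxDr mulmxDl -scalemxAr -scalemxAl.
have [r [r0 hr]] := posdef_spectrum Mp.
have pos1 : posdef (horner_mx M ('X * 'X + (a0 - a1) *: 'X - (a0 * a1)%:P)).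
  rewrite rmorphB rmorphD rmorphM /= horner_mx_X -mulmxE horner_mxZ horner_mx_X.
  rewrite horner_mx_C DE /C mulmxDr mulmxDl mul_mx_scalar -scalemxAl HE /B.
  rewrite scalerDr scale_scalar_mx -!addrA subrr addr0; apply: posdefD.
    by rewrite -{1}Hs; apply: posdef_congr => //; exact: posdef_inv.
  by apply: posdefZ => //; exact: posdef_inv.
have r1 i : 0 < r i - a1.
  have := posdef_horner_gt0 hr pos1 i.
  have -> : ('X * 'X + (a0 - a1) *: 'X - (a0 * a1)%:P).[r i] = (r i + a0) * (r i - a1).
    by rewrite hornerD hornerN hornerD hornerM hornerZ !hornerX hornerC; ring.
  by rewrite pmulr_rgt0 // addr_gt0.
have pos2 : posdef (horner_mx M ('X * 'X - a1 *: 'X)).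
  apply: (posdef_horner Mp hr) => i.
  rewrite hornerD hornerN hornerM hornerZ !hornerX.
  by rewrite -mulrBl mulr_gt0.
rewrite rmorphB rmorphM /= horner_mx_X -mulmxE horner_mxZ horner_mx_X in pos2.
have Hip := posdef_inv Hp.
have := posdef_congr (posdef_unit Hip) pos2; rewrite (posdef_sym Hip).
rewrite MM /M opt_PiE -/B mulmxBr mulmxBl -scalemxAr -scalemxAl.
by rewrite !mulmxA mulVmx // mul1mx !mulmxK.
Qed.

Lemma opt_P_pd : posdef (opt_P t0 mu L).
Proof. exact: posdef_inv opt_Pi_pd. Qed.

Lemma opt_Q_pd : posdef (opt_Q t0 mu L).
Proof. by rewrite /opt_Q -{1}Ls; apply: posdef_congr => //; exact: opt_P_pd. Qed.

Lemma opt_Q_inv :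
  invmx (opt_Q t0 mu L) = invmx L *m opt_Pi t0 mu L *m invmx L.
Proof.
have Pu := posdef_unit opt_P_pd.
by rewrite /opt_Q !invmx_mul ?unitmx_mul ?Lu ?Pu // invmxK mulmxA.
Qed.

Lemma opt_Q_invE : invmx (opt_Q t0 mu L) = invmx nu.2 + a1 *: (1%:M - invmx L).
Proof.
rewrite opt_Q_inv opt_PiE mulmxBr mulmxBl -scalemxAr -scalemxAl.
rewrite !mulmxA mulVmx // mul1mx mulmxK // mul1mx scalerBr addrA.
by rewrite scale_scalar_mx mulr1.
Qed.

Let N_pd : posdef (1%:M + (2 / t0) *: mu.2 + (2 / t1) *: nu.2).
Proof.
apply: posdefD; last exact: posdefZ.
by apply: posdefD; [exact: posdef_scalar|exact: posdefZ].
Qed.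

Lemma opt_uvw : opt_u t0 t1 mu nu - opt_v t0 t1 mu nu = opt_w t0 t1 mu nu.
Proof.
have : mu.1 - nu.1 = (1%:M + (2 / t0) *: mu.2 + (2 / t1) *: nu.2) *m opt_w t0 t1 mu nu.
  by rewrite /opt_w mulKVmx // posdef_unit.
rewrite !mulmxDl mul1mx -!scalemxAl /opt_u /opt_v.
move: (opt_w _ _ _ _) => w h; apply/colP => i.
have {h} := congr1 (fun M : 'cV[R]_n => M i 0) h; rewrite !mxE.
move: (\sum_j _) (\sum_j _) => x y; lra.
Qed.

(** The duality gap is the L-form of the deviation from the optimal map, so it is nonnegative and
    vanishes exactly on the graph of that map. *)
Lemma opt_duality x y :
  opt_phi t0 t1 mu nu L x + opt_psi t0 t1 mu nu L y
  + dotp (opt_w t0 t1 mu nu) (opt_w t0 t1 mu nu)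
  + qf L (x - opt_u t0 t1 mu nu - invmx L *m (y - opt_v t0 t1 mu nu)) =
  dotp (x - y) (x - y).
Proof.
rewrite /opt_phi /opt_psi.
have -> : x - y = (x - opt_u t0 t1 mu nu) - (y - opt_v t0 t1 mu nu) + opt_w t0 t1 mu nu.
  rewrite -opt_uvw; move: (opt_u _ _ _ _) (opt_v _ _ _ _) => u v.
  by apply/matrixP => i j; rewrite !mxE; ring.
move: (x - _) (y - _) (opt_w _ _ _ _) => xi eta w.
rewrite qfDr // qfNr !qfD !qfN !qf1 [qf L (invmx L *m eta)]qfE mulKVmx //.
rewrite mulmxN mulKVmx // [qf (invmx L) eta]qfE (dotpC (_ *m eta) eta).
rewrite !dotpDl !dotpDr !dotpNl !dotpNr !(dotpC w) (dotpC eta xi); ring.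
Qed.

Lemma opt_duality_le x y :
  opt_phi t0 t1 mu nu L x + opt_psi t0 t1 mu nu L y
  + dotp (opt_w t0 t1 mu nu) (opt_w t0 t1 mu nu) <= dotp (x - y) (x - y).
Proof. by rewrite -(opt_duality x y) lerDl posdef_ge0. Qed.

Lemma opt_log_ratio_p x :
  log_density (opt_p t0 t1 mu nu L) x - log_density mu x =
  opt_kp t0 t1 mu nu L - opt_phi t0 t1 mu nu L x / t0.
Proof.
rewrite /log_density /opt_kp /opt_phi /opt_p /opt_P /= invmxK det_inv.
rewrite lnV ?posrE ?posdef_det //; last exact: opt_Pi_pd.
have -> : x - mu.1 = (x - opt_u t0 t1 mu nu) - a0 *: (mu.2 *m opt_w t0 t1 mu nu).
  by rewrite /opt_u opprB addrA addrAC addrK.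
move: (x - _) (opt_w _ _ _ _) => xi w.
rewrite qfDr ?trmx_inv ?(posdef_sym mu_pd) // qfNr qfZr qf_inv_mul //.
rewrite mulmxN -scalemxAr mulKmx ?posdef_unit // dotpNr dotpZr (dotpC xi w).
rewrite /opt_Pi !qfD !qfN qfZ !qf1 -/a0 /a0; field.
by rewrite gt_eqF.
Qed.

Lemma opt_log_ratio_q y :
  log_density (opt_q t0 t1 mu nu L) y - log_density nu y =
  opt_kq t0 t1 mu nu L - opt_psi t0 t1 mu nu L y / t1.
Proof.
rewrite /log_density /opt_kq /opt_psi /opt_q /= opt_Q_invE.
have -> : ln (\det (opt_Q t0 mu L)) = 2 * ln (\det L) - ln (\det (opt_Pi t0 mu L)).
  have l0 := posdef_det L_pd; have p0 := posdef_det opt_Pi_pd.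
  rewrite /opt_Q /opt_P !det_mulmx det_inv !lnM ?lnV ?posrE ?mulr_gt0 ?invr_gt0 //.
  ring.
have -> : y - nu.1 = (y - opt_v t0 t1 mu nu) + a1 *: (nu.2 *m opt_w t0 t1 mu nu).
  by rewrite /opt_v opprD addrA subrK.
move: (y - _) (opt_w _ _ _ _) => eta w.
rewrite qfDr ?trmx_inv ?(posdef_sym nu_pd) // qfZr qf_inv_mul //.
rewrite -scalemxAr mulKmx ?posdef_unit // dotpZr (dotpC eta w).
rewrite !qfD !qfZ !qfD !qfN !qf1 /a1; field.
by rewrite gt_eqF.
Qed.

End optimal_pair.

(** * A priori bounds on the optimal pair *)

Section optimal_bounds.
Variables (R : realType) (d : nat).
Local Notation n := d.+1.
Implicit Types (mu nu : gparam R n) (L : 'M[R]_n).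

Lemma dotp_Cauchy (u v : 'cV[R]_n) : dotp u v ^+ 2 <= dotp u u * dotp v v.
Proof.
rewrite !dotpE; apply: le_trans (sum_Cauchy _ _) _.
by under eq_bigr do rewrite expr2; under [X in _ * X <= _]eq_bigr do rewrite expr2.
Qed.

Lemma dotpD_le (u v : 'cV[R]_n) : dotp (u + v) (u + v) <= 2 * dotp u u + 2 * dotp v v.
Proof.
have := dotp_ge0 (u - v); rewrite dotpBl !dotpBr dotpDl !dotpDr (dotpC v u); lra.
Qed.

Lemma qf_delta (S : 'M[R]_n) i : qf S (delta_mx i 0) = S i i.
Proof. by rewrite /qf trmx_delta -rowE -colE !mxE. Qed.

Lemma dotp_delta (i : 'I_n) : dotp (delta_mx i 0) (delta_mx i 0) = 1 :> R.
Proof. by rewrite -[LHS]mul1r -qf1 qf_delta mxE eqxx. Qed.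

Lemma posdef_tr_le (S T : 'M[R]_n) : posdef (T - S) -> \tr S <= \tr T.
Proof. by move=> /posdef_tr_ge0; rewrite raddfB subr_ge0. Qed.

Variables (t0 t1 : R).
Hypotheses (t0_gt0 : 0 < t0) (t1_gt0 : 0 < t1).

Section fixed_pair.
Variables (mu nu : gparam R n) (L : 'M[R]_n).
Hypotheses (mu_pd : posdef mu.2) (nu_pd : posdef nu.2).
Hypotheses (L_pd : posdef L) (L_eq : opt_eq t0 t1 mu nu L).
Let P_pd := opt_P_pd t0_gt0 t1_gt0 mu_pd nu_pd L_pd L_eq.
Let Q_pd := opt_Q_pd t0_gt0 t1_gt0 mu_pd nu_pd L_pd L_eq.
Let Pi_pd := opt_Pi_pd t0_gt0 t1_gt0 mu_pd nu_pd L_pd L_eq.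

Lemma opt_gKL_p : gKL (opt_p t0 t1 mu nu L) mu =
  opt_kp t0 t1 mu nu L - \tr ((1%:M - L) *m opt_P t0 mu L) / t0.
Proof.
rewrite /gKL /opt_kp /= mulmxDr mxtraceD -qf_tr.
have -> : opt_u t0 t1 mu nu - mu.1 = - (2 / t0) *: (mu.2 *m opt_w t0 t1 mu nu).
  by rewrite /opt_u addrC addKr scaleNr.
rewrite qfZr qf_inv_mul // sqrrN {2}/opt_P det_inv lnV ?posrE ?posdef_det //.
have -> : \tr (invmx mu.2 *m opt_P t0 mu L) =
    n%:R - (2 / t0) * \tr ((1%:M - L) *m opt_P t0 mu L).
  rewrite -mxtraceZ -[n%:R]mxtrace1 -raddfB /=; congr (\tr _).
  rewrite -[X in X - _](mulmxV (posdef_unit Pi_pd)) scalemxAl -mulmxBl; congr (_ *m _).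
  by rewrite /opt_Pi scalerBr scale_scalar_mx mulr1 opprB addrA subrK addrK.
by field; rewrite gt_eqF.
Qed.

Lemma opt_gKL_q : gKL (opt_q t0 t1 mu nu L) nu =
  opt_kq t0 t1 mu nu L - \tr ((1%:M - invmx L) *m opt_Q t0 mu L) / t1.
Proof.
rewrite /gKL /opt_kq /= mulmxDr mxtraceD -qf_tr.
have -> : opt_v t0 t1 mu nu - nu.1 = (2 / t1) *: (nu.2 *m opt_w t0 t1 mu nu).
  by rewrite /opt_v addrC addKr.
rewrite qfZr qf_inv_mul //.
have -> : ln (\det (opt_Q t0 mu L)) = 2 * ln (\det L) - ln (\det (opt_Pi t0 mu L)).
  have l0 := posdef_det L_pd; have p0 := posdef_det Pi_pd.
  rewrite /opt_Q /opt_P !det_mulmx det_inv !lnM ?lnV ?posrE ?mulr_gt0 ?invr_gt0 //.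
  ring.
have -> : \tr (invmx nu.2 *m opt_Q t0 mu L) =
    n%:R - (2 / t1) * \tr ((1%:M - invmx L) *m opt_Q t0 mu L).
  rewrite -mxtraceZ -[n%:R]mxtrace1 -raddfB /=; congr (\tr _).
  rewrite -[X in X - _](mulVmx (posdef_unit Q_pd)) scalemxAl -mulmxBl; congr (_ *m _).
  by rewrite (opt_Q_invE t0_gt0 t1_gt0 mu_pd nu_pd L_pd L_eq) addrK.
by field; rewrite gt_eqF.
Qed.

(** The cost of moving p by the affine map with linear part L, whose displacement has mean w. *)
Definition opt_W2 := dotp (opt_w t0 t1 mu nu) (opt_w t0 t1 mu nu) +
  \tr ((1%:M - L) *m opt_P t0 mu L *m (1%:M - L)).

Lemma opt_A_cost : opt_A t0 t1 mu nu L =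
  opt_W2 + t0 * gKL (opt_p t0 t1 mu nu L) mu + t1 * gKL (opt_q t0 t1 mu nu L) nu.
Proof.
rewrite opt_gKL_p opt_gKL_q /opt_A /opt_W2.
have -> : \tr ((1%:M - L) *m opt_P t0 mu L *m (1%:M - L)) =
  \tr ((1%:M - L) *m opt_P t0 mu L) + \tr ((1%:M - invmx L) *m opt_Q t0 mu L).
  rewrite mulmxBr mulmx1 raddfB /=; congr (_ + _).
  rewrite -raddfN /= -mulNmx -mulNmx opprB; congr (\tr _).
  rewrite /opt_Q !mulmxA; congr (_ *m _ *m _).
  by rewrite mulmxBl mul1mx mulVmx ?posdef_unit.
by field; rewrite !gt_eqF.
Qed.

Lemma opt_A_bounds (K : R) : 0 <= K -> opt_A t0 t1 mu nu L <= K ->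
  [/\ dotp (opt_w t0 t1 mu nu) (opt_w t0 t1 mu nu) <= K,
      \tr (opt_Q t0 mu L) <= 2 * K + 2 * \tr (opt_P t0 mu L),
      gKL (opt_p t0 t1 mu nu L) mu <= K / t0 &
      gKL (opt_q t0 t1 mu nu L) nu <= K / t1].
Proof.
move=> K0; rewrite opt_A_cost /opt_W2.
have w0 := dotp_ge0 (opt_w t0 t1 mu nu).
have g0 := mulr_ge0 (ltW t0_gt0) (@gKL_ge0 _ _ (opt_p t0 t1 mu nu L) _ P_pd mu_pd).
have g1 := mulr_ge0 (ltW t1_gt0) (@gKL_ge0 _ _ (opt_q t0 t1 mu nu L) _ Q_pd nu_pd).
have Ls := posdef_sym L_pd.
have [G Gp GE] := posdef_sqrt P_pd; have Gs := posdef_sym Gp.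
have trE (X : 'M[R]_n) : X^T = X -> \tr (X *m opt_P t0 mu L *m X) = frob (X *m G).
  move=> Xs; rewrite frob_tr trmx_mul Xs Gs -GE mxtrace_mulC !mulmxA.
  by rewrite mxtrace_mulC !mulmxA.
have Is : (1%:M - L)^T = 1%:M - L by rewrite raddfB /= tr_scalar_mx Ls.
have f0 := frob_ge0 ((1%:M - L) *m G); rewrite -trE // in f0.
have hQ : \tr (opt_Q t0 mu L) <=
    2 * \tr ((1%:M - L) *m opt_P t0 mu L *m (1%:M - L)) + 2 * \tr (opt_P t0 mu L).
  rewrite /opt_Q !trE //.
  have -> : \tr (opt_P t0 mu L) = frob G by rewrite frob_tr Gs GE.
  rewrite mulmxBl mul1mx /frob !mulr_sumr -big_split ler_sum //= => i _.
  rewrite !mulr_sumr -big_split ler_sum //= => j _; rewrite !mxE.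
  set x := G i j; set y := \sum_j _.
  by have := sqr_ge0 (2 * x - y); rewrite !expr2; nra.
move=> hK; split.
- lra.
- lra.
- rewrite ler_pdivlMr // mulrC; lra.
- rewrite ler_pdivlMr // mulrC; lra.
Qed.

End fixed_pair.

(** A bound on the value bounds both entropies and the transport cost. The first entropy bounds P by
    mu, the transport cost bounds Q by P, and the second entropy bounds nu by Q; the means are
    chained in the same order. *)
Lemma opt_A_proper mu (K : R) : posdef mu.2 -> exists M : R, forall nu L,
  posdef nu.2 -> posdef L -> opt_eq t0 t1 mu nu L -> opt_A t0 t1 mu nu L <= K ->
  dotp nu.1 nu.1 <= M /\ \tr nu.2 <= M.
Proof.
move=> mu_pd; wlog K0 : K / 0 <= K.
  move=> H; have [M HM] := H `|K| (normr_ge0 _).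
  by exists M => nu L h1 h2 h3 h4; apply: (HM nu L) => //; apply: le_trans h4 (ler_norm _).
(* p will bound the trace of P, s the trace of nu.2, and m the squared norm of nu.1. *)
set p := (4 * (K / t0) + 3) * \tr mu.2.
set c := expR (- (2 * (K / t1) + 2)).
set s := (2 * K + 2 * p) / c.
set m := 2 * (2 * dotp mu.1 mu.1 + 2 * ((\tr mu.2 + 1) * (2 * (K / t0)))) +
         2 * (2 * K + 2 * ((s + 1) * (2 * (K / t1)))).
have c0 : 0 < c by exact: expR_gt0.
exists (Num.max m s) => nu L nu_pd L_pd L_eq hA.
have P_pd := opt_P_pd t0_gt0 t1_gt0 mu_pd nu_pd L_pd L_eq.
have Q_pd := opt_Q_pd t0_gt0 t1_gt0 mu_pd nu_pd L_pd L_eq.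
have [hw hQ hp hq] := opt_A_bounds mu_pd nu_pd L_pd L_eq K0 hA.
have [_ p1 p2] := @gKL_bounds _ _ _ (opt_p t0 t1 mu nu L) _ P_pd mu_pd hp.
have [q1 _ q2] := @gKL_bounds _ _ _ (opt_q t0 t1 mu nu L) _ Q_pd nu_pd hq.
move: p1 p2 q1 q2 => /posdef_tr_le p1 p2 /posdef_tr_le q1 q2.
rewrite !mxtraceZ /= -/p in p1 q1; rewrite -/c /= in q1 q2 p2.
have trS : \tr nu.2 <= s by rewrite ler_pdivlMr // mulrC; lra.
rewrite !le_max trS orbT; split=> //; apply/orP; left.
have -> : nu.1 = (mu.1 + (opt_u t0 t1 mu nu - mu.1)) +
   (- opt_w t0 t1 mu nu + - (opt_v t0 t1 mu nu - nu.1)).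
  by rewrite -(opt_uvw t0_gt0 t1_gt0 mu_pd nu_pd); apply/colP => i; rewrite !mxE; ring.
have KT0 : 0 <= K / t0 by rewrite divr_ge0 // ltW.
have KT1 : 0 <= K / t1 by rewrite divr_ge0 // ltW.
have h3 : (\tr nu.2 + 1) * (2 * (K / t1)) <= (s + 1) * (2 * (K / t1)).
  apply: ler_wpM2r; first by apply: mulr_ge0.
  by have := trS; lra.
apply: le_trans (dotpD_le _ _) _; rewrite /m.
have := dotpD_le mu.1 (opt_u t0 t1 mu nu - mu.1).
have := dotpD_le (- opt_w t0 t1 mu nu) (- (opt_v t0 t1 mu nu - nu.1)).
rewrite !(dotpNl, dotpNr, opprK); lra.
Qed.

(** Let W = L^-1. Where qf W y >= |y|^2, the identity Q^-1 = nu.2^-1 + a1 (1 - W) shows that Q^-1 is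
    no larger than nu.2^-1 at y. Elsewhere Q^-1 = W Pi W <= W C W is at most c1 (tr W + 1) |y|^2.
    The Riccati equation, read as W C W = nu.2^-1 + a1 + k W, makes tr W small compared with E when
    E is large. *)
Lemma opt_Q_lower mu : posdef mu.2 -> exists E0 : R, forall E nu L,
  E0 <= E -> posdef nu.2 -> posdef L -> opt_eq t0 t1 mu nu L ->
  (forall y, qf (invmx nu.2) y <= E * dotp y y) ->
  forall y, qf (invmx (opt_Q t0 mu L)) y <= E * dotp y y.
Proof.
move=> mu_pd; set a0 := 2 / t0; set a1 := 2 / t1; set k := a0 - a1.
have a0_gt0 : 0 < a0 by exact: divr_gt0.
have a1_gt0 : 0 < a1 by exact: divr_gt0.
set C := invmx mu.2 + a0%:M.
have Cp : posdef C by apply: posdefD; [exact: posdef_inv|exact: posdef_scalar].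
set c1 := \tr C + 1; have c1_gt0 : 0 < c1 by rewrite ltr_wpDl ?posdef_tr_ge0.
have C1 u : qf C u <= c1 * dotp u u by exact: qf_le_tr.
have C0 u : a0 * dotp u u <= qf C u.
  by rewrite qfD qf1 lerDr; apply/posdef_ge0/posdef_inv.
(* dl makes c1 * tr W at most E / 2; beyond the threshold E1 a diagonal entry of W above dl * E
   would violate the quadratic inequality [h4]. *)
set dl := (2 * n%:R * c1)^-1.
have n0 : 0 < n%:R :> R by rewrite ltr0n.
have dl0 : 0 < dl by rewrite invr_gt0 !mulr_gt0.
set E1 := (`|k| + (1 + a1) / dl) / (a0 * dl).
exists (Num.max 1 (Num.max (2 * c1) E1)) => E nu L hE nu_pd L_pd L_eq nuE.
move: hE; rewrite !ge_max => /and3P[E_1 E_2 E_3].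
set W := invmx L; have Wp : posdef W by exact: posdef_inv.
have QE := opt_Q_invE t0_gt0 t1_gt0 mu_pd nu_pd L_pd L_eq; have QE' := opt_Q_inv t0_gt0 t1_gt0 mu_pd nu_pd L_pd L_eq.
have tW0 := posdef_tr_ge0 Wp.
have CW y : qf C (W *m y) <= E * dotp y y + a1 * dotp y y + `|k| * qf W y.
  have -> : qf C (W *m y) = qf (invmx nu.2) y + a1 * dotp y y + k * qf W y.
    rewrite -qf_congr (posdef_sym Wp) -qf1 -!qfD -qfZ -qfD; congr qf.
    rewrite /C -L_eq mulmxDr mulmxDl -scalemxAr -scalemxAl /W.
    by rewrite !mulmxA mulVmx ?posdef_unit // mul1mx mulmxK ?posdef_unit // mul1mx.
  rewrite lerD ?lerD2r // ler_wpM2r ?ler_norm //.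
  exact: posdef_ge0.
have WX y : qf W y ^+ 2 <= dotp y y * dotp (W *m y) (W *m y).
  by rewrite qfE dotp_Cauchy.
have trW : c1 * (\tr W + 1) <= E.
  have Wi i : W i i <= dl * E.
    rewrite leNgt; apply/negP => hi.
    set X := W i i in hi.
    have := CW (delta_mx i 0); have := WX (delta_mx i 0).
    have := C0 (W *m delta_mx i 0).
    rewrite qf_delta dotp_delta -/X mul1r !mulr1; move: (dotp _ _) (qf _ _) => N Z.
    move=> h1 h2 h3.
    have h4 : a0 * X ^+ 2 <= E + a1 + `|k| * X.
      by apply: le_trans (ler_wpM2l (ltW a0_gt0) h2) _; lra.
    have E0 : 0 < E by lra.
    have dE : 0 < dl * E by exact: mulr_gt0.
    have X0 : 0 < X by lra.
    have h5 : `|k| + (1 + a1) / dl <= a0 * dl * E.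
      by rewrite [leRHS]mulrC -ler_pdivrMr //; exact: mulr_gt0.
    have h6 : `|k| + (1 + a1) / dl < a0 * X.
      by apply: le_lt_trans h5 _; rewrite -mulrA ltr_pM2l.
    have h7 : (`|k| + (1 + a1) / dl) * X < a0 * X ^+ 2.
      by rewrite expr2 mulrA ltr_pM2r.
    have h8 : (1 + a1) * E <= (1 + a1) / dl * X.
      by rewrite -mulrA ler_pM2l ?addr_gt0 // [leRHS]mulrC ler_pdivlMr // [leLHS]mulrC ltW.
    have h9 : a1 <= a1 * E by rewrite ler_peMr // ltW.
    lra.
  have : \tr W <= n%:R * (dl * E).
    apply: le_trans (ler_sum _ (fun i _ => Wi i)) _.
    by rewrite sumr_const card_ord mulr_natl.
  have dlE : c1 * (n%:R * dl) = 2^-1.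
    by rewrite /dl; field; rewrite !gt_eqF // lt0r_neq0.
  move=> h; have : c1 * \tr W <= c1 * (n%:R * (dl * E)) by rewrite ler_wpM2l // ltW.
  rewrite (_ : c1 * (n%:R * (dl * E)) = 2^-1 * E); last by rewrite -dlE; ring.
  lra.
move=> y; have D0 := dotp_ge0 y.
have [h|h] := leP (dotp y y) (qf W y).
  rewrite QE -/a1 qfD qfZ qfD qfN qf1 mul1r -/W.
  have : a1 * (dotp y y - qf W y) <= 0 by rewrite pmulr_rle0 // subr_le0.
  have := nuE y; lra.
have -> : qf (invmx (opt_Q t0 mu L)) y = qf (opt_Pi t0 mu L) (W *m y).
  by rewrite QE' -/W -{1}(posdef_sym Wp) qf_congr.
apply: le_trans (_ : qf C (W *m y) <= _).
  rewrite /opt_Pi -/a0 -/C qfD qfN qfZ gerBl mulr_ge0 ?(ltW a0_gt0) //.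
  exact: posdef_ge0.
apply: le_trans (C1 _) _.
have := dotp_sq_le y Wp (fun u => qf_le_tr u Wp) => h1.
apply: le_trans (ler_wpM2l (ltW c1_gt0) h1) _; rewrite mulrA.
apply: le_trans (_ : c1 * (\tr W + 1) * dotp y y <= _).
  by rewrite ler_wpM2l ?ltW // mulr_gt0 // ltr_wpDl.
by rewrite ler_wpM2r.
Qed.

End optimal_bounds.

(** * Gaussian measures and unbalanced transport *)

Section lebesgue_euclid.
Context {R : realType}.
Local Open Scope ereal_scope.
Local Notation leb n := (@lebesgue_euclid R n).
Local Notation leb1 := (@lebesgue_measure R).

Definition box n (k : nat) : set (euclid R n) :=
  [set x | forall i, tnth x i \in `[(- k%:R)%R, k%:R]].

Lemma measurable_box n k : measurable (@box n k).
Proof.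
rewrite (_ : box k = \bigcap_(i in [set: 'I_n])
    (fun x : euclid R n => tnth x i) @^-1` `[(- k%:R)%R, k%:R]%classic).
  apply: fin_bigcap_measurable => // i _; rewrite -[X in measurable X]setTI.
  exact: measurable_tnth.
by apply/seteqP; split => [x h i _|x h i]; [exact: h|exact: (h i I)].
Qed.

Lemma lebesgue_box n k : leb n (box k) < +oo.
Proof.
elim: n => [|n IH]; first by rewrite /= diracE ltry.
rewrite /= /pushforward (_ : _ @^-1` _ = box k `*` `[(- k%:R)%R, k%:R]%classic).
  rewrite product_measure1E //; last exact: measurable_box.
  apply: lte_mul_pinfty; [exact: measure_ge0|by rewrite ge0_fin_numE|].
  change (leb1 `[(- k%:R)%R, k%:R]%classic < +oo); rewrite lebesgue_measure_itv /=; case: ifP => _; last by rewrite ltry.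
  by rewrite -EFinD ltry.
apply/seteqP; split => [[x t] h|[x t] [h1 h2] i] /=.
  split => [i|] /=; last by have := h ord0; rewrite tnth0.
  by have := h (lift ord0 i); rewrite tnthS.
by case: (unliftP ord0 i) => [j ->|->]; rewrite ?tnthS ?tnth0 //; exact: h1.
Qed.

Lemma lebesgue_euclid_sigma_finite n : sigma_finite setT (leb n).
Proof.
exists (@box n) => [|k]; last by split; [exact: measurable_box|exact: lebesgue_box].
apply/esym/seteqP; split => // x _.
have [k hk] : exists k : nat, forall i, (`|tnth x i| <= k%:R)%R.
  exists (Num.truncn (\sum_i `|tnth x i|)%R).+1 => i; apply: ltW.
  apply: le_lt_trans (truncnS_gt _); rewrite (bigD1 i) //= lerDl.
  by apply: sumr_ge0.
by exists k => // i; rewrite in_itv /= -ler_norml.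
Qed.

HB.instance Definition _ n := Measure_isSigmaFinite.Build _ _ _ (leb n)
  (@lebesgue_euclid_sigma_finite n).

Lemma measurable_cons_tuple n (x : euclid R n) (y : R) :
  measurable_fun setT (fun t : measurableTypeR R => [tuple of t :: x] : euclid R n.+1) /\
  measurable_fun setT (fun x : euclid R n => [tuple of (y : measurableTypeR R) :: x] : euclid R n.+1).
Proof.
split.
  exact: (@measurable_cons _ _ (measurableTypeR R) (measurableTypeR R)
    (fun t => t) n (fun=> x)).
exact: (@measurable_cons _ _ (euclid R n) (measurableTypeR R) (fun=> y) n (fun t => t)).
Qed.

Lemma lebesgue_euclidS n (f : euclid R n.+1 -> \bar R) :
  measurable_fun setT f -> (forall x, 0 <= f x) ->
  \int[leb n.+1]_x f x = \int[leb n]_x \int[leb1]_t f [tuple of t :: x] /\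
  \int[leb n.+1]_x f x = \int[leb1]_t \int[leb n]_x f [tuple of t :: x].
Proof.
move=> mf f0.
have -> : \int[leb n.+1]_x f x =
    \int[leb n \x leb1]_z (f \o @tuple_snoc R n) z.
  rewrite -[RHS](@ge0_integral_pushforward _ _ _ _ R _ _
    (leb n \x leb1) setT) //; exact: measurable_tuple_snoc.
have mfs : measurable_fun setT (f \o @tuple_snoc R n).
  by apply: measurableT_comp => //; exact: measurable_tuple_snoc.
split; first by rewrite fubini_tonelli1 // => z; exact: f0.
by rewrite fubini_tonelli2 // => z; exact: f0.
Qed.

(** The image of Lebesgue measure under the affine map, scaled by a, agrees with Lebesgue measure on
    half-open intervals; uniqueness of Lebesgue measure does the rest. *)
Lemma lebesgue_affine (a b : R) (f : R -> \bar R) : (0 < a)%R ->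
  measurable_fun (setT : set (measurableTypeR R)) f -> (forall x, 0 <= f x) ->
  \int[leb1]_t f (a * t + b)%R = (a^-1)%:E * \int[leb1]_t f t.
Proof.
move=> a0 mf f0; have a1 : a != 0%R by rewrite gt_eqF.
pose phi (t : measurableTypeR R) : measurableTypeR R := (a * t + b)%R.
have mphi : measurable_fun setT phi.
  by apply: measurable_funD => //; exact: measurable_funM.
have [m mE] : exists m : {measure set (measurableTypeR R) -> \bar R},
    forall A, m A = pushforward leb1 phi A.
  by unshelve eexists (pushforward leb1 phi : {measure set _ -> \bar R}).
pose k : {nonneg R} := NngNum (ltW a0).
have lE A : measurable A -> leb1 A = mscale k m A.
  apply: lebesgue_measure_unique => _ [[c e] _ <-] /=.
  rewrite /mscale /= mE /pushforward.
  rewrite (_ : phi @^-1` _ = `]((c - b) / a)%R, ((e - b) / a)%R]%classic); last first.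
    apply/seteqP; split => t /=; rewrite !in_itv /= /phi;
      by rewrite ltr_pdivrMr // ler_pdivlMr // ltrBlDr lerBrDr (mulrC t).
  rewrite !lebesgue_measure_itv /= !lte_fin ltr_pM2r ?invr_gt0 // ltrD2r.
  case: ifPn => _; last by rewrite mule0.
  by rewrite -!EFinD -EFinM; congr (_%:E); field.
have -> : \int[leb1]_t f t = a%:E * \int[leb1]_t f (phi t).
  rewrite (@eq_measure_integral _ _ _ _ (mscale k m)); last by move=> A mA _; exact: lE.
  rewrite ge0_integral_mscale //; congr (_ * _).
  rewrite (@eq_measure_integral _ _ _ _ (pushforward leb1 phi)); last by [].
  by rewrite ge0_integral_pushforward.
by rewrite muleA -EFinM mulVf // mul1e.
Qed.

End lebesgue_euclid.

(** * Linear change of variables *)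

Section affine_substitution.
Context {R : realType}.
Local Notation leb n := (@lebesgue_euclid R n).
Local Notation leb1 := (@lebesgue_measure R).

Definition vtup n (v : 'cV[R]_n) : euclid R n := [tuple v i 0 | i < n].

Lemma cvec_of_vtup n (v : 'cV[R]_n) : cvec_of (vtup v) = v.
Proof. by apply/colP => i; rewrite mxE tnth_mktuple. Qed.

Lemma vtup_cvec_of n (x : euclid R n) : vtup (cvec_of x) = x.
Proof. by apply: eq_from_tnth => i; rewrite tnth_mktuple mxE. Qed.

Definition aff n (M : 'M[R]_n) (b : 'cV[R]_n) (x : euclid R n) : euclid R n :=
  vtup (M *m cvec_of x + b).

Lemma measurable_vtup d (T : measurableType d) n (F : T -> 'cV[R]_n) :
  (forall i, measurable_fun [set: T] (fun x => F x i 0)) ->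
  measurable_fun [set: T] (fun x => vtup (F x)).
Proof.
move=> mF; apply/measurable_fun_tnthP => i.
have -> : @tnth n _ ^~ i \o (fun x => vtup (F x)) = fun x => F x i 0.
  by apply/funext => x /=; rewrite tnth_mktuple.
exact: mF.
Qed.

Lemma measurable_aff n (M : 'M[R]_n) b : measurable_fun setT (aff M b).
Proof.
apply: measurable_vtup => i.
rewrite (_ : (fun _ => _) = fun x : euclid R n =>
  \sum_j M i j * tnth x j + b i 0); last first.
  by apply/funext => x; rewrite !mxE; under eq_bigr do rewrite mxE.
apply: measurable_funD => //; apply: measurable_sum => j.
by apply: measurable_funM => //; exact: measurable_tnth.
Qed.

(** The vector v completes u so that the first component of M v vanishes; the form of M at v is then
    the form of the Schur complement at u, which inherits positivity. *)
Lemma posdef_schur n (M : 'M[R]_(1 + n)) : posdef M ->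
  let a := M 0 0 in
  let S := drsubmx M - a^-1 *: (dlsubmx M *m ursubmx M) in
  [/\ 0 < a, posdef S & \det M = a * \det S].
Proof.
move=> Mp a S.
have a0 : 0 < a.
  have := Mp.2 (delta_mx 0 0); rewrite trmx_delta -rowE -colE !mxE; apply.
  by apply/eqP => /matrixP/(_ 0 0)/eqP; rewrite !mxE eqxx oner_eq0.
have aE : ulsubmx M = a%:M.
  apply/matrixP => i j; rewrite !ord1 !mxE eqxx mulr1n /a.
  by congr (M _ _); apply/val_inj.
have rE : ursubmx M = (dlsubmx M)^T by rewrite trmx_dlsub Mp.1.
have ME : M = block_mx 1%:M 0 (a^-1 *: dlsubmx M) 1%:M *m
              block_mx a%:M (ursubmx M) 0 S.
  rewrite mulmx_block !mul1mx !mul0mx !addr0 mul_mx_scalar scalerA.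
  by rewrite mulfV ?gt_eqF // scale1r -scalemxAl addrC subrK -aE submxK.
have Ss : S^T = S.
  rewrite /S raddfB /= linearZ /= trmx_mul rE trmxK; congr (_ - _).
  by rewrite trmx_drsub Mp.1.
split => //; last by rewrite [LHS](congr1 determinant ME) det_mulmx det_lblock
  det_ublock !det1 !mul1r det_scalar1.
split => // u u0; pose v := col_mx (- (a^-1 *: (ursubmx M *m u))) u.
have Mv : M *m v = col_mx 0 (S *m u).
  rewrite [in LHS]ME -mulmxA [X in _ *m X](_ : _ = col_mx 0 (S *m u)).
    by rewrite mul_block_col mul1mx !mul0mx mulmx0 mul1mx addr0 add0r.
  rewrite mul_block_col mul_scalar_mx scalerN scalerA mulfV ?gt_eqF // scale1r.
  by rewrite addNr mul0mx add0r.
have v0 : v != 0.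
  apply: contra u0 => /eqP v0; have := congr1 dsubmx v0.
  by rewrite col_mxKd => ->; rewrite linear0.
have := Mp.2 _ v0; rewrite -mulmxA Mv tr_col_mx mul_row_col mulmx0 add0r.
by rewrite mulmxA.
Qed.

Lemma posdef_det_any n (S : 'M[R]_n) : posdef S -> 0 < \det S.
Proof. by case: n S => [S _|n S]; [rewrite det_mx00|exact: posdef_det]. Qed.

Lemma cvec_of_cons n t (x : euclid R n) :
  cvec_of ([tuple of (t : measurableTypeR R) :: x] : euclid R n.+1) =
  col_mx t%:M (cvec_of x) :> 'cV[R]_(1 + n).
Proof.
apply/colP => i; case: (unliftP ord0 i) => [j ->|->]; rewrite mxE ?tnthS ?tnth0.
  by rewrite (_ : lift ord0 j = rshift 1 j) ?col_mxEd ?mxE //; apply/val_inj.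
have E : col_mx t%:M (cvec_of x) (lshift n 0) 0 = t by rewrite col_mxEu mxE.
by rewrite -[LHS]E; congr (col_mx _ _ _ _); apply/val_inj.
Qed.

Lemma vtup_col n t (v : 'cV[R]_n) :
  vtup (col_mx t%:M v : 'cV[R]_(1 + n)) =
  [tuple of (t : measurableTypeR R) :: vtup v] :> euclid R n.+1.
Proof.
by rewrite -[RHS]vtup_cvec_of cvec_of_cons cvec_of_vtup.
Qed.

Local Open Scope ereal_scope.

Let affine_elimination n (a t rho b : R) (c w : 'cV[R]_n) : a != 0%R ->
  (t *: c + w = w - (a^-1 * (rho - b)) *: c + (a^-1 * (a * t + rho - b)) *: c)%R.
Proof. by move=> a0; apply/colP => i; rewrite !mxE; field. Qed.

(** Gaussian elimination, by induction on the dimension: the first coordinate is substituted at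
    fixed z with factor 1 / a, then z at fixed s with factor 1 / det S. The Schur complement S is
    again positive definite. *)
Lemma lebesgue_aff n (M : 'M[R]_n) b (f : euclid R n -> \bar R) : posdef M ->
  measurable_fun setT f -> (forall x, 0 <= f x) ->
  \int[leb n]_x f (aff M b x) = ((\det M)^-1)%:E * \int[leb n]_x f x.
Proof.
elim: n M b f => [|n IH] M b f Mp mf f0.
  rewrite det_mx00 invr1 mul1e; apply: eq_integral => x _.
  by congr f; rewrite (tuple0 x) [LHS]tuple0.
have [a0 Sp detE] := @posdef_schur n M Mp.
move: a0 Sp detE; set a := ((M : 'M[R]_(1 + n)) 0 0)%R; set S := (_ - _)%R => a0 Sp detE.
pose c : 'cV[R]_n := dlsubmx (M : 'M[R]_(1 + n)).
pose r : 'rV[R]_n := ursubmx (M : 'M[R]_(1 + n)).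
pose b0 : R := ((b : 'cV[R]_(1 + n)) 0 0)%R; pose b' : 'cV[R]_n := dsubmx (b : 'cV[R]_(1 + n)).
pose rho (z : euclid R n) : R := ((r *m cvec_of z) 0 0 + b0)%R.
(* Once s = a t + rho z has replaced t, the lower block of M x + b is S z + beta s. *)
pose beta (s : R) : 'cV[R]_n := ((a^-1 * (s - b0)) *: c + b')%R.
pose G (x : euclid R n.+1) : \bar R :=
  f [tuple of thead x :: aff S (beta (thead x)) [tuple of behead x]].
have GE (s : measurableTypeR R) (z : euclid R n) : G [tuple of s :: z] = f [tuple of s :: aff S (beta s) z].
  rewrite /G theadE; congr f; congr ([tuple of _ :: aff S _ _]).
  by apply/val_inj.
have mG : measurable_fun setT G.
  apply: measurableT_comp => //.
  apply: (@measurable_cons _ _ (euclid R n.+1) (measurableTypeR R)); first exact: measurable_tnth.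
  apply: measurable_vtup => i.
  rewrite (_ : (fun _ => _) = fun x : euclid R n.+1 =>
    (\sum_j S i j * tnth x (lift ord0 j) +
     (a^-1 * (tnth x ord0 - b0) * c i 0 + b' i 0))%R); last first.
    apply/funext => x; rewrite !mxE; congr (_ + _)%R.
    apply: eq_bigr => j _; congr (_ * _)%R; rewrite mxE.
    apply: etrans (tnth_behead x j) _; congr tnth; apply/val_inj.
    by rewrite /= inordK // ltnS.
  apply: measurable_funD.
    apply: measurable_sum => j.
    by apply: measurable_funM => //; exact: measurable_tnth.
  apply: measurable_funD => //; apply: measurable_funM => //.
  by apply: measurable_funM => //; apply: measurable_funB => //; exact: measurable_tnth.
have affE (t : measurableTypeR R) (z : euclid R n) : f (aff M b [tuple of t :: z]) = G [tuple of ((a * t + rho z)%R : measurableTypeR R) :: z].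
  rewrite GE; congr f; rewrite /aff cvec_of_cons -vtup_col; congr vtup.
  have -> : (M *m col_mx t%:M (cvec_of z) + b = block_mx
      (ulsubmx (M : 'M[R]_(1 + n))) (ursubmx (M : 'M[R]_(1 + n)))
      (dlsubmx (M : 'M[R]_(1 + n))) (drsubmx (M : 'M[R]_(1 + n))) *m
      col_mx t%:M (cvec_of z) + col_mx (usubmx (b : 'cV[R]_(1 + n)))
        (dsubmx (b : 'cV[R]_(1 + n))) :> 'cV[R]_(1 + n))%R.
    by rewrite submxK vsubmxK.
  rewrite mul_block_col add_col_mx; apply: (f_equal2 (@col_mx R 1 n 1)).
    apply/matrixP => i j; rewrite !ord1 mul_mx_scalar !mxE eqxx mulr1n /rho.
    rewrite [in RHS]mxE addrA; congr (_ + _ + _)%R.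
      by rewrite mulrC; congr (M _ _ * _)%R; apply/val_inj.
    by rewrite /b0; congr (b _ _); apply/val_inj.
  rewrite mul_mx_scalar -/c /beta -/b' addrA; congr (_ + _)%R.
  rewrite /S mulmxBl -scalemxAl -mulmxA.
  have -> : (ursubmx (M : 'M[R]_(1 + n)) *m cvec_of z = (rho z - b0)%:M)%R.
    by apply/matrixP => i j; rewrite !ord1 [RHS]mxE eqxx mulr1n /rho addrK.
  rewrite mul_mx_scalar -/c scalerA.
  by apply: affine_elimination; rewrite gt_eqF.
have ia0 : 0 <= (a^-1)%:E by rewrite lee_fin invr_ge0 ltW.
have id0 : 0 <= ((\det S)^-1)%:E.
  by rewrite lee_fin invr_ge0 ltW // posdef_det_any.
have [-> _] := lebesgue_euclidS (measurableT_comp mf (measurable_aff M b)) (fun x => f0 _).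
have mGz (z : euclid R n) : measurable_fun setT (fun s : measurableTypeR R => G [tuple of s :: z]).
  by apply: measurableT_comp => //; exact: (measurable_cons_tuple z 0%R).1.
transitivity (\int[leb n]_z \int[leb1]_s ((a^-1)%:E * G [tuple of s :: z])).
  apply: eq_integral => z _; under eq_integral do rewrite /= affE.
  rewrite (lebesgue_affine (rho z) a0 (mGz z)) ?ge0_integralZl //;
    by move=> *; exact: f0.
have mZ (k : \bar R) : measurable_fun setT (fun x => k * G x).
  exact: measurable_funeM.
rewrite -(lebesgue_euclidS (mZ _) _).1; last by move=> x; rewrite mule_ge0 // f0.
rewrite (lebesgue_euclidS (mZ _) _).2; last by move=> x; rewrite mule_ge0 // f0.
transitivity (\int[leb1]_s \int[leb n]_z
    ((a^-1)%:E * (((\det S)^-1)%:E * f [tuple of s :: z]))).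
  apply: eq_integral => s _; under eq_integral do rewrite GE.
  have mfs : measurable_fun setT (fun z : euclid R n => f [tuple of (s : measurableTypeR R) :: z]).
    by apply: measurableT_comp => //; exact: (measurable_cons_tuple [tuple of nseq n 0%R] s).2.
  rewrite !ge0_integralZl //; first congr (_ * _).
  - exact: (IH S (beta s) (fun z : euclid R n => f [tuple of (s : measurableTypeR R) :: z]) Sp mfs).
  - exact: measurable_funeM.
  - by move=> x _; rewrite mule_ge0.
  - exact: (measurableT_comp mfs (measurable_aff S (beta s))).
rewrite -(lebesgue_euclidS _ _ (f := fun x => (a^-1)%:E * (((\det S)^-1)%:E * f x))).2.
- rewrite ge0_integralZl // ?ge0_integralZl //.
  + by rewrite muleA -EFinM detE invfM.
  + exact: measurable_funeM.
  + by move=> x _; rewrite mule_ge0.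
- by do 2 apply: measurable_funeM.
- by move=> x; rewrite !mule_ge0.
Qed.

End affine_substitution.

(** * Densities and Radon-Nikodym derivatives *)

Section densities.
Local Open Scope ereal_scope.
Local Open Scope charge_scope.
Context d (T : measurableType d) (R : realType).
Variables (nu : {finite_measure set T -> \bar R})
  (mu : {sigma_finite_measure set T -> \bar R}) (h : T -> R).
Hypotheses (mh : measurable_fun setT h).
Hypothesis nuE : forall A, measurable A -> nu A = \int[mu]_(x in A) (h x)%:E.

Lemma density_dominates : nu `<< mu.
Proof.
apply/null_content_dominatesP => A mA A0; rewrite nuE //.
apply: null_set_integral => //.
by apply/measurable_EFinP; exact: measurable_funTS.
Qed.

Lemma density_ae_eq_RN :
  ae_eq mu setT (fun x => (h x)%:E) ('d (charge_of_finite_measure nu) '/d mu).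
Proof.
apply: ae_eq_sym; apply: integral_ae_eq => //.
- by apply: Radon_Nikodym_integrable; exact: density_dominates.
- exact/measurable_EFinP.
- move=> E _ mE; rewrite -nuE // -Radon_Nikodym_integral //.
  exact: density_dominates.
Qed.

Lemma ge0_integral_density f E : measurable E -> (forall x, 0 <= f x) ->
  measurable_fun setT f ->
  \int[nu]_(x in E) f x = \int[mu]_(x in E) (f x * (h x)%:E).
Proof.
move=> mE f0 mf; have dom := density_dominates.
rewrite -(Radon_Nikodym_SigmaFinite.change_of_variables dom f0 mE); last first.
  exact: measurable_funTS.
apply: ae_eq_integral => //.
- apply: emeasurable_funM; first exact: measurable_funTS.
  apply: measurable_funTS.
  exact: measurable_int (Radon_Nikodym_SigmaFinite.f_integrable dom).
- apply: emeasurable_funM; first exact: measurable_funTS.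
  by apply/measurable_EFinP; exact: measurable_funTS.
- apply: ae_eqe_mul2l; apply: integral_ae_eq => //.
  + apply: (integrableS measurableT) => //.
    exact: Radon_Nikodym_SigmaFinite.f_integrable.
  + by apply/measurable_EFinP; exact: measurable_funTS.
  + move=> A AE mA; rewrite -Radon_Nikodym_SigmaFinite.f_integral //.
    exact: nuE.
Qed.

End densities.

(** * Gaussian densities *)

Section gaussian_density.
Context {R : realType}.
Local Open Scope ereal_scope.
Local Notation leb n := (@lebesgue_euclid R n).
Local Notation leb1 := (@lebesgue_measure R).

Lemma integral_gauss1 :
  \int[leb1]_t (expR (- (t ^+ 2) / 2))%:E = (Num.sqrt (2 * pi))%:E :> \bar R.
Proof.
pose a : R := (Num.sqrt 2)^-1%R.
have a0 : (0 < a)%R by rewrite invr_gt0 sqrtr_gt0.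
have mg : measurable_fun (setT : set (measurableTypeR R)) (fun t : R => (gauss_fun t)%:E).
  by apply/measurable_EFinP; exact: measurable_gauss_fun.
have := lebesgue_affine 0%R a0 mg (fun x => gauss_fun_ge0 _).
rewrite integralT_gauss -EFinM /a invrK -sqrtrM // => <-.
apply: eq_integral => t _; congr (_%:E); rewrite /gauss_fun addr0 exprMn exprVn.
by rewrite sqr_sqrtr //; congr expR; field.
Qed.

Lemma measurable_std_gauss k : measurable_fun setT (fun x : euclid R k =>
    (expR (- dotp (cvec_of x) (cvec_of x) / 2))%:E).
Proof.
  apply/measurable_EFinP; apply: measurableT_comp => //.
  apply: measurable_funM => //; apply: measurable_funN.
  rewrite (_ : (fun _ => _) = fun x : euclid R k => (\sum_i tnth x i * tnth x i)%R).
    by apply: measurable_sum => i; apply: measurable_funM; exact: measurable_tnth.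
  by apply/funext => x; rewrite dotpE; apply: eq_bigr => i _; rewrite !mxE.
Qed.

Lemma integral_gauss_euclid n :
  \int[leb n]_x (expR (- dotp (cvec_of x) (cvec_of x) / 2))%:E =
  (Num.sqrt (2 * pi) ^+ n)%:E.
Proof.
have E0 k (x : euclid R k) : 0 <= (expR (- dotp (cvec_of x) (cvec_of x) / 2))%:E.
  by rewrite lee_fin expR_ge0.
elim: n => [|n IH].
  have := @integral_dirac _ (euclid R 0) [tuple] R setT measurableT _ (@measurable_std_gauss 0%N).
  rewrite diracT mul1e dotpE big_ord0 oppr0 mul0r expR0 expr0; exact.
rewrite (lebesgue_euclidS (@measurable_std_gauss n.+1) (E0 n.+1)).1.
transitivity (\int[leb n]_x ((expR (- dotp (cvec_of x) (cvec_of x) / 2))%:E *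
    (Num.sqrt (2 * pi))%:E)).
  apply: eq_integral => x _; rewrite -integral_gauss1 -ge0_integralZl //.
  - apply: eq_integral => t _; rewrite -EFinM -expRD; congr (expR _)%:E.
    rewrite !dotpE big_ord_recl /= !mxE tnth0 -mulrDl -opprD addrC expr2.
    congr (- (_ + _) / 2)%R; apply: eq_bigr => i _.
    by rewrite !mxE tnthS.
  - apply/measurable_EFinP; apply: measurableT_comp => //.
    by apply: measurable_funM => //; apply: measurable_funN; exact: exprn_measurable.
rewrite ge0_integralZr ?lee_fin ?sqrtr_ge0 //.
  by rewrite IH -EFinM exprSr.
exact: measurable_std_gauss.
Qed.

Variable d : nat.
Local Notation n := d.+1.
Implicit Types nu : gparam R n.

Lemma gauss_pdfE nu x : posdef nu.2 ->
  gauss_pdf nu x = (Num.sqrt ((2 * pi) ^+ n)^-1 * expR (log_density nu (cvec_of x)))%R.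
Proof.
move=> Sp; have dS := posdef_det Sp.
rewrite /gauss_pdf /log_density.
set Q := qf _ _; rewrite -/(qf _ _) -/Q.
have -> : (- (ln (\det nu.2) + Q) / 2 = - (ln (\det nu.2) / 2) + - Q / 2)%R by field.
rewrite expRD mulrA; congr (_ * _)%R.
have p0 : (0 <= (2 * pi) ^+ n :> R)%R by rewrite exprn_ge0 // mulr_ge0 ?pi_ge0.
rewrite sqrtrM // invfM sqrtrV //; congr (_ * _)%R.
have sd : (0 < Num.sqrt (\det nu.2))%R by rewrite sqrtr_gt0.
rewrite -{2}[\det nu.2]sqr_sqrtr ?ltW // lnXn //.
rewrite (_ : (_ *+ 2 / 2 = ln (Num.sqrt (\det nu.2)))%R).
  by rewrite expRN lnK.
by rewrite -mulr_natr mulfK.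
Qed.

(** The substitution x = H y + nu.1, with H the square root of the covariance, reduces to the
    standard Gaussian. *)
Lemma integral_gauss_pdf nu : posdef nu.2 ->
  \int[leb n]_x (gauss_pdf nu x)%:E = 1.
Proof.
move=> Sp; have [H Hp HE] := posdef_sqrt Sp; have dH := posdef_det Hp.
have Hu := posdef_unit Hp; have Hs := posdef_sym Hp.
have mp : measurable_fun setT (fun x => (gauss_pdf nu x)%:E).
  by apply/measurable_EFinP; exact: measurable_gauss_pdf.
have := lebesgue_aff nu.1 Hp mp (fun x => gauss_pdf_ge0 nu x).
under eq_integral => x _.
  rewrite /gauss_pdf cvec_of_vtup addrK -HE invmx_mul // trmx_mul Hs.
  rewrite !mulmxA mulmxK // mulmxKV // -/(dotp _ _).
  rewrite EFinM.
  over.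
rewrite ge0_integralZl ?lee_fin ?invr_ge0 ?sqrtr_ge0 //; last exact: measurable_std_gauss.
rewrite integral_gauss_euclid -EFinM det_mulmx -expr2 sqrtrM ?exprn_ge0 ?mulr_ge0 ?pi_ge0 //.
rewrite sqrtr_sqr gtr0_norm // => h.
have s0 : (0 < Num.sqrt (2 * pi) :> R)%R by rewrite sqrtr_gt0 mulr_gt0 ?pi_gt0.
have sX : Num.sqrt ((2 * pi) ^+ n)%R = (Num.sqrt (2 * pi) ^+ n)%R :> R.
  have p0 : (0 <= 2 * pi :> R)%R by rewrite mulr_ge0 ?pi_ge0.
  by rewrite -{1}(sqr_sqrtr p0) -exprM mulnC exprM sqrtr_sqr ger0_norm // exprn_ge0 // sqrtr_ge0.
rewrite sX in h.
have -> : \int[leb n]_x (gauss_pdf nu x)%:E =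
    (\det H)%:E * (((\det H)^-1)%:E * \int[leb n]_x (gauss_pdf nu x)%:E).
  by rewrite muleA -EFinM mulfV ?gt_eqF // mul1e.
rewrite -h -EFinM; congr (_%:E); field.
by rewrite expf_neq0 !gt_eqF.
Qed.

Lemma gaussE nu A : posdef nu.2 ->
  gauss nu A = \int[leb n]_(x in A) (gauss_pdf nu x)%:E.
Proof.
move=> Sp; have e1 : gauss_density_measure nu setT = 1 by exact: integral_gauss_pdf.
rewrite (_ : gauss nu A = (if (gauss_density_measure nu setT == 0) ||
    (gauss_density_measure nu setT == +oo) then fun U => \d_([tuple of nseq n 0%R] : euclid R n) U
    else fun U => gauss_density_measure nu U *
      ((fine (gauss_density_measure nu setT))^-1)%:E) A) //.
by rewrite e1 onee_eq0 /= invr1 mule1.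
Qed.

Lemma integral_gauss nu f E : posdef nu.2 -> measurable E -> (forall x, 0 <= f x) ->
  measurable_fun setT f ->
  \int[gauss nu]_(x in E) f x = \int[leb n]_(x in E) (f x * (gauss_pdf nu x)%:E).
Proof.
move=> Sp mE f0 mf; apply: ge0_integral_density => //.
- exact: measurable_gauss_pdf.
- by move=> A mA; exact: gaussE.
Qed.

Lemma measurable_log_density nu :
  measurable_fun setT (fun x : euclid R n => log_density nu (cvec_of x)).
Proof.
apply: measurable_funM => //; apply: measurable_funN; apply: measurable_funD => //.
rewrite (_ : (fun _ => _) = fun x : euclid R n =>
  (\sum_i \sum_j (tnth x i - nu.1 i 0) * (invmx nu.2 i j * (tnth x j - nu.1 j 0)))%R).
  apply: measurable_sum => i; apply: measurable_sum => j.
  apply: measurable_funM; first by apply: measurable_funB => //; exact: measurable_tnth.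
  apply: measurable_funM => //.
  by apply: measurable_funB => //; exact: measurable_tnth.
apply/funext => x; rewrite qfE dotpE; apply: eq_bigr => i _.
rewrite !mxE mulr_sumr; apply: eq_bigr => j _.
by rewrite !mxE.
Qed.

Lemma gauss_density_ratio q nu E : posdef q.2 -> posdef nu.2 -> measurable E ->
  gauss q E = \int[gauss nu]_(x in E)
    (expR (log_density q (cvec_of x) - log_density nu (cvec_of x)))%:E.
Proof.
move=> Qp Sp mE; rewrite integral_gauss //; last first.
  apply/measurable_EFinP; apply: measurableT_comp => //.
  by apply: measurable_funB; exact: measurable_log_density.
rewrite gaussE //; apply: eq_integral => x _; rewrite -EFinM !gauss_pdfE //.
by rewrite mulrCA -expRD subrK.
Qed.

End gaussian_density.

Lemma integral_prob_cst d (T : measurableType d) (R : realType)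
    (P : probability T R) (k : R) : (\int[P]_x k%:E = k%:E)%E.
Proof.
have := @integral_cst _ _ _ P setT measurableT k%:E.
move=> h; apply: etrans h _; rewrite -[RHS]mule1; congr (_ * _)%E.
exact: probability_setT.
Qed.

(** * Gaussian means of quadratic functions *)

Section gaussian_moments.
Context {R : realType}.
Local Open Scope ereal_scope.
Variable d : nat.
Local Notation n := d.+1.
Implicit Types nu : gparam R n.

Lemma integral_gauss_exp_ratio q nu : posdef q.2 -> posdef nu.2 ->
  \int[gauss nu]_x (expR (log_density q (cvec_of x) - log_density nu (cvec_of x)))%:E = 1.
Proof.
by move=> Qp Sp; rewrite -gauss_density_ratio // probability_setT.
Qed.

Definition quad_fun (c : R) (b : 'cV[R]_n) (M : 'M[R]_n) (a : 'cV[R]_n) (x : euclid R n) : R :=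
  (c + dotp b (cvec_of x - a) + qf M (cvec_of x - a))%R.

Lemma measurable_quad_fun c b M a : measurable_fun setT (quad_fun c b M a).
Proof.
apply: measurable_funD.
  apply: measurable_funD => //.
  rewrite (_ : (fun _ => _) = fun x : euclid R n => (\sum_i b i 0 * (tnth x i - a i 0))%R).
    apply: measurable_sum => i; apply: measurable_funM => //.
    by apply: measurable_funB => //; exact: measurable_tnth.
  by apply/funext => x; rewrite dotpE; apply: eq_bigr => i _; rewrite !mxE.
rewrite (_ : (fun _ => _) = fun x : euclid R n =>
  (\sum_i \sum_j (tnth x i - a i 0) * (M i j * (tnth x j - a j 0)))%R).
  apply: measurable_sum => i; apply: measurable_sum => j.
  apply: measurable_funM; first by apply: measurable_funB => //; exact: measurable_tnth.
  apply: measurable_funM => //.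
  by apply: measurable_funB => //; exact: measurable_tnth.
apply/funext => x; rewrite qfE dotpE; apply: eq_bigr => i _.
rewrite !mxE mulr_sumr; apply: eq_bigr => j _.
by rewrite !mxE.
Qed.

Lemma qf_inv_le (S : 'M[R]_n) (c : R) w : posdef S -> (0 < c)%R ->
  (forall u, c * dotp u u <= qf S u)%R -> (c * qf (invmx S) w <= dotp w w)%R.
Proof.
move=> Sp c0 h; set z := invmx S *m w.
have := dotp_Cauchy w z; rewrite -qfE.
have := h z; rewrite -qf_inv //.
have : (0 <= qf (invmx S) w)%R by exact/posdef_ge0/posdef_inv.
have := dotp_ge0 w; move: (qf _ _) (dotp w w) (dotp z z) => x a b a0 x0 hb hx.
have : (c * x ^+ 2 <= a * x)%R by apply: le_trans (ler_wpM2l (ltW c0) hx) _; nra.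
have [x1|x1] := ltP 0%R x; last by move=> _; nra.
by rewrite expr2 mulrA ler_pM2r.
Qed.

Lemma ln_sub_ge (s : R) : (`|s| <= 1 / 2 -> - s - 2 * s ^+ 2 <= ln (1 - s))%R.
Proof.
move=> hs; have [h1 h2] : (- (1 / 2) <= s /\ s <= 1 / 2)%R by apply/andP; rewrite -ler_norml.
have p : (0 < 1 - s)%R by lra.
have := @le_ln1Dx R ((1 - s)^-1 - 1)%R; rewrite addrCA subrr addr0.
have pi0 : (0 < (1 - s)^-1)%R by rewrite invr_gt0.
have pv : ((1 - s)^-1 * (1 - s) = 1)%R by rewrite mulVf // gt_eqF.
rewrite lnV ?posrE // => h; have {}h : (- ln (1 - s) <= (1 - s)^-1 - 1)%R.
  by apply: h; lra.
suff : ((1 - s)^-1 <= 1 + s + 2 * s ^+ 2)%R by move: h; move: ((1 - s)^-1)%R (ln _) => u v; lra.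
rewrite -(ler_pM2r p) pv expr2; nra.
Qed.

Section log_det_perturbation.
Variables (Y : 'M[R]_n) (r : 'I_n -> R).
Hypothesis hr : spectrum Y r.

Lemma spectrum_perturbation (t : R) : (forall i, `|2 * t * r i| <= 1 / 2)%R ->
  (0 < \det (1%:M - (2 * t) *: Y))%R /\
  (- ln (\det (1%:M - (2 * t) *: Y)) <= 2 * (t * \tr Y) + 8 * t ^+ 2 * \sum_i r i ^+ 2)%R.
Proof.
move=> ht; have [_ dE _] := hr (1%:P - (2 * t) *: 'X)%R.
have -> : (1%:M - (2 * t) *: Y = horner_mx Y (1%:P - (2 * t) *: 'X))%R.
  by rewrite rmorphB /= horner_mx_C horner_mxZ horner_mx_X.
have pE i : ((1%:P - (2 * t) *: 'X).[r i] = 1 - 2 * t * r i)%R.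
  by rewrite hornerD hornerN hornerZ hornerX hornerC.
have pos i : (0 < (1%:P - (2 * t) *: 'X).[r i])%R.
  rewrite pE; have := ht i; rewrite ler_norml => /andP[_ h]; lra.
rewrite dE; have [-> p0] := ln_prod pos; split => //.
rewrite (spectrum_tr hr) !mulr_sumr -big_split /= -sumrN ler_sum // => i _.
rewrite pE; have := ln_sub_ge (ht i); rewrite !exprMn; move: (ln _) => l; lra.
Qed.

End log_det_perturbation.

(* E[exp(t h)] is computed by completing the square in the density. *)
Lemma gauss_exp_quad nu (b : 'cV[R]_n) (M : 'M[R]_n) : posdef nu.2 -> M^T = M ->
  exists (K e : R), [/\ (0 <= K)%R, (0 < e)%R & forall t : R, (`|t| <= e)%R ->
    \int[gauss nu]_x (expR (t * quad_fun 0 b M nu.1 x))%:E <=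
    (expR (t * \tr (M *m nu.2) + K * t ^+ 2))%:E].
Proof.
move=> Sp Ms; have [H Hp HE] := posdef_sqrt Sp.
have Hs := posdef_sym Hp; have Hu := posdef_unit Hp; have Hip := posdef_inv Hp.
have Hiu := posdef_unit Hip; have His := posdef_sym Hip.
pose Y := H *m M *m H.
have Ys : Y^T = Y by rewrite /Y !trmx_mul Hs Ms mulmxA.
have [r hr] := symmetric_spectrum Ys.
have trY : \tr Y = \tr (M *m nu.2) by rewrite /Y -mulmxA mxtrace_mulC -mulmxA HE.
pose rho : R := (\sum_i `|r i|)%R.
have rho0 : (0 <= rho)%R by apply: sumr_ge0.
have ri i : (`|r i| <= rho)%R by rewrite /rho (bigD1 i) //= lerDl sumr_ge0.
(* This e keeps |2 t r_i| <= 1/4, so [Mt t] stays above 1/2 and the tilted precision [Nt t] is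
   positive definite. *)
have [e e0 eE] : exists2 e : R, (0 < e)%R & (e * (rho + 1) = 1 / 8)%R.
  exists (8 * (rho + 1))^-1%R; first by rewrite invr_gt0 mulr_gt0 // ltr_wpDl.
  by field; rewrite gt_eqF // ltr_wpDl.
have tr_small (t : R) i : (`|t| <= e -> `|2 * t * r i| <= 1 / 4)%R.
  move=> te; rewrite !normrM ger0_norm // -mulrA.
  have : (`|t| * `|r i| <= e * (rho + 1))%R.
    by apply: ler_pM => //; apply: le_trans (ri i) _; rewrite lerDl.
  by rewrite eE => h; lra.
pose Mt (t : R) := (1%:M - (2 * t) *: Y)%R.
have Mth (t : R) : (`|t| <= e)%R -> posdef (Mt t - (1 / 2)%:M).
  move=> te; have -> : (Mt t - (1 / 2)%:M = horner_mx Y ((1 / 2)%:P - (2 * t) *: 'X))%R.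
    rewrite rmorphB /= horner_mx_C horner_mxZ horner_mx_X /Mt addrAC -raddfB /=.
    by congr (_%:M - _)%R; field.
  apply: (symmetric_horner_posdef Ys hr) => i.
  rewrite hornerD hornerN hornerC hornerZ hornerX.
  by have := tr_small t i te; rewrite ler_norml => /andP[_ h]; lra.
have Mt_ge (t : R) u : (`|t| <= e -> 1 / 2 * dotp u u <= qf (Mt t) u)%R.
  by move=> /Mth/(posdef_ge0 u); rewrite qfD qfN qf1 subr_ge0.
have Mtp (t : R) : (`|t| <= e)%R -> posdef (Mt t).
  move=> te; rewrite -[Mt t](subrK (1 / 2)%:M); apply: posdefD; first exact: Mth.
  by apply: posdef_scalar; lra.
pose Nt (t : R) := invmx H *m Mt t *m invmx H.
have Ntp (t : R) : (`|t| <= e)%R -> posdef (Nt t).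
  by move=> te; rewrite /Nt -{1}His; apply: posdef_congr => //; exact: Mtp.
have NtE t : Nt t = (invmx nu.2 - (2 * t) *: M)%R.
  rewrite /Nt /Mt mulmxBr mulmxBl mulmx1 -scalemxAr -scalemxAl -invmx_mul // HE.
  by rewrite /Y !mulmxA mulVmx // mul1mx mulmxK.
(* Tilting nu by the exponential of t times the quadratic function gives the Gaussian [nut t], up to
   the constant computed in [exponent]. *)
pose nut (t : R) : gparam R n := (nu.1 + t *: (invmx (Nt t) *m b), invmx (Nt t))%R.
have nutp (t : R) : (`|t| <= e)%R -> posdef (nut t).2 by move=> te; exact/posdef_inv/Ntp.
have exponent (t : R) x : (`|t| <= e)%R -> (t * quad_fun 0 b M nu.1 x =
    (log_density (nut t) (cvec_of x) - log_density nu (cvec_of x)) +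
    (t ^+ 2 * qf (invmx (Nt t)) b - ln (\det (Mt t))) / 2)%R.
  move=> te; have Np := Ntp t te.
  rewrite /log_density /quad_fun /= invmxK.
  have -> : (cvec_of x - (nu.1 + t *: (invmx (Nt t) *m b)) =
             cvec_of x - nu.1 + - (t *: (invmx (Nt t) *m b)))%R by rewrite opprD addrA.
  move: (_ - nu.1)%R => xi.
  rewrite qfDr ?(posdef_sym Np) // qfNr qfZr.
  have -> : qf (Nt t) (invmx (Nt t) *m b) = qf (invmx (Nt t)) b by rewrite -qf_inv ?invmxK //.
  rewrite mulmxN -scalemxAr mulKVmx ?posdef_unit // dotpNr dotpZr (dotpC xi b).
  have -> : ln (\det (invmx (Nt t))) = (ln (\det nu.2) - ln (\det (Mt t)))%R.
    have dH := posdef_det Hp; have dM := posdef_det (Mtp t te).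
    rewrite -HE /Nt !(det_inv, det_mulmx) lnV ?posrE ?mulr_gt0 ?invr_gt0 //.
    rewrite !lnM ?posrE ?mulr_gt0 ?invr_gt0 // lnV ?posrE //; ring.
  have -> : qf (Nt t) xi = (qf (invmx nu.2) xi - 2 * t * qf M xi)%R.
    by rewrite NtE qfD qfN qfZ.
  move: (ln _) (ln _) (qf _ _) (qf _ _) (qf _ _) (dotp _ _) => *; by field.
pose K : R := (4 * \sum_i r i ^+ 2 + dotp (H *m b) (H *m b))%R.
have K0 : (0 <= K)%R.
  rewrite addr_ge0 ?dotp_ge0 // mulr_ge0 // sumr_ge0 // => i _; exact: sqr_ge0.
exists K; exists e; split=> // t te.
rewrite (eq_integral (fun x => (expR (log_density (nut t) (cvec_of x) - log_density nu (cvec_of x)))%:E *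
  (expR ((t ^+ 2 * qf (invmx (Nt t)) b - ln (\det (Mt t))) / 2))%:E)); last first.
  by move=> x _; rewrite exponent // expRD EFinM.
rewrite ge0_integralZr ?lee_fin ?expR_ge0 //; last first.
  apply/measurable_EFinP; apply: measurableT_comp => //.
  by apply: measurable_funB; exact: measurable_log_density.
rewrite integral_gauss_exp_ratio ?mul1e ?lee_fin ?ler_expR //; last exact: nutp.
have ht i : (`|2 * t * r i| <= 1 / 2)%R by apply: le_trans (tr_small t i te) _; lra.
have [_ h1] := @spectrum_perturbation Y r hr t ht.
have h2 : (qf (invmx (Nt t)) b <= 2 * dotp (H *m b) (H *m b))%R.
  have -> : qf (invmx (Nt t)) b = qf (invmx (Mt t)) (H *m b).
    have Mu := posdef_unit (Mtp t te).
    rewrite /Nt !invmx_mul ?unitmx_mul ?Mu ?Hiu // invmxK -qf_congr Hs.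
    by rewrite mulmxA.
  have := qf_inv_le (H *m b) (Mtp t te) (ltac:(lra) : (0 < 1 / 2 :> R)%R)
    (fun u => Mt_ge t u te); lra.
rewrite trY -/(Mt t) in h1.
have h3 : (t ^+ 2 * qf (invmx (Nt t)) b <= t ^+ 2 * (2 * dotp (H *m b) (H *m b)))%R.
  by rewrite ler_wpM2l ?sqr_ge0.
rewrite /K; move: h1 h3; move: (ln _) (qf _ _) (dotp _ _) (\sum_i _)%R (t ^+ 2)%R (\tr _).
move=> *; lra.
Qed.

Lemma expR_le_quad (s : R) : (`|s| <= 1 / 2 -> expR s <= 1 + s + 2 * s ^+ 2)%R.
Proof.
move=> hs; have [h1 h2] : (- (1 / 2) <= s /\ s <= 1 / 2)%R by apply/andP; rewrite -ler_norml.
have p : (0 < 1 - s)%R by lra.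
have h := expR_ge1Dx (- s)%R; rewrite expRN in h.
have e0 := expR_gt0 s.
have {}h : (expR s * (1 - s) <= 1)%R by rewrite mulrC -ler_pdivlMr // mul1r.
have h3 : (1 <= (1 + s + 2 * s ^+ 2) * (1 - s))%R by rewrite expr2; nra.
by rewrite -(ler_pM2r p); apply: le_trans h h3.
Qed.

(** Integrability follows from |h| <= (exp(e h) + exp(- e h)) / e. The mean m satisfies 1 + t m <=
    E[exp(t h)] <= exp(t tau + K t^2) for small t of both signs, so the first-order terms agree; no
    second moment is integrated directly. *)
Lemma gauss_mean_quad0 nu (b : 'cV[R]_n) (M : 'M[R]_n) : posdef nu.2 -> M^T = M ->
  (gauss nu).-integrable setT (fun x => (quad_fun 0 b M nu.1 x)%:E) /\ \int[gauss nu]_x (quad_fun 0 b M nu.1 x)%:E = (\tr (M *m nu.2))%:E.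
Proof.
move=> Sp Ms; have [K [e [K0 e0 H]]] := gauss_exp_quad b Sp Ms.
set h := quad_fun 0 b M nu.1; set tau := \tr (M *m nu.2).
have mh : measurable_fun setT h by exact: measurable_quad_fun.
have mexp (t : R) : measurable_fun setT (fun x => (expR (t * h x))%:E).
  by apply/measurable_EFinP; apply: measurableT_comp => //; exact: measurable_funM.
have iexp (t : R) : (`|t| <= e)%R -> (gauss nu).-integrable setT (fun x => (expR (t * h x))%:E).
  move=> te; apply/integrableP; split => //.
  under eq_integral do rewrite gee0_abs ?lee_fin ?expR_ge0 //.
  by apply: le_lt_trans (H t te) _; rewrite ltry.
have ee : (`|e| <= e)%R by rewrite ger0_norm // ltW.
have eN : (`|- e| <= e)%R by rewrite normrN.
have ih : (gauss nu).-integrable setT (fun x => (h x)%:E).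
  apply: (le_integrable measurableT _ _ (integrableZl measurableT (e^-1) (integrableD measurableT (iexp e ee) (iexp (- e)%R eN)))) => //.
    exact/measurable_EFinP.
  move=> x _; rewrite -EFinD -EFinM !abse_EFin lee_fin.
  rewrite [leRHS]ger0_norm; last by rewrite mulr_ge0 ?invr_ge0 ?(ltW e0) // addr_ge0 // expR_ge0.
  rewrite ler_pdivlMl // -{1}(gtr0_norm e0) -normrM ler_norml.
  have h1 := expR_ge1Dx (e * h x); have h2 := expR_ge1Dx (- e * h x).
  have h3 := expR_ge0 (e * h x); have h4 := expR_ge0 (- e * h x).
  by rewrite mulNr in h2 h4 *; apply/andP; split; lra.
split => //; have fin := integrable_fin_num measurableT ih.
rewrite -(fineK fin); congr (_%:E); set m := fine _.
have upper (t : R) : (`|t| <= e)%R -> (1 + t * m <= expR (t * tau + K * t ^+ 2))%R.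
  move=> te; rewrite -lee_fin; apply: le_trans (H t te).
  have i1 : (gauss nu).-integrable setT (fun=> 1%:E : \bar R).
    by apply: finite_measure_integrable_cst.
  have -> : (1 + t * m)%:E = \int[gauss nu]_x (1%:E + t%:E * (h x)%:E).
    rewrite integralD //; last exact: integrableZl.
    rewrite integral_prob_cst integralZl // -(fineK fin).
    by rewrite EFinD EFinM.
  apply: le_integral => //.
  - by apply: integrableD => //; exact: integrableZl.
  - exact: iexp.
  - by move=> x _; rewrite -EFinM -EFinD lee_fin expR_ge1Dx.
have K2 : exists (K' e' : R), [/\ (0 < K')%R, (0 < e')%R & forall t : R, (`|t| <= e' ->
    t * m <= t * tau + K' * t ^+ 2)%R].
  pose D := (`|tau| + K + 1)%R.
  have D0 : (0 < D)%R by rewrite ltr_wpDl // addr_ge0.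
  exists (K + 2 * D ^+ 2)%R, (Num.min 1 (Num.min e (1 / 2 / D)))%R; split.
  - by rewrite ltr_wpDl // mulr_gt0 // exprn_gt0.
  - by rewrite !lt_min ltr01 e0 !divr_gt0.
  move=> t; rewrite !le_min => /and3P[t1 te tD].
  set s := (t * tau + K * t ^+ 2)%R.
  have sb : (`|s| <= D * `|t|)%R.
    apply: le_trans (ler_normD _ _) _; rewrite !normrM (ger0_norm K0).
    rewrite /D; have := normr_ge0 t; have := normr_ge0 tau; move: t1.
    move: (`|t|)%R (`|tau|)%R => x y *.
    have : (K * (x * x) <= K * x)%R by rewrite ler_wpM2l // ler_piMr.
    lra.
  have s2 : (`|s| <= 1 / 2)%R.
    by apply: le_trans sb _; rewrite mulrC -ler_pdivlMr.
  have s3 : (s ^+ 2 <= D ^+ 2 * t ^+ 2)%R.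
    rewrite -exprMn -[leLHS]real_normK ?num_real // -[leRHS]real_normK ?num_real //.
    rewrite normrM (gtr0_norm D0).
    by rewrite ler_pXn2r // nnegrE // mulr_ge0 // ltW.
  have := expR_le_quad s2; have := upper t te; rewrite -/s => u1 u2.
  have h4 : (2 * s ^+ 2 <= 2 * (D ^+ 2 * t ^+ 2))%R by rewrite ler_pM2l.
  have h5 := le_trans (le_trans u1 u2) (lerD (lexx (1 + s)%R) h4).
  rewrite -(lerD2l 1%R); apply: le_trans h5 _; rewrite /s le_eqVlt.
  by apply/orP; left; apply/eqP; ring.
have [K' [e' [K'0 e'0 up]]] := K2.
apply/eqP; rewrite -subr_eq0 -normr_eq0; apply/negPn/negP => ne.
have g0 : (0 < `|m - tau|)%R by rewrite lt_neqAle eq_sym ne normr_ge0.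
(* For t this small the quadratic error K' * t^2 cannot hide a gap |m - tau| multiplied by t. *)
pose t := Num.min e' (`|m - tau| / (2 * K'))%R.
have t0 : (0 < t)%R by rewrite lt_min e'0 divr_gt0 // mulr_gt0.
have t1 : (t <= e')%R by rewrite ge_min lexx.
have t2 : (t * K' <= `|m - tau| / 2)%R.
  rewrite -ler_pdivlMr // -mulrA -invfM ge_min; apply/orP; right.
  by rewrite mulrC.
have := up t; rewrite gtr0_norm // => /(_ t1) u1.
have := up (- t)%R; rewrite normrN gtr0_norm // sqrrN => /(_ t1) u2.
have v1 : (m - tau <= K' * t)%R by rewrite -(ler_pM2l t0); lra.
have v2 : (tau - m <= K' * t)%R by rewrite -(ler_pM2l t0); lra.
have : (`|m - tau| <= K' * t)%R by rewrite ler_norml; apply/andP; split; lra.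
by move: t2 g0; rewrite mulrC; lra.
Qed.

Lemma gauss_mean_quad nu c (b : 'cV[R]_n) (M : 'M[R]_n) a : posdef nu.2 -> M^T = M ->
  (gauss nu).-integrable setT (fun x => (quad_fun c b M a x)%:E) /\ \int[gauss nu]_x (quad_fun c b M a x)%:E =
  (c + dotp b (nu.1 - a) + \tr (M *m (nu.2 + (nu.1 - a) *m (nu.1 - a)^T)))%:E.
Proof.
move=> Sp Ms.
have E x : quad_fun c b M a x = (quad_fun c b M a (vtup nu.1) +
    quad_fun 0 (b + 2 *: (M *m (nu.1 - a))) M nu.1 x)%R.
  rewrite /quad_fun cvec_of_vtup.
  have -> : (cvec_of x - a = (cvec_of x - nu.1) + (nu.1 - a))%R by rewrite addrA subrK.
  move: (_ - nu.1)%R (nu.1 - a)%R => xi m; rewrite qfDr // dotpDr dotpDl dotpZl.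
  by rewrite (dotpC xi (M *m m)); ring.
have [i1 E1] := gauss_mean_quad0 (b + 2 *: (M *m (nu.1 - a))) Sp Ms.
have i2 : (gauss nu).-integrable setT (fun=> (quad_fun c b M a (vtup nu.1))%:E).
  exact: finite_measure_integrable_cst.
have EE : (fun x => (quad_fun c b M a x)%:E) = (fun x => (quad_fun c b M a (vtup nu.1))%:E +
    (quad_fun 0 (b + 2 *: (M *m (nu.1 - a))) M nu.1 x)%:E).
  by apply/funext => x; rewrite E EFinD.
split; first by rewrite EE; exact: integrableD.
rewrite EE integralD // E1 integral_prob_cst -EFinD.
by congr (_%:E); rewrite /quad_fun cvec_of_vtup mulmxDr mxtraceD -qf_tr; ring.
Qed.

Lemma gauss_mean_log_density q nu : posdef q.2 -> posdef nu.2 ->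
  (gauss q).-integrable setT (fun x => (log_density nu (cvec_of x))%:E) /\ \int[gauss q]_x (log_density nu (cvec_of x))%:E = (mean_log_density q nu)%:E.
Proof.
move=> Qp Sp; have Is := posdef_sym (posdef_inv Sp).
have [] := gauss_mean_quad (- ln (\det nu.2) / 2) 0 nu.1 (M := - 2^-1 *: invmx nu.2) Qp.
  by rewrite linearZ /= Is.
have -> : (fun x => (quad_fun (- ln (\det nu.2) / 2) 0 (- 2^-1 *: invmx nu.2) nu.1 x)%:E) =
    (fun x => (log_density nu (cvec_of x))%:E).
  apply/funext => x; congr (_%:E); rewrite /quad_fun /log_density qfZ.
  by rewrite dotpE big1 => [|i _]; [|by rewrite mxE mul0r]; field.
move=> i1 ->; split => //; congr (_%:E); rewrite /mean_log_density.
rewrite dotpE big1 => [|i _]; last by rewrite mxE mul0r.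
by rewrite -scalemxAl mxtraceZ; field.
Qed.

End gaussian_moments.

(** * The Gibbs variational inequality *)

Section relative_entropy.
Local Open Scope ereal_scope.
Local Open Scope charge_scope.
Context d (T : measurableType d) (R : realType).
Variables (P M : probability T R).
Hypothesis PM : P `<< M.

Definition log_RN (x : T) : R := ln (fine (('d (charge_of_finite_measure P) '/d M) x)).

Lemma measurable_log_RN : measurable_fun setT log_RN.
Proof.
apply: measurableT_comp; first exact: measurable_ln.
apply: (measurableT_comp (fine_measurable measurableT)).
by apply: (measurable_int M); apply: Radon_Nikodym_integrable; exact: PM.
Qed.

Variable l : T -> R.
Hypothesis ml : measurable_fun setT l.

Let w (x : T) : R := expR (l x - log_RN x).

Let mw : measurable_fun setT w.
Proof.
by apply: measurableT_comp => //; apply: measurable_funB => //; exact: measurable_log_RN.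
Qed.

(* [w] is the density of the measure exp(l) M with respect to P, on the set
   where the Radon-Nikodym derivative of P is positive. *)
Lemma integral_exp_log_RN :
  \int[P]_x (w x)%:E <= \int[M]_x (expR (l x))%:E.
Proof.
have w0 x : 0 <= (w x)%:E by rewrite lee_fin expR_ge0.
have mwE : measurable_fun setT (fun x => (w x)%:E) by exact/measurable_EFinP.
rewrite -(Radon_Nikodym_SigmaFinite.change_of_variables PM w0 measurableT mwE).
apply: ae_ge0_le_integral => //.
- by move=> x _; rewrite mule_ge0 // Radon_Nikodym_SigmaFinite.f_ge0.
- apply: emeasurable_funM => //.
  exact: measurable_int (Radon_Nikodym_SigmaFinite.f_integrable PM).
- by apply/measurable_EFinP; apply: measurableT_comp.
have := ae_eq_Radon_Nikodym_SigmaFinite PM measurableT.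
apply: filterS => x /(_ I) -> _.
have : ('d (charge_of_finite_measure P) '/d M) x \is a fin_num.
  by apply: Radon_Nikodym_fin_num; exact: PM.
rewrite /w /log_RN; case: (('d _ '/d M) x) => //= r _.
rewrite -EFinM lee_fin; have [r0|r0] := ltP 0%R r.
  by rewrite expRD expRN lnK // mulfVK // gt_eqF.
by apply: le_trans (expR_ge0 _); rewrite mulr_ge0_le0 // expR_ge0.
Qed.

Hypothesis KLfin : (M.-integrable setT (fun x => (expR (l x))%:E)).

Let iw : P.-integrable setT (fun x => (w x)%:E).
Proof.
apply/integrableP; split; first exact/measurable_EFinP.
under eq_integral do rewrite gee0_abs ?lee_fin ?expR_ge0 //.
apply: le_lt_trans integral_exp_log_RN _.
move/integrableP : KLfin => [_]; apply: le_lt_trans.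
apply: ge0_le_integral => //.
- by apply/measurable_EFinP; apply: measurableT_comp.
- by apply: measurableT_comp => //; apply/measurable_EFinP; apply: measurableT_comp.
- by move=> x _; rewrite gee0_abs ?lee_fin ?expR_ge0.
Qed.

Hypothesis iRN : P.-integrable setT (fun x => (log_RN x)%:E).

(** From 1 + z <= exp z at z = l - log_RN, the function l is at most |log_RN| + w, and both summands
    are P-integrable. *)
Lemma integrable_of_exp : (forall x, (0 <= l x)%R) -> P.-integrable setT (fun x => (l x)%:E).
Proof.
move=> l0; have ia := integrable_abse iRN.
apply: (le_integrable measurableT _ _ (integrableD measurableT ia iw)) => //.
  exact/measurable_EFinP.
move=> x _; have -> : (abse \o (fun x => (log_RN x)%:E)) x = (`|log_RN x|%R)%:E by [].
rewrite -EFinD !abse_EFin lee_fin ger0_norm //.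
rewrite [leRHS]ger0_norm ?addr_ge0 ?expR_ge0 //.
have := expR_ge1Dx (l x - log_RN x)%R; rewrite -/(w x).
have := ler_norm (log_RN x); move: (log_RN x) (`|_|)%R (w x) => *; lra.
Qed.

(** Pointwise l <= log_RN + (w - 1), and the P-integral of w is at most 1. *)
Lemma relative_entropy_dual : P.-integrable setT (fun x => (l x)%:E) ->
  \int[M]_x (expR (l x))%:E <= 1 ->
  \int[P]_x (l x)%:E <= \int[P]_x (log_RN x)%:E.
Proof.
move=> il l1; have w1 := le_trans integral_exp_log_RN l1.
have i1 : P.-integrable setT (fun=> 1%:E : \bar R) by exact: finite_measure_integrable_cst.
have iw1 := integrableB measurableT iw i1.
have fl := integrable_fin_num measurableT il.
have fw := integrable_fin_num measurableT iw.
have h : \int[P]_x (l x)%:E <= \int[P]_x ((log_RN x)%:E + ((w x)%:E - 1%:E)).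
  apply: le_integral => //.
  - exact: integrableD.
  - move=> x _; rewrite -EFinB -EFinD lee_fin.
    by have := expR_ge1Dx (l x - log_RN x)%R; rewrite -/(w x); lra.
apply: le_trans h _; rewrite integralD // integralB // integral_prob_cst.
have fR := integrable_fin_num measurableT iRN.
move: w1; rewrite -(fineK fw) -(fineK fR) -EFinB -EFinD !lee_fin => w1; lra.
Qed.

End relative_entropy.

Section kullback_leibler.
Local Open Scope ereal_scope.
Local Open Scope charge_scope.
Context {R : realType} {d : nat}.
Implicit Types P M : probability (euclid R d) R.

Lemma KL_dominated P M : KL P M < +oo -> P `<< M.
Proof. by rewrite /KL; case: ifPn => [/asboolP|]. Qed.

Lemma KLE P M : P `<< M -> KL P M = \int[P]_x (log_RN P M x)%:E.
Proof. by move=> PM; rewrite /KL asboolT. Qed.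

(** The negative part of [log_RN] lies below exp(- log_RN), whose P-integral is at most 1;
    finiteness of the entropy then bounds the positive part. *)
Lemma KL_integrable P M : KL P M < +oo -> P.-integrable setT (fun x => (log_RN P M x)%:E).
Proof.
move=> fin; have PM := KL_dominated fin; rewrite KLE // integralE in fin.
have mR : measurable_fun setT (fun x => (log_RN P M x)%:E).
  by apply/measurable_EFinP; exact: measurable_log_RN.
have neg : \int[P]_x (fun x => (log_RN P M x)%:E)^\- x <= 1.
  have := @integral_exp_log_RN _ _ _ P M PM (fun=> 0%R) (measurable_cst _).
  under [leRHS]eq_integral do rewrite expR0.
  rewrite integral_prob_cst; apply: le_trans; apply: ge0_le_integral => //.
  - exact: measurable_funeneg.
  - apply/measurable_EFinP; apply: measurableT_comp => //.
    by apply: measurable_funB => //; exact: measurable_log_RN.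
  - move=> x _; rewrite funenegE ge_max; apply/andP; split; last by rewrite lee_fin expR_ge0.
    by rewrite -EFinN lee_fin sub0r; apply: le_trans (expR_ge1Dx _); rewrite lerDr.
have negf : \int[P]_x (fun x => (log_RN P M x)%:E)^\- x \is a fin_num.
  rewrite ge0_fin_numE; first by apply: le_lt_trans neg _; rewrite ltry.
  exact: integral_ge0.
apply/integrableP; split => //.
under eq_integral => x _ do rewrite -/((abse \o (fun x => (log_RN P M x)%:E)) x) fune_abse.
rewrite ge0_integralD //; last 2 first.
- exact: measurable_funepos.
- exact: measurable_funeneg.
move: fin negf; case: (\int[P]_x _^\+ x) => [a| |]; case: (\int[P]_x _^\- x) => [b| |] // _ _.
by rewrite -EFinD ltry.
Qed.

Lemma KL_ge0_gtNy P M : KL P M != -oo.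
Proof.
have [fin|] := ltP (KL P M) +oo; last by rewrite leye_eq => /eqP ->.
have i := KL_integrable fin; rewrite KLE; last exact: KL_dominated.
by apply/eqP => h; have := integrable_fin_num measurableT i; rewrite h.
Qed.

End kullback_leibler.

(** * Weak Kantorovich duality *)

Section wasserstein.
Local Open Scope ereal_scope.
Context {R : realType} {d : nat}.
Implicit Types P Q : probability (euclid R d) R.

Lemma measurable_sqdist :
  measurable_fun setT (fun z : euclid R d * euclid R d => (sqdist z.1 z.2)).
Proof.
apply: measurable_sum => i; apply: measurable_funX; apply: measurable_funB.
  by apply: (measurableT_comp (measurable_tnth i)); exact: measurable_fst.
by apply: (measurableT_comp (measurable_tnth i)); exact: measurable_snd.
Qed.

Lemma sqdist_ge0 (x y : euclid R d) : (0 <= sqdist x y)%R.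
Proof. by apply: sumr_ge0 => i _; exact: sqr_ge0. Qed.

Lemma W2sq_ge0 P Q : 0 <= W2sq P Q.
Proof.
apply: le_ereal_inf_tmp => _ [g _ <-]; apply: integral_ge0 => z _.
by rewrite lee_fin sqdist_ge0.
Qed.

Lemma marginal_integral (dT : measure_display) (T : measurableType dT)
    (G : probability T R) (phi : T -> euclid R d) P (f : euclid R d -> R) :
  measurable_fun setT phi -> (forall A, measurable A -> G (phi @^-1` A) = P A) ->
  P.-integrable setT (fun x => (f x)%:E) ->
  G.-integrable setT (fun z => (f (phi z))%:E) /\
  \int[G]_z (f (phi z))%:E = \int[P]_x (f x)%:E.
Proof.
move=> mphi GP /integrableP[mf fin].
have pE (h : euclid R d -> \bar R) : \int[P]_x h x = \int[pushforward G phi]_x h x.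
  by apply: eq_measure_integral => A mA _; rewrite /pushforward; first [exact: GP|exact/esym/GP].
have i : G.-integrable setT (fun z => (f (phi z))%:E).
  apply/integrableP; split; first exact: (measurableT_comp mf mphi).
  move: fin; rewrite pE ge0_integral_pushforward //.
  by apply: measurableT_comp.
by split => //; rewrite pE (integral_pushforward mphi mf).
Qed.

Lemma W2sq_dual P Q (f g : euclid R d -> R) :
  (forall x y, (f x + g y <= sqdist x y)%R) ->
  P.-integrable setT (fun x => (f x)%:E) -> Q.-integrable setT (fun x => (g x)%:E) ->
  \int[P]_x (f x)%:E + \int[Q]_x (g x)%:E <= W2sq P Q.
Proof.
move=> fg iff ig; apply: le_ereal_inf_tmp => _ [G GPQ <-].
have e1 A : measurable A -> G (fst @^-1` A) = P A.
  move=> mA; rewrite -(GPQ A mA).1; congr (G _).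
  by apply/seteqP; split => -[x y] //= [].
have e2 A : measurable A -> G (snd @^-1` A) = Q A.
  move=> mA; rewrite -(GPQ A mA).2; congr (G _).
  by apply/seteqP; split => -[x y] //= [].
have [i1 <-] := marginal_integral measurable_fst e1 iff.
have [i2 <-] := marginal_integral measurable_snd e2 ig.
have [fin|] := ltP (\int[G]_z (sqdist z.1 z.2)%:E) +oo; last first.
  by rewrite leye_eq => /eqP ->; rewrite leey.
rewrite -integralD //; apply: le_integral => //; first exact: integrableD.
  apply/integrableP; split; first by apply/measurable_EFinP; exact: measurable_sqdist.
  by under eq_integral do rewrite gee0_abs ?lee_fin ?sqdist_ge0 //.
by move=> z _; rewrite -EFinD lee_fin.
Qed.

End wasserstein.

(** * Measures of finite entropy relative to a Gaussian *)

Section gaussian_KL.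
Local Open Scope ereal_scope.
Local Open Scope charge_scope.
Context {R : realType} {d : nat}.
Local Notation n := d.+1.
Implicit Types q nu : gparam R n.

Lemma KL_gauss q nu : posdef q.2 -> posdef nu.2 ->
  KL (gauss q) (gauss nu) = (gKL q nu)%:E.
Proof.
move=> Qp Sp.
pose h x : R := expR (log_density q (cvec_of x) - log_density nu (cvec_of x)).
have mh : measurable_fun setT h.
  by apply: measurableT_comp => //; apply: measurable_funB; exact: measurable_log_density.
have hE A : measurable A -> gauss q A = \int[gauss nu]_(x in A) (h x)%:E.
  by move=> mA; exact: gauss_density_ratio.
have dom := density_dominates mh hE.
rewrite KLE //; have [i1 E1] := gauss_mean_log_density Qp Qp.
have [i2 E2] := gauss_mean_log_density Qp Sp.
transitivity (\int[gauss q]_x ((log_density q (cvec_of x))%:E - (log_density nu (cvec_of x))%:E)).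
  apply: ae_eq_integral => //.
  - by apply/measurable_EFinP; exact: measurable_log_RN.
  - by apply: emeasurable_funB; apply/measurable_EFinP; exact: measurable_log_density.
  - have := null_dominates_ae_eq measurableT dom (density_ae_eq_RN mh hE).
    apply: filterS => x /(_ I) E _; rewrite /log_RN -E /= /h expRK.
    by rewrite EFinB.
by rewrite integralB // E1 E2 gKL_mean_log_density.
Qed.

Lemma dotp0l (v : 'cV[R]_n) : dotp 0 v = 0%R.
Proof. by rewrite /dotp linear0 mul0mx mxE. Qed.

Lemma quad_fun_le (b : 'cV[R]_n) (M : 'M[R]_n) (c : R) : exists C : R, (0 <= C)%R /\
  forall xi : 'cV[R]_n, (`|c + dotp b xi + qf M xi| <= C * (1 + dotp xi xi))%R.
Proof.
exists (`|c| + dotp b b + 1 + (frob M + 1))%R; split.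
  by rewrite !addr_ge0 ?normr_ge0 ?dotp_ge0 ?frob_ge0.
move=> xi; set x := dotp xi xi; have x0 : (0 <= x)%R by exact: dotp_ge0.
have b0 := dotp_ge0 b; have f0 := frob_ge0 M.
have h1 : (`|dotp b xi| <= dotp b b + x)%R.
  have p1 := dotp_ge0 (b - xi); have p2 := dotp_ge0 (b + xi).
  rewrite dotpBl !dotpBr (dotpC xi b) -/x in p1.
  rewrite dotpDl !dotpDr (dotpC xi b) -/x in p2.
  by rewrite ler_norml; apply/andP; split; lra.
have h2 : (`|qf M xi| <= (frob M + 1) * x)%R.
  have : (qf M xi ^+ 2 <= ((frob M + 1) * x) ^+ 2)%R.
    rewrite qfE; apply: le_trans (dotp_Cauchy _ _) _; rewrite -/x.
    have : (dotp (M *m xi) (M *m xi) <= frob M * x)%R by rewrite /x -!frob_dotp frobM.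
    move=> h; apply: le_trans (ler_wpM2l x0 h) _.
    rewrite exprMn mulrCA -expr2 ler_wpM2r ?sqr_ge0 // expr2; nra.
  by rewrite -[leLHS]real_normK ?num_real // ler_pXn2r ?nnegrE // mulr_ge0 // addr_ge0.
apply: le_trans (ler_normD _ _) _; apply: le_trans (lerD (ler_normD _ _) h2) _.
move: h1; have := normr_ge0 c; move: (`|c|)%R (`|dotp b xi|)%R (dotp b b) (frob M) b0 f0.
move=> u v y z y0 z0 u0 h1; rewrite !mulrDr !mulrDl; nra.
Qed.

(** A small multiple of |x - nu.1|^2 has an exponential moment under the Gaussian, and finite
    entropy transfers integrability to P by [integrable_of_exp]. Every quadratic function is
    dominated by a multiple of 1 + |x - nu.1|^2. *)
Lemma quad_fun_integrable P nu c b M a : posdef nu.2 -> KL P (gauss nu) < +oo ->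
  P.-integrable setT (fun x => (quad_fun c b M a x : R)%:E).
Proof.
move=> Sp fin; have PM := KL_dominated fin; have iRN := KL_integrable fin.
have [K [e [K0 e0 H]]] := gauss_exp_quad 0 Sp (tr_scalar_mx n (1 : R)).
have ee : (`|e| <= e)%R by rewrite ger0_norm // ltW.
pose l x : R := (e * dotp (cvec_of x - nu.1) (cvec_of x - nu.1))%R.
have lE x : l x = (e * quad_fun 0 0 1%:M nu.1 x)%R.
  by rewrite /l /quad_fun qf1 mul1r dotp0l !add0r.
have ml : measurable_fun setT l.
  rewrite (_ : l = fun x => (e * quad_fun 0 0 1%:M nu.1 x)%R); last exact/funext.
  by apply: measurable_funM => //; exact: measurable_quad_fun.
have il : P.-integrable setT (fun x => (l x)%:E).
  apply: (integrable_of_exp PM ml _ iRN); last first.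
    by move=> x; rewrite mulr_ge0 ?dotp_ge0 // ltW.
  apply/integrableP; split; first by apply/measurable_EFinP; exact: measurableT_comp.
  under eq_integral do rewrite gee0_abs ?lee_fin ?expR_ge0 // lE.
  by apply: le_lt_trans (H e ee) _; rewrite ltry.
have [C [C0 hC]] := quad_fun_le (b + (M^T *m (nu.1 - a) + M *m (nu.1 - a)))%R M (quad_fun c b M a (vtup nu.1)).
have i1 : P.-integrable setT (fun=> 1%:E : \bar R) by exact: finite_measure_integrable_cst.
apply: (le_integrable measurableT _ _
  (integrableZl measurableT C (integrableD measurableT i1 (integrableZl measurableT e^-1 il)))) => //.
  by apply/measurable_EFinP; exact: measurable_quad_fun.
move=> x _.
have -> : C%:E * (1 + (e^-1)%:E * (l x)%:E) = (C * (1 + e^-1 * l x))%:E by [].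
rewrite !abse_EFin lee_fin /l mulKf ?gt_eqF //.
rewrite [leRHS]ger0_norm ?mulr_ge0 ?addr_ge0 ?dotp_ge0 //.
apply: le_trans (hC _); rewrite le_eqVlt; apply/orP; left; apply/eqP; congr (`|_|)%R.
rewrite /quad_fun cvec_of_vtup.
have -> : (cvec_of x - a = (cvec_of x - nu.1) + (nu.1 - a))%R by rewrite addrA subrK.
move: (_ - nu.1)%R (nu.1 - a)%R => xi m.
have e1 : dotp (M^T *m m) xi = dotp m (M *m xi) by rewrite dotp_mul.
by rewrite !qfE mulmxDr !dotpDl !dotpDr e1 (dotpC (M *m m) xi); ring.
Qed.

End gaussian_KL.

(** * Optimality of the Gaussian pair *)

Section unbalanced_transport.
Context {R : realType} {d : nat}.
Local Notation n := d.+1.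
Variables (t0 t1 : R) (mu nu : gparam R n) (L : 'M[R]_n).
Hypotheses (t0_gt0 : 0 < t0) (t1_gt0 : 0 < t1).
Hypotheses (mu_pd : posdef mu.2) (nu_pd : posdef nu.2).
Hypotheses (L_pd : posdef L) (L_eq : opt_eq t0 t1 mu nu L).
Local Open Scope ereal_scope.

Let op := opt_p t0 t1 mu nu L.
Let oq := opt_q t0 t1 mu nu L.
Let w := opt_w t0 t1 mu nu.
Let u := opt_u t0 t1 mu nu.
Let v := opt_v t0 t1 mu nu.
Let op_pd : posdef op.2. Proof. exact: (opt_P_pd t0_gt0 t1_gt0 mu_pd nu_pd L_pd L_eq). Qed.
Let oq_pd : posdef oq.2. Proof. exact: (opt_Q_pd t0_gt0 t1_gt0 mu_pd nu_pd L_pd L_eq). Qed.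
Let Ls := posdef_sym L_pd.
Let Lu := posdef_unit L_pd.

Let phi (x : euclid R n) : R := opt_phi t0 t1 mu nu L (cvec_of x).
Let psi (x : euclid R n) : R := opt_psi t0 t1 mu nu L (cvec_of x).

Lemma sqdist_dotp (x y : euclid R n) :
  sqdist x y = dotp (cvec_of x - cvec_of y) (cvec_of x - cvec_of y).
Proof. by rewrite dotpE; apply: eq_bigr => i _; rewrite !mxE expr2. Qed.

Lemma phi_quad x : phi x = quad_fun 0 (2 *: w) (1%:M - L) u x.
Proof. by rewrite /phi /opt_phi /quad_fun add0r dotpZl addrC. Qed.

Lemma psi_quad x : psi x = quad_fun 0 (- (2 *: w)) (1%:M - invmx L) v x.
Proof. by rewrite /psi /opt_psi /quad_fun add0r dotpNl dotpZl addrC. Qed.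

(** exp(k - f / t) is the density of [gauss q] with respect to [gauss gm]; it has integral one, so
    the Gibbs inequality applies to its logarithm. *)
Lemma dual_integrable (P : probability (euclid R n) R) (gm q : gparam R n) (f : euclid R n -> R) (k t : R) :
  (0 < t)%R -> posdef gm.2 -> posdef q.2 -> KL P (gauss gm) < +oo ->
  (forall x, log_density q (cvec_of x) - log_density gm (cvec_of x) = k - f x / t)%R ->
  measurable_fun setT f -> P.-integrable setT (fun x => (f x)%:E) ->
  (t * k)%:E - \int[P]_x (f x)%:E <= t%:E * KL P (gauss gm).
Proof.
move=> tp gp qp fin hf mf i_f; have PM := KL_dominated fin; have iRN := KL_integrable fin.
rewrite KLE //.
pose l (x : euclid R n) : R := (log_density q (cvec_of x) - log_density gm (cvec_of x))%R.
have ml : measurable_fun setT l by apply: measurable_funB; exact: measurable_log_density.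
have lE x : (l x)%:E = k%:E - (t^-1)%:E * (f x)%:E.
  by rewrite /l hf -EFinM -EFinB mulrC.
have ik : P.-integrable setT (fun=> k%:E : \bar R) by exact: finite_measure_integrable_cst.
have itf := integrableZl measurableT t^-1 i_f.
have il : P.-integrable setT (fun x => (l x)%:E).
  rewrite (_ : (fun _ => _) = fun x => k%:E - (t^-1)%:E * (f x)%:E); last exact/funext.
  exact: integrableB.
have l1 : \int[gauss gm]_x (expR (l x))%:E = 1 by exact: integral_gauss_exp_ratio.
have i1 : (gauss gm).-integrable setT (fun x => (expR (l x))%:E).
  apply/integrableP; split; first by apply/measurable_EFinP; exact: measurableT_comp.
  by under eq_integral do rewrite gee0_abs ?lee_fin ?expR_ge0 //; rewrite l1 ltry.
have := relative_entropy_dual PM ml i1 iRN il.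
rewrite l1 => /(_ (lexx _)).
have -> : \int[P]_x (l x)%:E = k%:E - (t^-1)%:E * \int[P]_x (f x)%:E.
  rewrite (_ : (fun x => (l x)%:E) = fun x => k%:E - (t^-1)%:E * (f x)%:E); last exact/funext.
  by rewrite integralB // integral_prob_cst integralZl.
have ff := integrable_fin_num measurableT i_f; have fR := integrable_fin_num measurableT iRN.
rewrite -(fineK ff) -(fineK fR) -!EFinM -!EFinB !lee_fin => h.
have := ler_wpM2l (ltW tp) h; rewrite mulrBr mulrA mulfV ?gt_eqF // mul1r; exact.
Qed.

Lemma measurable_phi : measurable_fun setT phi.
Proof.
by rewrite (_ : phi = quad_fun 0 (2 *: w) (1%:M - L) u);
  [exact: measurable_quad_fun|apply/funext => x; exact: phi_quad].
Qed.

Lemma measurable_psi : measurable_fun setT psi.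
Proof.
by rewrite (_ : psi = quad_fun 0 (- (2 *: w)) (1%:M - invmx L) v);
  [exact: measurable_quad_fun|apply/funext => x; exact: psi_quad].
Qed.

(** The constant k is left free: [opt_kq] gives the bound for arbitrary Q, and [opt_kq] plus an
    entropy excess gives the sharper bound for Gaussian Q. *)
Lemma ut_cost_ge_aux (P Q : probability (euclid R n) R) (k : R) :
  KL P (gauss mu) < +oo -> KL Q (gauss nu) < +oo ->
  ((t1 * k)%:E - \int[Q]_x (psi x)%:E <= t1%:E * KL Q (gauss nu)) ->
  (dotp w w + t0 * opt_kp t0 t1 mu nu L + t1 * k)%:E <=
    ut_cost t0 t1 (gauss mu) (gauss nu) P Q.
Proof.
move=> fP fQ hQ.
have iphi : P.-integrable setT (fun x => (phi x)%:E).
  rewrite (_ : (fun _ => _) = fun x => (quad_fun 0 (2 *: w) (1%:M - L) u x)%:E).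
    exact: (quad_fun_integrable _ _ _ _ mu_pd fP).
  by apply/funext => x; rewrite phi_quad.
have ipsi : Q.-integrable setT (fun x => (psi x)%:E).
  rewrite (_ : (fun _ => _) = fun x => (quad_fun 0 (- (2 *: w)) (1%:M - invmx L) v x)%:E).
    exact: (quad_fun_integrable _ _ _ _ nu_pd fQ).
  by apply/funext => x; rewrite psi_quad.
have hP := dual_integrable t0_gt0 mu_pd op_pd fP
  (fun x => opt_log_ratio_p t0_gt0 t1_gt0 mu_pd nu_pd L_pd L_eq (cvec_of x)) measurable_phi iphi.
have iww : Q.-integrable setT (fun x => (psi x + dotp w w)%:E).
  rewrite (_ : (fun _ => _) = fun x => (psi x)%:E + (dotp w w)%:E) //.
  by apply: integrableD => //; exact: finite_measure_integrable_cst.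
have hW := W2sq_dual (f := phi) (g := fun x => psi x + dotp w w)%R _ iphi iww.
have {}hW : \int[P]_x (phi x)%:E + (\int[Q]_x (psi x)%:E + (dotp w w)%:E) <= W2sq P Q.
  have -> : \int[Q]_x (psi x)%:E + (dotp w w)%:E = \int[Q]_x (psi x + dotp w w)%:E.
    rewrite [RHS](_ : _ = \int[Q]_x ((psi x)%:E + (dotp w w)%:E)) //.
    rewrite integralD //; last exact: finite_measure_integrable_cst.
    by rewrite integral_prob_cst.
  apply: hW => x y; rewrite sqdist_dotp addrA.
  exact: (opt_duality_le t0_gt0 t1_gt0 mu_pd nu_pd L_pd).
have f1 := integrable_fin_num measurableT iphi.
have f2 := integrable_fin_num measurableT ipsi.
move: hP hQ hW; rewrite /ut_cost -(fineK f1) -(fineK f2) -!EFinB -!EFinD.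
move: (fine _) (fine _) => a b hP hQ hW.
apply: le_trans (leeD (leeD hW hP) hQ); rewrite -!EFinD lee_fin.
by rewrite le_eqVlt; apply/orP; left; apply/eqP; ring.
Qed.

Lemma ut_cost_infinite (P Q : probability (euclid R n) R) :
  ~ (KL P (gauss mu) < +oo /\ KL Q (gauss nu) < +oo) ->
  ut_cost t0 t1 (gauss mu) (gauss nu) P Q = +oo.
Proof.
move=> h; have W0 := W2sq_ge0 P Q.
have P0 := KL_ge0_gtNy P (gauss mu); have Q0 := KL_ge0_gtNy Q (gauss nu).
have t_ne (t : R) (k : \bar R) : (0 < t)%R -> k != -oo -> t%:E * k != -oo.
  by move=> tp; case: k => [r| |] // _; rewrite gt0_muley ?lte_fin.
have ne (x y : \bar R) : x != -oo -> y != -oo -> x + y != -oo.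
  by case: x => [r| |]; case: y => [r'| |].
have W : W2sq P Q != -oo by apply: contraTneq W0 => ->.
rewrite /ut_cost; have [Pi|p1] := eqVneq (KL P (gauss mu)) +oo.
  by rewrite Pi gt0_muley ?lte_fin // addey // addye // t_ne.
have [Qi|q1] := eqVneq (KL Q (gauss nu)) +oo.
  by rewrite Qi gt0_muley ?lte_fin // addey // ne // t_ne.
case: h; split; rewrite ltey; [exact: p1|exact: q1].
Qed.

Lemma ut_cost_ge (P Q : probability (euclid R n) R) :
  (opt_A t0 t1 mu nu L)%:E <= ut_cost t0 t1 (gauss mu) (gauss nu) P Q.
Proof.
have [[fP fQ]|h] := pselect (KL P (gauss mu) < +oo /\ KL Q (gauss nu) < +oo); last first.
  by rewrite ut_cost_infinite // leey.
apply: ut_cost_ge_aux => //.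
have ipsi : Q.-integrable setT (fun x => (psi x)%:E).
  rewrite (_ : (fun _ => _) = fun x => (quad_fun 0 (- (2 *: w)) (1%:M - invmx L) v x)%:E).
    exact: (quad_fun_integrable _ _ _ _ nu_pd fQ).
  by apply/funext => x; rewrite psi_quad.
exact: (dual_integrable t1_gt0 nu_pd oq_pd fQ
  (fun x => opt_log_ratio_q t0_gt0 t1_gt0 mu_pd nu_pd L_pd L_eq (cvec_of x)) measurable_psi ipsi).
Qed.

(** For Gaussian q the loss in the Gibbs inequality is known exactly and equals t1 * gKL q oq; this
    excess gives uniqueness of the second component. *)
Lemma ut_cost_ge_gauss (P : probability (euclid R n) R) (q : gparam R n) : posdef q.2 ->
  (opt_A t0 t1 mu nu L + t1 * gKL q oq)%:E <=
    ut_cost t0 t1 (gauss mu) (gauss nu) P (gauss q).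
Proof.
move=> qp; have KQ := KL_gauss qp nu_pd.
have fQ : KL (gauss q) (gauss nu) < +oo by rewrite KQ ltry.
have [fP|h] := ltP (KL P (gauss mu)) +oo; last first.
  by rewrite ut_cost_infinite ?leey // => -[h' _]; move: h; rewrite leNgt h'.
have := @ut_cost_ge_aux P (gauss q) (opt_kq t0 t1 mu nu L + gKL q oq)%R fP fQ.
rewrite /opt_A -/w mulrDr !addrA; apply.
have [i1 E1] := gauss_mean_log_density qp oq_pd.
have [i2 E2] := gauss_mean_log_density qp nu_pd.
have -> : \int[gauss q]_x (psi x)%:E =
  (t1 * (opt_kq t0 t1 mu nu L - (mean_log_density q oq - mean_log_density q nu)))%:E.
  rewrite (_ : (fun x => (psi x)%:E) = fun x => (t1 * opt_kq t0 t1 mu nu L)%:E -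
    t1%:E * ((log_density oq (cvec_of x))%:E - (log_density nu (cvec_of x))%:E)); last first.
    apply/funext => x; transitivity (t1 * opt_kq t0 t1 mu nu L -
      t1 * (log_density oq (cvec_of x) - log_density nu (cvec_of x)))%R%:E; last by [].
    congr (_%:E); rewrite /oq (opt_log_ratio_q t0_gt0 t1_gt0 mu_pd nu_pd L_pd L_eq) /psi; field.
    by rewrite gt_eqF.
  have i3 := integrableB measurableT i1 i2.
  rewrite integralB //; last 2 first.
  - exact: finite_measure_integrable_cst.
  - exact: integrableZl.
  rewrite integral_prob_cst integralZl // integralB // E1 E2.
  rewrite [in RHS]mulrBr; exact: erefl.
rewrite KQ -EFinB -EFinM lee_fin !gKL_mean_log_density // le_eqVlt.
by apply/orP; left; apply/eqP; ring.
Qed.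

Let Tmap := aff L (v - L *m u).

Let TmapE x : cvec_of (Tmap x) = (v + L *m (cvec_of x - u))%R.
Proof.
rewrite /Tmap cvec_of_vtup (mulmxBr L (cvec_of x) u); exact: addrCA.
Qed.

Lemma gauss_push A : measurable A -> gauss op (Tmap @^-1` A) = gauss oq A.
Proof.
move=> mA; have mT : measurable_fun setT Tmap by exact: measurable_aff.
have mTA : measurable (Tmap @^-1` A) by rewrite -[X in measurable X]setTI; exact: mT.
have dL := posdef_det L_pd; have dP := posdef_det op_pd.
rewrite [LHS](gaussE _ op_pd) [RHS](gaussE _ oq_pd) [LHS]integral_mkcond [RHS]integral_mkcond.
have f0 x : 0 <= ((fun x => (gauss_pdf oq x)%:E) \_ A) x.
  by rewrite erestrict_ge0 // => y _; rewrite lee_fin gauss_pdf_ge0.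
have mf : measurable_fun setT ((fun x => (gauss_pdf oq x)%:E) \_ A).
  apply/(measurable_restrictT _ mA); apply: measurable_funTS.
  by apply/measurable_EFinP; exact: measurable_gauss_pdf.
have := lebesgue_aff (v - L *m u) L_pd mf f0.
set I := \int[_]_x (_ \_ A) x => h.
have -> : I = (\det L)%:E * (((\det L)^-1)%:E * I).
  by rewrite muleA -EFinM mulfV ?gt_eqF // mul1e.
rewrite -h -ge0_integralZl ?lee_fin ?(ltW dL) //; last first.
  by apply: (measurableT_comp mf); exact: measurable_aff.
apply: eq_integral => x _; rewrite /patch /= -/Tmap.
have -> : (x \in Tmap @^-1` A) = (Tmap x \in A) by apply/idP/idP; rewrite !inE.
case: ifP => _; last by rewrite mule0.
rewrite -EFinM; congr (_%:E); rewrite (gauss_pdfE _ op_pd) (gauss_pdfE _ oq_pd) mulrCA.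
congr (_ * _)%R.
rewrite -[X in (X * _)%R]lnK ?posrE // -expRD; congr expR.
rewrite /log_density TmapE /=.
have -> : (v + L *m (cvec_of x - u) - opt_v t0 t1 mu nu = L *m (cvec_of x - u))%R.
  by rewrite -/v [LHS]addrC addKr.
rewrite -/u.
have -> : ln (\det (opt_Q t0 mu L)) = (2 * ln (\det L) + ln (\det (opt_P t0 mu L)))%R.
  by rewrite /opt_Q !det_mulmx !lnM ?posrE ?mulr_gt0 //; ring.
have -> : qf (invmx (opt_Q t0 mu L)) (L *m (cvec_of x - u)) =
    qf (invmx (opt_P t0 mu L)) (cvec_of x - u).
  rewrite (opt_Q_inv t0_gt0 t1_gt0 mu_pd nu_pd L_pd L_eq) -{1}(posdef_sym (posdef_inv L_pd)).
  by rewrite qf_congr mulKmx // /opt_P invmxK.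
by field.
Qed.

Let sub_shift (V : zmodType) (x y z t : V) : (x - (z + t) = (y - z) + ((x - y) - t))%R.
Proof.
by rewrite opprD addrA [RHS]addrA; congr (_ - t)%R; rewrite [RHS]addrC addrA subrK.
Qed.

(** The coupling is the law of (x, Tmap x) under [gauss op]. *)
Lemma W2sq_le : W2sq (gauss op) (gauss oq) <= (opt_W2 t0 t1 mu nu L)%:E.
Proof.
have mT : measurable_fun setT Tmap by exact: measurable_aff.
pose pr (x : euclid R n) : euclid R n * euclid R n := (x, Tmap x).
have mpr : measurable_fun setT pr by exact: measurable_fun_pair.
have [G GE] : exists G : probability (euclid R n * euclid R n)%type R,
    forall A, measurable A -> G A = gauss op (pr @^-1` A).
  pose mix := isMeasurableFun.Build _ _ _ _ _ mpr.
  pose X : {mfun euclid R n >-> (euclid R n * euclid R n)%type} := HB.pack pr mix.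
  by exists (distribution (gauss op) X).
apply: ge_ereal_inf; exists (\int[G]_z (sqdist z.1 z.2)%:E).
  exists G => // A mA; split.
    rewrite GE; last exact: measurableX.
    by congr (gauss op _); apply/seteqP; split => x //= [].
  rewrite GE; last exact: measurableX.
  rewrite -[RHS](gauss_push mA); congr (gauss op _); apply/seteqP; split => x.
    by case=> _ h; exact: h.
  by move=> h; split; [exact: I|exact: h].
have msq : measurable_fun setT (fun z : euclid R n * euclid R n => (sqdist z.1 z.2)%:E).
  by apply/measurable_EFinP; exact: measurable_sqdist.
have -> : \int[G]_z (sqdist z.1 z.2)%:E = \int[gauss op]_x (sqdist x (Tmap x))%:E.
  rewrite (@eq_measure_integral _ _ _ _ (pushforward (gauss op) pr)); last first.
    by move=> A mA _; exact: GE.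
  rewrite ge0_integral_pushforward // => z _.
  by rewrite lee_fin sqdist_ge0.
have Ms : (1%:M - L)^T = (1%:M - L)%R by rewrite raddfB /= tr_scalar_mx Ls.
have Ms2 : ((1%:M - L) *m (1%:M - L))^T = (1%:M - L) *m (1%:M - L).
  by rewrite trmx_mul Ms.
have [_] := gauss_mean_quad (dotp w w) (2 *: ((1%:M - L) *m w)) u op_pd Ms2.
rewrite (_ : (fun x => (quad_fun _ _ _ _ x)%:E) = fun x => (sqdist x (Tmap x))%:E).
  move=> ->; rewrite lee_fin /opt_W2 /= subrr mul0mx addr0 -/w.
  rewrite (dotpC _ 0) dotp0l addr0.
  rewrite -mulmxA [X in (_ + X <= _)%R]mxtrace_mulC; exact: lexx.
apply/funext => x; congr (_%:E); rewrite sqdist_dotp TmapE /quad_fun.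
have -> : (cvec_of x - (v + L *m (cvec_of x - u)) = w + (1%:M - L) *m (cvec_of x - u))%R.
  rewrite mulmxBl mul1mx.
  have -> : w = (u - v)%R by rewrite /w -(opt_uvw t0_gt0 t1_gt0 mu_pd nu_pd).
  exact: sub_shift.
move: (cvec_of x - u)%R => xi.
have e1 : dotp ((1%:M - L) *m w) xi = dotp w ((1%:M - L) *m xi) by rewrite dotp_mul Ms.
have e2 : qf ((1%:M - L) *m (1%:M - L)) xi = dotp ((1%:M - L) *m xi) ((1%:M - L) *m xi).
  by rewrite qfE -mulmxA dotp_mul Ms.
rewrite e2 dotpZl e1; move: ((1%:M - L) *m xi) => z.
by rewrite dotpDl !dotpDr (dotpC z w); ring.
Qed.

Let weighted_sum_le (W K0 K1 : \bar R) (c g0 g1 : R) :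
  W <= c%:E -> K0 = g0%:E -> K1 = g1%:E ->
  W + t0%:E * K0 + t1%:E * K1 <= (c + t0 * g0 + t1 * g1)%:E.
Proof. by move=> h -> ->; exact: (leeD2r _ (leeD2r _ h)). Qed.

(** The reference nu' may differ from the nu for which the pair is optimal; this freedom is the
    source of the envelope inequality. *)
Lemma ut_cost_opt (nu' : gparam R n) : posdef nu'.2 ->
  ut_cost t0 t1 (gauss mu) (gauss nu') (gauss op) (gauss oq) <=
  (opt_W2 t0 t1 mu nu L + t0 * gKL op mu + t1 * gKL oq nu')%:E.
Proof.
move=> np.
exact: (weighted_sum_le W2sq_le (KL_gauss op_pd mu_pd) (KL_gauss oq_pd np)).
Qed.

Lemma ut_cost_opt_value :
  ut_cost t0 t1 (gauss mu) (gauss nu) (gauss op) (gauss oq) = (opt_A t0 t1 mu nu L)%:E.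
Proof.
apply/eqP; rewrite eq_le ut_cost_ge andbT.
by rewrite (opt_A_cost t0_gt0 t1_gt0 mu_pd nu_pd L_pd L_eq) ut_cost_opt.
Qed.

Lemma ut_inf : ereal_inf [set ut_cost t0 t1 (gauss mu) (gauss nu) pq.1 pq.2 |
  pq in [set: probability (euclid R n) R * probability (euclid R n) R]] =
  (opt_A t0 t1 mu nu L)%:E.
Proof.
apply/eqP; rewrite eq_le; apply/andP; split.
  apply: ereal_inf_lbound; exists (gauss op, gauss oq) => //=.
  exact: ut_cost_opt_value.
by apply: le_ereal_inf_tmp => _ [[P Q] _ <-]; exact: ut_cost_ge.
Qed.

Lemma ut_valueE : ut_value t0 t1 mu nu = opt_A t0 t1 mu nu L.
Proof. by rewrite /ut_value ut_inf. Qed.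

(** [xget] ranges over Gaussian second components of minimizers, and the excess in
    [ut_cost_ge_gauss] excludes all of them but [oq]. *)
Lemma ut_secondE : ut_second t0 t1 mu nu = oq.
Proof.
rewrite /ut_second; apply: xget_unique.
  split => //; exists (gauss op) => P Q; rewrite ut_cost_opt_value.
  exact: ut_cost_ge.
move=> q [qp [P hP]]; have := hP (gauss op) (gauss oq); rewrite ut_cost_opt_value.
move=> /(le_trans (ut_cost_ge_gauss P qp)); rewrite lee_fin gerDl pmulr_rle0 //.
exact: gKL_eq0.
Qed.

End unbalanced_transport.

(** * Comparison of transport values *)

Section envelope.
Context {R : realType} {d : nat}.
Local Notation n := d.+1.
Variables (t0 t1 : R) (mu : gparam R n).
Hypotheses (t0_gt0 : 0 < t0) (t1_gt0 : 0 < t1) (mu_pd : posdef mu.2).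

Lemma ut_second_posdef nu : posdef nu.2 -> posdef (ut_second t0 t1 mu nu).2.
Proof.
move=> np; have [L Lp Le] := opt_eq_exists t0_gt0 t1_gt0 mu_pd np.
by rewrite (ut_secondE t0_gt0 t1_gt0 mu_pd np Lp Le);
  exact: (opt_Q_pd t0_gt0 t1_gt0 mu_pd np Lp Le).
Qed.

Lemma ut_value_envelope nu nu' : posdef nu.2 -> posdef nu'.2 ->
  ut_value t0 t1 mu nu' <= ut_value t0 t1 mu nu +
    t1 * (gKL (ut_second t0 t1 mu nu) nu' - gKL (ut_second t0 t1 mu nu) nu).
Proof.
move=> np np'; have [L Lp Le] := opt_eq_exists t0_gt0 t1_gt0 mu_pd np.
have [L' Lp' Le'] := opt_eq_exists t0_gt0 t1_gt0 mu_pd np'.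
rewrite (ut_valueE t0_gt0 t1_gt0 mu_pd np' Lp' Le') (ut_valueE t0_gt0 t1_gt0 mu_pd np Lp Le).
rewrite (ut_secondE t0_gt0 t1_gt0 mu_pd np Lp Le).
rewrite (opt_A_cost t0_gt0 t1_gt0 mu_pd np Lp Le).
have := le_trans (ut_cost_ge t0_gt0 t1_gt0 mu_pd np' Lp' Le' _ _)
  (ut_cost_opt t0_gt0 t1_gt0 mu_pd np Lp Le np').
rewrite lee_fin => h; apply: le_trans h _; lra.
Qed.

End envelope.

(** * Analytic matrix functions *)

Section analytic_matrices.
Variables (R : realType) (I : finType).
Implicit Types a : I -> R.

Definition anam m k (F : (I -> R) -> 'M[R]_(m, k)) a :=
  forall i j, ana (fun x => F x i j) a.

Lemma anam_eq m k (F G : (I -> R) -> 'M[R]_(m, k)) a :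
  nearpt a (fun x => F x = G x) -> anam F a -> anam G a.
Proof.
move=> h Fa i j; apply: ana_ext (Fa i j).
by apply: nearptS h => x ->.
Qed.

Lemma anam_cst m k (A : 'M[R]_(m, k)) a : anam (fun=> A) a.
Proof. by move=> i j; exact: ana_cst. Qed.

Lemma anam_add m k (F G : (I -> R) -> 'M[R]_(m, k)) a :
  anam F a -> anam G a -> anam (fun x => F x + G x) a.
Proof.
move=> Fa Ga i j; apply: (ana_ext _ (ana_add (Fa i j) (Ga i j))).
by apply: nearptW => x; rewrite mxE.
Qed.

Lemma anam_opp m k (F : (I -> R) -> 'M[R]_(m, k)) a :
  anam F a -> anam (fun x => - F x) a.
Proof.
move=> Fa i j; apply: (ana_ext _ (ana_opp (Fa i j))).
by apply: nearptW => x; rewrite mxE.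
Qed.

Lemma anam_scale m k (f : (I -> R) -> R) (F : (I -> R) -> 'M[R]_(m, k)) a :
  ana f a -> anam F a -> anam (fun x => f x *: F x) a.
Proof.
move=> fa Fa i j; apply: (ana_ext _ (ana_mul fa (Fa i j))).
by apply: nearptW => x; rewrite mxE.
Qed.

Lemma anam_mul m k l (F : (I -> R) -> 'M[R]_(m, k)) (G : (I -> R) -> 'M[R]_(k, l)) a :
  anam F a -> anam G a -> anam (fun x => F x *m G x) a.
Proof.
move=> Fa Ga i j.
apply: (ana_ext (f := fun x => \sum_p F x i p * G x p j)).
  by apply: nearptW => x; rewrite mxE.
by apply: ana_sum => p _; exact: ana_mul.
Qed.

Lemma anam_tr m k (F : (I -> R) -> 'M[R]_(m, k)) a :
  anam F a -> anam (fun x => (F x)^T) a.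
Proof.
move=> Fa i j; apply: (ana_ext _ (Fa j i)).
by apply: nearptW => x; rewrite mxE.
Qed.

Lemma ana_det m (F : (I -> R) -> 'M[R]_m) a : anam F a -> ana (fun x => \det (F x)) a.
Proof.
move=> Fa; apply: ana_sum => s _; apply: ana_mul; first exact: ana_cst.
by apply: ana_prod => i _; exact: Fa.
Qed.

Lemma anam_inv m (F : (I -> R) -> 'M[R]_m) a : F a \in unitmx ->
  anam F a -> anam (fun x => invmx (F x)) a.
Proof.
rewrite unitmxE unitfE => Fu Fa; have da := ana_det Fa.
have h : nearpt a (fun x => (\det (F x))^-1 *: \adj (F x) = invmx (F x)).
  apply: nearptS (ana_neq0 da Fu) => x hx; rewrite /invmx unitmxE unitfE.
  have dx : \det (F x) != 0 by rewrite -normr_gt0 (le_lt_trans _ hx) // divr_ge0.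
  by rewrite dx.
apply: (anam_eq h); apply: anam_scale; first exact: ana_inv.
move=> i j; apply: (ana_ext (f := fun x => cofactor (F x) j i)).
  by apply: nearptW => x; rewrite mxE.
apply: ana_mul; first exact: ana_cst.
apply: ana_det => p q; apply: (ana_ext _ (Fa (lift j p) (lift i q))).
by apply: nearptW => x; rewrite !mxE.
Qed.

Lemma ana_dotp m (u v : (I -> R) -> 'cV[R]_m) a :
  anam u a -> anam v a -> ana (fun x => dotp (u x) (v x)) a.
Proof. by move=> ua va; apply: anam_mul => //; exact: anam_tr. Qed.

Lemma ana_qf m (S : (I -> R) -> 'M[R]_m) (u : (I -> R) -> 'cV[R]_m) a :
  anam S a -> anam u a -> ana (fun x => qf (S x) (u x)) a.
Proof. by move=> Sa ua; apply: anam_mul => //; apply: anam_mul => //; exact: anam_tr. Qed.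

Lemma anam_near m k (F : (I -> R) -> 'M[R]_(m, k)) a (e : R) : anam F a -> 0 < e ->
  nearpt a (fun x => forall i j, `|F x i j - F a i j| < e).
Proof.
move=> Fa e0; apply: nearpt_all => i; apply: nearpt_all => j.
exact: ana_cont.
Qed.

End analytic_matrices.

Lemma injective_inverse (R : realType) (J : finType) (D : J -> J -> R) :
  (forall z : J -> R, (forall j, \sum_k D j k * z k = 0) -> forall j, z j = 0) ->
  exists K : J -> J -> R, (forall j l, \sum_k K j k * D k l = (j == l)%:R) /\
    (forall j l, \sum_k D j k * K k l = (j == l)%:R).
Proof.
move=> inj; pose M := \matrix_(i < #|J|, j < #|J|) D (enum_val i) (enum_val j).
have sumE (f : 'I_#|J| -> R) : \sum_(k : J) f (enum_rank k) = \sum_i f i.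
  by rewrite [RHS](reindex (@enum_rank J)) //; exact/onW_bij/enum_rank_bij.
have Mu : M \in unitmx.
  rewrite -unitmx_tr unitmxE unitfE; apply/negP => /det0P [v v0 vM].
  move/negP: v0; apply; apply/eqP/rowP => i; rewrite mxE.
  have := inj (fun j => v 0 (enum_rank j)) _ (enum_val i); rewrite enum_valK; apply => j.
  have := congr1 (fun A : 'rV[R]_#|J| => A 0 (enum_rank j)) vM; rewrite !mxE => h.
  apply: (etrans _ h); apply: (etrans _ (sumE (fun p => v 0 p * M^T p (enum_rank j)))).
  apply: eq_bigr => k _.
  by rewrite !mxE !enum_rankK mulrC.
pose K j k := invmx M (enum_rank j) (enum_rank k).
exists K; split=> j l.
  have := congr1 (fun A : 'M[R]_#|J| => A (enum_rank j) (enum_rank l)) (mulVmx Mu).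
  rewrite !mxE (inj_eq enum_rank_inj) => <-; rewrite -sumE; apply: eq_bigr => k _.
  by rewrite mxE !enum_rankK.
have := congr1 (fun A : 'M[R]_#|J| => A (enum_rank j) (enum_rank l)) (mulmxV Mu).
rewrite !mxE (inj_eq enum_rank_inj) => <-; rewrite -sumE; apply: eq_bigr => k _.
by rewrite mxE !enum_rankK.
Qed.

Section posdef_open.
Variables (R : realType) (d : nat).
Local Notation n := d.+1.

Lemma posdef_lower (S : 'M[R]_n) : posdef S ->
  exists2 c : R, 0 < c & forall u, c * dotp u u <= qf S u.
Proof.
move=> Sp; have [h _ _] := entropy_bounds Sp (lexx _).
exists (expR (- (entropy S + 2))); first exact: expR_gt0.
by move=> u; have := posdef_ge0 u h; rewrite qfD qfN qf1 subr_ge0.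
Qed.

Lemma qf_le_frob (S : 'M[R]_n) u : `|qf S u| <= Num.sqrt (frob S) * dotp u u.
Proof.
have x0 := dotp_ge0 u; have f0 := frob_ge0 S.
have h : qf S u ^+ 2 <= (Num.sqrt (frob S) * dotp u u) ^+ 2.
  rewrite exprMn sqr_sqrtr // qfE; apply: le_trans (dotp_Cauchy _ _) _.
  have : dotp (S *m u) (S *m u) <= frob S * dotp u u by rewrite -!frob_dotp frobM.
  by move=> h; apply: le_trans (ler_wpM2l x0 h) _; rewrite expr2 mulrCA.
by rewrite -[leLHS]ger0_norm // -ler_sqr ?nnegrE ?mulr_ge0 ?sqrtr_ge0 //
  ?normr_ge0 // normr_id real_normK ?num_real.
Qed.

Lemma posdef_open (S : 'M[R]_n) : posdef S -> exists2 e : R, 0 < e &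
  forall T : 'M[R]_n, T^T = T -> (forall i j, `|T i j - S i j| < e) -> posdef T.
Proof.
move=> Sp; have [c c0 hc] := posdef_lower Sp.
have n0 : 0 < n%:R :> R by rewrite ltr0n.
exists (c / 2 / n%:R); first by rewrite !divr_gt0.
move=> T Ts hT; split => // u u0; rewrite -/(qf T u).
have -> : T = S + (T - S) by rewrite addrC subrK.
rewrite qfD; have := qf_le_frob (T - S) u; rewrite ler_norml => /andP[h _].
have : Num.sqrt (frob (T - S)) <= c / 2.
  rewrite -[leRHS]ger0_norm; last by rewrite divr_ge0 // ltW.
  rewrite -sqrtr_sqr ler_wsqrtr //.
  apply: le_trans (_ : \sum_(i < n) \sum_(j < n) (c / 2 / n%:R) ^+ 2 <= _).
    apply: ler_sum => i _; apply: ler_sum => j _; rewrite !mxE.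
    rewrite -[leLHS]real_normK ?num_real //.
    apply: lerXn2r; rewrite ?nnegrE ?normr_ge0 //; last exact: ltW.
    by rewrite !divr_ge0 // ltW.
  rewrite !sumr_const card_ord -mulrnA -[leLHS]mulr_natl natrM exprMn exprVn le_eqVlt.
  by apply/orP; left; apply/eqP; field; rewrite gt_eqF.
move=> h2; have p := dotp_gt0 u0; have := hc u.
have := ler_wpM2r (ltW p) h2; nra.
Qed.

Lemma frob_eq0 m k (X : 'M[R]_(m, k)) : frob X = 0 -> X = 0.
Proof.
move/eqP; rewrite psumr_eq0 => [/allP hX|i _]; last first.
  by apply: sumr_ge0 => j _; exact: sqr_ge0.
apply/matrixP => i j; have := hX i (mem_index_enum i).
rewrite /= psumr_eq0 => [/allP/(_ j)|k' _]; last exact: sqr_ge0.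
by rewrite mem_index_enum sqrf_eq0 mxE => /(_ isT)/eqP.
Qed.

(** Write Z = L Y. The linearized equation, multiplied by L^-1 on both sides, by Y^T on the right
    and by L on the left, has as its trace a sum of two squared Frobenius norms, so both vanish and
    Y = 0. *)
Lemma riccati_derivative_inj (B C L Z : 'M[R]_n) (k : R) :
  posdef B -> posdef C -> posdef L -> L *m B *m L + k *: L = C ->
  Z *m B *m L + L *m B *m Z + k *: Z = 0 -> Z = 0.
Proof.
move=> Bp Cp Lp LE ZE; have Lu := posdef_unit Lp; have Ls := posdef_sym Lp.
pose Y := invmx L *m Z; have ZY : Z = L *m Y by rewrite /Y mulKVmx.
have Wp := posdef_inv Lp.
have h1 : L *m (Y *m B *m Y^T) + C *m (Y *m invmx L *m Y^T) = 0.
  have : invmx L *m (Z *m B *m L + L *m B *m Z + k *: Z) *m invmx L *m Y^T = 0.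
    by rewrite ZE mulmx0 !mul0mx.
  rewrite ZY !mulmxDr !mulmxDl -!scalemxAr -!scalemxAl => h.
  rewrite -[LHS](mulKVmx Lu) -[RHS](mulmx0 _ L) -h mulmxDr; congr (L *m _).
  rewrite mulKmx // -LE !mulmxDl mulmxDr -!scalemxAl -!scalemxAr -addrA.
  by rewrite !mulmxA !(mulVmx Lu) !mul1mx !(mulmxK Lu) ?mul1mx.
have [H Hp HE] := posdef_sqrt Bp; have [G Gp GE] := posdef_sqrt Lp.
have [E Ep EE] := posdef_sqrt Cp; have [W Wp' WE] := posdef_sqrt Wp.
have trE (X T U V : 'M[R]_n) : U^T = U -> V^T = V -> U *m U = X -> V *m V = T ->
    \tr (X *m (Y *m T *m Y^T)) = frob (U *m Y *m V).
  move=> Us Vs <- <-; rewrite frob_tr !trmx_mul Us Vs.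
  rewrite [RHS]mxtrace_mulC !mulmxA [RHS]mxtrace_mulC !mulmxA.
  by rewrite mxtrace_mulC !mulmxA.
have := congr1 mxtrace h1; rewrite mxtraceD mxtrace0.
rewrite (trE _ _ _ _ (posdef_sym Gp) (posdef_sym Hp) GE HE).
rewrite (trE _ _ _ _ (posdef_sym Ep) (posdef_sym Wp') EE WE).
have f1 := frob_ge0 (G *m Y *m H); have f2 := frob_ge0 (E *m Y *m W) => h2.
have f0 : frob (G *m Y *m H) = 0 by lra.
have : G *m Y *m H = 0.
  exact: frob_eq0.
move=> h; have Y0 : Y = 0.
  rewrite -[Y](mulKmx (posdef_unit Gp)) -[G *m Y](mulmxK (posdef_unit Hp)) h.
  by rewrite mul0mx mulmx0.
by rewrite ZY Y0 mulmx0.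
Qed.

End posdef_open.

(** * Analytic dependence of the optimal pair on nu *)

Section analytic_transport.
Variables (R : realType) (d : nat).
Local Notation n := d.+1.
Local Notation I := ('I_n + 'I_n * 'I_n)%type.
Local Notation J := ('I_n * 'I_n)%type.

(** Covariances are given by all n * n entries and symmetrized, so that functions of a Gaussian
    become functions on an open subset of a full coordinate space. *)
Definition par (x : I -> R) : gparam R n :=
  (\col_i x (inl i), \matrix_(i, j) ((x (inr (i, j)) + x (inr (j, i))) / 2)).
Definition crd (nu : gparam R n) (k : I) : R :=
  match k with inl i => nu.1 i 0 | inr p => nu.2 p.1 p.2 end.

Lemma crdK nu : nu.2^T = nu.2 -> par (crd nu) = nu.
Proof.
move=> Ss; rewrite [RHS]surjective_pairing; congr (_, _).
  by apply/colP => i; rewrite mxE.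
apply/matrixP => i j; rewrite mxE /=; have := congr1 (fun A : 'M[R]_n => A i j) Ss.
by rewrite mxE => ->; field.
Qed.

Lemma par_sym x : (par x).2^T = (par x).2.
Proof. by apply/matrixP => i j; rewrite !mxE addrC. Qed.

Lemma anam_par1 a : anam (fun x => (par x).1) a.
Proof.
move=> i j; apply: (ana_ext _ (ana_var (inl i) a)).
by apply: nearptW => x; rewrite mxE.
Qed.

Lemma anam_par2 a : anam (fun x => (par x).2) a.
Proof.
move=> i j; apply: (ana_ext _ (ana_mul (ana_add (ana_var (inr (i, j)) a)
  (ana_var (inr (j, i)) a)) (ana_cst 2^-1 a))).
by apply: nearptW => x; rewrite mxE.
Qed.

Lemma posdef_par a : posdef (par a).2 -> nearpt a (fun x => posdef (par x).2).
Proof.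
move=> /posdef_open [e e0 he]; apply: nearptS (anam_near (anam_par2 a) e0) => x hx.
by apply: he => //; exact: par_sym.
Qed.

Variables (t0 t1 : R) (mu : gparam R n).
Hypotheses (t0_gt0 : 0 < t0) (t1_gt0 : 0 < t1) (mu_pd : posdef mu.2).

Let matJ (z : J -> R) : 'M[R]_n := \matrix_(i, j) z (i, j).

Let sum_matJ (f : {linear 'M[R]_n -> 'M[R]_n}) (z : J -> R) (j : J) :
  \sum_k f (delta_mx k.1 k.2) j.1 j.2 * z k = f (matJ z) j.1 j.2.
Proof.
rewrite [in RHS](matrix_sum_delta (matJ z)) !linear_sum summxE.
rewrite (eq_bigr (fun k : J => f (delta_mx k.1 k.2) j.1 j.2 * z (k.1, k.2))); last by case.
rewrite -(pair_bigA _ (fun p q => f (delta_mx p q) j.1 j.2 * z (p, q))) /=.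
apply: eq_bigr => p _; rewrite linear_sum summxE; apply: eq_bigr => q _.
by rewrite linearZ /= !mxE mulrC.
Qed.

(** The implicit function theorem is applied in all n * n entries of L, its derivative being
    invertible by [riccati_derivative_inj]. The transpose of the branch solves the same equation
    near L0, so local uniqueness makes the branch symmetric, and openness makes it positive
    definite. *)
Lemma analytic_opt_eq a : posdef (par a).2 -> exists L : (I -> R) -> 'M[R]_n,
  anam L a /\ nearpt a (fun x => posdef (L x) /\ opt_eq t0 t1 mu (par x) (L x)).
Proof.
move=> Sp; have [L0 L0p L0e] := opt_eq_exists t0_gt0 t1_gt0 mu_pd Sp.
set k := 2 / t0 - 2 / t1; set C := invmx mu.2 + (2 / t0)%:M.
pose B (x : I -> R) := invmx (par x).2 + (2 / t1)%:M.
have Bp : posdef (B a).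
  by apply: posdefD; [exact: posdef_inv|apply: posdef_scalar; exact: divr_gt0].
have Cp : posdef C.
  by apply: posdefD; [exact: posdef_inv|apply: posdef_scalar; exact: divr_gt0].
pose FM (z : (I + J)%type -> R) : 'M[R]_n :=
  let L := matJ (fun j => z (inr j)) in
  L *m B (fun i => z (inl i)) *m L + k *: L - C.
pose F (j : J) z := FM z j.1 j.2.
pose b (j : J) : R := L0 j.1 j.2.
have L0E : matJ b = L0 by apply/matrixP => i j; rewrite mxE.
have FMj x y : FM (join x y) = matJ y *m B x *m matJ y + k *: matJ y - C by [].
have F0 j : F j (join a b) = 0.
  by rewrite /F FMj L0E; rewrite /opt_eq -/k -/C -/(B a) in L0e; rewrite L0e subrr mxE.
have Fa j : ana (F j) (join a b).
  have Lz : anam (fun z : (I + J)%type -> R => matJ (fun j => z (inr j))) (join a b).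
    move=> p q; apply: (ana_ext _ (ana_var (inr (p, q)) _)).
    by apply: nearptW => x; rewrite mxE.
  have Bz : anam (fun z : (I + J)%type -> R => B (fun i => z (inl i))) (join a b).
    apply: anam_add; last exact: anam_cst.
    apply: anam_inv; first exact: posdef_unit.
    move=> p q; apply: (ana_ext _ (ana_mul (ana_add (ana_var (inl (inr (p, q))) _)
      (ana_var (inl (inr (q, p))) _)) (ana_cst 2^-1 _))).
    by apply: nearptW => x; rewrite mxE.
  apply: anam_add; last exact: anam_cst.
  apply: anam_add; first by apply: anam_mul => //; exact: anam_mul.
  by apply: anam_scale => //; exact: ana_cst.
pose lm (Z : 'M[R]_n) := Z *m B a *m L0 + L0 *m B a *m Z + k *: Z.
have lm_lin : linear lm.
  move=> c X Y; rewrite /lm -!(mulmxA _ (B a) L0).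
  move: (B a *m L0) (L0 *m B a) => A A'; rewrite !mulmxDl !mulmxDr !scalerDr -!scalemxAl -!scalemxAr.
  move: (X *m A) (Y *m A) (A' *m X) (A' *m Y) => *.
  by apply/matrixP => i j; rewrite !mxE; ring.
pose mix := GRing.isLinear.Build R _ _ _ lm lm_lin.
pose lml : {linear 'M[R]_n -> 'M[R]_n} := HB.pack lm mix.
pose D (j l : J) : R := lm (delta_mx l.1 l.2) j.1 j.2.
have sumD z j : \sum_l D j l * z l = lm (matJ z) j.1 j.2 by exact: (sum_matJ lml).
have [K [KD DK]] : exists K : J -> J -> R, (forall j l, \sum_k K j k * D k l = (j == l)%:R) /\
    (forall j l, \sum_k D j k * K k l = (j == l)%:R).
  apply: injective_inverse => z hz [i j].
  suff : matJ z = 0 by move/matrixP/(_ i j); rewrite !mxE.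
  apply: (riccati_derivative_inj Bp Cp L0p L0e).
  by apply/matrixP => p q; rewrite -/(lm _) -(sumD z (p, q)) hz mxE.
have FD (e : R) : 0 < e -> exists2 dl : R, 0 < dl & forall (z : J -> R) (t : R),
    0 <= t -> t < dl -> (forall j, `|z j| <= t) ->
    forall j, `|F j (join a (fun j => b j + z j)) - \sum_l D j l * z l| <= e * t.
  move=> e0; pose s : R := \sum_p \sum_q `|B a p q|.
  have s0 : 0 <= s by apply: sumr_ge0 => p _; apply: sumr_ge0.
  exists (e / (s + 1)); first by rewrite divr_gt0 // ltr_wpDl.
  move=> z t tge tlt hz j; rewrite sumD /F FMj.
  have -> : matJ (fun j => b j + z j) = L0 + matJ z.
    by rewrite -L0E; apply/matrixP => p q; rewrite !mxE.
  have -> : ((L0 + matJ z) *m B a *m (L0 + matJ z) + k *: (L0 + matJ z) - C) j.1 j.2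
      - lm (matJ z) j.1 j.2 = (matJ z *m B a *m matJ z) j.1 j.2.
    have E : (L0 + matJ z) *m B a *m (L0 + matJ z) + k *: (L0 + matJ z) - C =
        lm (matJ z) + matJ z *m B a *m matJ z.
      rewrite /lm; rewrite /opt_eq -/k -/C -/(B a) in L0e; rewrite -L0e.
      move: (B a) => Ba; rewrite !mulmxDl !mulmxDr scalerDr.
      move: (L0 *m Ba *m L0) (L0 *m Ba *m matJ z) (matJ z *m Ba *m L0)
        (matJ z *m Ba *m matJ z) (matJ z) => m1 m2 m3 m4 m5.
      by apply/matrixP => p q; rewrite !mxE; ring.
    rewrite E; move: (lm _) (matJ z *m B a *m matJ z) => A1 A2.
    by rewrite mxE addrAC subrr add0r.
  have h : `|(matJ z *m B a *m matJ z) j.1 j.2| <= s * (t * t).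
    rewrite mxE; apply: le_trans (ler_norm_sum _ _ _) _.
    rewrite /s exchange_big /= mulr_suml; apply: ler_sum => q _.
    rewrite mxE normrM mulr_suml.
    apply: le_trans (_ : (\sum_p t * `|B a p q|) * t <= _).
      apply: ler_pM => //; last by rewrite mxE.
      apply: le_trans (ler_norm_sum _ _ _) _; apply: ler_sum => p _.
      by rewrite normrM mxE ler_wpM2r.
    rewrite mulr_suml; apply: ler_sum => p _; rewrite le_eqVlt.
    by apply/orP; left; apply/eqP; ring.
  apply: le_trans h _; rewrite mulrA ler_wpM2r //.
  have := ltW tlt; rewrite ler_pdivlMr; last by rewrite ltr_wpDl.
  by rewrite mulrDr mulr1 mulrC; lra.
have [g [ga gb gF [dl dl0 gU]]] := ana_ift Fa F0 KD DK FD.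
pose L x := matJ (fun j => g j x).
have La : anam L a.
  move=> i j; apply: (ana_ext _ (ga (i, j))).
  by apply: nearptW => x; rewrite mxE.
have LaE : L a = L0 by apply/matrixP => i j; rewrite mxE gb.
exists L; split => //; have [e e0 he] := posdef_open L0p.
have near1 : nearpt a (fun x => forall i, `|x i - a i| < dl) by exists dl.
have near2 := anam_near La e0; have near3 := anam_near La dl0.
have near4 := posdef_par Sp.
apply: nearptS (nearptI (nearptI gF near1) (nearptI near4 (nearptI near2 near3))).
move=> x [[hF h1] [Sx [h2 h3]]].
have FMx : L x *m B x *m L x + k *: L x = C.
  apply/matrixP => i j; have := hF (i, j); rewrite /F FMj mxE => /eqP.
  by rewrite [X in _ + X == 0]mxE subr_eq0 => /eqP.
have Bs : (B x)^T = B x.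
  by apply: posdef_sym; apply: posdefD; [exact: posdef_inv|
    apply: posdef_scalar; exact: divr_gt0].
have Lsym : (L x)^T = L x.
  apply/matrixP => i j; rewrite !mxE.
  apply: (gU x (fun p => g (p.2, p.1) x) h1 _ _ (i, j)).
    move=> [p q] /=; have := h3 q p; rewrite LaE mxE /b /=.
    by rewrite -[in L0 q p](posdef_sym L0p) mxE.
  have LTE : matJ (fun p => g (p.2, p.1) x) = (L x)^T by apply/matrixP => p q; rewrite !mxE.
  move=> p; rewrite /F FMj LTE.
  have := congr1 trmx FMx; rewrite linearD /= !trmx_mul linearZ /= Bs (posdef_sym Cp).
  by rewrite mulmxA => ->; rewrite subrr mxE.
split; last by rewrite /opt_eq -/k -/C -/(B x).
by apply: he => // i j; have := h2 i j; rewrite LaE.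
Qed.

Lemma analytic_transport a : posdef (par a).2 ->
  [/\ ana (fun x => ut_value t0 t1 mu (par x)) a,
      anam (fun x => (ut_second t0 t1 mu (par x)).1) a &
      anam (fun x => (ut_second t0 t1 mu (par x)).2) a].
Proof.
move=> Sp; have [L [La Lh]] := analytic_opt_eq Sp; have near4 := posdef_par Sp.
have [Lp Le] := nearpt_self Lh.
have Sa := anam_par2 a; have ma := anam_par1 a.
have a0p : 0 < 2 / t0 by rewrite divr_gt0.
have a1p : 0 < 2 / t1 by rewrite divr_gt0.
have wa : anam (fun x => opt_w t0 t1 mu (par x)) a.
  apply: anam_mul.
    apply: anam_inv.
      apply: posdef_unit; apply: posdefD; last exact: posdefZ.
      by apply: posdefD; [exact: posdef_scalar|exact: posdefZ].
    apply: anam_add; first exact: anam_cst.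
    by apply: anam_scale => //; exact: ana_cst.
  by apply: anam_add; [exact: anam_cst|exact: anam_opp].
have Pia : anam (fun x => opt_Pi t0 mu (L x)) a.
  apply: anam_add; first exact: anam_cst.
  by apply: anam_opp; apply: anam_scale => //; exact: ana_cst.
have Pip := opt_Pi_pd t0_gt0 t1_gt0 mu_pd Sp Lp Le.
have Pa : anam (fun x => opt_P t0 mu (L x)) a by apply: anam_inv => //; exact: posdef_unit.
have Qa : anam (fun x => opt_Q t0 mu (L x)) a.
  by apply: anam_mul => //; apply: anam_mul.
have va : anam (fun x => opt_v t0 t1 mu (par x)) a.
  apply: anam_add => //; apply: anam_scale; first exact: ana_cst.
  exact: anam_mul.
have lPi : ana (fun x => ln (\det (opt_Pi t0 mu (L x)))) a.
  by apply: ana_ln; [exact: ana_det|exact: posdef_det].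
have lS : ana (fun x => ln (\det (par x).2)) a.
  by apply: ana_ln; [exact: ana_det|exact: posdef_det].
have lL : ana (fun x => ln (\det (L x))) a.
  by apply: ana_ln; [exact: ana_det|exact: posdef_det].
have Aa : ana (fun x => opt_A t0 t1 mu (par x) (L x)) a.
  apply: ana_add; first apply: ana_add.
  - exact: ana_dotp.
  - apply: ana_mul; first exact: ana_cst.
    apply: ana_mul; last exact: ana_cst.
    apply: ana_add; first by apply: ana_add => //; exact: ana_cst.
    apply: ana_mul; first exact: ana_cst.
    by apply: ana_qf => //; exact: anam_cst.
  - apply: ana_mul; first exact: ana_cst.
    apply: ana_mul; last exact: ana_cst.
    apply: ana_add.
      apply: ana_sub; first exact: ana_add.
      by apply: ana_mul => //; exact: ana_cst.
    apply: ana_mul; first exact: ana_cst.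
    exact: ana_qf.
have E : nearpt a (fun x => ut_value t0 t1 mu (par x) = opt_A t0 t1 mu (par x) (L x) /\
    ut_second t0 t1 mu (par x) = opt_q t0 t1 mu (par x) (L x)).
  apply: nearptS (nearptI Lh near4) => x [[Lpx Lex] Spx].
  by split; [exact: ut_valueE|exact: ut_secondE].
split.
- by apply: (ana_ext _ Aa); apply: nearptS E => x [-> _].
- by apply: (anam_eq _ va); apply: nearptS E => x [_ ->].
- by apply: (anam_eq _ Qa); apply: nearptS E => x [_ ->].
Qed.

End analytic_transport.

(** * The moment update *)

Section barycenter_dynamics.
Variables (R : realType) (d N : nat).
Local Notation n := d.+1.
Variables (t0 t1 : R) (lam a : 'I_N -> R) (mu : 'I_N -> gparam R n).
Hypotheses (t0_gt0 : 0 < t0) (t1_gt0 : 0 < t1).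
Hypotheses (lam_gt0 : forall i, 0 < lam i) (lam1 : \sum_(i < N) lam i = 1).
Hypotheses (a_gt0 : forall i, 0 < a i) (mu_pd : forall i, gaussians (mu i)).

Local Notation T := (moment_update t0 t1 lam a mu).
Local Notation Z := (bary_Z t0 t1 lam a mu).
Local Notation term := (bary_term t0 t1 lam a mu).
Local Notation om := (bary_omega t0 t1 lam a mu).
Local Notation sec i nu := (ut_second t0 t1 (mu i) nu).
Local Notation s := (t0 + t1).

Let s_gt0 : 0 < s. Proof. exact: addr_gt0. Qed.

Let i0 : exists i : 'I_N, True.
Proof.
case: (posnP N) => [N0|N0]; last by exists (Ordinal N0).
move: lam1; rewrite big1 => [/eqP|i _]; first by rewrite eq_sym oner_eq0.
by move: (ltn_ord i); rewrite [X in (_ < X)%N]N0.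
Qed.

Lemma bary_term_gt0 nu i : 0 < term nu i.
Proof. by rewrite !mulr_gt0 ?expR_gt0 ?powR_gt0. Qed.

Lemma bary_Z_gt0 nu : 0 < Z nu.
Proof.
have [i _] := i0; rewrite /bary_Z (bigD1 i) //= ltr_wpDr ?bary_term_gt0 //.
by apply: sumr_ge0 => j _; rewrite ltW // bary_term_gt0.
Qed.

Lemma bary_omega_gt0 nu i : 0 < om nu i.
Proof. by rewrite divr_gt0 ?bary_term_gt0 ?bary_Z_gt0. Qed.

Lemma bary_omega_sum nu : \sum_i om nu i = 1.
Proof. by rewrite -mulr_suml mulfV // gt_eqF // bary_Z_gt0. Qed.

Definition lnZ nu : R := ln (Z nu).

Lemma second_pd nu i : posdef nu.2 -> posdef (sec i nu).2.
Proof. by move=> np; apply: ut_second_posdef => //; exact: mu_pd. Qed.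

Let sq_mx (u : 'cV[R]_n) y : qf (u *m u^T) y = dotp u y ^+ 2.
Proof.
have -> : qf (u *m u^T) y = ((y^T *m u) *m (u^T *m y)) 0 0 by rewrite /qf !mulmxA.
by rewrite mxE big_ord1 -/(dotp y u) -/(dotp u y) dotpC expr2.
Qed.

Lemma qf_sum (I : finType) (w : I -> R) (M : I -> 'M[R]_n) y :
  qf (\sum_i w i *: M i) y = \sum_i w i * qf (M i) y.
Proof.
elim/big_ind2: _ => [|A x B z <- <-|i _]; first by rewrite /qf mulmx0 mul0mx mxE.
  by rewrite qfD.
by rewrite qfZ.
Qed.

Lemma moment_update_sym nu : posdef nu.2 -> (T nu).2^T = (T nu).2.
Proof.
move=> np; rewrite /moment_update /= raddf_sum; apply: eq_bigr => i _ /=.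
have tZ (c : R) (A : 'M[R]_n) : (c *: A)^T = c *: A^T.
  by apply/matrixP => p q; rewrite !mxE.
have tD (A B : 'M[R]_n) : (A + B)^T = A^T + B^T.
  by apply/matrixP => p q; rewrite !mxE.
by rewrite tZ tD trmx_mul trmxK (posdef_sym (second_pd i np)).
Qed.

Lemma moment_update_ge nu y : posdef nu.2 ->
  \sum_i om nu i * qf (sec i nu).2 y <= qf (T nu).2 y.
Proof.
move=> np; rewrite /moment_update /= qf_sum; apply: ler_sum => i _.
by rewrite ler_wpM2l ?(ltW (bary_omega_gt0 _ _)) // qfD lerDl sq_mx sqr_ge0.
Qed.

Lemma moment_update_pd nu : posdef nu.2 -> posdef (T nu).2.
Proof.
move=> np; split; first exact: moment_update_sym.
move=> u u0; rewrite -/(qf _ _); apply: lt_le_trans (moment_update_ge u np).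
have [i _] := i0; rewrite (bigD1 i) //= ltr_wpDr //.
  apply: sumr_ge0 => j _; rewrite mulr_ge0 ?(ltW (bary_omega_gt0 _ _)) //.
  exact/posdef_ge0/second_pd.
by rewrite mulr_gt0 ?bary_omega_gt0 // posdef_gt0 //; exact: second_pd.
Qed.

(** The parallel-axis identity: the cross terms carry the factor sum_i w_i (v_i - m) = 0. *)
Lemma mixture_second_moment (w : 'I_N -> R) (v : 'I_N -> 'cV[R]_n)
    (Q : 'I_N -> 'M[R]_n) c : \sum_i w i = 1 ->
  let m := \sum_i w i *: v i in
  \sum_i w i *: (Q i + (v i - c) *m (v i - c)^T) =
  \sum_i w i *: (Q i + (v i - m) *m (v i - m)^T) + (m - c) *m (m - c)^T.
Proof.
move=> w1 m.
have E i : w i *: (Q i + (v i - c) *m (v i - c)^T) =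
    w i *: (Q i + (v i - m) *m (v i - m)^T) + w i *: ((m - c) *m (m - c)^T) +
    ((w i *: v i - w i *: m) *m (m - c)^T + (m - c) *m (w i *: v i - w i *: m)^T).
  have -> : v i - c = (v i - m) + (m - c) by rewrite addrA subrK.
  rewrite -scalerBr; move: (v i - m) (m - c) => x y.
  have tZ (c' : R) (A : 'cV[R]_n) : (c' *: A)^T = c' *: A^T.
    by apply/matrixP => p q; rewrite !mxE.
  have tD (A B : 'cV[R]_n) : (A + B)^T = A^T + B^T.
    by apply/matrixP => p q; rewrite !mxE.
  rewrite tD tZ mulmxDl !mulmxDr -!scalemxAl -!scalemxAr.
  move: (x *m x^T) (x *m y^T) (y *m x^T) (y *m y^T) (Q i) => *.
  by apply/matrixP => p q; rewrite !mxE; ring.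
rewrite (eq_bigr _ (fun i _ => E i)) !big_split /= -scaler_suml w1 scale1r.
have z : \sum_i (w i *: v i - w i *: m) = 0.
  by rewrite sumrB -scaler_suml w1 scale1r subrr.
have zt : \sum_i (w i *: v i - w i *: m)^T = 0.
  by rewrite -[RHS]trmx0 -z raddf_sum.
by rewrite -mulmx_suml z mul0mx add0r -mulmx_sumr zt mulmx0 addr0.
Qed.

(** A Gaussian log-density is quadratic, so its mean over the mixture depends only on the first two
    moments, and T nu has exactly these. *)
Lemma mixture_mean_log_density nu nu' : 
  \sum_i om nu i * mean_log_density (sec i nu) nu' = mean_log_density (T nu) nu'.
Proof.
rewrite /mean_log_density.
transitivity (- (ln (\det nu'.2) + \tr (invmx nu'.2 *m
  \sum_i om nu i *: ((sec i nu).2 + ((sec i nu).1 - nu'.1) *m ((sec i nu).1 - nu'.1)^T))) / 2).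
  rewrite mulmx_sumr raddf_sum /= -[in RHS](mul1r (ln _)) -(bary_omega_sum nu).
  rewrite mulr_suml -big_split -sumrN mulr_suml /=; apply: eq_bigr => i _.
  by rewrite -scalemxAr mxtraceZ; ring.
by rewrite (mixture_second_moment _ _ _ (bary_omega_sum nu)).
Qed.

Lemma expR_Jensen (I : finType) (w x : I -> R) : (forall i, 0 <= w i) -> \sum_i w i = 1 ->
  expR (\sum_i w i * x i) <= \sum_i w i * expR (x i).
Proof.
move=> w0 w1; set m := \sum_i w i * x i.
have h i : w i * (expR m * (1 + (x i - m))) <= w i * expR (x i).
  rewrite ler_wpM2l //; have -> : x i = m + (x i - m) by rewrite addrC subrK.
  rewrite expRD; have -> : m + (x i - m) - m = x i - m by ring.
  by rewrite ler_wpM2l ?expR_ge0 // expR_ge1Dx.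
apply: le_trans (ler_sum _ (fun i _ => h i)); rewrite le_eqVlt; apply/orP; left; apply/eqP.
transitivity (\sum_i (expR m * (1 - m) * w i + expR m * (w i * x i))).
  by rewrite big_split -!mulr_sumr /= w1 -/m; ring.
by apply: eq_bigr => i _; ring.
Qed.

Let exp_bound (c A A' D : R) : 0 <= c -> A' <= A + t1 * D ->
  c * expR (- A / s) * expR (- (t1 / s) * D) <= c * expR (- A' / s).
Proof.
move=> c0 h; rewrite -mulrA ler_wpM2l // -expRD ler_expR.
have -> : - A / s + - (t1 / s) * D = - ((A + t1 * D) / s) by ring.
by rewrite mulNr lerN2 ler_wpM2r // invr_ge0 ltW.
Qed.

Lemma bary_term_envelope nu nu' i : posdef nu.2 -> posdef nu'.2 ->
  term nu i * expR (- (t1 / s) * (gKL (sec i nu) nu' - gKL (sec i nu) nu)) <= term nu' i.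
Proof.
move=> np np'; apply: exp_bound; first by rewrite mulr_ge0 ?powR_ge0 // ltW.
exact: (ut_value_envelope t0_gt0 t1_gt0 (mu_pd i) np np').
Qed.

Let div_bound (p p' z e : R) : 0 < z -> p * e <= p' -> p / z * e <= p' / z.
Proof. by move=> z0 h; rewrite mulrAC ler_pM2r ?invr_gt0. Qed.

(** Z nu' / Z nu is at least an omega-weighted mean of exponentials, and Jensen takes the mean into
    the exponent. In the differences of entropies the self-entropies of the q_i cancel, and moment
    matching replaces the average by T nu. *)
Lemma lnZ_envelope nu nu' : posdef nu.2 -> posdef nu'.2 ->
  - (t1 / s) * (gKL (T nu) nu' - gKL (T nu) nu) <= lnZ nu' - lnZ nu.
Proof.
move=> np np'; pose x i := - (t1 / s) * (gKL (sec i nu) nu' - gKL (sec i nu) nu).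
have Tp := moment_update_pd np.
have -> : - (t1 / s) * (gKL (T nu) nu' - gKL (T nu) nu) = \sum_i om nu i * x i.
  rewrite (gKL_mean_log_density nu' Tp) (gKL_mean_log_density nu Tp) -!mixture_mean_log_density.
  transitivity (- (t1 / s) * \sum_i (om nu i * mean_log_density (sec i nu) nu -
    om nu i * mean_log_density (sec i nu) nu')); first by rewrite sumrB; ring.
  rewrite mulr_sumr; apply: eq_bigr => i _.
  by rewrite /x (gKL_mean_log_density nu' (second_pd i np))
    (gKL_mean_log_density nu (second_pd i np)); ring.
rewrite /lnZ -ln_div ?posrE ?bary_Z_gt0 // -[leLHS]expRK ler_ln ?posrE ?expR_gt0 //;
  last by rewrite divr_gt0 ?bary_Z_gt0.
apply: le_trans (expR_Jensen x (fun i => ltW (bary_omega_gt0 nu i)) (bary_omega_sum nu)) _.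
have -> : Z nu' / Z nu = \sum_i term nu' i / Z nu by rewrite -mulr_suml.
by apply: ler_sum => i _; exact: div_bound (bary_Z_gt0 nu) (bary_term_envelope i np np').
Qed.

Lemma gKL_self (nu : gparam R n) : posdef nu.2 -> gKL nu nu = 0.
Proof. by move=> np; rewrite gKL_mean_log_density // subrr. Qed.

Lemma lnZ_ascent nu : posdef nu.2 -> t1 / s * gKL (T nu) nu <= lnZ (T nu) - lnZ nu.
Proof.
move=> np; have := lnZ_envelope np (moment_update_pd np).
by rewrite (gKL_self (moment_update_pd np)) sub0r mulrNN.
Qed.

(** Each Q_i inherits the precision bound E, and the covariance of a mixture is at least the average
    of the Q_i. The threshold E0 is independent of nu, so the bound can be iterated. *)
Lemma moment_update_lower : exists E0 : R, forall E nu, E0 <= E -> 0 < E -> posdef nu.2 ->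
  (forall y, qf (invmx nu.2) y <= E * dotp y y) ->
  forall y, qf (invmx (T nu).2) y <= E * dotp y y.
Proof.
have /choice [e he] : forall i, exists E0 : R, forall E nu L,
  E0 <= E -> posdef nu.2 -> posdef L -> opt_eq t0 t1 (mu i) nu L ->
  (forall y, qf (invmx nu.2) y <= E * dotp y y) ->
  forall y, qf (invmx (opt_Q t0 (mu i) L)) y <= E * dotp y y.
  by move=> i; apply: opt_Q_lower => //; exact: mu_pd.
exists (\sum_i `|e i|) => E nu hE E_gt0 np hnu y.
have ei i : e i <= E.
  apply: le_trans hE; apply: le_trans (ler_norm _) _.
  by rewrite (bigD1 i) //= lerDl sumr_ge0.
have Tp := moment_update_pd np.
have hQ i u : E^-1 * dotp u u <= qf (sec i nu).2 u.
  have [L Lp Le] := opt_eq_exists t0_gt0 t1_gt0 (mu_pd i) np.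
  rewrite (ut_secondE t0_gt0 t1_gt0 (mu_pd i) np Lp Le) /=.
  have Qp := opt_Q_pd t0_gt0 t1_gt0 (mu_pd i) np Lp Le.
  have h := he i E nu L (ei i) np Lp Le hnu.
  have := qf_inv_ge u (posdef_inv Qp) h.
  by rewrite invmxK ler_pdivrMl.
have hT u : E^-1 * dotp u u <= qf (T nu).2 u.
  apply: le_trans (moment_update_ge u np).
  rewrite -[leLHS]mul1r -(bary_omega_sum nu) mulr_suml; apply: ler_sum => i _.
  by rewrite ler_wpM2l // ltW // bary_omega_gt0.
have := qf_inv_le y Tp _ hT; rewrite invr_gt0 => /(_ E_gt0).
by rewrite ler_pdivrMl.
Qed.

(** Some term is at least exp(z0) / N, so the transport value for that [mu i] is bounded above and
    [opt_A_proper] applies. *)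
Lemma lnZ_proper (z0 : R) : exists M : R, forall nu, posdef nu.2 -> z0 <= lnZ nu ->
  dotp nu.1 nu.1 <= M /\ \tr nu.2 <= M.
Proof.
pose c i := lam i * (a i `^ (t0 / s)).
have c0 i : 0 < c i by rewrite mulr_gt0 ?powR_gt0.
pose K := \sum_i `|s * (ln (N%:R * c i) - z0)|.
have /choice [m hm] : forall i, exists M : R, forall nu L,
  posdef nu.2 -> posdef L -> opt_eq t0 t1 (mu i) nu L -> opt_A t0 t1 (mu i) nu L <= K ->
  dotp nu.1 nu.1 <= M /\ \tr nu.2 <= M.
  by move=> i; apply: opt_A_proper => //; exact: mu_pd.
exists (\sum_i `|m i|) => nu np hz.
have N0 : 0 < N%:R :> R.
  by have [i _] := i0; rewrite ltr0n; exact: leq_ltn_trans (ltn_ord i).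
have [i hi] : exists i, expR z0 / N%:R <= term nu i.
  apply: contrapT => /forallNP h.
  have : Z nu < \sum_(i < N) (expR z0 / N%:R).
    rewrite /bary_Z; have [j _] := i0; rewrite (bigD1 j) //= [ltRHS](bigD1 j) //=.
    have hh k : term nu k < expR z0 / N%:R by rewrite ltNge; apply/negP/h.
    by apply: ltr_leD => //; apply: ler_sum => k _; exact: ltW.
  rewrite sumr_const card_ord -[ltRHS]mulr_natl mulrCA mulfV ?gt_eqF // mulr1.
  by rewrite ltNge -[leRHS]lnK ?posrE ?bary_Z_gt0 // ler_expR hz.
have [L Lp Le] := opt_eq_exists t0_gt0 t1_gt0 (mu_pd i) np.
have : opt_A t0 t1 (mu i) nu L <= K.
  rewrite -(ut_valueE t0_gt0 t1_gt0 (mu_pd i) np Lp Le).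
  apply: le_trans (_ : s * (ln (N%:R * c i) - z0) <= _); last first.
    by apply: le_trans (ler_norm _) _; rewrite /K (bigD1 i) //= lerDl sumr_ge0.
  move: hi; rewrite /bary_term -/(c i) ler_pdivrMr // => hi.
  have {hi} : expR (z0 + ut_value t0 t1 (mu i) nu / s) <= N%:R * c i.
    rewrite expRD -ler_pdivlMr ?expR_gt0 // -expRN -mulNr.
    by apply: le_trans hi _; rewrite le_eqVlt; apply/orP; left; apply/eqP; ring.
  move=> hE; have h : z0 + ut_value t0 t1 (mu i) nu / s <= ln (N%:R * c i).
    have P : 0 < N%:R * c i by apply: mulr_gt0; [exact: N0|exact: c0].
    rewrite -[leLHS]expRK ler_ln; [exact: hE|by rewrite posrE expR_gt0|by rewrite posrE].
  by rewrite mulrC -ler_pdivrMr // lerBrDl.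
move=> /(hm i nu L np Lp Le) [h1 h2].
have hM : m i <= \sum_i `|m i|.
  by apply: le_trans (ler_norm _) _; rewrite (bigD1 i) //= lerDl sumr_ge0.
by split; [exact: le_trans h1 hM|exact: le_trans h2 hM].
Qed.

End barycenter_dynamics.

(** * Finite length from descent and a gradient inequality *)

Section gradient_inequality_descent.
Variables (R : realType).

Lemma powR_le_tangent (r p : R) : 0 <= r -> 0 < p -> p < 1 -> r `^ p <= 1 + p * (r - 1).
Proof.
move=> r0 p0 p1; move: r0; rewrite le_eqVlt => /predU1P[<-|r0].
  by rewrite powR0 ?gt_eqF //; lra.
pose w (b : bool) := if b then p else 1 - p.
pose x (b : bool) := if b then ln r else 0.
have w0 b : 0 <= w b by case: b; rewrite /w; lra.
have w1 : \sum_b w b = 1 by rewrite big_bool /w /=; ring.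
have := expR_Jensen x w0 w1; rewrite !big_bool /w /x /= mulr0 addr0 expR0.
rewrite lnK ?posrE // => h; apply: le_trans (_ : _ <= p * r + (1 - p) * 1) _; last lra.
by apply: le_trans h; rewrite /powR gt_eqF.
Qed.

(** By concavity, F^(1 - th) decreases by at least (1 - th) (F - F') / F^th; descent and the
    gradient inequality make this at least (1 - th) c l / C. *)
Lemma gradient_inequality_step (F F' l th C c : R) : 0 < th -> th < 1 -> 0 < C -> 0 < c ->
  0 <= l -> 0 <= F -> 0 <= F' -> c * l ^+ 2 <= F - F' -> (F != 0 -> F `^ th <= C * l) ->
  l <= C / (c * (1 - th)) * (F `^ (1 - th) - F' `^ (1 - th)).
Proof.
move=> th0 th1 C0 c0 l0 F0 F'0 hd hL.
have k0 : 0 < c * (1 - th) by rewrite mulr_gt0 // subr_gt0.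
have [Fz|Fnz] := eqVneq F 0.
  have F'z : F' = 0 by apply/eqP; rewrite eq_le F'0 andbT; nra.
  have : c * l ^+ 2 <= 0 by rewrite Fz F'z subr0 in hd.
  rewrite pmulr_rle0 // => l2; rewrite Fz F'z subrr mulr0.
  by rewrite -(@ler_pXn2r _ 2) ?nnegrE // expr0n.
have Fgt : 0 < F by rewrite lt_neqAle eq_sym Fnz.
have P0 : 0 < F `^ th by rewrite powR_gt0.
have {hL} hL := hL Fnz.
have lgt : 0 < l by have := lt_le_trans P0 hL; rewrite pmulr_rgt0.
rewrite -ler_pdivrMl ?divr_gt0 // invf_div.
have r0 : 0 <= F' / F by rewrite divr_ge0.
have q0 : 0 < 1 - th by rewrite subr_gt0.
have q1 : 1 - th < 1 by rewrite gtrBl.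
have := powR_le_tangent r0 q0 q1.
have G0 : 0 < F `^ (1 - th) by rewrite powR_gt0.
have -> : (F' / F) `^ (1 - th) = F' `^ (1 - th) / F `^ (1 - th).
  by rewrite powRM ?invr_ge0 // -{1}(powR_inv1 F0) -powRrM mulN1r powRN.
rewrite ler_pdivrMr // => h.
have FF : F `^ (1 - th) * F `^ th = F.
  by rewrite -powRD ?subrK ?powRr1 // (gt_eqF Fgt) implybT.
have h2 : (1 - th) * (F - F') / F `^ th <= F `^ (1 - th) - F' `^ (1 - th).
  apply: le_trans (_ : _ <= (1 - th) * (1 - F' / F) * F `^ (1 - th)) _.
    rewrite ler_pdivrMr // -[leRHS]mulrA FF -[leRHS]mulrA.
    by rewrite [(1 - F' / F) * F]mulrBl mul1r divfK ?gt_eqF.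
  by move: (F' / F) h => u h; nra.
apply: le_trans h2; rewrite ler_pdivlMr //.
have -> : c * (1 - th) / C * l * F `^ th = c * (1 - th) * l * F `^ th / C by ring.
rewrite ler_pdivrMr //.
apply: le_trans (_ : _ <= (c * l ^+ 2 * (1 - th)) * C) _.
  have -> : c * l ^+ 2 * (1 - th) * C = (c * (1 - th) * l) * (C * l) by ring.
  by rewrite ler_wpM2l // mulr_ge0 // ltW.
by rewrite ler_wpM2r ?(ltW C0) // mulrC ler_wpM2l // ltW.
Qed.

Variables (I : finType) (x : nat -> I -> R) (o : I -> R) (F l : nat -> R).
Variables (r th C c : R).
Hypotheses (r0 : 0 < r) (th0 : 0 < th) (th1 : th < 1) (C0 : 0 < C) (c0 : 0 < c).
Hypotheses (l0 : forall k, 0 <= l k) (F0 : forall k, 0 <= F k).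
Hypothesis xl : forall k i, `|x k.+1 i - x k i| <= l k.
Hypothesis descent : forall k, c * l k ^+ 2 <= F k - F k.+1.
Hypothesis gradient : forall k, (forall i, `|x k i - o i| < r) -> F k != 0 ->
  F k `^ th <= C * l k.
Hypothesis cluster : forall (e : R) N, 0 < e ->
  exists2 k, (N <= k)%N & forall i, `|x k i - o i| < e.
Hypothesis F_to0 : forall e : R, 0 < e -> exists N, forall k, (N <= k)%N -> F k < e.

Let K := C / (c * (1 - th)).
Let G k := F k `^ (1 - th).

Let K0 : 0 < K. Proof. by rewrite divr_gt0 ?mulr_gt0 ?subr_gt0. Qed.

Let G_to0 (e : R) : 0 < e -> exists N, forall k, (N <= k)%N -> G k < e.
Proof.
move=> e0; have q0 : 0 < 1 - th by rewrite subr_gt0.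
have [N hN] := F_to0 (powR_gt0 (1 - th)^-1 e0); exists N => k /hN h.
have -> : e = (e `^ (1 - th)^-1) `^ (1 - th).
  by rewrite -powRrM mulVf ?lt0r_neq0 // powRr1 // ltW.
by apply: gt0_ltr_powR => //; rewrite nnegrE ?powR_ge0 ?F0.
Qed.

Let trap (e : R) : 0 < e -> e <= r -> exists N, forall m,
  \sum_(j < m) l (N + j) <= K * G N /\ forall i, `|x (N + m) i - o i| < e.
Proof.
move=> e0 er; have e2 : 0 < e / 2 by rewrite divr_gt0.
have [N0 hN0] := G_to0 (divr_gt0 e2 K0).
have [N hN hx] := cluster N0 e2; exists N => m.
have KG : K * G N < e / 2 by rewrite mulrC -ltr_pdivlMr //; exact: hN0.
suff [h1 h2] : \sum_(j < m) l (N + j) <= K * (G N - G (N + m)) /\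
    forall i, `|x (N + m) i - x N i| <= \sum_(j < m) l (N + j).
  have h3 : \sum_(j < m) l (N + j) <= K * G N.
    by apply: le_trans h1 _; rewrite ler_wpM2l ?(ltW K0) // gerBl powR_ge0.
  split=> // i; rewrite -(subrK (x N i) (x (N + m) i)) -addrA.
  apply: le_lt_trans (ler_normD _ _) _; have := h2 i; have := hx i.
  by move: KG h3; move: (K * G N) => u; lra.
elim: m => [|m [IH1 IH2]].
  by rewrite addn0 big_ord0 subrr mulr0; split=> // i; rewrite subrr normr0.
have ball i : `|x (N + m) i - o i| < r.
  rewrite -(subrK (x N i) (x (N + m) i)) -addrA.
  apply: le_lt_trans (ler_normD _ _) _.
  have h3 : \sum_(j < m) l (N + j) <= K * G N.
    by apply: le_trans IH1 _; rewrite ler_wpM2l ?(ltW K0) // gerBl powR_ge0.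
  have := IH2 i; have := hx i.
  by move: KG h3 er; move: (K * G N) => u; lra.
have st := gradient_inequality_step th0 th1 C0 c0 (l0 (N + m)) (F0 _) (F0 _)
  (descent _) (gradient ball).
rewrite !big_ord_recr /= addnS; split.
  apply: le_trans (lerD IH1 st) _; rewrite -mulrDr /G.
  by rewrite le_eqVlt; apply/orP; left; apply/eqP; congr (_ * _); ring.
move=> i; rewrite -(subrK (x (N + m) i) (x (N + m).+1 i)) -addrA addrC.
by apply: le_trans (ler_normD _ _) _; apply: lerD; [exact: IH2|exact: xl].
Qed.

Lemma gradient_descent_length : exists M, forall m, \sum_(j < m) l j <= M.
Proof.
have [N hN] := trap r0 (lexx r); exists (\sum_(j < N) l j + K * G N) => m.
have [h _] := hN m; apply: le_trans (_ : _ <= \sum_(j < N + m) l j) _.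
  rewrite addnC big_split_ord /= lerDl; exact: sumr_ge0.
by rewrite big_split_ord /= lerD2l.
Qed.

Lemma gradient_descent_limit (e : R) : 0 < e ->
  exists N, forall k, (N <= k)%N -> forall i, `|x k i - o i| < e.
Proof.
move=> e0; have e'0 : 0 < Num.min e r by rewrite lt_min e0.
have [|N hN] := trap e'0; first by rewrite ge_min lexx orbT.
exists N => k Nk i; have [_ h] := hN (k - N)%N; have := h i.
by rewrite subnKC // lt_min => /andP[].
Qed.

End gradient_inequality_descent.

(** * Variation of the entropy in its second argument *)

Section divergence_variation.
Variables (R : realType) (d : nat).
Local Notation n := d.+1.
Implicit Types q nu : gparam R n.

(** Adding the nonnegative term 2 * gKL nu' nu cancels the logarithms of determinants exactly and
    leaves traces that are small with nu' - nu. *)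
Lemma gKL_variation q nu nu' (w z : 'cV[R]_n) : posdef q.2 -> posdef nu.2 -> posdef nu'.2 ->
  w = q.1 - nu.1 -> z = nu'.1 - nu.1 ->
  2 * (gKL q nu' - gKL q nu) <=
  \tr ((invmx nu'.2 - invmx nu.2) *m (q.2 - nu'.2 + w *m w^T)) +
  \tr (invmx nu.2 *m (z *m z^T)) +
  \tr (invmx nu'.2 *m (z *m z^T - w *m z^T - z *m w^T)).
Proof.
move=> qp np np' wE zE; have g := gKL_ge0 np' np.
have : 2 * (gKL q nu' - gKL q nu) <= 2 * (gKL q nu' - gKL q nu) + 2 * gKL nu' nu.
  by rewrite lerDl mulr_ge0.
move/le_trans; apply; rewrite le_eqVlt; apply/orP; left; apply/eqP.
rewrite /gKL -wE -zE.
have -> : q.1 - nu'.1 = w - z by rewrite wE zE opprB addrA subrK.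
have -> : (w - z) *m (w - z)^T = w *m w^T - w *m z^T - z *m w^T + z *m z^T.
  rewrite raddfB /= mulmxBl !mulmxBr.
  move: (w *m w^T) (w *m z^T) (z *m w^T) (z *m z^T) => A B C' D.
  by apply/matrixP => i j; rewrite !mxE; ring.
have u' : \tr (invmx nu'.2 *m nu'.2) = n%:R.
  by rewrite mulVmx ?mxtrace1 // posdef_unit.
move: (w *m w^T) (w *m z^T) (z *m w^T) (z *m z^T) => A B C' D.
rewrite mulmxBl !mulmxDr !mulmxN !mxtraceD !raddfN /=.
rewrite !mxtraceD !raddfN /= u'.
move: (\tr _) (\tr _) (\tr _) (\tr _) (\tr _) (\tr _) (\tr _) (\tr _) (\tr _) => *.
by field.
Qed.

Lemma normrM_le (x y p q : R) : `|x| <= p -> `|y| <= q -> `|x * y| <= p * q.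
Proof. by move=> hx hy; rewrite normrM ler_pM. Qed.

Lemma normr_trM_le m (A B : 'M[R]_m) (p q : R) : 0 <= p ->
  (forall i j, `|A i j| <= p) -> (forall i j, `|B i j| <= q) ->
  `|\tr (A *m B)| <= m%:R ^+ 2 * (p * q).
Proof.
move=> p0 hA hB; rewrite /mxtrace; apply: le_trans (ler_norm_sum _ _ _) _.
apply: le_trans (_ : _ <= \sum_(i < m) \sum_(j < m) p * q) _.
  apply: ler_sum => i _; rewrite mxE; apply: le_trans (ler_norm_sum _ _ _) _.
  by apply: ler_sum => j _; exact: normrM_le (hA i j) (hB j i).
by rewrite !sumr_const !card_ord -mulrnA -[leLHS]mulr_natl natrM expr2.
Qed.

Let outer_le (u v : 'cV[R]_n) (p q : R) i j : (forall i, `|u i 0| <= p) ->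
  (forall i, `|v i 0| <= q) -> `|(u *m v^T) i j| <= p * q.
Proof. by move=> hu hv; rewrite !mxE big_ord1 !mxE; exact: normrM_le. Qed.

Let bound_alg (N t l K B : R) : 0 <= N -> 0 <= t -> 0 <= l -> 0 <= K -> 0 <= B -> l <= B ->
  N * (K * t * (l + t + l * l)) + N * (B * (t * t)) + N * (B * (t * t + l * t + t * l)) <=
  N * (K + K * B + 2 * B) * (t * (l + t)).
Proof.
move=> N0 t0 l0 K0 B0 lB; rewrite -[leRHS]mulrA.
have -> : N * (K * t * (l + t + l * l)) + N * (B * (t * t)) + N * (B * (t * t + l * t + t * l)) =
  N * (K * t * (l + t + l * l) + B * (t * t) + B * (t * t + l * t + t * l)) by ring.
rewrite ler_wpM2l //.
have h : K * t * (l * l) <= K * t * (l * B) by rewrite !ler_wpM2l // mulr_ge0.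
have h1 : 0 <= K * t * (t * B) by rewrite !mulr_ge0.
apply: le_trans (_ : _ <= K * t * (l + t) + K * t * (l * B) + 2 * B * (t * t) + 2 * B * (l * t)) _.
  move: h; rewrite !mulrDr; lra.
move: h1; rewrite !mulrDr !mulrDl; lra.
Qed.

(** t measures the displacement of nu and l the distance from q to nu. The bound is of order t * l +
    t^2, so its slope at t = 0 is proportional to l. *)
Lemma gKL_variation_le q nu nu' (t l K B : R) : posdef q.2 -> posdef nu.2 -> posdef nu'.2 ->
  0 <= t -> 0 <= l -> 0 <= K -> l <= B ->
  (forall i, `|nu'.1 i 0 - nu.1 i 0| <= t) -> (forall i j, `|nu'.2 i j - nu.2 i j| <= t) ->
  (forall i, `|q.1 i 0 - nu.1 i 0| <= l) -> (forall i j, `|q.2 i j - nu.2 i j| <= l) ->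
  (forall i j, `|invmx nu'.2 i j - invmx nu.2 i j| <= K * t) ->
  (forall i j, `|invmx nu.2 i j| <= B) -> (forall i j, `|invmx nu'.2 i j| <= B) ->
  2 * (gKL q nu' - gKL q nu) <= n%:R ^+ 2 * (K + K * B + 2 * B) * (t * (l + t)).
Proof.
move=> qp np np' t0 l0 K0 lB h1 h2 h3 h4 h5 h6 h7.
apply: le_trans (gKL_variation qp np np' erefl erefl) _.
set w := q.1 - nu.1; set z := nu'.1 - nu.1.
have hw i : `|w i 0| <= l by rewrite !mxE.
have hz i : `|z i 0| <= t by rewrite !mxE.
have B0 : 0 <= B by exact: le_trans lB.
have ww i j := outer_le i j hw hw.
have wz i j := outer_le i j hw hz.
have zw i j := outer_le i j hz hw.
have zz i j := outer_le i j hz hz.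
apply: le_trans (bound_alg (sqr_ge0 _) t0 l0 K0 B0 lB).
have Kt : 0 <= K * t by rewrite mulr_ge0.
apply: lerD; [apply: lerD|]; apply: le_trans (ler_norm _) _; apply: normr_trM_le => //.
- by move=> i j; rewrite !mxE; move: (h5 i j).
- move=> i j; move: (w *m w^T) ww => A ww; rewrite !mxE.
  apply: le_trans (ler_normD _ _) _; apply: lerD => //.
  have -> : q.2 i j - nu'.2 i j = (q.2 i j - nu.2 i j) - (nu'.2 i j - nu.2 i j) by ring.
  by apply: le_trans (ler_normB _ _) _; apply: lerD.
- move=> i j; move: (w *m z^T) (z *m w^T) (z *m z^T) wz zw zz => A D E wz zw zz.
  rewrite !mxE; apply: le_trans (ler_normB _ _) _; apply: lerD => //.
  by apply: le_trans (ler_normB _ _) _; apply: lerD.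
Qed.

End divergence_variation.

(** * Analyticity and Lipschitz constants of ln Z *)

Section analytic_barycenter.
Variables (R : realType) (d N : nat).
Local Notation n := d.+1.
Local Notation J := ('I_n + 'I_n * 'I_n)%type.
Variables (t0 t1 : R) (lam a : 'I_N -> R) (mu : 'I_N -> gparam R n).
Hypotheses (t0_gt0 : 0 < t0) (t1_gt0 : 0 < t1).
Hypotheses (lam_gt0 : forall i, 0 < lam i) (lam1 : \sum_(i < N) lam i = 1).
Hypotheses (a_gt0 : forall i, 0 < a i) (mu_pd : forall i, gaussians (mu i)).

Local Notation T := (moment_update t0 t1 lam a mu).
Local Notation F := (lnZ t0 t1 lam a mu).

Lemma anam_sum (I S : finType) m k (G : S -> (I -> R) -> 'M[R]_(m, k)) o :
  (forall s, anam (G s) o) -> anam (fun x => \sum_s G s x) o.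
Proof.
move=> Ga i j; apply: (ana_ext (f := fun x => \sum_s G s x i j)).
  by apply: nearptW => x; rewrite summxE.
by apply: ana_sum => s _; exact: Ga.
Qed.

Lemma analytic_term (o : J -> R) i : posdef (par o).2 ->
  ana (fun x => bary_term t0 t1 lam a mu (par x) i) o.
Proof.
move=> op; have [h _ _] := analytic_transport t0_gt0 t1_gt0 (mu_pd i) op.
exact: (ana_mul (ana_cst _ o) (ana_expR (ana_mul (ana_opp h) (ana_cst _ o)))).
Qed.

Lemma analytic_Z (o : J -> R) : posdef (par o).2 ->
  ana (fun x => bary_Z t0 t1 lam a mu (par x)) o.
Proof. by move=> op; apply: ana_sum => i _; exact: analytic_term. Qed.

Lemma analytic_lnZ (o : J -> R) : posdef (par o).2 -> ana (fun x => F (par x)) o.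
Proof.
by move=> op; exact: (ana_ln (analytic_Z op) (bary_Z_gt0 t0 t1 mu lam_gt0 lam1 a_gt0 (par o))).
Qed.

Lemma analytic_update (o : J -> R) k : posdef (par o).2 ->
  ana (fun x => crd (T (par x)) k) o.
Proof.
move=> op.
have Z0 : bary_Z t0 t1 lam a mu (par o) != 0.
  by rewrite gt_eqF // bary_Z_gt0.
have omA i : ana (fun x => bary_omega t0 t1 lam a mu (par x) i) o.
  exact: (ana_mul (analytic_term i op) (ana_inv (analytic_Z op) Z0)).
have mA : anam (fun x => (T (par x)).1) o.
  apply: (anam_sum (G := fun i x => bary_omega t0 t1 lam a mu (par x) i *:
    (ut_second t0 t1 (mu i) (par x)).1)) => i.
  have [_ h _] := analytic_transport t0_gt0 t1_gt0 (mu_pd i) op.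
  exact: anam_scale.
have SA : anam (fun x => (T (par x)).2) o.
  apply: (anam_sum (G := fun i x => bary_omega t0 t1 lam a mu (par x) i *:
    ((ut_second t0 t1 (mu i) (par x)).2 +
     ((ut_second t0 t1 (mu i) (par x)).1 - (T (par x)).1) *m
     ((ut_second t0 t1 (mu i) (par x)).1 - (T (par x)).1)^T))) => i.
  have [_ h1 h2] := analytic_transport t0_gt0 t1_gt0 (mu_pd i) op.
  have h3 := anam_add h1 (anam_opp mA).
  exact: (anam_scale (omA i) (anam_add h2 (anam_mul h3 (anam_tr h3)))).
by case: k => [i|[i j]]; [exact: mA|exact: SA].
Qed.

Definition gap (nu nu' : gparam R n) : R := \sum_(k : J) `|crd nu k - crd nu' k|.

Lemma gap_ge0 nu nu' : 0 <= gap nu nu'.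
Proof. by apply: sumr_ge0 => k _; exact: normr_ge0. Qed.

Lemma gap_ge nu nu' k : `|crd nu k - crd nu' k| <= gap nu nu'.
Proof.
rewrite /gap (bigD1 k) //= lerDl; apply: sumr_ge0 => i _; exact: normr_ge0.
Qed.

Let avg_le (x1 x2 y1 y2 t : R) : `|y1 - x1| <= t -> `|y2 - x2| <= t ->
  `|(y1 + y2) / 2 - (x1 + x2) / 2| <= t.
Proof. by rewrite !ler_norml => /andP[? ?] /andP[? ?]; apply/andP; split; lra. Qed.

Let half_twice (p D : R) : p / 2 * (2 * D) = p * D.
Proof. by field. Qed.

Let tri_diff (c1 c2 c3 c4 p : R) : `|c1 - c2| <= p -> `|c3 - c4| <= p ->
  `|c1 - c3| <= `|c2 - c4| + p *+ 2.
Proof.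
move=> h1 h2; have -> : c1 - c3 = (c2 - c4) + ((c1 - c2) - (c3 - c4)) by ring.
apply: le_trans (ler_normD _ _) _; rewrite lerD2l; apply: le_trans (ler_normB _ _) _.
by rewrite mulr2n lerD.
Qed.

Let half_lt (u v w t : R) : v <= t -> w < u / 2 -> t < u / 2 -> v + w < u.
Proof. by move=> *; lra. Qed.

Let slope_le (C g w t L D g' k : R) : 0 < C -> 0 <= t -> w = k + 1 ->
  t * (C * w) <= L - C * g -> D <= C * (t * (g' + t)) -> g' <= g + k * t -> D <= L * t.
Proof.
move=> C0 tt wE h2 hD hg; apply: le_trans hD _.
have h : C * (t * (g' + t)) <= C * (t * (g + w * t)).
  rewrite ler_wpM2l ?(ltW C0) // ler_wpM2l // wE mulrDl mul1r; lra.
apply: le_trans h _.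
have -> : C * (t * (g + w * t)) = (C * g + t * (C * w)) * t by ring.
by rewrite ler_wpM2r // -lerBrDl.
Qed.

(** The envelope inequality is one-sided. Exchanging x and y gives the other side with the gap at y,
    which exceeds the gap at x by O(t); the strict inequality C * gap < L absorbs all such
    corrections for small t. *)
Lemma lnZ_lip_at (o : J -> R) : posdef (par o).2 -> exists C r : R, [/\ 0 < C, 0 < r &
  forall x, (forall i, `|x i - o i| < r) -> forall L, C * gap (T (par x)) (par x) < L ->
    lip_at (fun x => F (par x)) x L].
Proof.
move=> op.
pose q (j : J + J + 'I_n * 'I_n) (x : J -> R) : R :=
  match j with
  | inl (inl k) => crd (T (par x)) k
  | inl (inr k) => crd (par x) k
  | inr p => invmx (par x).2 p.1 p.2
  end.
have qa j : ana (q j) o.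
  case: j => [[k|[i|[i j]]]|[i j]].
  - exact: analytic_update.
  - exact: anam_par1.
  - exact: anam_par2.
  - by apply: anam_inv; [exact: posdef_unit|exact: anam_par2].
have [K [e [K0 e0 hK]]] := ana_lip_fam qa.
have [e1 e10 hp] := posdef_par op.
pose m : R := #|{: J}|%:R.
have m0 : 0 <= m by rewrite ler0n.
have [b0 b0E] : exists b0 : R, b0 = \sum_j `|q j o| + K * e by eexists.
have b00 : 0 <= b0.
  by rewrite b0E addr_ge0 ?sumr_ge0 // mulr_ge0 // ltW.
have hb j x : (forall i, `|x i - o i| < e) -> `|q j x| <= b0.
  move=> hx; rewrite -(subrK (q j o) (q j x)); apply: le_trans (ler_normD _ _) _.
  rewrite addrC b0E lerD //.
    by rewrite (bigD1 j) //= lerDl sumr_ge0.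
  by apply: hK => // [i|i|]; [rewrite subrr normr0|exact: ltW|exact: ltW].
(* B bounds the entries of the inverse covariance and the gap on the whole neighbourhood. *)
pose B := (m * 2 + 1) * b0.
have b0B : b0 <= B by rewrite /B ler_peMl // lerDr mulr_ge0.
have gapB x : (forall i, `|x i - o i| < e) -> gap (T (par x)) (par x) <= B.
  move=> hx; apply: le_trans (_ : _ <= \sum_(k : J) b0 *+ 2) _.
    apply: ler_sum => k _; apply: le_trans (ler_normB _ _) _; rewrite mulr2n.
    by apply: lerD; [exact: (hb (inl (inl k)))|exact: (hb (inl (inr k)))].
  have -> : \sum_(k : J) b0 *+ 2 = m * 2 * b0.
    by rewrite sumr_const -[LHS]mulr_natl -[b0 *+ 2]mulr_natl mulrA.
  by rewrite /B mulrDl mul1r lerDl.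
have B0 : 0 <= B by exact: le_trans b0B.
have [C [C0 hC]] : exists C : R, 0 < C /\ t1 / (t0 + t1) *
    (n%:R ^+ 2 * (K + K * B + 2 * B)) / 2 = C.
  eexists; split; last reflexivity.
  have KB : 0 < K + K * B + 2 * B.
    by rewrite -addrA ltr_pwDl // addr_ge0 // mulr_ge0 // ltW.
  apply: divr_gt0 => //; apply: mulr_gt0; first by rewrite divr_gt0 ?addr_gt0.
  by rewrite mulr_gt0 // exprn_gt0 // ltr0n.
have one x y t : (forall i, `|x i - o i| < e) -> (forall i, `|y i - o i| < e) ->
    posdef (par x).2 -> posdef (par y).2 -> 0 <= t -> (forall i, `|y i - x i| <= t) ->
    F (par x) - F (par y) <= C * (t * (gap (T (par x)) (par x) + t)).
  move=> hx hy xp yp tt hxy.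
  have Txp := moment_update_pd t0_gt0 t1_gt0 lam_gt0 lam1 a_gt0 mu_pd xp.
  have env := lnZ_envelope t0_gt0 t1_gt0 lam_gt0 lam1 a_gt0 mu_pd xp yp.
  have v : 2 * (gKL (T (par x)) (par y) - gKL (T (par x)) (par x)) <=
      n%:R ^+ 2 * (K + K * B + 2 * B) * (t * (gap (T (par x)) (par x) + t)).
    apply: gKL_variation_le => //.
    - exact: gap_ge0.
    - exact: ltW.
    - exact: gapB.
    - by move=> i; rewrite !mxE.
    - by move=> i j; rewrite !mxE; exact: avg_le.
    - by move=> i; exact: (gap_ge (T (par x)) (par x) (inl i)).
    - by move=> i j; exact: (gap_ge (T (par x)) (par x) (inr (i, j))).
    - by move=> i j; exact: (hK (inr (i, j)) x y t hx hy hxy tt).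
    - by move=> i j; apply: le_trans (hb (inr (i, j)) x hx) b0B.
    - by move=> i j; apply: le_trans (hb (inr (i, j)) y hy) b0B.
  have p0 : 0 <= t1 / (t0 + t1) / 2 by rewrite !divr_ge0 // ltW // addr_gt0.
  have := ler_wpM2l p0 v; rewrite -hC; move: env.
  move: (gKL _ _ - gKL _ _) (t * _) (n%:R ^+ 2 * _) => D w M env h.
  rewrite -lerN2 opprB; apply: le_trans env.
  rewrite mulNr lerN2; move: h; rewrite half_twice => /le_trans; apply.
  by rewrite le_eqVlt; apply/orP; left; apply/eqP; ring.
exists C, (Num.min e e1 / 2).
have ee : 0 < Num.min e e1 by rewrite lt_min e0.
split=> //; first by rewrite divr_gt0.
move=> x hx L hL; set g := gap _ _ in hL.
have [w [w0 wE]] : exists w : R, 0 < w /\ w = 2 * m * K + 1.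
  by eexists; split; last reflexivity; rewrite ltr_wpDl // !mulr_ge0 // ltW.
(* r is the largest t for which the correction C * w * t fits into the slack L - C * g. *)
have [r [r0 rE]] : exists r : R, 0 < r /\ r = (L - C * g) / (C * w).
  by eexists; split; last reflexivity; rewrite divr_gt0 ?subr_gt0 ?mulr_gt0.
exists (Num.min (Num.min e e1 / 2) r); first by rewrite lt_min r0 divr_gt0.
move=> y t tt; rewrite lt_min => /andP[t1' t2'] hyx.
have hx' i : `|x i - o i| < Num.min e e1.
  by apply: lt_trans (hx i) _; rewrite gtr_pMr // invf_lt1 ?ltr1n.
have hy' i : `|y i - o i| < Num.min e e1.
  rewrite -(subrK (x i) (y i)) -addrA; apply: le_lt_trans (ler_normD _ _) _.
  exact: half_lt (hyx i) (hx i) t1'.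
have hxe i : `|x i - o i| < e by have := hx' i; rewrite lt_min => /andP[].
have hye i : `|y i - o i| < e by have := hy' i; rewrite lt_min => /andP[].
have xp : posdef (par x).2 by apply: hp => i; have := hx' i; rewrite lt_min => /andP[].
have yp : posdef (par y).2 by apply: hp => i; have := hy' i; rewrite lt_min => /andP[].
have hxy i : `|x i - y i| <= t by rewrite distrC.
have A1 := one x y t hxe hye xp yp tt hyx.
have A2 := one y x t hye hxe yp xp tt hxy.
have gy : gap (T (par y)) (par y) <= g + 2 * m * K * t.
  have -> : 2 * m * K * t = \sum_(k : J) (K * t) *+ 2.
    by rewrite sumr_const -[RHS]mulr_natl -[(K * t) *+ 2]mulr_natl -/m; ring.
  rewrite /g /gap -big_split; apply: ler_sum => k _ /=.
  have h1 := hK (inl (inl k)) x y t hxe hye hyx tt.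
  have h2 := hK (inl (inr k)) x y t hxe hye hyx tt.
  exact: (tri_diff h1 h2).
have h2 : t * (C * w) <= L - C * g by rewrite -ler_pdivlMr ?mulr_gt0 // -rE ltW.
have fin (D g' : R) := @slope_le C g w t L D g' (2 * m * K) C0 tt wE h2.
have mk : 0 <= 2 * m * K * t by rewrite !mulr_ge0 // ltW.
rewrite ler_norml -lerN2 opprK opprB; apply/andP; split.
  by apply: fin A1 _; rewrite lerDl.
exact: fin A2 gy.
Qed.

(** Every number above C2 * gap is a Lipschitz constant, so the inequality is obtained with a margin
    e / C1 and then e is sent to zero. *)
Lemma lnZ_lojasiewicz (o : J -> R) : posdef (par o).2 -> exists th C r : R,
  [/\ 0 < th < 1, 0 < C, 0 < r & forall x, (forall i, `|x i - o i| < r) ->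
    F (par o) - F (par x) != 0 ->
    `|F (par o) - F (par x)| `^ th <= C * gap (T (par x)) (par x)].
Proof.
move=> op; pose f x := F (par x) - F (par o).
have fa : ana f o by exact: (ana_sub (analytic_lnZ op) (ana_cst _ o)).
have [|th [C1 [th0 th1 C10 [r1 r10 h1]]]] := lojasiewicz fa; first by rewrite /f subrr.
have [C2 [r2 [C20 r20 h2]]] := lnZ_lip_at op.
exists th, (C1 * C2), (Num.min r1 r2); split; rewrite ?th0 ?mulr_gt0 ?lt_min ?r10 //.
move=> x hx fx; set g := gap _ _.
have hx1 i : `|x i - o i| < r1 by have := hx i; rewrite lt_min => /andP[].
have hx2 i : `|x i - o i| < r2 by have := hx i; rewrite lt_min => /andP[].
have fx' : f x != 0 by rewrite -oppr_eq0 /f opprB.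
rewrite distrC -/(f x); apply/ler_addgt0Pr => e e0.
have -> : C1 * C2 * g + e = C1 * (C2 * g + e / C1) by field; rewrite gt_eqF.
apply: (h1 x hx1 fx').
have hL : C2 * g < C2 * g + e / C1 by rewrite ltrDl divr_gt0.
have [dd dd0 hd] := h2 x hx2 _ hL.
exists dd => // y t tt tdd hy.
have fE (u v w : R) : (u - w) - (v - w) = u - v by ring.
rewrite /f fE; exact: (hd y t tt tdd hy).
Qed.

End analytic_barycenter.

(** * Coordinates, parameter distance and convergence *)

Section coordinates.
Variables (R : realType) (d : nat).
Local Notation n := d.+1.
Local Notation J := ('I_n + 'I_n * 'I_n)%type.
Implicit Types nu : gparam R n.

Lemma tr_invmx_mul_le (S Q : 'M[R]_n) (E : R) : posdef S -> posdef Q ->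
  (forall y, qf (invmx S) y <= E * dotp y y) -> \tr (invmx S *m Q) <= E * \tr Q.
Proof.
move=> Sp /posdef_sqrt [H Hp <-] hE; have Hs := posdef_sym Hp.
rewrite mulmxA mxtrace_mulC mulmxA /mxtrace mulr_sumr; apply: ler_sum => i _.
rewrite -!qf_delta -{1}Hs qf_congr; apply: le_trans (hE _) _.
by rewrite dotp_mul Hs qfE mulmxA dotpC.
Qed.

Lemma tr_mul_posdef_ge0 (A B : 'M[R]_n) : posdef A -> posdef B -> 0 <= \tr (A *m B).
Proof.
move=> /posdef_sqrt [H Hp <-] Bp; rewrite -mulmxA mxtrace_mulC; apply: posdef_tr_ge0.
by rewrite -{1}(posdef_sym Hp); exact: (posdef_congr (posdef_unit Hp) Bp).
Qed.

Lemma posdef_entry_le (S : 'M[R]_n) i j : posdef S -> `|S i j| <= \tr S + 1.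
Proof.
move=> Sp; have k0 : 0 <= \tr S + 1 by rewrite addr_ge0 // posdef_tr_ge0.
rewrite -(@ler_pXn2r _ 2) ?nnegrE // real_normK ?num_real //.
have h := dotp_sq_le (delta_mx j 0) Sp (fun u => qf_le_tr u Sp).
have h2 := qf_le_tr (delta_mx j 0) Sp.
have e1 : dotp (delta_mx j 0) (delta_mx j 0) = 1 :> R.
  by have := qf_delta (1%:M : 'M[R]_n) j; rewrite qf1 mul1r !mxE eqxx.
rewrite e1 mulr1 in h2; apply: le_trans (_ : _ <= dotp (S *m delta_mx j 0) (S *m delta_mx j 0)) _.
  rewrite -colE dotpE (bigD1 i) //= !mxE -expr2 lerDl.
  by apply: sumr_ge0 => k _; rewrite -expr2 sqr_ge0.
by apply: le_trans h _; rewrite expr2 ler_wpM2l.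
Qed.

Lemma sum_sqr_crd nu nu' : \sum_(k : J) (crd nu k - crd nu' k) ^+ 2 =
  \sum_i (nu.1 i 0 - nu'.1 i 0) ^+ 2 + \sum_i \sum_j (nu.2 i j - nu'.2 i j) ^+ 2.
Proof. by rewrite big_sumType /=; congr (_ + _); rewrite pair_bigA. Qed.

Lemma frob_crd nu nu' : frob (nu.1 - nu'.1) + frob (nu.2 - nu'.2) =
  \sum_(k : J) (crd nu k - crd nu' k) ^+ 2.
Proof.
rewrite sum_sqr_crd /frob; congr (_ + _); apply: eq_bigr => i _.
  by rewrite big_ord1 !mxE.
by apply: eq_bigr => j _; rewrite !mxE.
Qed.

Lemma gap_sqr_le nu nu' : gap nu nu' ^+ 2 <=
  #|{: J}|%:R * \sum_(k : J) (crd nu k - crd nu' k) ^+ 2.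
Proof.
have := sum_Cauchy (fun=> 1) (fun k : J => `|crd nu k - crd nu' k|).
under eq_bigr do rewrite mul1r; rewrite -/(gap nu nu').
have -> : \sum_(k : J) (1 : R) ^+ 2 = #|{: J}|%:R by rewrite sumr_const expr1n.
by under [X in _ <= _ * X]eq_bigr do rewrite real_normK ?num_real //.
Qed.

Lemma dpar_gap nu nu' : dpar nu nu' <= gap nu nu'.
Proof.
rewrite /dpar -sum_sqr_crd -[leRHS](ger0_norm (gap_ge0 _ _)) -sqrtr_sqr ler_wsqrtr // expr2.
rewrite {1}/gap mulr_suml; apply: ler_sum => k _.
by rewrite -real_normK ?num_real // expr2 ler_wpM2l // gap_ge.
Qed.

Lemma crd_dpar nu nu' k : `|crd nu k - crd nu' k| <= dpar nu nu'.
Proof.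
rewrite /dpar -sum_sqr_crd -sqrtr_sqr ler_wsqrtr // (bigD1 k) //= lerDl.
by apply: sumr_ge0 => i _; exact: sqr_ge0.
Qed.

Lemma crd_inj nu nu' : crd nu = crd nu' -> nu = nu'.
Proof.
case: nu nu' => [m S] [m' S'] h; congr (_, _).
  by apply/colP => i; have := congr1 (fun f : J -> R => f (inl i)) h.
by apply/matrixP => i j; have := congr1 (fun f : J -> R => f (inr (i, j))) h.
Qed.

Lemma par_crdK (o : J -> R) : (forall i j, o (inr (i, j)) = o (inr (j, i))) ->
  crd (par o) = o.
Proof.
move=> os; apply/funext => -[i|[i j]]; rewrite /crd /= !mxE //.
by rewrite -os mulrDl -splitr.
Qed.

Lemma ball_crd nu nu' (e : R) : 0 < e -> (forall k, `|crd nu k - crd nu' k| < e) ->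
  ball nu e nu'.
Proof.
move=> e0 h; split; split=> // i j; rewrite /ball /=.
  by rewrite ord1; exact: (h (inl i)).
exact: (h (inr (i, j))).
Qed.

Lemma cvg_crd (nu : nat -> gparam R n) nu' :
  (forall e : R, 0 < e -> exists N, forall k, (N <= k)%N ->
    forall j, `|crd (nu k) j - crd nu' j| < e) -> nu @ \oo --> nu'.
Proof.
move=> h; apply/cvg_ballP => e e0; have [N hN] := h _ e0.
exists N => // k /= Nk; apply: ball_crd => // j.
by rewrite distrC; exact: hN.
Qed.

End coordinates.

(** If the limit is not a cluster point of the filter, then the filter lives on finitely many terms
    of the sequence, and a finite set is compact. *)
Lemma compact_cvg_sequence (X : topologicalType) (u : nat -> X) (l : X) :
  u @ \oo --> l -> compact (range u `|` [set l]).
Proof.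
move=> ul G PG GK; have [cl|ncl] := pselect (cluster G l).
  by exists l; split=> //; right.
have [A [B [GA lB AB]]] : exists A B, [/\ G A, nbhs l B & ~ (A `&` B !=set0)].
  apply: contrapT => h; apply: ncl => A B GA lB; apply: contrapT => AB.
  by apply: h; exists A, B.
have [M _ hM] := ul B lB.
have fin : finite_set (u @` `I_M) by apply: finite_image; exact: finite_II.
have GF : G (u @` `I_M).
  apply: filterS (filterI GA GK) => x [Ax [[k _ kx]|xl]].
    have [kM|Mk] := ltnP k M; first by exists k.
    by case: AB; exists x; split=> //; rewrite -kx; exact: hM.
  by case: AB; exists x; split=> //; rewrite xl; exact: nbhs_singleton.
have [p [[k _ kp] clp]] := finite_compact fin PG GF.
by exists p; split=> //; left; exists k.
Qed.

Lemma nneseries_lt_pinfty (R : realType) (u : nat -> R) (M : R) : (forall k, 0 <= u k) ->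
  (forall m, \sum_(k < m) u k <= M) -> (\sum_(0 <= k <oo) (u k)%:E < +oo)%E.
Proof.
move=> u0 hM; apply: (@le_lt_trans _ _ M%:E); last exact: ltry.
apply: lime_le; first by apply: is_cvg_nneseries => k _ _; rewrite lee_fin.
by apply: nearW => m; rewrite big_mkord sumEFin lee_fin.
Qed.

(** * Bounds, descent and a cluster point of the trajectory *)

Section trajectory.
Variables (R : realType) (d N : nat).
Local Notation n := d.+1.
Local Notation J := ('I_n + 'I_n * 'I_n)%type.
Variables (t0 t1 : R) (lam a : 'I_N -> R) (mu : 'I_N -> gparam R n) (nu0 : gparam R n).
Hypotheses (t0_gt0 : 0 < t0) (t1_gt0 : 0 < t1).
Hypotheses (lam_gt0 : forall i, 0 < lam i) (lam1 : \sum_(i < N) lam i = 1).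
Hypotheses (a_gt0 : forall i, 0 < a i) (mu_pd : forall i, gaussians (mu i)).
Hypothesis nu0_pd : gaussians nu0.

Local Notation T := (moment_update t0 t1 lam a mu).
Local Notation F := (lnZ t0 t1 lam a mu).
Local Notation nu k := (iter k T nu0).

Lemma trajectory_pd k : posdef (nu k).2.
Proof.
elim: k => [|k IH] /=; first exact: nu0_pd.
exact: (moment_update_pd t0_gt0 t1_gt0 lam_gt0 lam1 a_gt0 mu_pd IH).
Qed.

Lemma trajectory_sym k : (nu k).2^T = (nu k).2.
Proof. exact: posdef_sym (trajectory_pd k). Qed.

Lemma trajectory_step k : F (nu k) <= F (nu k.+1).
Proof.
have pk := trajectory_pd k; have pk1 := trajectory_pd k.+1.
have asc := lnZ_ascent t0_gt0 t1_gt0 lam_gt0 lam1 a_gt0 mu_pd pk.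
have g0 := gKL_ge0 pk1 pk.
rewrite -subr_ge0; apply: le_trans asc; apply: mulr_ge0 g0.
by apply: divr_ge0; [exact: ltW|exact: ltW (addr_gt0 t0_gt0 t1_gt0)].
Qed.

Lemma trajectory_lnZ_homo k m : (k <= m)%N -> F (nu k) <= F (nu m).
Proof.
move=> km; rewrite -(subnK km); move: (m - k)%N => p {km}.
elim: p => [|p IH]; first by rewrite add0n.
by rewrite addSn; apply: le_trans IH (trajectory_step _).
Qed.

Lemma trajectory_bounds : exists E M : R, 0 < E /\ 0 <= M /\ forall k,
  [/\ forall y, qf (invmx (nu k).2) y <= E * dotp y y,
      dotp (nu k).1 (nu k).1 <= M & \tr (nu k).2 <= M].
Proof.
have [E0 hE0] := moment_update_lower t0_gt0 t1_gt0 lam_gt0 lam1 a_gt0 mu_pd.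
have [M hM] := lnZ_proper t0_gt0 t1_gt0 lam_gt0 lam1 a_gt0 mu_pd (F nu0).
have [c c0 hc] := posdef_lower nu0_pd.
(* E lies above both the precision of nu0 and the threshold E0, so [moment_update_lower] propagates
   it along the trajectory. *)
have [E [E_gt0 [EE0 Ec]]] : exists E : R, 0 < E /\ E0 <= E /\ c^-1 <= E.
  exists (`|E0| + c^-1); split; first by rewrite ltr_wpDl // invr_gt0.
  split; first by rewrite (le_trans (ler_norm _)) // lerDl invr_ge0 ltW.
  by rewrite lerDr.
exists E, M; split=> //; split.
  have [h _] := hM _ (trajectory_pd 0) (lexx _); exact: le_trans (dotp_ge0 _) h.
have hinv k : forall y, qf (invmx (nu k).2) y <= E * dotp y y.
  elim: k => [y|k IH] /=; last exact: (hE0 _ _ EE0 E_gt0 (trajectory_pd k) IH).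
  apply: le_trans (_ : _ <= c^-1 * dotp y y) _; last by rewrite ler_wpM2r ?dotp_ge0.
  by rewrite ler_pdivlMl //; exact: qf_inv_le.
move=> k; have [h1 h2] := hM _ (trajectory_pd k) (trajectory_lnZ_homo (leq0n k)).
by split.
Qed.

Lemma trajectory_descent : exists2 c : R, 0 < c &
  forall k, c * gap (nu k.+1) (nu k) ^+ 2 <= F (nu k.+1) - F (nu k).
Proof.
have [E [M [E0 [M0 hB]]]] := trajectory_bounds.
(* m, the number of coordinates, comes from Cauchy-Schwarz between the l1 and l2 norms; w below
   bounds the factor in [gKL_lower] uniformly in k. *)
have [m [m0 mE]] : exists m : R, 0 < m /\ m = #|{: J}|%:R.
  eexists; split; last reflexivity.
  by rewrite ltr0n; apply/card_gt0P; exists (inl ord0).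
have [w [w0 wE]] : exists w : R, 0 < w /\ w = 4 * (M + 1) ^+ 2 * (E * M + 1).
  eexists; split; last reflexivity.
  by rewrite !mulr_gt0 ?exprn_gt0 ?ltr_wpDl // mulr_ge0 // ltW.
have s0 : 0 < t1 / (t0 + t1) by rewrite divr_gt0 // addr_gt0.
exists (t1 / (t0 + t1) / (m * w)); first by rewrite divr_gt0 // mulr_gt0.
move=> k; have [_ _ h3] := hB k; have [_ _ h4] := hB k.+1; have [h1 _ _] := hB k.
have pk := trajectory_pd k; have pk1 := trajectory_pd k.+1.
have asc := lnZ_ascent t0_gt0 t1_gt0 lam_gt0 lam1 a_gt0 mu_pd pk.
apply: le_trans asc; rewrite -mulrA ler_wpM2l ?(ltW s0) // ler_pdivrMl ?mulr_gt0 //.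
apply: le_trans (gap_sqr_le _ _) _; rewrite -mE -mulrA ler_wpM2l ?(ltW m0) // -frob_crd.
have g0 := gKL_ge0 pk1 pk.
apply: le_trans (gKL_lower pk1 pk) _; rewrite ler_wpM2r // wE.
have tr0 := posdef_tr_ge0 pk.
have tq := tr_invmx_mul_le pk pk1 h1.
have tq2 : E * \tr (nu k.+1).2 <= E * M by rewrite ler_wpM2l // ltW.
have tq0 : 0 <= \tr (invmx (nu k).2 *m (nu k.+1).2) + 1.
  by rewrite addr_ge0 // (tr_mul_posdef_ge0 (posdef_inv pk) pk1).
apply: ler_pM => //.
- by rewrite mulr_ge0 // sqr_ge0.
- by rewrite ler_wpM2l // ler_pXn2r ?nnegrE ?lerD2r ?addr_ge0.
- by rewrite lerD2r; exact: le_trans tq tq2.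
Qed.

Let inv_split (E m : R) : 0 < E -> 0 < m -> (E * 2)^-1 = m * (E * m * 2)^-1.
Proof. by move=> E0 m0; field; rewrite !gt_eqF. Qed.

Let half_cancel (E D : R) : 0 < E -> E * ((E * 2)^-1 * D) = D / 2.
Proof. by move=> E0; field; rewrite gt_eqF. Qed.

(** The limit is taken along a free ultrafilter, coordinate by coordinate, and the uniform bound on
    the precisions keeps its covariance positive definite. *)
Lemma trajectory_cluster : exists o : J -> R, [/\ posdef (par o).2, crd (par o) = o &
  forall (e : R) K, 0 < e -> exists2 k, (K <= k)%N & forall j, `|crd (nu k) j - o j| < e].
Proof.
have [E [M [E0 [M0 hB]]]] := trajectory_bounds.
have bnd j k : `|crd (nu k) j| <= M + 1.
  have [_ h2 h3] := hB k; case: j => [i|[i j]] /=; last first.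
    by apply: le_trans (posdef_entry_le i j (trajectory_pd k)) _; rewrite lerD2r.
  have h : (nu k).1 i 0 ^+ 2 <= M.
    apply: le_trans h2; rewrite dotpE (bigD1 i) //= -expr2 lerDl.
    by apply: sumr_ge0 => p _; rewrite -expr2 sqr_ge0.
  rewrite -(@ler_pXn2r _ 2) ?nnegrE ?addr_ge0 // real_normK ?num_real //.
  apply: le_trans h _; apply: le_trans (_ : _ <= M + 1) _; first by rewrite lerDl.
  by rewrite expr2 ler_peMr ?addr_ge0 // lerDr.
have [U [UU hU]] := free_ultrafilter.
have /choice [c hc] : forall j : J, exists l, evlim U (fun k : nat => crd (nu k) j) l.
  by move=> j; apply: (ev_bounded_lim (M := M + 1)); apply: evW => k; exact: bnd.
have cl (e : R) K : 0 < e -> exists2 k, (K <= k)%N & forall j, `|crd (nu k) j - c j| < e.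
  move=> e0; have h : ev U (fun k => forall j, `|crd (nu k) j - c j| < e).
    by apply: ev_all => j; exact: hc.
  have hK : ev U (fun k => (K <= k)%N) := hU K.
  have [k [k1 k2]] := ev_ex (evI hK h).
  by exists k.
have o_sym i j : c (inr (i, j)) = c (inr (j, i)).
  apply/eqP; rewrite -subr_eq0 -normr_le0; apply/ler_addgt0Pr => e e0.
  have [k _ hk] := cl (e / 2) 0%N (divr_gt0 e0 (ltr0n _ 2)).
  have := hk (inr (i, j)); have := hk (inr (j, i)).
  have -> : crd (nu k) (inr (j, i)) = crd (nu k) (inr (i, j)).
    by have := congr1 (fun A : 'M[R]_n => A i j) (trajectory_sym k); rewrite mxE.
  move: (crd _ _) (c _) (c _) => p q r; rewrite !ltr_norml ler_norml => /andP[? ?] /andP[? ?].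
  by apply/andP; split; lra.
exists c; split; [|exact: par_crdK|exact: cl].
split; first exact: par_sym.
move=> u u0; rewrite -/(qf _ _).
have u1 : 0 < dotp u u by exact: dotp_gt0.
have n0 : 0 < n%:R :> R by rewrite ltr0n.
(* Entries within this distance change the quadratic form at u by at most |u|^2 / (2 E), half of its
   lower bound |u|^2 / E. *)
have e0 : 0 < (E * n%:R * 2)^-1 by rewrite invr_gt0 !mulr_gt0.
have [k _ hk] := cl _ 0%N e0.
have lowk : dotp u u <= E * qf (nu k).2 u.
  have [h1 _ _] := hB k.
  have := qf_inv_ge u (posdef_inv (trajectory_pd k)) h1.
  by rewrite invmxK.
have dif : qf (nu k).2 u - qf (par c).2 u <= (E * 2)^-1 * dotp u u.
  have -> : qf (nu k).2 u - qf (par c).2 u = qf ((nu k).2 - (par c).2) u.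
    by rewrite qfD qfN.
  apply: le_trans (ler_norm _) _; apply: le_trans (qf_le_frob _ _) _.
  rewrite ler_wpM2r ?dotp_ge0 //.
  rewrite (inv_split E0 n0).
  set e := (E * n%:R * 2)^-1 in hk e0 *.
  have ne0 : 0 <= n%:R * e by rewrite mulr_ge0 // ltW.
  rewrite -[leRHS](ger0_norm ne0) -sqrtr_sqr ler_wsqrtr //.
  apply: le_trans (_ : _ <= \sum_(i < n) \sum_(j < n) e ^+ 2) _; last first.
    by rewrite !sumr_const !card_ord -mulrnA -[leLHS]mulr_natl natrM -expr2 exprMn.
  apply: ler_sum => i _; apply: ler_sum => j _.
  have -> : ((nu k).2 - (par c).2) i j = crd (nu k) (inr (i, j)) - c (inr (i, j)).
    by rewrite -{2}(par_crdK o_sym) /crd /= !mxE.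
  by rewrite -real_normK ?num_real // ler_pXn2r ?nnegrE ?(ltW e0) // ltW.
have E2 : E * (qf (nu k).2 u - qf (par c).2 u) <= dotp u u / 2.
  apply: le_trans (ler_wpM2l (ltW E0) dif) _.
  by rewrite half_cancel.
by rewrite -(pmulr_rgt0 _ E0); move: E2 lowk u1; rewrite mulrBr; lra.
Qed.

End trajectory.

(** * Convergence to a stationary fixed point *)

Section trajectory_limit.
Variables (R : realType) (d N : nat).
Local Notation n := d.+1.
Local Notation J := ('I_n + 'I_n * 'I_n)%type.
Variables (t0 t1 : R) (lam a : 'I_N -> R) (mu : 'I_N -> gparam R n) (nu0 : gparam R n).
Hypotheses (t0_gt0 : 0 < t0) (t1_gt0 : 0 < t1).
Hypotheses (lam_gt0 : forall i, 0 < lam i) (lam1 : \sum_(i < N) lam i = 1).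
Hypotheses (a_gt0 : forall i, 0 < a i) (mu_pd : forall i, gaussians (mu i)).
Hypothesis nu0_pd : gaussians nu0.

Local Notation T := (moment_update t0 t1 lam a mu).
Local Notation F := (lnZ t0 t1 lam a mu).
Local Notation b := (bary_mass t0 t1 lam a mu).
Local Notation nu k := (iter k T nu0).
Local Notation w := ((t0 / (t0 + t1))^-1).

Variable o : J -> R.
Hypotheses (o_pd : posdef (par o).2) (o_crd : crd (par o) = o).
Hypothesis o_cluster : forall (e : R) K, 0 < e ->
  exists2 k, (K <= k)%N & forall j, `|crd (nu k) j - o j| < e.

Let nu_sym k : (nu k).2^T = (nu k).2.
Proof. exact: (trajectory_sym t0_gt0 t1_gt0 lam_gt0 lam1 a_gt0 mu_pd nu0_pd). Qed.

Let nu_homo k m : (k <= m)%N -> F (nu k) <= F (nu m).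
Proof. exact: (trajectory_lnZ_homo t0_gt0 t1_gt0 lam_gt0 lam1 a_gt0 mu_pd nu0_pd). Qed.

Let lnZ_ana : ana (fun x : J -> R => F (par x)) o.
Proof. exact: (analytic_lnZ t0_gt0 t1_gt0 lam_gt0 lam1 a_gt0 mu_pd). Qed.

Let lnZ_cluster (e : R) K : 0 < e -> exists2 k, (K <= k)%N & `|F (nu k) - F (par o)| < e.
Proof.
move=> e0; have [r r0 hr] := ana_cont lnZ_ana e0; have [k Kk hk] := o_cluster K r0.
by exists k => //; have := hr _ hk; rewrite crdK.
Qed.

Lemma trajectory_lnZ_le k : F (nu k) <= F (par o).
Proof.
apply/ler_addgt0Pr => e e0; have [m km] := lnZ_cluster k e0.
rewrite ltr_norml => /andP[_]; rewrite ltrBlDr addrC => /ltW h.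
exact: le_trans (nu_homo km) h.
Qed.

Lemma trajectory_lnZ_gap (e : R) : 0 < e ->
  exists K, forall k, (K <= k)%N -> F (par o) - F (nu k) < e.
Proof.
move=> e0; have [K _ hK] := lnZ_cluster 0%N e0; exists K => k Kk.
apply: le_lt_trans (lerB (lexx _) (nu_homo Kk)) _.
by apply: le_lt_trans (ler_norm _) _; rewrite distrC.
Qed.

Let sub_sub (u v z : R) : z - v = (u - v) - (u - z). Proof. by ring. Qed.

Lemma trajectory_length_limit :
  (exists M, forall m, \sum_(k < m) gap (nu k.+1) (nu k) <= M) /\
  forall e : R, 0 < e -> exists K, forall k, (K <= k)%N ->
    forall j, `|crd (nu k) j - o j| < e.
Proof.
have [th [C [r [/andP[th0 th1] C0 r0 hL]]]] :=
  lnZ_lojasiewicz t0_gt0 t1_gt0 lam_gt0 lam1 a_gt0 mu_pd o_pd.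
have [c c0 hc] := trajectory_descent t0_gt0 t1_gt0 lam_gt0 lam1 a_gt0 mu_pd nu0_pd.
have F0 k : 0 <= F (par o) - F (nu k) by rewrite subr_ge0; exact: trajectory_lnZ_le.
have l0 k : 0 <= gap (nu k.+1) (nu k) := gap_ge0 _ _.
have xl k i : `|crd (nu k.+1) i - crd (nu k) i| <= gap (nu k.+1) (nu k) := gap_ge _ _ i.
have ds k : c * gap (nu k.+1) (nu k) ^+ 2 <=
    (F (par o) - F (nu k)) - (F (par o) - F (nu k.+1)).
  by rewrite -sub_sub; exact: hc.
have gr k : (forall i, `|crd (nu k) i - o i| < r) -> F (par o) - F (nu k) != 0 ->
    (F (par o) - F (nu k)) `^ th <= C * gap (nu k.+1) (nu k).
  move=> hk; have := hL _ hk; rewrite crdK // => h /h.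
  by rewrite ger0_norm.
split.
  exact: (gradient_descent_length (x := fun k => crd (nu k)) (o := o)
    (F := fun k => F (par o) - F (nu k)) (l := fun k => gap (nu k.+1) (nu k))
    r0 th0 th1 C0 c0 l0 F0 xl ds gr o_cluster trajectory_lnZ_gap).
exact: (gradient_descent_limit (x := fun k => crd (nu k)) (o := o)
    (F := fun k => F (par o) - F (nu k)) (l := fun k => gap (nu k.+1) (nu k))
    r0 th0 th1 C0 c0 l0 F0 xl ds gr o_cluster trajectory_lnZ_gap).
Qed.

Let tri (u v z e : R) : `|u - v| < e / 2 -> `|u - z| < e / 2 -> `|v - z| <= e.
Proof.
by rewrite !ltr_norml ler_norml => /andP[? ?] /andP[? ?]; apply/andP; split; lra.
Qed.

(** The sequences nu k and T (nu k) = nu k.+1 have the same limit, and T is continuous there. *)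
Lemma limit_fixed : T (par o) = par o.
Proof.
have [_ lim] := trajectory_length_limit.
apply: crd_inj; apply/funext => j; rewrite o_crd.
apply/eqP; rewrite -subr_eq0 -normr_le0; apply/ler_addgt0Pr => e e0; rewrite add0r.
have e2 : 0 < e / 2 by rewrite divr_gt0.
have [r r0 hr] := ana_cont (analytic_update t0_gt0 t1_gt0 lam_gt0 lam1 a_gt0 mu_pd j o_pd) e2.
have [K1 hK1] := lim r r0; have [K2 hK2] := lim _ e2.
have K1m : (K1 <= maxn K1 K2)%N := leq_maxl _ _.
have K2m : (K2 <= (maxn K1 K2).+1)%N by rewrite leqW ?leq_maxr.
have := hr _ (hK1 _ K1m); rewrite crdK // => h1.
exact: tri h1 (hK2 _ K2m j).
Qed.

Let mass_expR nu' : b nu' = expR (w * F nu').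
Proof. by rewrite /bary_mass /powR gt_eqF // bary_Z_gt0. Qed.

Let w_gt0 : 0 < w. Proof. by rewrite invr_gt0 divr_gt0 // addr_gt0. Qed.

Let expR_lip (u0 : R) : exists K r : R, [/\ 0 < K, 0 < r & forall u v, `|u - u0| < r ->
  `|v - u0| < r -> `|expR (w * v) - expR (w * u)| <= K * `|v - u|].
Proof.
have h : ana (fun z : unit -> R => expR (w * z tt)) (fun=> u0).
  exact: (ana_expR (ana_mul (ana_cst w _) (ana_var tt (fun=> u0)))).
have [K [r [K0 r0 hK]]] := ana_lip h; exists K, r; split=> // u v hu hv.
exact: (hK (fun=> u) (fun=> v) `|v - u| (fun=> hu) (fun=> hv) (fun=> lexx _) (normr_ge0 _)).
Qed.

Let Phi_sub (c A p q : R) : c * (A - p) - c * (A - q) = - (c * (p - q)).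
Proof. by ring. Qed.

(** At the fixed point the gap is zero, so by [lnZ_lip_at] every positive number is a Lipschitz
    constant of ln Z there. This is differentiability with zero gradient, and the local Lipschitz
    bound on the exponential passes it to Phi. *)
Lemma limit_stationary : stationary (bary_Phi t0 t1 lam a mu) (par o).
Proof.
have [C [r [C0 r0 hlip]]] := lnZ_lip_at t0_gt0 t1_gt0 lam_gt0 lam1 a_gt0 mu_pd o_pd.
have [K [q [K0 q0 hK]]] := expR_lip (F (par o)).
have [q1 q10 hq] := ana_cont lnZ_ana q0.
split; first by rewrite /= trmx0.
move=> e e0; have L0 : 0 < e / (t0 * K) by rewrite divr_gt0 // mulr_gt0.
have g0 : gap (T (par o)) (par o) = 0.
  by rewrite limit_fixed /gap big1 // => k _; rewrite subrr normr0.
have CL : C * gap (T (par o)) (par o) < e / (t0 * K) by rewrite g0 mulr0.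
have oo i : `|o i - o i| < r by rewrite subrr normr0.
have [dd dd0 hd] := hlip o oo _ CL.
exists (Num.min dd q1) => [|nu' nu'_pd]; first by rewrite lt_min dd0.
rewrite lt_min => /andP[h1 h2].
have tt : 0 <= dpar nu' (par o) by rewrite sqrtr_ge0.
have hc i : `|crd nu' i - o i| <= dpar nu' (par o).
  by have := crd_dpar nu' (par o) i; rewrite o_crd.
have hc1 i : `|crd nu' i - o i| < q1 := le_lt_trans (hc i) h2.
have := hd _ _ tt h1 hc; have := hq _ hc1.
rewrite crdK; last exact: posdef_sym nu'_pd.
move=> hF hFL; have oF : `|F (par o) - F (par o)| < q by rewrite subrr normr0.
have hb := hK _ _ oF hF.
rewrite /bary_Phi !mass_expR /= !trmx0 !mul0mx mxtrace0 mxE addr0 subr0 Phi_sub.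
rewrite normrN normrM (gtr0_norm t0_gt0).
apply: le_trans (ler_wpM2l (ltW t0_gt0) hb) _.
rewrite mulrA; have tK : 0 < t0 * K by rewrite mulr_gt0.
apply: le_trans (ler_wpM2l (ltW tK) hFL) _.
by rewrite mulrA mulrCA mulfV ?gt_eqF // mulr1.
Qed.

Let tele (p q c S S' u g : R) : S' <= p - c + S -> u <= q - p + g ->
  S' + u <= q - c + (S + g).
Proof. by move=> ? ?; lra. Qed.

Let mass_homo p q : F p <= F q -> b p <= b q.
Proof. by move=> h; rewrite !mass_expR ler_expR; apply: ler_wpM2l h; exact: ltW. Qed.

(** The mass increases along the trajectory with ln Z, so its variation telescopes and is bounded by
    the mass at the limit. *)
Lemma mass_length : exists M, forall m,
  \sum_(k < m) (`|b (nu k.+1) - b (nu k)| + dpar (nu k.+1) (nu k)) <= M.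
Proof.
have [[M hM] _] := trajectory_length_limit; exists (b (par o) + M) => m.
apply: le_trans (_ : _ <= (b (nu m) - b (nu 0)) + \sum_(k < m) gap (nu k.+1) (nu k)) _.
  elim: m => [|m IH]; first by rewrite !big_ord0 subrr add0r.
  have hb : b (nu m) <= b (nu m.+1) := mass_homo (nu_homo (leqnSn m)).
  have hs : `|b (nu m.+1) - b (nu m)| + dpar (nu m.+1) (nu m) <=
      (b (nu m.+1) - b (nu m)) + gap (nu m.+1) (nu m).
    rewrite (ger0_norm (_ : 0 <= b (nu m.+1) - b (nu m))); last by rewrite subr_ge0; exact: hb.
    by apply: lerD (lexx _) _; exact: dpar_gap.
  rewrite big_ord_recr [X in _ <= _ + X]big_ord_recr.
  exact: tele IH hs.
apply: lerD (hM m); apply: le_trans (_ : _ <= b (nu m)) _.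
  by rewrite gerBl powR_ge0.
exact: mass_homo (trajectory_lnZ_le m).
Qed.

Lemma trajectory_cvg : (fun k => nu k) @ \oo --> par o.
Proof.
have [_ lim] := trajectory_length_limit.
by apply: cvg_crd => e e0; rewrite o_crd; exact: lim.
Qed.

Lemma beta_cvg : (fun k => bary_beta t0 t1 lam a mu (nu k)) @ \oo -->
  bary_beta t0 t1 lam a mu (par o).
Proof.
have [_ lim] := trajectory_length_limit.
apply/cvg_ballP => e e0.
have [r r0 hr] := ana_cont (ana_expR (ana_mul (ana_cst w o) lnZ_ana)) e0.
have [K1 hK1] := lim r r0; have [K2 hK2] := lim e e0.
exists (maxn K1 K2) => // k /=; rewrite geq_max => /andP[k1 k2]; split.
  rewrite /ball /= !mass_expR distrC; have := hr _ (hK1 _ k1).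
  by rewrite crdK.
apply: ball_crd => // j; rewrite distrC o_crd; exact: hK2.
Qed.

End trajectory_limit.

Theorem theorem5p11 (R : realType) (d n : nat) (t0 t1 : R)
    (lam a : 'I_n -> R) (mu : 'I_n -> gparam R d) (nu0 : gparam R d) :
  (0 < d)%N -> (1 <= n)%N -> 0 < t0 -> 0 < t1 ->
  (forall i, 0 < lam i) -> \sum_(i < n) lam i = 1 ->
  (forall i, 0 < a i) -> (forall i, gaussians (mu i)) -> gaussians nu0 ->
  let T := moment_update t0 t1 lam a mu in
  let Phi := bary_Phi t0 t1 lam a mu in
  let b := bary_mass t0 t1 lam a mu in
  let beta := bary_beta t0 t1 lam a mu in
  let nu := fun k : nat => iter k T nu0 in
  [/\ exists K : set (gparam R d),
        [/\ compact K, K `<=` gaussians & forall k, K (nu k)],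
      (\sum_(0 <= k <oo) (dpar (nu k.+1) (nu k))%:E < +oo)%E &
      exists nu_oo : gparam R d,
        [/\ gaussians nu_oo, nu @ \oo --> nu_oo, stationary Phi nu_oo,
            T nu_oo = nu_oo &
            (\sum_(0 <= k <oo)
               (`|b (nu k.+1) - b (nu k)| + dpar (nu k.+1) (nu k))%:E
             < +oo)%E /\
            (fun k => beta (nu k)) @ \oo --> beta nu_oo]].
Proof.
(* Polynomials in a matrix are taken in the ring of matrices of size d.+1. *)
case: d mu nu0 => [//|d] mu nu0 _ _ t0_gt0 t1_gt0 lam_gt0 lam1 a_gt0 mu_pd nu0_pd.
move=> T Phi b beta nu.
have [x [x_pd x_crd x_cl]] :=
  trajectory_cluster t0_gt0 t1_gt0 lam_gt0 lam1 a_gt0 mu_pd nu0_pd.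
have nu_pd := trajectory_pd t0_gt0 t1_gt0 lam_gt0 lam1 a_gt0 mu_pd nu0_pd.
have [[M hM] _] := trajectory_length_limit t0_gt0 t1_gt0 lam_gt0 lam1 a_gt0 mu_pd
  nu0_pd x_pd x_cl.
have cvg_nu := trajectory_cvg t0_gt0 t1_gt0 lam_gt0 lam1 a_gt0 mu_pd nu0_pd x_pd x_crd x_cl.
have [M' hM'] := mass_length t0_gt0 t1_gt0 lam_gt0 lam1 a_gt0 mu_pd nu0_pd x_pd x_cl.
have d0 (p q : gparam R d.+1) : 0 <= dpar p q by rewrite sqrtr_ge0.
split.
(* The orbit together with its limit serves as the compact set. *)
- exists (range nu `|` [set par x]); split.
  + exact: (@compact_cvg_sequence _ nu (par x) cvg_nu).
  + by move=> y [[k _ <-]|->]; [exact: nu_pd|exact: x_pd].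
  + by move=> k; left; exists k.
- apply: (nneseries_lt_pinfty (M := M)) => [k|m]; first exact: d0.
  by apply: le_trans (hM m); apply: ler_sum => k _; exact: dpar_gap.
- exists (par x); split.
  + exact: x_pd.
  + exact: cvg_nu.
  + exact: (limit_stationary t0_gt0 t1_gt0 lam_gt0 lam1 a_gt0 mu_pd nu0_pd x_pd x_crd x_cl).
  + exact: (limit_fixed t0_gt0 t1_gt0 lam_gt0 lam1 a_gt0 mu_pd nu0_pd x_pd x_crd x_cl).
  + split; last exact: (beta_cvg t0_gt0 t1_gt0 lam_gt0 lam1 a_gt0 mu_pd nu0_pd x_pd x_crd x_cl).
    apply: (nneseries_lt_pinfty (M := M')) => [k|m]; last exact: hM'.
    by rewrite addr_ge0.
Qed.
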